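(* Let $\beta\in(0,1)$, $b\in(0,\lambda_1/\sqrt2)$ and $d\in(0,\pi/4)$. For a positive integer $N$ and a real number $k>0$, let $Q_h^{N,k}(t)$ be the sinc quadrature approximation of $e^{-tL_h^\beta}$ defined in the context. Then there is a constant $C$ not depending on $t$, $h$, $k$ and $N$ such that for $t>0$ $$\|e^{-tL_h^\beta}-Q_h^{N,k}(t)\|_{L^2(\Omega)\to L^2(\Omega)}\le C\left(\frac{N(d,t)}{e^{2\pi d/k}-1}+\frac{M(t)\cosh(kN)}{\sinh(kN)}\,e^{-\kappa 2^{-\beta}te^{kN\beta}}\right).$$ The function $N(d,t)$ is uniformly bounded when $t$ is bounded away from zero, and is bounded by $CM(t)$ as $t\to0$.
   Context: Let $\Omega\subset\mathbb R^n$, $n=2,3$, be a bounded polygonal (polyhedral) domain with Lipschitz boundary. All function spaces are complex valued; $(\cdot,\cdot)$ and $\|\cdot\|$ are the Hermitian inner product and norm of $L^2(\Omega)$, and $\|v\|_{H^1_0(\Omega)}=\|\,|\nabla v|\,\|$. $A(\cdot,\cdot)$ is a Hermitian, coercive and bounded sesquilinear form on $H^1_0(\Omega)$: there are $c_0,c_1>0$ with $A(v,v)\ge c_0\|v\|_{H^1_0(\Omega)}^2$ and $|A(v,w)|\le c_1\|v\|_{H^1_0(\Omega)}\|w\|_{H^1_0(\Omega)}$. $T:L^2(\Omega)\to H^1_0(\Omega)$ is defined by $A(Tf,\theta)=(f,\theta)$ for all $\theta\in H^1_0(\Omega)$, $L:=T^{-1}$ with domain $\mathrm{Range}(T)$,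 and $\lambda_1>0$ is the smallest eigenvalue of $L$. Finite elements: $\{\mathcal T_h\}_{h>0}$ is a sequence of conforming simplicial subdivisions of $\Omega$, with mesh size $h$, globally quasi-uniform: with $R_\tau$ the diameter of $\tau$ and $r_\tau$ the radius of the largest ball inscribed in $\tau$, there are $c,\rho>0$ independent of $h$ with $R_\tau/r_\tau\le c$ and $\max_{\tau\in\mathcal T_h}R_\tau\le\rho\min_{\tau\in\mathcal T_h}R_\tau$. $H_h\subset H^1_0(\Omega)$ is the space of continuous piecewise linear functions with respect to $\mathcal T_h$, $M=\dim H_h$. $L_h:H_h\to H_h$ is defined by $(L_hv_h,\phi_h)=A(v_h,\phi_h)$ for all $\phi_h\in H_h$; it has $L^2(\Omega)$-orthonormal eigenfunctions $\{\psi_{j,h}\}_{j=1}^M$ with eigenvalues $\lambda_{j,h}>0$, and $e^{-tL_h^\beta}w_h:=\sum_{j=1}^Me^{-t\lambda_{j,h}^\beta}(w_h,\psi_{j,h})\psi_{j,h}$ for $w_h\in H_h$. Quadrature: $\gamma(z):=b(\cosh z+i\sinh z)$ for $z\in\mathbb C$; $z^\beta:=e^{\beta\ln z}$ with the branch cut of the logarithm along the negative real axis. With $y_j:=jk$, for $w_h\in H_h$, $$Q_h^{N,k}(t)w_h:=-\frac{k}{2\pi i}\sum_{j=-N}^{N}e^{-t\gamma(y_j)^\beta}\gamma'(y_j)\,[(\gamma(y_j)I-L_h)^{-1}w_h].$$ The norm $\|\cdot\|_{L^2(\Omega)\to L^2(\Omega)}$ of an operator on $H_h$ is its operator norm with $H_h$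 equipped with the $L^2(\Omega)$ norm. Notation: $g_\lambda(z,t):=e^{-t\gamma(z)^\beta}(\gamma(z)-\lambda)^{-1}\gamma'(z)$ for $z\in\mathbb C$, $t>0$; $$\kappa:=\cos[\beta(\pi/4+d)]\,\big[\sqrt2\,b\sin(\pi/4-d)\big]^\beta,\qquad N(d,t):=\max_{\lambda\ge\lambda_1}\int_{-\infty}^\infty\big(|g_\lambda(y+id,t)|+|g_\lambda(y-id,t)|\big)\,dy$$ (maximum understood as a supremum), and $M(t):=1+\mathcal L(\kappa t)$ with $\mathcal L(x):=1+|\ln(1-e^{-x})|$. (The integer $N$ and the function $N(d,t)$, and the dimension $M$ and the function $M(t)$, are different objects.) *)

(* Defs.v *)
From HB Require Import structures.
From mathcomp Require Import all_boot all_order all_algebra.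
From mathcomp Require Import all_classical all_reals all_analysis.
From mathcomp Require Import complex.
Set Implicit Arguments.
Unset Strict Implicit.
Unset Printing Implicit Defensive.
Import Order.TTheory GRing.Theory Num.Theory.
Import numFieldNormedType.Exports.
Local Open Scope classical_set_scope.
Local Open Scope ring_scope.

Local Notation Re := (@complex.Re _).
Local Notation Im := (@complex.Im _).
Local Notation normc := (@Normc.normc _).

Definition row_display : measure_display -> measure_display.
Proof. exact. Qed.

(* The sigma-algebra of 'rV[R]_n generated by the coordinates, i.e. the Borel
   sigma-algebra of R^n. *)
Section measurable_row.
Context {R : realType} (n : nat).
Let coord (i : 'I_n) (x : 'rV[R]_n) : measurableTypeR R := x ord0 i.

Let row_set0 : g_sigma_preimage coord set0.
Proof. exact: sigma_algebra0. Qed.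
Let row_setC A : g_sigma_preimage coord A -> g_sigma_preimage coord (~` A).
Proof. exact: sigma_algebraC. Qed.
Let row_bigcup (F : (set 'rV[R]_n)^nat) :
  (forall i, g_sigma_preimage coord (F i)) ->
  g_sigma_preimage coord (\bigcup_i (F i)).
Proof. exact: sigma_algebra_bigcup. Qed.

HB.instance Definition _ := @isMeasurable.Build
  (row_display (measure_tuple_display default_measure_display)) 'rV[R]_n
  (g_sigma_preimage coord) row_set0 row_setC row_bigcup.
End measurable_row.

Section lebesgue_row.
Context {R : realType}.
Local Notation RM := (measurableTypeR R).

Lemma measurable_coord n (i : 'I_n) :
  measurable_fun [set: 'rV[R]_n] (fun x : 'rV[R]_n => x ord0 i : RM).
Proof.
move=> _ Y mY; rewrite setTI; apply: sub_sigma_algebra => /=.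
rewrite -bigcup_seq/=; exists i => /=; first by rewrite mem_index_enum.
by exists Y => //; rewrite setTI.
Qed.

Lemma measurable_row d (T : measurableType d) n (f : T -> 'rV[R]_n) :
  (forall i, measurable_fun [set: T] (fun t => f t ord0 i : RM)) ->
  measurable_fun [set: T] f.
Proof.
move=> mf; suff H : measurable `<=` [set A : set 'rV[R]_n |
    measurable (f @^-1` A)].
  by move=> _ A mA; rewrite setTI; exact: H.
apply: smallest_sub.
  split=> /=.
  - by rewrite preimage_set0; exact: measurable0.
  - by move=> A mA; rewrite setTD preimage_setC; exact: measurableC.
  - by move=> F mF; rewrite preimage_bigcup; exact: bigcup_measurable.
move=> A; rewrite -bigcup_seq => -[i _ [B mB <-]] /=; rewrite setTI.
by have := mf i measurableT B mB; rewrite setTI.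
Qed.

Definition cons_row n (p : RM * 'rV[R]_n) : 'rV[R]_n.+1 :=
  \row_i (if unlift ord0 i is Some j then p.2 ord0 j else p.1).

Definition uncons_row n (x : 'rV[R]_n.+1) : RM * 'rV[R]_n :=
  (x ord0 ord0, \row_j x ord0 (lift ord0 j)).

Lemma cons_rowK n : cancel (@cons_row n) (@uncons_row n).
Proof.
case=> a v; rewrite /uncons_row !mxE unlift_none; congr pair.
by apply/rowP => j; rewrite !mxE liftK.
Qed.

Lemma uncons_rowK n : cancel (@uncons_row n) (@cons_row n).
Proof.
by move=> x; apply/rowP => i; rewrite mxE; case: unliftP => [j ->|->]; rewrite ?mxE.
Qed.

Lemma measurable_cons_row n :
  measurable_fun [set: RM * 'rV[R]_n] (@cons_row n).
Proof.
apply: measurable_row => i; under eq_fun do rewrite mxE.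
case: unliftP => [j _|_]; last exact: measurable_fst.
exact: (measurableT_comp (measurable_coord j) measurable_snd).
Qed.

Lemma measurable_uncons_row n :
  measurable_fun [set: 'rV[R]_n.+1] (@uncons_row n).
Proof.
apply: measurable_fun_pair; first exact: measurable_coord.
apply: measurable_row => i; under eq_fun do rewrite mxE.
exact: measurable_coord.
Qed.

Section step.
Variables (n : nat) (m : {sigma_finite_measure set 'rV[R]_n -> \bar R}).
Local Open Scope ereal_scope.

Definition lebesgue_step (A : set 'rV[R]_n.+1) : \bar R :=
  (@lebesgue_measure R \x m) (@cons_row n @^-1` A).

Let mpre A : measurable A -> measurable (@cons_row n @^-1` A).
Proof.
by move=> mA; rewrite -[X in measurable X]setTI; exact: measurable_cons_row.
Qed.

Let step0 : lebesgue_step set0 = 0.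
Proof. by rewrite /lebesgue_step preimage_set0 measure0. Qed.

Let step_ge0 A : 0 <= lebesgue_step A.
Proof. exact: measure_ge0. Qed.

Let step_sigma_additive : semi_sigma_additive lebesgue_step.
Proof.
move=> F mF tF mUF; rewrite /lebesgue_step preimage_bigcup.
apply: measure_semi_sigma_additive.
- by move=> k; exact: mpre.
- apply/trivIsetP => /= i j _ _ ij; rewrite -preimage_setI.
  by move/trivIsetP : tF => /(_ _ _ _ _ ij) ->//; rewrite preimage_set0.
- by rewrite -preimage_bigcup; exact: mpre.
Qed.

HB.instance Definition _ :=
  isMeasure.Build _ _ _ lebesgue_step step0 step_ge0 step_sigma_additive.

Let step_sigma_finite : sigma_finite setT lebesgue_step.
Proof.
have /sigma_finiteP[F [TF ndF Foo]] := sigma_finiteT (@lebesgue_measure R).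
have /sigma_finiteP[G [TG ndG Goo]] := sigma_finiteT m.
exists (fun k => @uncons_row n @^-1` (F k `*` G k)) => [|k].
  rewrite -preimage_bigcup (_ : \bigcup_k _ = setT) ?preimage_setT//.
  apply/seteqP; split => // -[x y] _.
  have [k _ Fkx] : (\bigcup_k F k) x by rewrite -TF.
  have [l _ Gly] : (\bigcup_k G k) y by rewrite -TG.
  exists (maxn k l) => //; split.
  - by move: x Fkx; exact/subsetPset/ndF/leq_maxl.
  - by move: y Gly; exact/subsetPset/ndG/leq_maxr.
have [mF Fk] := Foo k; have [mG Gk] := Goo k.
have mFG : measurable (F k `*` G k) by exact: measurableX.
split.
  by rewrite -[X in measurable X]setTI; exact: measurable_uncons_row.
rewrite /lebesgue_step -comp_preimage (_ : _ \o _ = id) ?preimage_id//.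
  by rewrite product_measure1E// lte_mul_pinfty// ge0_fin_numE.
by apply/funext => p /=; rewrite cons_rowK.
Qed.

HB.instance Definition _ := Measure_isSigmaFinite.Build _ _ _ lebesgue_step
  step_sigma_finite.
End step.

(* n-fold product of the one-dimensional Lebesgue measure *)
Fixpoint lebesgue_row n : {sigma_finite_measure set 'rV[R]_n -> \bar R} :=
  match n with
  | 0 => \d_(0 : 'rV[R]_0)
  | n'.+1 => lebesgue_step (lebesgue_row n')
  end.
End lebesgue_row.

Section euclidean.
Context {R : realType} {n : nat}.
Implicit Types (x y e : 'rV[R]_n) (Om : set 'rV[R]_n).

Definition edot x y : R := \sum_i x ord0 i * y ord0 i.

(* The norm `|x| of 'rV[R]_n is the sup norm. *)
Definition enorm x : R := Num.sqrt (edot x x).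

Definition eball x (r : R) : set 'rV[R]_n := [set y | enorm (y - x) < r].

Definition conv_hull (V : seq 'rV[R]_n) : set 'rV[R]_n :=
  [set x | exists w : 'rV[R]_n -> R, [/\ forall p, 0 <= w p,
    \sum_(p <- V) w p = 1 & x = \sum_(p <- V) w p *: p]].

(* An n-simplex is given by its n+1 vertices. *)
Definition nondegenerate (s : n.+1.-tuple 'rV[R]_n) : bool :=
  free [seq p - thead s | p <- behead s].

Definition diameter (K : set 'rV[R]_n) : R :=
  sup [set r | exists x y, [/\ K x, K y & r = enorm (x - y)]].

Definition inradius (K : set 'rV[R]_n) : R :=
  sup [set r | 0 <= r /\ exists x, eball x r `<=` K].

(* Near each boundary point, Om is the strict epigraph, in the direction of the
   unit vector e, of a Lipschitz function on the hyperplane orthogonal to e. *)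
Definition lipschitz_boundary Om : Prop :=
  forall x, (closure Om `\` interior Om) x ->
  exists (r : R) (e : 'rV[R]_n) (phi : 'rV[R]_n -> R) (K : R),
    [/\ 0 < r, enorm e = 1,
        forall y z, `|phi y - phi z| <= K * enorm (y - z) &
        forall y, eball x r y -> (Om y <-> phi (y - edot y e *: e) < edot y e)].

Record polyhedral_lipschitz_domain Om : Prop := PolyhedralLipschitzDomain {
  domain_nonempty : Om !=set0;
  domain_open : open Om;
  domain_connected : connected Om;
  domain_bounded : bounded_set Om;
  domain_polyhedral : exists S : seq (n.+1.-tuple 'rV[R]_n),
    all nondegenerate S /\ closure Om = \bigcup_(s in [set` S]) conv_hull s;
  domain_lipschitz : lipschitz_boundary Om }.

Record conforming_triangulation Om (T : seq (n.+1.-tuple 'rV[R]_n)) : Prop :=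
  ConformingTriangulation {
  triangulation_nondegenerate : all nondegenerate T;
  triangulation_cover : closure Om = \bigcup_(s in [set` T]) conv_hull s;
  triangulation_conforming : forall s s', s \in T -> s' \in T ->
    conv_hull s `&` conv_hull s' = conv_hull [seq p <- s | p \in (s' : seq _)] }.

Definition mesh_size (T : seq (n.+1.-tuple 'rV[R]_n)) : R :=
  \big[Num.max/0]_(s <- T) diameter (conv_hull s).

(* A family of meshes T h, with h ranging over a set hs of mesh sizes. *)
Record quasi_uniform_meshes Om (hs : set R)
    (T : R -> seq (n.+1.-tuple 'rV[R]_n)) : Prop := QuasiUniformMeshes {
  meshes_gt0 : forall h, hs h -> 0 < h;
  meshes_triangulation : forall h, hs h -> conforming_triangulation Om (T h);
  meshes_size : forall h, hs h -> mesh_size (T h) = h;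
  meshes_quasi_uniform : exists c rho : R, [/\ 0 < c, 0 < rho,
    forall h s, hs h -> s \in T h ->
      diameter (conv_hull s) / inradius (conv_hull s) <= c &
    forall h s s', hs h -> s \in T h -> s' \in T h ->
      diameter (conv_hull s) <= rho * diameter (conv_hull s')] }.

End euclidean.

(* Elements of L^2(Om) and H^1_0(Om) are represented by functions on the whole
   space whose values off Om are irrelevant; equality in L^2(Om) is equality
   almost everywhere on Om, i.e. vanishing of the l2norm of the difference. *)
Section sobolev.
Context {R : realType} {n : nat}.
Local Notation fn := ('rV[R]_n -> R[i]).
Variable Om : set 'rV[R]_n.
Implicit Types (v w : fn) (phi : 'rV[R]_n -> R).

Definition cintegral (f : fn) : R[i] :=
  ((\int[lebesgue_row n]_(x in Om) Re (f x)) +i*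
   (\int[lebesgue_row n]_(x in Om) Im (f x)))%C.

Definition L2 v : Prop :=
  [/\ measurable_fun Om (fun x => Re (v x)),
      measurable_fun Om (fun x => Im (v x)) &
      (\int[lebesgue_row n]_(x in Om) ((normc (v x)) ^+ 2)%:E < +oo)%E].

Definition inner v w : R[i] := cintegral (fun x => v x * (w x)^*%C).

Definition l2norm v : R :=
  Num.sqrt (\int[lebesgue_row n]_(x in Om) (normc (v x)) ^+ 2).

Definition partial (i : 'I_n) phi : 'rV[R]_n -> R :=
  fun x => 'D_(delta_mx ord0 i) phi x.

Fixpoint class_C (k : nat) phi : Prop :=
  continuous phi /\
  if k is k'.+1 then
    forall i, (forall x, derivable phi x (delta_mx ord0 i)) /\
              class_C k' (partial i phi)
  else True.

(* C_c^oo(Om) *)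
Definition test_function phi : Prop :=
  (forall k, class_C k phi) /\
  exists K : set 'rV[R]_n,
    [/\ compact K, K `<=` Om & forall x, ~ K x -> phi x = 0].

Definition ctest_function v : Prop :=
  test_function (fun x => Re (v x)) /\ test_function (fun x => Im (v x)).

Definition cpartial (i : 'I_n) v : fn :=
  fun x => (partial i (fun y => Re (v y)) x +i*
            partial i (fun y => Im (v y)) x)%C.

Definition weak_gradient v (G : 'I_n -> fn) : Prop :=
  forall i, L2 (G i) /\ forall phi, test_function phi ->
    cintegral (fun x => v x * (partial i phi x)%:C%C) =
    - cintegral (fun x => G i x * (phi x)%:C%C).

(* Unique up to equality almost everywhere on Om. *)
Definition grad v : 'I_n -> fn := xget (fun _ _ => 0) [set G | weak_gradient v G].

Definition H1 v : Prop := L2 v /\ exists G, weak_gradient v G.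

(* The closure of C_c^oo(Om) in H^1(Om). *)
Definition H10 v : Prop :=
  H1 v /\ forall eps : R, 0 < eps -> exists w, ctest_function w /\
    l2norm (fun x => v x - w x) ^+ 2 +
    \sum_i l2norm (fun x => grad v i x - cpartial i w x) ^+ 2 < eps ^+ 2.

Definition H10norm v : R :=
  Num.sqrt (\int[lebesgue_row n]_(x in Om) \sum_i (normc (grad v i x)) ^+ 2).

(* A respects equality almost everywhere by sesquilinearity and boundedness. *)
Record hermitian_coercive_bounded (A : fn -> fn -> R[i]) : Prop :=
  HermitianCoerciveBounded {
  form_linear : forall (a : R[i]) u v w, H10 u -> H10 v -> H10 w ->
    A (fun x => a * u x + v x) w = a * A u w + A v w;
  form_hermitian : forall v w, H10 v -> H10 w -> A v w = (A w v)^*%C;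
  form_coercive : exists2 c0 : R, 0 < c0 &
    forall v, H10 v -> (c0 * H10norm v ^+ 2)%:C%C <= A v v;
  form_bounded : exists2 c1 : R, 0 < c1 &
    forall v w, H10 v -> H10 w -> normc (A v w) <= c1 * H10norm v * H10norm w }.

Variable A : fn -> fn -> R[i].

(* u = T f *)
Definition solution_of (f u : fn) : Prop :=
  H10 u /\ forall theta, H10 theta -> A u theta = inner f theta.

(* u is in the domain Range(T) of L = T^-1, and L u = f *)
Definition L_graph (u f : fn) : Prop := L2 f /\ solution_of f u.

Definition L_eigenvalue (mu : R[i]) : Prop :=
  exists u, l2norm u != 0 /\ L_graph u (fun x => mu * u x).

Definition smallest_eigenvalue (lambda1 : R) : Prop :=
  L_eigenvalue lambda1%:C%C /\
  forall mu, L_eigenvalue mu -> lambda1%:C%C <= mu.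

(* Finite element functions are extended by zero off Om, so that they are
   determined everywhere by their class in L^2(Om). *)
Definition fe_space (T : seq (n.+1.-tuple 'rV[R]_n)) : set fn :=
  [set v | [/\ H10 v,
      continuous (fun x => Re (v x)) /\ continuous (fun x => Im (v x)),
      forall x, ~ Om x -> v x = 0 &
      forall s, s \in T -> exists (c : R[i]) (a : 'I_n -> R[i]),
        forall x, conv_hull s x -> v x = c + \sum_i a i * (x ord0 i)%:C%C]].

Variable Vh : set fn.

Definition discrete_op v : fn :=
  xget (fun=> 0) [set u | Vh u /\ forall w, Vh w -> inner u w = A v w].

(* (z I - L_h)^-1 w *)
Definition discrete_resolvent (z : R[i]) w : fn :=
  xget (fun=> 0) [set u | Vh u /\ (fun x => z * u x - discrete_op u x) = w].

(* An L^2-orthonormal basis of Vh of eigenfunctions of L_h; M = dim Vh. *)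
Record discrete_eigenbasis (M : nat) (psi : 'I_M -> fn) (lam : 'I_M -> R) : Prop :=
  DiscreteEigenbasis {
  eigenbasis_in : forall j, Vh (psi j);
  eigenbasis_orthonormal : forall i j, inner (psi i) (psi j) = (i == j)%:R;
  eigenbasis_span : forall v, Vh v -> exists c : 'I_M -> R[i],
    v = fun x => \sum_j c j * psi j x;
  eigenbasis_gt0 : forall j, 0 < lam j;
  eigenbasis_eigen : forall j,
    discrete_op (psi j) = fun x => (lam j)%:C%C * psi j x }.

(* exp (- t L_h^beta) w *)
Definition discrete_semigroup (M : nat) (psi : 'I_M -> fn) (lam : 'I_M -> R)
    (beta t : R) (w : fn) : fn :=
  fun x => \sum_j (expR (- (t * lam j `^ beta)))%:C%C * inner w (psi j) * psi j x.

(* Norm of F : Vh -> Vh, with Vh normed by l2norm. *)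
Definition op_norm (F : fn -> fn) : \bar R :=
  ereal_sup [set (l2norm (F w))%:E | w in [set w | Vh w /\ l2norm w <= 1]].

End sobolev.

Section complex_functions.
Context {R : realType}.
Implicit Types z : R[i].

Definition cexp z : R[i] := ((expR (Re z) * cos (Im z)) +i* (expR (Re z) * sin (Im z)))%C.

Definition ccosh z : R[i] := (cexp z + cexp (- z)) / 2.

Definition csinh z : R[i] := (cexp z - cexp (- z)) / 2.

(* principal argument, in ]-pi, pi] *)
Definition carg z : R :=
  let a := acos (Re z / normc z) in if 0 <= Im z then a else - a.

Definition cln z : R[i] := (ln (normc z) +i* carg z)%C.

Definition cpow z (beta : R) : R[i] := cexp (beta%:C%C * cln z).

Definition gamma (b : R) z : R[i] := b%:C%C * (ccosh z + 'i%C * csinh z).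

Definition gamma' (b : R) z : R[i] := derive1 (gamma b : R[i]^o -> R[i]^o) z.

Definition g_fun (b beta lambda : R) z (t : R) : R[i] :=
  cexp (- (t%:C%C * cpow (gamma b z) beta)) * (gamma b z - lambda%:C%C)^-1 *
  gamma' b z.

Definition kappa (b beta d : R) : R :=
  cos (beta * (pi / 4 + d)) * (Num.sqrt 2 * b * sin (pi / 4 - d)) `^ beta.

Definition N_fun (b beta lambda1 d t : R) : \bar R :=
  ereal_sup [set (\int[@lebesgue_measure R]_y
      (normc (g_fun b beta lambda (y +i* d)%C t) +
       normc (g_fun b beta lambda (y -i* d)%C t))%:E)%E |
    lambda in [set lambda | lambda1 <= lambda]].

Definition L_fun (x : R) : R := 1 + `|ln (1 - expR (- x))|.

Definition M_fun (b beta d t : R) : R := 1 + L_fun (kappa b beta d * t).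

Definition rcosh (x : R) : R := (expR x + expR (- x)) / 2.

Definition rsinh (x : R) : R := (expR x - expR (- x)) / 2.

End complex_functions.

Section quadrature.
Context {R : realType} {n : nat}.
Local Notation fn := ('rV[R]_n -> R[i]).
Variables (Om : set 'rV[R]_n) (A : fn -> fn -> R[i]) (Vh : set fn).

Definition sinc_node (N : nat) (k : R) (j : nat) : R := (j%:R - N%:R) * k.

(* The summation index is shifted by N, so that it runs over 0, ..., 2N. *)
Definition sinc_quadrature (b beta : R) (N : nat) (k t : R) (w : fn) : fn :=
  fun x => - (k%:C%C / (2 * pi%:C%C * 'i%C)) *
    \sum_(0 <= j < N.*2.+1)
      cexp (- (t%:C%C * cpow (gamma b (sinc_node N k j)%:C%C) beta)) *
      gamma' b (sinc_node N k j)%:C%C *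
      discrete_resolvent Om A Vh (gamma b (sinc_node N k j)%:C%C) w x.

End quadrature.

(* Main.v *)
(* Expanding in the eigenbasis reduces the operator norm of the error to the
   scalar errors at the eigenvalues lam_j of L_h.  These satisfy
   lam_j >= lambda1, because by Rellich's theorem the Rayleigh quotient of A has
   a minimiser on H^1_0, which is an eigenfunction of L.
   For a scalar lambda >= lambda1, moving the path to Im z = -pi/4, where gamma
   is real, shows that g integrates to -2 pi i exp(-t lambda^beta) over the line.
   For the trapezoidal rule, let S be the sum of the translates of g by the
   nodes.  On the cell [-k/2, k/2] the kernel 1/(1 - exp(-2 pi i z/k)) has real
   part 1/2 on the real axis, is the same at both vertical edges, has zero mean
   and modulus at most 1/(exp(2 pi d/k) - 1) on Im z = d.  Cauchy's theorem for
   (S - S 0) times this kernel gives the error in terms of g on Im z = d and -d.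
   Finally |g| <= C0 exp(-p e^(beta |y|)) with p = kappa 2^-beta t, and
   exp(-p (e^(beta y) - 1)) is dominated by a logistic function of y, whose
   explicit primitive bounds both the omitted terms and N(d,t). *)

Require Import Defs.
From mathcomp Require Import all_boot all_order all_algebra.
From mathcomp Require Import all_classical all_reals all_analysis.
From mathcomp Require Import measurable_realfun complex.
From mathcomp Require Import ring lra.
Import Order.TTheory GRing.Theory Num.Theory.
Import numFieldNormedType.Exports.
Local Open Scope classical_set_scope.
Local Open Scope ring_scope.
Set Implicit Arguments.
Unset Strict Implicit.
Unset Printing Implicit Defensive.

(** * Square-integrable functions *)

(** The mesh may enter the constant only through the eigenvalues of [L_h], so every bound on the
    integrand has to be uniform over all [lambda >= lambda1]. The condition [b < lambda1 / sqrt 2]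
    gives this: on a line of constant imaginary part [gamma] traces a branch of a hyperbola whose
    vertex stays below [lambda1], so no pole enters the open strip of half-width [pi / 4], and for
    [|Im z| <= d] the quotient [gamma' / (gamma - lambda)] has one bound for all [lambda]. The
    obstacle is that two poles sit exactly on the line [Im z = - pi / 4] to which the path is moved.
    Instead of indenting the path, a multiple of [1 / gamma] is subtracted so that the numerator
    vanishes at [lambda]; the part split off has an explicit primitive made of arguments, and it
    produces the residue. For the same reason Cauchy's theorem is proved in a form that exempts a
    null set of each horizontal edge. Rellich's theorem is obtained as an inequality with finitely
    many functionals, by induction on the dimension from product measures and the one-dimensional
    Poincare inequality; ultrafilters then take the place of subsequences. *)

Lemma discriminant_le (R : realFieldType) (a b c : R) : 0 <= a -> 0 <= c ->
  (forall t, 0 <= a + 2 * t * b + t ^+ 2 * c) -> b ^+ 2 <= a * c.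
Proof.
move=> a0 c0 H; have [c_0|cN0] := eqVneq c 0.
  rewrite c_0 mulr0; have [->|b0] := eqVneq b 0; first by rewrite expr0n.
  (* A nonnegative affine function of [t] has slope 0: at this [t] its value would be [- 1]. *)
  have := H (- (a + 1) / (2 * b)); rewrite c_0 mulr0 addr0.
  have -> : 2 * (- (a + 1) / (2 * b)) * b = - (a + 1) by field.
  by move=> ?; lra.
have cp : 0 < c by rewrite lt_neqAle eq_sym cN0.
have := H (- b / c).
have -> : a + 2 * (- b / c) * b + (- b / c) ^+ 2 * c = (a * c - b ^+ 2) / c by field.
by rewrite pmulr_lge0 ?invr_gt0// subr_ge0.
Qed.

Section sqint.
Context d (T : measurableType d) (R : realType).
Variables (mu : {measure set T -> \bar R}) (D : set T).
Hypothesis mD : measurable D.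
Implicit Types f g h : T -> R.

Definition sqint f : Prop :=
  measurable_fun D f /\ (\int[mu]_(x in D) ((f x) ^+ 2)%:E < +oo)%E.

Definition ip f g : R := \int[mu]_(x in D) (f x * g x).

Definition nrm f : R := Num.sqrt (ip f f).

Lemma sqint_integrable f : sqint f -> mu.-integrable D (fun x => ((f x) ^+ 2)%:E).
Proof.
move=> [mf fi]; apply/integrableP; split.
  by apply/measurable_EFinP; exact: measurable_funX.
under eq_integral do rewrite gee0_abs ?lee_fin ?sqr_ge0//.
exact: fi.
Qed.

Lemma sqintM f g : sqint f -> sqint g -> mu.-integrable D (fun x => (f x * g x)%:E).
Proof.
move=> sf sg.
apply: (le_integrable mD _ _ (integrableD mD (sqint_integrable sf) (sqint_integrable sg))).
  by apply/measurable_EFinP; apply: measurable_funM; [case: sf|case: sg].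
move=> x _; rewrite /= lee_fin normrM.
rewrite [leRHS]ger0_norm ?addr_ge0 ?sqr_ge0// -[f x ^+ 2]real_normK ?num_real//.
rewrite -[g x ^+ 2]real_normK ?num_real//.
have := sqr_ge0 (`|f x| - `|g x|); have := sqr_ge0 (`|f x|); have := sqr_ge0 (`|g x|).
by move=> *; nra.
Qed.

Lemma sqintP f : measurable_fun D f ->
  mu.-integrable D (fun x => ((f x) ^+ 2)%:E) -> sqint f.
Proof.
move=> mf /integrableP[_ fi]; split=> //; apply: le_lt_trans fi.
by under [leRHS]eq_integral do rewrite gee0_abs ?lee_fin ?sqr_ge0//.
Qed.

Lemma sqint0 : sqint (fun=> 0).
Proof.
split; first exact: measurable_cst.
by under eq_integral do rewrite expr0n/=; rewrite integral0.
Qed.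

Lemma sqintZ r f : sqint f -> sqint (fun x => r * f x).
Proof.
move=> sf; have [mf _] := sf; apply: sqintP; first exact: measurable_funM.
have := integrableZl mD (r ^+ 2) (sqint_integrable sf).
by apply: eq_integrable => // x _; rewrite /= exprMn EFinM.
Qed.

Lemma sqintD f g : sqint f -> sqint g -> sqint (fun x => f x + g x).
Proof.
move=> sf sg; apply: sqintP.
  by apply: measurable_funD; [case: sf|case: sg].
have := integrableD mD (integrableD mD (sqint_integrable sf) (sqint_integrable sg))
  (integrableZl mD 2 (sqintM sf sg)).
apply: eq_integrable => // x _ /=; rewrite -!EFinM -!EFinD; congr EFin; ring.
Qed.

Lemma sqintN f : sqint f -> sqint (fun x => - f x).
Proof. by move=> /(sqintZ (-1)); under eq_fun do rewrite mulN1r. Qed.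

Lemma sqintB f g : sqint f -> sqint g -> sqint (fun x => f x - g x).
Proof. by move=> sf /sqintN; exact: sqintD. Qed.

Lemma ipC f g : ip f g = ip g f.
Proof. by apply: eq_Rintegral => x _; rewrite mulrC. Qed.

Lemma ipDl f g h : sqint f -> sqint g -> sqint h ->
  ip (fun x => f x + g x) h = ip f h + ip g h.
Proof.
move=> sf sg sh; rewrite /ip -RintegralD//; [|exact: sqintM..].
by apply: eq_Rintegral => x _; rewrite mulrDl.
Qed.

Lemma ipZl r f g : sqint f -> sqint g -> ip (fun x => r * f x) g = r * ip f g.
Proof.
move=> sf sg; rewrite /ip -RintegralZl//; last exact: sqintM.
by apply: eq_Rintegral => x _; rewrite mulrA.
Qed.

Lemma ipNl f g : sqint f -> sqint g -> ip (fun x => - f x) g = - ip f g.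
Proof.
by move=> sf sg; rewrite -mulN1r -ipZl//; congr ip; apply/funext => x; rewrite mulN1r.
Qed.

Lemma ipBl f g h : sqint f -> sqint g -> sqint h ->
  ip (fun x => f x - g x) h = ip f h - ip g h.
Proof. by move=> sf sg sh; rewrite ipDl ?ipNl//; exact: sqintN. Qed.

Lemma ipDr f g h : sqint f -> sqint g -> sqint h ->
  ip h (fun x => f x + g x) = ip h f + ip h g.
Proof. by move=> *; rewrite ipC ipDl// !(ipC _ h). Qed.

Lemma ipZr r f g : sqint f -> sqint g -> ip g (fun x => r * f x) = r * ip g f.
Proof. by move=> *; rewrite ipC ipZl// ipC. Qed.

Lemma ipBr f g h : sqint f -> sqint g -> sqint h ->
  ip h (fun x => f x - g x) = ip h f - ip h g.
Proof. by move=> *; rewrite ipC ipBl// !(ipC _ h). Qed.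

Lemma ip_ge0 f : 0 <= ip f f.
Proof. by apply: Rintegral_ge0 => x _; rewrite -expr2 sqr_ge0. Qed.

Lemma nrm_ge0 f : 0 <= nrm f. Proof. exact: sqrtr_ge0. Qed.

Lemma nrm_sqr f : nrm f ^+ 2 = ip f f.
Proof. by rewrite sqr_sqrtr// ip_ge0. Qed.

(** The quadratic [t -> ip (f + t g) (f + t g)] is nonnegative, so its discriminant is not
    positive. *)
Lemma CauchySchwarz f g : sqint f -> sqint g -> `|ip f g| <= nrm f * nrm g.
Proof.
move=> sf sg; rewrite -(@ler_pXn2r _ 2) ?nnegrE ?mulr_ge0 ?nrm_ge0//.
rewrite real_normK ?num_real// exprMn !nrm_sqr.
apply: discriminant_le; rewrite ?ip_ge0// => t.
have st := sqintZ t sg.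
have := ip_ge0 (fun x => f x + t * g x).
rewrite ipDl ?ipDr ?ipZl ?ipZr//; [|exact: sqintD..].
by rewrite (ipC g f) => h; apply: le_trans h _; rewrite le_eqVlt; apply/orP; left; apply/eqP; ring.
Qed.

Lemma nrmD f g : sqint f -> sqint g -> nrm (fun x => f x + g x) <= nrm f + nrm g.
Proof.
move=> sf sg; rewrite -(@ler_pXn2r _ 2) ?nnegrE ?addr_ge0 ?nrm_ge0//.
rewrite nrm_sqr ipDl ?ipDr//; [|exact: sqintD..].
rewrite (ipC g f) sqrrD !nrm_sqr.
have := CauchySchwarz sf sg; rewrite ler_norml => /andP[_ ?].
by rewrite mulr2n; lra.
Qed.

Lemma nrmN f : nrm (fun x => - f x) = nrm f.
Proof. by rewrite /nrm /ip; congr Num.sqrt; apply: eq_Rintegral => x _; rewrite mulrNN. Qed.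

Lemma nrm_distC f g : nrm (fun x => f x - g x) = nrm (fun x => g x - f x).
Proof. by rewrite -nrmN; congr nrm; apply/funext => x; rewrite opprB. Qed.

Lemma nrmB_tri h f g : sqint f -> sqint g -> sqint h ->
  nrm (fun x => f x - g x) <= nrm (fun x => f x - h x) + nrm (fun x => h x - g x).
Proof.
move=> sf sg sh; apply: le_trans (nrmD (sqintB sf sh) (sqintB sh sg)).
by under [X in nrm X <= _]eq_fun => x do rewrite -(subrKA (h x)).
Qed.

Lemma integral_sqr f : sqint f ->
  (\int[mu]_(x in D) ((f x) ^+ 2)%:E = (nrm f ^+ 2)%:E)%E.
Proof.
move=> sf; rewrite nrm_sqr /ip /Rintegral fineK.
  by apply: eq_integral => x _; rewrite expr2.
exact/integrable_fin_num/sqintM.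
Qed.

Lemma nrm_le f (e : R) : measurable_fun D f -> 0 <= e ->
  (\int[mu]_(x in D) ((f x) ^+ 2)%:E <= (e ^+ 2)%:E)%E -> sqint f /\ nrm f <= e.
Proof.
move=> mf e0 fe; have sf : sqint f by split=> //; apply: le_lt_trans fe _; exact: ltry.
split=> //; rewrite -(@ler_pXn2r _ 2) ?nnegrE ?nrm_ge0//.
by rewrite -lee_fin -integral_sqr.
Qed.

Lemma sqint_sum (I : Type) (s : seq I) (F : I -> T -> R) : (forall i, sqint (F i)) ->
  sqint (fun x => \sum_(i <- s) F i x).
Proof.
move=> sF; elim: s => [|i s IH].
  by under eq_fun do rewrite big_nil; exact: sqint0.
by under eq_fun do rewrite big_cons; exact: sqintD.
Qed.

Lemma nrm0 : nrm (fun=> 0) = 0.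
Proof.
by rewrite /nrm /ip; under eq_Rintegral do rewrite mulr0; rewrite Rintegral_cst// mul0r sqrtr0.
Qed.

Lemma nrm_sum (I : Type) (s : seq I) (F : I -> T -> R) : (forall i, sqint (F i)) ->
  nrm (fun x => \sum_(i <- s) F i x) <= \sum_(i <- s) nrm (F i).
Proof.
move=> sF; elim: s => [|i s IH].
  by under eq_fun do rewrite big_nil; rewrite big_nil nrm0.
under eq_fun do rewrite big_cons; rewrite big_cons.
by apply: (le_trans (nrmD (sF i) (sqint_sum s sF))); rewrite lerD2l.
Qed.

Lemma nrm_abs f : nrm (fun x => `|f x|) = nrm f.
Proof.
rewrite /nrm /ip; congr Num.sqrt; apply: eq_Rintegral => x _.
by rewrite -expr2 real_normK ?num_real// expr2.
Qed.

Lemma sqint_abs f : sqint f -> sqint (fun x => `|f x|).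
Proof.
move=> [mf fi]; split; first exact: measurableT_comp.
by under eq_integral do rewrite real_normK ?num_real//.
Qed.

(** Riesz-Fischer. The sums [S n] of the increments have norm at most 2, so monotone convergence
    makes their limit finite almost everywhere; there the sequence converges absolutely, and Fatou's
    lemma turns this into convergence in norm. *)
Lemma sqint_complete (f_ : nat -> T -> R) :
  (forall k, sqint (f_ k)) ->
  (forall k, nrm (fun x => f_ k.+1 x - f_ k x) <= (2^-1) ^+ k) ->
  exists2 f, sqint f & nrm (fun x => f_ k x - f x) @[k --> \oo] --> 0.
Proof.
move=> sf df.
pose S n x := \sum_(0 <= k < n) `|f_ k.+1 x - f_ k x|.
have sS n : sqint (S n) by apply: sqint_sum => k; exact/sqint_abs/sqintB.
have nS n : nrm (S n) <= 2.
  apply: (le_trans (nrm_sum _ _)) => [k|]; first exact/sqint_abs/sqintB.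
  apply: (@le_trans _ _ (\sum_(0 <= k < n) (2^-1) ^+ k)).
    by apply: ler_sum => k _; rewrite nrm_abs.
  suff -> : \sum_(0 <= k < n) (2^-1 : R) ^+ k = 2 - 2 * (2^-1) ^+ n.
    by rewrite gerBl mulr_ge0// exprn_ge0.
  elim: n => [|n IH]; first by rewrite big_geq// expr0; lra.
  by rewrite big_nat_recr//= IH exprS; lra.
have sB m n : sqint (fun x => f_ n x - f_ m x) by exact: sqintB.
have dist m n : (m <= n)%N -> nrm (fun x => f_ n x - f_ m x) <= 2 * (2^-1) ^+ m.
  move=> mn.
  (* The geometric bound in telescoping form is the one that goes through by induction. *)
  suff : nrm (fun x => f_ n x - f_ m x) <= 2 * (2^-1) ^+ m - 2 * (2^-1) ^+ n.
    by move=> /le_trans; apply; rewrite gerBl mulr_ge0// exprn_ge0.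
  rewrite -(subnKC mn); elim: (n - m)%N => [|p IH].
    by rewrite addn0; under eq_fun do rewrite subrr; rewrite nrm0 subrr.
  apply: (le_trans (nrmB_tri (sf _) (sf _) (sf (m + p)%N))); rewrite addnS.
  by have := df (m + p)%N; rewrite exprS; move: IH; lra.
have mS2 n : measurable_fun D (fun x => ((S n x) ^+ 2)%:E).
  by apply/measurable_EFinP/measurable_funX; case: (sS n).
have S_ge0 n x : 0 <= S n x by apply: sumr_ge0.
have Snd x : nondecreasing_seq (S ^~ x).
  by apply/nondecreasing_seqP => n; rewrite /S big_nat_recr//= lerDl.
have S2nd x : {homo (fun n => ((S n x) ^+ 2)%:E) : m n / (m <= n)%N >-> (m <= n)%E}.
  by move=> m n mn; rewrite lee_fin lerXn2r ?nnegrE//; exact: Snd.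
pose G x := limn (fun n => ((S n x) ^+ 2)%:E).
have G0 x : (0 <= G x)%E.
  apply: lime_ge; first by apply: ereal_nondecreasing_is_cvgn => m n; exact: S2nd.
  by apply: nearW => n; rewrite lee_fin sqr_ge0.
have mG : measurable_fun D G.
  apply: emeasurable_fun_cvg mS2 _ => x _.
  by apply: ereal_nondecreasing_is_cvgn => m n; exact: S2nd.
have iG : mu.-integrable D G.
  apply/integrableP; split => //; under eq_integral do rewrite gee0_abs//.
  rewrite monotone_convergence//; last first.
    by move=> n x _; rewrite lee_fin sqr_ge0.
  apply: (@le_lt_trans _ _ 4%:E); last exact: ltry.
  apply: lime_le.
    apply: ereal_nondecreasing_is_cvgn => m n mn; apply: ge0_le_integral => //.
    - by move=> x _; rewrite lee_fin sqr_ge0.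
    - by move=> x _; exact: S2nd.
  apply: nearW => n; rewrite integral_sqr// lee_fin.
  by rewrite (_ : 4 = 2 ^+ 2); [rewrite lerXn2r ?nnegrE// nrm_ge0|ring].
(* The upper limit is measurable without any convergence and equals the limit wherever that
   exists. *)
pose f x := fine (limn_esup (fun n => (f_ n x)%:E)).
have mf : measurable_fun D f.
  apply: (measurableT_comp (fine_measurable measurableT)).
  by apply: measurable_fun_limn_esup => n; apply/measurable_EFinP; case: (sf n).
have cf : {ae mu, forall x, D x -> f_ ^~ x @ \oo --> f x}.
  apply: filterS (integrable_ae mD iG) => x Gfin Dx.
  (* [s <= s ^+ 2 + 1] passes from the squares, whose limit is finite, to [S n x] itself. *)
  have Sb n : S n x <= fine (G x) + 1.
    have : (((S n x) ^+ 2)%:E <= G x)%E.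
      apply: lime_ge.
        by apply: ereal_nondecreasing_is_cvgn => p q; exact: S2nd.
      by exists n => // m /= nm; exact: S2nd.
    rewrite -[G x]fineK ?Gfin// lee_fin => h.
    have := sqr_ge0 (S n x - 1); have := S_ge0 n x.
    have : 0 <= fine (G x) by rewrite fine_ge0.
    by nra.
  have cS : cvgn (S ^~ x).
    by apply: nondecreasing_is_cvgn => //; exists (fine (G x) + 1) => _ [n _ <-].
  have : cvgn (series (telescope (f_ ^~ x))) by apply: normed_cvg; exact: cS.
  move=> cT.
  have cx : cvgn (f_ ^~ x).
    have -> : f_ ^~ x = fun n => f_ 0%N x + series (telescope (f_ ^~ x)) n.
      by apply/funext => n; rewrite telescopeK addrC subrK.
    by apply: is_cvgD => //; exact: is_cvg_cst.
  suff -> : f x = limn (f_ ^~ x) by [].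
  rewrite /f is_cvg_limn_esupE; last first.
    by apply/cvg_ex; exists (limn (f_ ^~ x))%:E; apply/cvg_EFin => //; exact: nearW.
  have -> // : limn (fun n => (f_ n x)%:E) = (limn (f_ ^~ x))%:E by exact: EFin_lim.
have key k : sqint (fun x => f_ k x - f x) /\ nrm (fun x => f_ k x - f x) <= 2 * (2^-1) ^+ k.
  apply: nrm_le.
  - by apply: measurable_funB => //; case: (sf k).
  - by rewrite mulr_ge0// exprn_ge0.
  have mF j : measurable_fun D (fun x => ((f_ k x - f_ j x) ^+ 2)%:E).
    by apply/measurable_EFinP/measurable_funX; case: (sB j k).
  apply: (@le_trans _ _ (\int[mu]_(x in D) limn_einf (fun j => ((f_ k x - f_ j x) ^+ 2)%:E))%E).
    apply: ae_ge0_le_integral => //.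
    - by move=> x _; rewrite lee_fin sqr_ge0.
    - apply/measurable_EFinP/measurable_funX; apply: measurable_funB => //.
      by case: (sf k).
    - move=> x _; rewrite limn_einf_lim; apply: lime_ge; first exact: is_cvg_einfs.
      apply: nearW => j; apply: le_ereal_inf_tmp => _ [i _ <-].
      by rewrite lee_fin sqr_ge0.
    - under eq_fun do rewrite -[limn_einf _]oppeK -limn_esupN.
      apply: measurableT_comp => //; apply: measurable_fun_limn_esup => j.
      exact: measurableT_comp.
    apply: filterS cf => x cf Dx.
    have -> // : limn_einf (fun j => ((f_ k x - f_ j x) ^+ 2)%:E) = ((f_ k x - f x) ^+ 2)%:E.
    have : (fun j => ((f_ k x - f_ j x) ^+ 2)%:E) @ \oo --> ((f_ k x - f x) ^+ 2)%:E.
      apply/cvg_EFin; first exact: nearW.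
      rewrite expr2 [X in X @ _ --> _](_ : _ = fun j => (f_ k x - f_ j x) * (f_ k x - f_ j x)).
        by apply: cvgM; apply: cvgB; [exact: cvg_cst|exact: cf|exact: cvg_cst|exact: cf].
      by apply/funext => j; rewrite /= expr2.
    by move=> /cvg_limn_einf_sup[].
  apply: le_trans (fatou mu mD mF _) _; first by move=> j x _; rewrite lee_fin sqr_ge0.
  rewrite limn_einf_lim; apply: lime_le; first exact: is_cvg_einfs.
  apply: nearW => j.
  (* [maxn j k] is an admissible index for the lower limit and lies beyond [k], where [dist]
     applies. *)
  apply: (@le_trans _ _ (\int[mu]_(x in D) ((f_ k x - f_ (maxn j k) x) ^+ 2)%:E)%E).
    by apply: ereal_inf_lbound; exists (maxn j k) => //=; exact: leq_maxl.
  rewrite integral_sqr// lee_fin lerXn2r ?nnegrE ?nrm_ge0 ?mulr_ge0 ?exprn_ge0//.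
  by rewrite nrm_distC; apply: dist; exact: leq_maxr.
exists f.
  have [+ _] := key 0%N; move=> /(sqintB (sf 0%N)).
  by under eq_fun do rewrite opprB addrC subrK.
apply: (@squeeze_cvgr _ _ _ _ (fun=> 0) (fun k => 2 * (2^-1) ^+ k)).
- by apply: nearW => k; rewrite nrm_ge0; case: (key k).
- exact: cvg_cst.
- rewrite -[X in _ --> X](mulr0 2); apply: cvgMr; apply: cvg_expr.
  by rewrite gtr0_norm ?invr_gt0// invf_lt1//; lra.
Qed.

End sqint.

(** * Test functions and the fundamental lemma *)

Section rowbox.
Context {R : realType} {n : nat}.
Implicit Types (U : set 'rV[R]_n) (a b x : 'rV[R]_n).

Definition obox a b : set 'rV[R]_n := [set x | forall i, a ord0 i < x ord0 i < b ord0 i].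

Definition cbox a b : set 'rV[R]_n := [set x | forall i, a ord0 i <= x ord0 i <= b ord0 i].

Lemma measurable_obox a b : measurable (obox a b).
Proof.
have -> : obox a b = \bigcap_(i in [set: 'I_n])
    ((fun x : 'rV[R]_n => x ord0 i : measurableTypeR R) @^-1` `]a ord0 i, b ord0 i[%classic).
  apply/seteqP; split=> x.
    by move=> abx i _ /=; rewrite in_itv /= abx.
  by move=> H i; have := H i Logic.I; rewrite /= in_itv.
apply: fin_bigcap_measurable => // i _; rewrite -[X in measurable X]setTI.
exact: measurable_coord.
Qed.

(** Balls of the sup norm are boxes, so rational endpoints fit in coordinate by coordinate. The
    closed box is kept inside [U] as well because it will carry the support of a test function. *)
Lemma open_obox_rat U x : open U -> U x ->
  exists a b : 'rV[rat]_n, obox (map_mx ratr a) (map_mx ratr b) x /\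
    cbox (map_mx ratr a) (map_mx ratr b) `<=` U.
Proof.
move=> oU Ux; have /nbhs_ballP[e /= e0 eU] : nbhs x U by exact: open_nbhs_nbhs.
have Ha i : exists q : rat, x ord0 i - e < ratr q < x ord0 i.
  have : x ord0 i - e < x ord0 i by rewrite ltrBlDr ltrDl.
  by move=> /rat_in_itvoo[q]; rewrite in_itv => h; exists q.
have Hb i : exists q : rat, x ord0 i < ratr q < x ord0 i + e.
  have : x ord0 i < x ord0 i + e by rewrite ltrDl.
  by move=> /rat_in_itvoo[q]; rewrite in_itv => h; exists q.
have [fa Hfa] := choice Ha; have [fb Hfb] := choice Hb.
exists (\row_i fa i), (\row_i fb i); split=> [i|y H].
  by rewrite !mxE; have /andP[_ ->] := Hfa i; have /andP[-> _] := Hfb i.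
apply: eU; split=> // i j; rewrite (ord1 i) /ball /= ltr_norml.
have /andP[h1 _] := Hfa j; have /andP[_ h2] := Hfb j.
have := H j; rewrite !mxE => /andP[h3 h4].
by apply/andP; split; lra.
Qed.

(** The sigma-algebra of rows is generated by the coordinates, so an open set has to be exhibited as
    a countable union of boxes. *)
Lemma open_measurable_row U : open U -> measurable U.
Proof.
move=> oU.
pose F (p : 'rV[rat]_n * 'rV[rat]_n) :=
  if `[< cbox (map_mx ratr p.1) (map_mx ratr p.2) `<=` U >]
  then obox (map_mx ratr p.1) (map_mx ratr p.2) else set0.
have -> : U = \bigcup_p F p.
  apply/seteqP; split=> [x /(open_obox_rat oU)[a [b [abx abU]]]|x [p _]].
    by exists (a, b) => //; rewrite /F /= asboolT.
  by rewrite /F; case: asboolP => // pU xp; apply: pU => i; have /andP[h1 h2] := xp i; rewrite !ltW.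
apply: countable_bigcupT_measurable => [|p]; first exact: countableP.
by rewrite /F; case: ifP => _; [exact: measurable_obox|exact: measurable0].
Qed.

Lemma continuous_measurable_row (f : 'rV[R]_n -> R) (D : set 'rV[R]_n) :
  measurable D -> continuous f -> measurable_fun D (f : 'rV[R]_n -> measurableTypeR R).
Proof.
move=> mD cf; apply: (@measurable_funS _ _ _ _ setT) => //.
apply: (measurability _ (RGenOpens.measurableE R)).
move=> _ [_ [a [b ->] <-]]; rewrite setTI; apply: open_measurable_row.
by move/continuousP : cf; apply; exact: interval_open.
Qed.

End rowbox.

(** * Smooth cutoff functions *)

Section line.
Context {R : realType} {V W : normedModType R}.

(** Turns a directional derivative into a derivative in one real variable, for which the chain rule
    is at hand. *)
Lemma is_derive_line (f : V -> W) (x v : V) (l : W) :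
  is_derive (0 : R) (1 : R) (fun t : R => f (t *: v + x)) l -> is_derive x v f l.
Proof.
have E : (fun h : R => h^-1 *: ((f \o shift x) (h *: v) - f x)) =
    (fun h : R => h^-1 *: (((fun t : R => f (t *: v + x)) \o shift 0) (h *: (1 : R)) -
       f (0 *: v + x))).
  by apply/funext => h /=; rewrite addr0 scale0r add0r [h *: 1]mulr1.
by move=> [d1 d2]; split; [rewrite /derivable E|rewrite /derive E].
Qed.

Lemma derive_is_line (f : V -> W) (x v : V) (l : W) :
  is_derive x v f l -> is_derive (0 : R) (1 : R) (fun t : R => f (t *: v + x)) l.
Proof.
have E : (fun h : R => h^-1 *: ((f \o shift x) (h *: v) - f x)) =
    (fun h : R => h^-1 *: (((fun t : R => f (t *: v + x)) \o shift 0) (h *: (1 : R)) -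
       f (0 *: v + x))).
  by apply/funext => h /=; rewrite addr0 scale0r add0r [h *: 1]mulr1.
by move=> [d1 d2]; split; [rewrite /derivable -E|rewrite /derive -E].
Qed.
End line.

Section flat.
Context {R : realType}.
Implicit Types (p : {poly R}) (x : R).

(* The functions p(1/x) exp(-1/x) on x > 0, extended by 0, are closed under derivation. *)
Definition flat p x : R := if 0 < x then p.[x^-1] * expR (- x^-1) else 0.

(** Termwise: [y ^+ m <= m! * expR y] by the exponential series. *)
Lemma horner_expR_bounded p : exists2 C : R, 0 <= C &
  forall y, 0 < y -> `|p.[y]| * expR (- y) <= C.
Proof.
elim/poly_ind: p => [|p c _].
  by exists 0 => // y _; rewrite horner0 normr0 mul0r.
pose q := p * 'X + c%:P; rewrite -/q.
exists (\sum_(i < size q) `|q`_i| * i`!%:R) => [|y y0].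
  by apply: sumr_ge0 => i _; rewrite mulr_ge0.
rewrite horner_coef; apply: (le_trans (ler_wpM2r (expR_ge0 _) (ler_norm_sum _ _ _))).
rewrite mulr_suml; apply: ler_sum => i _; rewrite normrM -mulrA ler_wpM2l//.
rewrite ger0_norm ?exprn_ge0 ?(ltW y0)// expRN ler_pdivrMr ?expR_gt0//.
rewrite mulrC -ler_pdivrMr ?ltr0n ?fact_gt0//.
case: (val i) => [|m].
  by rewrite expr0 fact0 divr1 -expR0 ler_expR ltW.
by apply: le_trans (expR_ge1Dxn m (ltW y0)); rewrite lerDr.
Qed.

(** Boundedness for [p * 'X ^+ 2] instead of [p]. Quadratic decay at 0 forces the difference
    quotient of [flat p] at 0 to vanish. *)
Lemma flat_le2 p : exists2 C : R, 0 <= C & forall x, `|flat p x| <= C * x ^+ 2.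
Proof.
have [C C0 HC] := horner_expR_bounded (p * 'X ^+ 2); exists C => // x.
rewrite /flat; case: ifPn => x0; last by rewrite normr0 mulr_ge0// sqr_ge0.
have := HC x^-1; rewrite invr_gt0 => /(_ x0).
rewrite hornerM hornerXn normrM => h.
rewrite normrM (ger0_norm (expR_ge0 _)) -ler_pdivrMr ?exprn_gt0//.
apply: le_trans h; rewrite [`|x^-1 ^+ 2|]ger0_norm ?sqr_ge0// exprVn.
by rewrite mulrAC.
Qed.

Lemma is_derive_flat p x : is_derive x 1 (flat p) (flat ('X ^+ 2 * (p - p^`())) x).
Proof.
have [x0|x0|x0] := ltgtP 0 x.
- apply: (@near_eq_is_derive R R R (fun y : R => p.[y^-1] * expR (- y^-1))).
    near=> y; rewrite /flat ifT//.
    by near: y; exact: lt_nbhsr.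
  have xN0 : x != 0 by rewrite gt_eqF.
  have dI : is_derive x 1 (fun y : R => y^-1) (- x ^- 2 *: 1).
    exact: (@is_deriveV _ id).
  have dN : is_derive x 1 (fun y : R => - y^-1) (- (- x ^- 2 *: 1)) by exact: is_deriveN.
  have d1 : is_derive x 1 (fun y : R => p.[y^-1]) (p^`().[x^-1] * (- x ^- 2 *: 1)).
    exact: (@is_derive1_comp R (horner p) (fun y : R => y^-1) x _ _ (is_derive_poly p _) dI).
  have d2 : is_derive x 1 (fun y : R => expR (- y^-1)) (expR (- x^-1) * - (- x ^- 2 *: 1)).
    exact: (@is_derive1_comp R expR (fun y : R => - y^-1) x _ _ (is_derive_expR _) dN).
  apply: (is_derive_eq (is_deriveM d1 d2)).
  rewrite /flat x0 hornerM hornerXn hornerD hornerN exprVn.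
  rewrite /GRing.scale /=; ring.
- apply: (@near_eq_is_derive R R R (fun=> 0)).
    near=> y; rewrite /flat ifF//; apply/negbTE; rewrite -leNgt ltW//.
    by near: y; exact: lt_nbhsl.
  have -> : flat ('X ^+ 2 * (p - p^`())) x = 0 by rewrite /flat lt_gtF.
  exact: is_derive_cst.
rewrite -x0 [flat ('X ^+ 2 * _) 0]/flat ltxx.
have [C C0 HC] := flat_le2 p.
have F : (fun h : R => h^-1 *: ((flat p \o shift 0) (h *: 1) - flat p 0)) @ 0^' --> (0:R).
  apply/cvgrPdist_le => /= e e0.
  near=> h; rewrite sub0r normrN addr0 [h *: 1]mulr1 [flat p 0]/flat ltxx subr0.
  have h0 : h != 0 by near: h; exact: nbhs_dnbhs_neq.
  rewrite normrZ normfV ler_pdivrMl ?normr_gt0//.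
  apply: (le_trans (HC h)); rewrite -[h ^+ 2]real_normK ?num_real// expr2 mulrA [leRHS]mulrC ler_wpM2r//.
  have : `|h| <= e / (C + 1).
    near: h; apply: nbhs_dnbhs; exists (e / (C + 1)) => /=.
      by rewrite divr_gt0// ltr_wpDl.
    by move=> z /=; rewrite sub0r normrN => /ltW.
  rewrite ler_pdivlMr ?ltr_wpDl// mulrC => /(le_trans _); apply.
  by rewrite ler_wpM2r// lerDl.
split; first by apply/cvg_ex; exists 0.
exact: cvg_lim F.
Unshelve. all: by end_near. Qed.

Lemma continuous_flat p : continuous (flat p).
Proof.
move=> x; apply: differentiable_continuous; apply/derivable1_diffP.
by have [] := is_derive_flat p x.
Qed.

End flat.

Section class_C.
Context {R : realType} {n : nat}.
Implicit Types (f g : 'rV[R]_n -> R) (k : nat).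

Lemma class_C_continuous k f : class_C k f -> continuous f.
Proof. by case: k => [|k] []. Qed.

Lemma class_CS k f : class_C k.+1 f -> class_C k f.
Proof.
elim: k f => [|k IH] f /= [cf df]; split=> // i.
by have [d1 d2] := df i; split=> //; exact: IH.
Qed.

Lemma class_CD k f g : class_C k f -> class_C k g -> class_C k (fun x => f x + g x).
Proof.
elim: k f g => [|k IH] f g [cf df] [cg dg].
  by split=> // x; exact: (cvgD (cf x) (cg x)).
split=> [x|i]; first by exact: (cvgD (cf x) (cg x)).
have [df1 df2] := df i; have [dg1 dg2] := dg i; split=> [x|].
  exact: (derivableD (df1 x) (dg1 x)).
have -> : partial i (fun x => f x + g x) = fun x => partial i f x + partial i g x.
  by apply/funext => x; exact: (deriveD (df1 x) (dg1 x)).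
exact: IH.
Qed.

Lemma class_CM k f g : class_C k f -> class_C k g -> class_C k (fun x => f x * g x).
Proof.
elim: k f g => [|k IH] f g Cf Cg; have [cf df] := Cf; have [cg dg] := Cg.
  by split=> // x; exact: (cvgM (cf x) (cg x)).
split=> [x|i]; first by exact: (cvgM (cf x) (cg x)).
have [df1 df2] := df i; have [dg1 dg2] := dg i; split=> [x|].
  exact: (derivableM (df1 x) (dg1 x)).
have -> : partial i (fun x => f x * g x) = fun x => f x * partial i g x + g x * partial i f x.
  by apply/funext => x; exact: (deriveM (df1 x) (dg1 x)).
by apply: class_CD; apply: IH => //; exact: class_CS.
Qed.

Lemma class_C_cst k (c : R) : @class_C R n k (fun=> c).
Proof.
elim: k c => [|k IH] c; first by split=> // x; exact: (@cst_continuous _ _ c x).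
split=> [x|i]; first exact: (@cst_continuous _ _ c x).
split=> [x|]; first exact: derivable_cst.
have -> : @partial R n i (fun=> c) = fun=> 0.
  by apply/funext => x; exact: derive_cst.
exact: IH.
Qed.

Lemma class_C_prod k (I : Type) (s : seq I) (F : I -> 'rV[R]_n -> R) :
  (forall i, class_C k (F i)) -> class_C k (fun x => \prod_(i <- s) F i x).
Proof.
move=> CF; elim: s => [|i s IH].
  by under eq_fun do rewrite big_nil; exact: class_C_cst.
by under eq_fun do rewrite big_cons; exact: class_CM.
Qed.

Lemma is_derive_coord (g : R -> R) (g' : R) (c e : R) (j i : 'I_n) (x : 'rV[R]_n) :
  is_derive (c * x ord0 j + e) 1 g g' ->
  is_derive x (delta_mx ord0 i) (fun y : 'rV[R]_n => g (c * y ord0 j + e))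
    (g' * (c * (i == j)%:R)).
Proof.
move=> dg; apply: is_derive_line.
pose l (t : R) := (c * (i == j)%:R) *: t + (c * x ord0 j + e).
have -> : (fun t : R => g (c * (t *: delta_mx ord0 i + x) ord0 j + e)) = g \o l.
  apply/funext => t; rewrite /l /= !mxE eqxx /= (eq_sym j) /GRing.scale /=; congr g; ring.
have dl : is_derive (0 : R) (1 : R) l ((c * (i == j)%:R) *: 1 + 0).
  exact: is_deriveD.
apply: (is_derive_eq (@is_derive1_comp R g l 0 g' ((c * (i == j)%:R) *: 1 + 0) _ dl)).
  by rewrite /l scaler0 add0r.
by rewrite /GRing.scale /= mulr1 addr0.
Qed.

Lemma coord_affine_continuous (c e : R) (j : 'I_n) :
  continuous (fun x : 'rV[R]_n => c * x ord0 j + e).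
Proof.
move=> x; have h := @coord_continuous R 1 n ord0 j x.
exact: (cvgD (cvgM (@cst_continuous _ _ c x) h) (@cst_continuous _ _ e x)).
Qed.

(** The induction runs over all [p] at once, since differentiation changes the polynomial. *)
Lemma class_C_flat k (p : {poly R}) (c e : R) (j : 'I_n) :
  class_C k (fun x : 'rV[R]_n => flat p (c * x ord0 j + e)).
Proof.
elim: k p => [|k IH] p.
  split=> // x; apply: (cvg_comp _ _ (@coord_affine_continuous c e j x)).
  exact: continuous_flat.
split=> [x|i].
  apply: (cvg_comp _ _ (@coord_affine_continuous c e j x)).
  exact: continuous_flat.
have D x := @is_derive_coord _ _ c e j i x (is_derive_flat p (c * x ord0 j + e)).
split=> [x|]; first by have [] := D x.
have -> : partial i (fun x : 'rV[R]_n => flat p (c * x ord0 j + e)) =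
    fun x => flat ('X ^+ 2 * (p - p^`())) (c * x ord0 j + e) * (c * (i == j)%:R).
  by apply/funext => x; have [_] := D x.
by apply: class_CM; [exact: IH|exact: class_C_cst].
Qed.

End class_C.

Section cube.
Context {R : realType}.

Definition cube n (rho : R) : set 'rV[R]_n := [set x | forall i, `|x ord0 i| <= rho].
Arguments cube : clear implicits.

Lemma cube_cbox n (rho : R) : cube n rho = cbox (const_mx (- rho)) (const_mx rho).
Proof.
by apply/seteqP; split=> x H i; have := H i; rewrite !mxE ler_norml.
Qed.

Lemma measurable_cbox n (a b : 'rV[R]_n) : measurable (cbox a b).
Proof.
have -> : cbox a b = \bigcap_(i in [set: 'I_n])
    ((fun x : 'rV[R]_n => x ord0 i : measurableTypeR R) @^-1` `[a ord0 i, b ord0 i]%classic).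
  apply/seteqP; split=> x.
    by move=> abx i _ /=; rewrite in_itv /= abx.
  by move=> H i; have := H i Logic.I; rewrite /= in_itv.
apply: fin_bigcap_measurable => // i _; rewrite -[X in measurable X]setTI.
exact: measurable_coord.
Qed.

Lemma measurable_cube n rho : measurable (cube n rho).
Proof. by rewrite cube_cbox; exact: measurable_cbox. Qed.

Lemma lebesgue_cube_fin n (rho : R) : (lebesgue_row n (cube n rho) < +oo)%E.
Proof.
elim: n => [|n IH]; first by rewrite /= diracE; exact: ltry.
rewrite /= /lebesgue_step.
have -> : @cons_row R n @^-1` cube n.+1 rho = `[- rho, rho]%classic `*` cube n rho.
  apply/seteqP; split=> -[x v] /=.
    move=> H; split; first by have := H ord0; rewrite mxE unlift_none /= in_itv /= ler_norml.
    by move=> i; have := H (lift ord0 i); rewrite mxE liftK.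
  rewrite in_itv /= -ler_norml => -[xr H] i; rewrite mxE.
  by case: unliftP => [j _|_] //=; exact: H.
rewrite product_measure1E//; last exact: measurable_cube.
rewrite /= lebesgue_measure_itv /=.
case: ifPn => [h|_]; last by rewrite mul0e; exact: ltry.
rewrite -EFinD lte_mul_pinfty// lee_fin opprK.
by move: h; rewrite lte_fin; lra.
Qed.

Lemma bounded_cube n (A : set 'rV[R]_n) : bounded_set A -> exists2 rho : R, 0 < rho & A `<=` cube n rho.
Proof.
move=> [M [_ HM]]; exists (`|M| + 1) => [|x Ax i]; first by rewrite ltr_wpDl.
have := HM (`|M| + 1); rewrite (le_lt_trans (ler_norm M)) ?ltrDl// => /(_ isT x Ax).
apply: le_trans; rewrite [leRHS]mx_normrE.
exact: (le_bigmax _ (fun i => `|x i.1 i.2|) (ord0, i)).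
Qed.

Lemma compact_cbox n (a b : 'rV[R]_n) : compact (cbox a b).
Proof.
rewrite (_ : cbox a b = [set v : 'rV[R]_n | forall i, `[a ord0 i, b ord0 i]%classic (v ord0 i)]).
  by apply: (@rV_compact R n (fun i => `[a ord0 i, b ord0 i]%classic)) => i; exact: segment_compact.
by apply/seteqP; split=> x H i; have := H i; rewrite /= in_itv.
Qed.

End cube.
Arguments cube {R} n rho.

Section bump.
Context {R : realType} {n : nat}.
Variables a b : 'rV[R]_n.

(** A product of one-sided cutoffs, two per coordinate. Stretching their arguments by [k.+1] makes
    the bumps tend to the indicator of the open box. *)
Definition bump (k : nat) (x : 'rV[R]_n) : R :=
  \prod_(i < n) (flat 1 (k.+1%:R * x ord0 i + - (k.+1%:R * a ord0 i)) *
                 flat 1 (- k.+1%:R * x ord0 i + k.+1%:R * b ord0 i)).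

Lemma flat1_ge0 (x : R) : 0 <= flat 1 x.
Proof. by rewrite /flat hornerC mul1r; case: ifP => // _; exact: expR_ge0. Qed.

Lemma flat1_le1 (x : R) : flat 1 x <= 1.
Proof.
rewrite /flat hornerC mul1r; case: ifPn => // x0.
by rewrite -expR0 ler_expR oppr_le0 invr_ge0 ltW.
Qed.

Lemma bump_ge0 k x : 0 <= bump k x.
Proof. by apply: prodr_ge0 => i _; rewrite mulr_ge0// flat1_ge0. Qed.

Lemma bump_le1 k x : bump k x <= 1.
Proof.
apply: prodr_ile1 => i _; rewrite mulr_ge0 ?flat1_ge0//=.
by rewrite mulr_ile1// ?flat1_ge0// flat1_le1.
Qed.

Lemma bump_out k x : ~ obox a b x -> bump k x = 0.
Proof.
move=> H; have : exists i, ~ (a ord0 i < x ord0 i < b ord0 i).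
  by apply/existsNP => h; exact: H.
move=> [j] /negP; rewrite negb_and -!leNgt => h.
have k0 : 0 < k.+1%:R :> R by rewrite ltr0n.
rewrite /bump (bigD1 j)//= /flat.
case/orP: h => h.
  by rewrite ifF ?mul0r// -mulrBr; apply/negbTE; rewrite -leNgt pmulr_rle0// subr_le0.
rewrite (ifF _ _ (_ : (0 < - k.+1%:R * x ord0 j + _) = false)) ?mulr0 ?mul0r//.
by rewrite mulNr addrC -mulrBr; apply/negbTE; rewrite -leNgt pmulr_rle0// subr_le0.
Qed.

Lemma class_C_bump j k : class_C j (bump k).
Proof. by apply: class_C_prod => i; apply: class_CM; exact: class_C_flat. Qed.

Lemma flat1_cvg (c : R) : 0 < c -> flat 1 (k.+1%:R * c) @[k --> \oo] --> (1 : R).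
Proof.
move=> c0.
have E k : flat 1 (k.+1%:R * c) = expR (- (c^-1 * harmonic k)).
  by rewrite /flat mulr_gt0 ?ltr0n// hornerC mul1r invfM mulrC.
under eq_fun do rewrite E.
have h0 : - (c^-1 * harmonic k) @[k --> \oo] --> (0 : R).
  rewrite -[X in _ --> X]oppr0; apply: cvgN; rewrite -[X in _ --> X](mulr0 c^-1).
  by apply: cvgMr; exact: cvg_harmonic.
rewrite -expR0; exact: (cvg_comp _ _ h0 (@continuous_expR R 0)).
Qed.

Lemma bump_in x : obox a b x -> bump k x @[k --> \oo] --> (1 : R).
Proof.
move=> abx; rewrite /bump.
pose F i (k : nat) := flat 1 (k.+1%:R * x ord0 i + - (k.+1%:R * a ord0 i)) *
                 flat 1 (- k.+1%:R * x ord0 i + k.+1%:R * b ord0 i).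
have : forall s : seq 'I_n,
    \prod_(i <- s) F i k @[k --> \oo] --> \prod_(i <- s) (1 * 1 : R); last first.
  by move=> /(_ (index_enum _)); rewrite (_ : \prod_(i <- index_enum _) (1 * 1) = 1 :> R)// big1// => i _; rewrite mulr1.
elim=> [|i s IH].
  by under eq_fun do rewrite big_nil; rewrite big_nil; exact: cvg_cst.
under eq_fun do rewrite big_cons; rewrite big_cons.
apply: cvgM; last exact: IH.
rewrite /F; apply: cvgM.
  under eq_fun do rewrite -mulrBr; apply: flat1_cvg.
  by have /andP[h _] := abx i; rewrite subr_gt0.
under eq_fun do rewrite mulNr addrC -mulrBr; apply: flat1_cvg.
by have /andP[_ h] := abx i; rewrite subr_gt0.
Qed.

Lemma test_bump (Om : set 'rV[R]_n) k : cbox a b `<=` Om -> test_function Om (bump k).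
Proof.
move=> abO; split=> [j|]; first exact: class_C_bump.
exists (cbox a b); split=> //; first exact: compact_cbox.
move=> x abx; apply: bump_out => h; apply: abx => i.
by have /andP[h1 h2] := h i; rewrite !ltW.
Qed.

End bump.

Section boxes_generate.
Context {R : realType} {n : nat}.

Definition oboxes : set (set 'rV[R]_n) := [set obox p.1 p.2 | p in [set: 'rV[R]_n * 'rV[R]_n]].

Lemma setI_obox (a b a' b' : 'rV[R]_n) : obox a b `&` obox a' b' =
  obox (\row_i Num.max (a ord0 i) (a' ord0 i)) (\row_i Num.min (b ord0 i) (b' ord0 i)).
Proof.
apply/seteqP; split=> x.
  by move=> [H H'] i; rewrite !mxE gt_max lt_min; have /andP[-> ->] := H i; have /andP[-> ->] := H' i.
by move=> H; split=> i; have := H i; rewrite !mxE gt_max lt_min => /andP[/andP[h1 h2] /andP[h3 h4]];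
  rewrite ?h1 ?h2 ?h3 ?h4.
Qed.

Lemma oboxes_setI : setI_closed oboxes.
Proof.
move=> _ _ [[a b] _ <-] [[a' b'] _ <-] /=; rewrite setI_obox.
by exists (\row_i Num.max (a ord0 i) (a' ord0 i), \row_i Num.min (b ord0 i) (b' ord0 i)).
Qed.

Lemma open_oboxes (U : set 'rV[R]_n) : open U -> <<s oboxes >> U.
Proof.
move=> oU; pose F (k : nat) : set 'rV[R]_n :=
  if @unpickle ('rV[rat]_n * 'rV[rat]_n)%type k is Some p then
    if `[< cbox (map_mx ratr p.1) (map_mx ratr p.2) `<=` U >]
    then obox (map_mx ratr p.1) (map_mx ratr p.2) else set0
  else set0.
have -> : U = \bigcup_k F k.
  apply/seteqP; split=> [x /(open_obox_rat oU)[a [b [abx abU]]]|x [k _]].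
    by exists (pickle (a, b)) => //; rewrite /F pickleK /= asboolT.
  rewrite /F; case: unpickle => // p; case: asboolP => // pU xp; apply: pU => i.
  by have /andP[h1 h2] := xp i; rewrite !ltW.
apply: sigma_algebra_bigcup => k; rewrite /F.
case: unpickle => [p|]; last exact: sigma_algebra0.
case: ifP => _; last exact: sigma_algebra0.
by apply: sub_sigma_algebra; exists (map_mx ratr p.1, map_mx ratr p.2).
Qed.

(** Together with [oboxes_setI] this makes the boxes a generating pi-system, ready for Dynkin's
    theorem. *)
Lemma measurable_oboxes (A : set 'rV[R]_n) : measurable A -> <<s oboxes >> A.
Proof.
move=> mA; apply: (smallest_sub _ _ mA); first exact: smallest_sigma_algebra.
move=> B; rewrite -bigcup_seq => -[i _ [Y mY <-]]; rewrite setTI.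
have : measurable Y by exact: mY.
rewrite RGenOpens.measurableE => /(_ [set Z | <<s oboxes >> ((fun x : 'rV[R]_n => x ord0 i : R) @^-1` Z)]) /=.
apply; split => /=.
  split => /=.
  - by rewrite preimage_set0; exact: sigma_algebra0.
  - by move=> Z; rewrite setTD preimage_setC; exact: sigma_algebraC.
  - by move=> F mF; rewrite preimage_bigcup; exact: sigma_algebra_bigcup.
move=> _ [r [s ->]]; apply: open_oboxes.
have /continuousP := @coord_continuous R 1 n ord0 i.
by apply; exact: interval_open.
Qed.

End boxes_generate.

(** * Fundamental lemma of the calculus of variations *)

Section fundamental.
Context {R : realType} {n : nat}.
Variables (Om : set 'rV[R]_n) (rho : R).
Hypotheses (oOm : open Om) (Omrho : Om `<=` cube n rho).
Notation mu := (lebesgue_row n).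

Lemma measurable_domain : measurable Om. Proof. exact: open_measurable_row. Qed.
Let mOm := measurable_domain.

Lemma sqint_cst_domain (c : R) : sqint mu Om (fun=> c).
Proof.
split; first exact: measurable_cst.
rewrite integral_cst// lte_mul_pinfty// ?lee_fin ?sqr_ge0//.
apply: le_lt_trans (lebesgue_cube_fin n rho).
by apply: le_measure => //; rewrite inE//; exact: measurable_cube.
Qed.

Lemma sqint_domain_integrable f : sqint mu Om f -> mu.-integrable Om (EFin \o f).
Proof.
move=> sf; have := sqintM mOm sf (sqint_cst_domain 1).
by apply: eq_integrable => // x _; rewrite /= mulr1.
Qed.

(** Dominated convergence along the bumps: each of them is a test function, and they tend to the
    indicator of the box. *)
Lemma integral_obox0 (f : 'rV[R]_n -> R) (a b : 'rV[R]_n) : sqint mu Om f ->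
  (forall phi, test_function Om phi -> \int[mu]_(x in Om) (f x * phi x) = 0) ->
  cbox a b `<=` Om ->
  (\int[mu]_(x in obox a b) (f x)%:E = 0)%E.
Proof.
move=> sf H abO.
have abO' : obox a b `<=` Om.
  by move=> x h; apply: abO => i; have /andP[h1 h2] := h i; rewrite !ltW.
have iF := sqint_domain_integrable sf.
have mb k : measurable_fun Om (bump a b k).
  apply: continuous_measurable_row => //.
  exact: (class_C_continuous (class_C_bump a b 0 k)).
have mf : measurable_fun Om f by case: sf.
have [|||||_ _] := @dominated_convergence _ _ _ mu Om mOm
   (fun k x => (f x * bump a b k x)%:E) ((EFin \o f) \_ (obox a b)) (fun x => `|f x|%:E).
- by move=> k; apply/measurable_EFinP; exact: measurable_funM.
- apply/(measurable_restrict _ _ _).1 => //; first exact: measurable_obox.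
  by apply: (measurable_funS mOm) => [x [] //|]; exact/measurable_EFinP.
- apply: aeW => x Ox; rewrite patchE; case: ifPn => [|].
    rewrite inE => abx; apply/cvg_EFin; first exact: nearW.
    by rewrite /= -[X in _ --> X]mulr1; apply: cvgMr; exact: bump_in.
  move=> /negP; rewrite inE => abx.
  by under eq_fun do rewrite bump_out// mulr0; exact: cvg_cst.
- exact: integrable_norm.
- apply: aeW => x k _; rewrite lee_fin normrM [`|bump a b k x|]ger0_norm ?bump_ge0//.
  by rewrite ler_piMr// bump_le1.
rewrite -integral_mkcondr setIC (setIidl abO') => h.
have E : [sequence (\int[mu]_(x in Om) (f x * bump a b k x)%:E)%E]_k = fun=> 0%E.
  apply/funext => k; have := H _ (test_bump k abO).
  rewrite /Rintegral => hk; rewrite -[LHS]fineK ?hk//.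
  apply: integrable_fin_num => //.
  apply: (le_integrable mOm _ _ (integrable_norm iF)).
    by apply/measurable_EFinP; exact: measurable_funM.
  move=> x _; rewrite lee_fin normrM [`|bump a b k x|]ger0_norm ?bump_ge0//.
  by rewrite normr_id ler_piMr// bump_le1.
move: h; rewrite E => h; symmetry; apply: (cvg_unique _ _ h) => //.
exact: cvg_cst.
Qed.

(** Within a box, the sets over which [f] has integral zero form a lambda-system containing the
    smaller boxes, hence all measurable sets. So [f] vanishes almost everywhere on each box whose
    closure is in [Om], and countably many rational boxes cover [Om]. *)
Lemma fundamental_lemma (f : 'rV[R]_n -> R) : sqint mu Om f ->
  (forall phi, test_function Om phi -> \int[mu]_(x in Om) (f x * phi x) = 0) ->
  {ae mu, forall x, Om x -> f x = 0}.
Proof.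
move=> sf H; have iF := sqint_domain_integrable sf.
have key (a b : 'rV[R]_n) : cbox a b `<=` Om -> {ae mu, forall x, obox a b x -> f x = 0}.
  move=> abO.
  have abO' : obox a b `<=` Om.
    by move=> x h; apply: abO => i; have /andP[h1 h2] := h i; rewrite !ltW.
  have iE E : measurable E -> mu.-integrable (E `&` obox a b) (EFin \o f).
    move=> mE; apply: integrableS iF => //; first by apply: measurableI => //; exact: measurable_obox.
    by move=> x [_ /abO'].
  pose HH := [set E : set 'rV[R]_n | measurable E /\
    (\int[mu]_(x in E `&` obox a b) (f x)%:E = 0)%E].
  have dH : lambda_system setT HH.
    apply/dynkin_lambda_system; split.
    - split => //; rewrite setTI; exact: integral_obox0.
    - move=> E [mE E0]; split; first exact: measurableC.
      have := integral_obox0 sf H abO.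
      rewrite -{1}[obox a b]setTI -(setUv E) setIUl integral_setU_EFin ?E0 ?add0e//.
      + by apply: measurableI => //; exact: measurable_obox.
      + by apply: measurableI; [exact: measurableC|exact: measurable_obox].
      + rewrite -setIUl setUv setTI; apply: (measurable_funS mOm abO').
        by case: sf.
      + by rewrite disj_set_sym; apply/disj_setPS => x [[? _] []].
    - move=> F tF HF; split; first by apply: bigcup_measurable => k _; case: (HF k).
      rewrite setI_bigcupl integral_bigcup.
      + by rewrite eseries0// => k _ _; case: (HF k).
      + by apply: trivIset_setIr.
      + by move=> k; apply: measurableI; [case: (HF k)|exact: measurable_obox].
      + rewrite -setI_bigcupl; apply: iE.
        by apply: bigcup_measurable => k _; case: (HF k).
  have all0 E : measurable E -> (\int[mu]_(x in E `&` obox a b) (f x)%:E = 0)%E.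
    move=> /measurable_oboxes /(lambda_system_subset oboxes_setI dH) []//.
    move=> _ [[a' b'] _ <-] /=; split; first exact: measurable_obox.
    rewrite setI_obox; apply: integral_obox0 => // x hx; apply: abO => i.
    have := hx i; rewrite !mxE ge_max le_min.
    by move=> /andP[/andP[_ ->] /andP[_ ->]].
  have := @integral_ae_eq _ _ _ mu _ (measurable_obox a b) (cst 0%E) (EFin \o f).
  have iB : mu.-integrable (obox a b) (EFin \o f).
    by rewrite -[obox a b]setTI; exact: iE.
  move=> /(_ iB (measurable_cst _)) h.
  apply: filterS (h _) => [x hx abx|E EB mE].
    by have [] := hx abx.
  by rewrite integral0 -(all0 E mE) (setIidl EB).
(* Indexing by codes makes the family countable; codes that decode to nothing impose no
   condition. *)
pose P (k : nat) x := if @unpickle ('rV[rat]_n * 'rV[rat]_n)%type k is Some p then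
    (cbox (map_mx ratr p.1) (map_mx ratr p.2) `<=` Om ->
     obox (map_mx ratr p.1) (map_mx ratr p.2) x -> f x = 0) else True.
have : forall k, {ae mu, forall x, P k x}.
  move=> k; rewrite /P; case: unpickle => [p|]; last exact: aeW.
  have [pO|pO] := pselect (cbox (map_mx ratr p.1) (map_mx ratr p.2) `<=` Om).
    by apply: filterS (key _ _ pO) => x + _.
  by apply: aeW => x /pO.
move=> /ae_foralln; apply: filterS => x Px Ox.
have [a [b [abx abO]]] := open_obox_rat oOm Ox.
by have := Px (pickle (a, b)); rewrite /P pickleK => /(_ abO abx).
Qed.

Lemma fundamental_nrm (f : 'rV[R]_n -> R) : sqint mu Om f ->
  (forall phi, test_function Om phi -> \int[mu]_(x in Om) (f x * phi x) = 0) ->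
  nrm mu Om f = 0.
Proof.
move=> sf /(fundamental_lemma sf) f0; rewrite /nrm /ip /Rintegral.
rewrite (ae_eq_integral (cst 0%E))//.
- by rewrite integral0 sqrtr0.
- by apply/measurable_EFinP; apply: measurable_funM; case: sf.
- by apply: filterS f0 => x f0 /f0 ->; rewrite mul0r.
Qed.

End fundamental.

(** * Rellich compactness *)

Section interval.
Context {R : realType}.
Notation mu := (@lebesgue_measure R).
Implicit Types (F G : R -> R) (a b : R).

Lemma continuous_sqr (F : R -> R) : continuous F -> continuous (fun x => F x ^+ 2).
Proof.
move=> cF; rewrite (_ : (fun x => F x ^+ 2) = fun x => F x * F x).
  by move=> x; exact: (cvgM (cF x) (cF x)).
by apply/funext => x; rewrite expr2.
Qed.

Lemma continuous_itv_integrable F a b : continuous F -> mu.-integrable `[a, b] (EFin \o F).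
Proof.
move=> cF; apply: continuous_compact_integrable; first exact: segment_compact.
exact: continuous_subspaceT.
Qed.

Lemma continuous_itv_sqint F a b : continuous F -> sqint mu `[a, b]%classic F.
Proof.
move=> cF; apply: sqintP => //.
  by apply: measurable_funTS; exact: continuous_measurable_fun.
have c2 : continuous (fun x => F x ^+ 2) by exact: continuous_sqr.
exact: (continuous_itv_integrable a b c2).
Qed.

Lemma Rintegral_itv_split F a b c : continuous F -> a <= b -> b <= c ->
  \int[mu]_(x in `[a, c]) F x = \int[mu]_(x in `[a, b]) F x + \int[mu]_(x in `[b, c]) F x.
Proof.
move=> cF ab bc.
have := @Rintegral_itvB _ F (BLeft a) (BRight c) b (continuous_itv_integrable a c cF).
rewrite !bnd_simp => /(_ ab bc) H.
have := @Rintegral_itv_obnd_cbnd _ b (BRight c) F.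
rewrite -H => <-; first by rewrite addrC subrK.
by apply: integrableS (continuous_itv_integrable b c cF) => //; exact: subset_itv_oc_cc.
Qed.

Lemma Rintegral_FTC F G a b : (forall x : R, is_derive x (1 : R) F (G x)) -> continuous G ->
  a <= b -> \int[mu]_(x in `[a, b]) G x = F b - F a.
Proof.
move=> dF cG; rewrite le_eqVlt => /orP[/eqP ->|ab].
  by rewrite set_itv1 Rintegral_set1 subrr.
have cF : continuous F.
  move=> x; apply: differentiable_continuous; apply/derivable1_diffP.
  by have [] := dF x.
rewrite /Rintegral (@continuous_FTC2 _ G F)//.
- exact: continuous_subspaceT.
- split=> [x _||]; first by have [] := dF x.
  + by apply: cvg_at_right_filter; exact: cF.
  + by apply: cvg_at_left_filter; exact: cF.
- by move=> x _; rewrite derive1E; have [] := dF x.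
Qed.

Lemma le_Rintegral_itv F a b a' b' : continuous F -> (forall x, 0 <= F x) ->
  a <= a' -> a' <= b' -> b' <= b ->
  \int[mu]_(x in `[a', b']) F x <= \int[mu]_(x in `[a, b]) F x.
Proof.
move=> cF F0 aa ab bb.
rewrite (@Rintegral_itv_split F a a' b)//; last exact: le_trans bb.
rewrite (@Rintegral_itv_split F a' b' b)//.
by rewrite addrCA lerDl addr_ge0// Rintegral_ge0.
Qed.

Lemma nrm_cst_itv a b : a <= b -> nrm mu `[a, b]%classic (fun=> 1) ^+ 2 = b - a.
Proof.
move=> ab; rewrite nrm_sqr /ip.
under eq_Rintegral do rewrite mul1r.
rewrite Rintegral_cst//= mul1r lebesgue_measure_itv /= lte_fin.
by move: ab; rewrite le_eqVlt => /predU1P[->|->] //; rewrite ltxx subrr.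
Qed.

(** With [A] the mean of [F], the integral of [F ^+ 2] is that of [(F - A) ^+ 2] plus the last term.
    Pointwise, [F - A] is at most the oscillation of [F], which Cauchy-Schwarz bounds through the
    integral of [G]. *)
Lemma Poincare_itv F G a b : (forall x : R, is_derive x (1 : R) F (G x)) -> continuous G -> a < b ->
  \int[mu]_(x in `[a, b]) (F x ^+ 2) <=
  (b - a) ^+ 2 * \int[mu]_(x in `[a, b]) (G x ^+ 2) +
  (b - a)^-1 * (\int[mu]_(x in `[a, b]) F x) ^+ 2.
Proof.
move=> dF cG ab.
have cF : continuous F.
  move=> x; apply: differentiable_continuous; apply/derivable1_diffP.
  by have [] := dF x.
have cG2 : continuous (fun x => G x ^+ 2) by exact: continuous_sqr.
have cF2 : continuous (fun x => F x ^+ 2) by exact: continuous_sqr.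
set K := \int[mu]_(x in `[a, b]) (G x ^+ 2); set S := \int[mu]_(x in `[a, b]) F x.
have K0 : 0 <= K by apply: Rintegral_ge0 => x _; exact: sqr_ge0.
have ba0 : 0 < b - a by rewrite subr_gt0.
have osc1 x y : a <= x -> x <= y -> y <= b -> (F y - F x) ^+ 2 <= (b - a) * K.
  move=> ax xy yb; rewrite -(Rintegral_FTC dF cG xy).
  have := @CauchySchwarz _ _ _ mu `[x, y]%classic (measurable_itv _) G (fun=> 1)
    (continuous_itv_sqint x y cG) (continuous_itv_sqint x y (@cst_continuous _ _ (1 : R))).
  rewrite /ip; under eq_Rintegral do rewrite mulr1; move=> h.
  rewrite -[leLHS]real_normK ?num_real//.
  apply: (@le_trans _ _ ((nrm mu `[x, y]%classic G * nrm mu `[x, y]%classic (fun=> 1)) ^+ 2)).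
    by rewrite lerXn2r ?nnegrE ?mulr_ge0 ?nrm_ge0.
  rewrite exprMn nrm_cst_itv// mulrC ler_pM ?sqr_ge0 ?subr_ge0//; first by lra.
  rewrite nrm_sqr /ip; under eq_Rintegral do rewrite -expr2.
  by apply: le_Rintegral_itv => // z; exact: sqr_ge0.
have osc x y : a <= x <= b -> a <= y <= b -> `|F x - F y| <= Num.sqrt ((b - a) * K).
  move=> /andP[ax xb] /andP[ay yb]; rewrite -sqrtr_sqr ler_sqrt ?mulr_ge0 ?(ltW ba0)//.
  have [xy|/ltW yx] := leP x y; last exact: osc1.
  by rewrite -sqrrN opprB; exact: osc1.
pose A := (b - a)^-1 * S.
have dev x : a <= x <= b -> (F x - A) ^+ 2 <= (b - a) * K.
  move=> xab.
  (* [F x - A] is the average over [y] of [F x - F y], hence within the oscillation. *)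
  have -> : F x - A = (b - a)^-1 * \int[mu]_(y in `[a, b]) (F x - F y).
    rewrite RintegralB//; last 2 first.
    - by apply: (continuous_itv_integrable a b); exact: cst_continuous.
    - exact: continuous_itv_integrable.
    rewrite Rintegral_cst//= lebesgue_measure_itv/= lte_fin ab /= /A -/S; field.
    by rewrite gt_eqF.
  have : `|(b - a)^-1 * \int[mu]_(y in `[a, b]) (F x - F y)| <= Num.sqrt ((b - a) * K).
    rewrite normrM gtr0_norm ?invr_gt0// ler_pdivrMl//.
    have cFx : continuous (fun y => F x - F y).
      by move=> y; exact: (cvgB (@cst_continuous _ _ (F x) y) (cF y)).
    apply: (le_trans (le_normr_Rintegral _ (continuous_itv_integrable a b cFx))) => //.
    have -> : (b - a) * Num.sqrt ((b - a) * K) =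
        \int[mu]_(y in `[a, b]) Num.sqrt ((b - a) * K).
      by rewrite Rintegral_cst//= lebesgue_measure_itv/= lte_fin ab /= mulrC.
    apply: le_Rintegral => //.
    - by apply: integrable_norm; exact: continuous_itv_integrable.
    - by apply: (continuous_itv_integrable a b); exact: cst_continuous.
    - by move=> y; rewrite /= in_itv /= => yab; exact: osc.
  rewrite -[X in _ -> X <= _]real_normK ?num_real// => h.
  apply: (@le_trans _ _ (Num.sqrt ((b - a) * K) ^+ 2)).
    by rewrite lerXn2r ?nnegrE ?sqrtr_ge0.
  by rewrite sqr_sqrtr// mulr_ge0// ltW.
have cFA : continuous (fun x => (F x - A) ^+ 2).
  by apply: continuous_sqr => x; exact: (cvgB (cF x) (@cst_continuous _ _ A x)).
have E : \int[mu]_(x in `[a, b]) ((F x - A) ^+ 2) =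
    \int[mu]_(x in `[a, b]) (F x ^+ 2) - (b - a)^-1 * S ^+ 2.
  have -> : \int[mu]_(x in `[a, b]) ((F x - A) ^+ 2) =
      \int[mu]_(x in `[a, b]) (F x ^+ 2 + ((- (2 * A)) * F x + A ^+ 2)).
    by apply: eq_Rintegral => x _; ring.
  have i1 : mu.-integrable `[a, b] (EFin \o (fun x => - (2 * A) * F x)).
    apply: (continuous_itv_integrable a b) => x.
    exact: (cvgM (@cst_continuous _ _ (- (2 * A)) x) (cF x)).
  have i2 : mu.-integrable `[a, b] (EFin \o (fun x : R => A ^+ 2)).
    by apply: (continuous_itv_integrable a b); exact: cst_continuous.
  rewrite RintegralD//; last 2 first.
  - exact: continuous_itv_integrable.
  - apply: (continuous_itv_integrable a b) => x.
    exact: (cvgD (cvgM (@cst_continuous _ _ (- (2 * A)) x) (cF x)) (@cst_continuous _ _ (A ^+ 2) x)).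
  rewrite RintegralD// RintegralZl//; last exact: continuous_itv_integrable.
  rewrite Rintegral_cst//= lebesgue_measure_itv/= lte_fin ab /= -/S /A; field.
  by rewrite gt_eqF.
suff : \int[mu]_(x in `[a, b]) ((F x - A) ^+ 2) <= (b - a) ^+ 2 * K by rewrite E; lra.
have -> : (b - a) ^+ 2 * K = \int[mu]_(y in `[a, b]) ((b - a) * K).
  by rewrite Rintegral_cst//= lebesgue_measure_itv/= lte_fin ab /=; ring.
apply: le_Rintegral => //.
- exact: continuous_itv_integrable.
- by apply: (continuous_itv_integrable a b); exact: cst_continuous.
Qed.

Lemma Rintegral_itv_sum F a (d : R) N : continuous F -> 0 <= d ->
  \int[mu]_(x in `[a, a + N%:R * d]) F x =
  \sum_(0 <= q < N) \int[mu]_(x in `[a + q%:R * d, a + q.+1%:R * d]) F x.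
Proof.
move=> cF d0; elim: N => [|N IH].
  by rewrite mul0r addr0 set_itv1 Rintegral_set1 big_geq.
rewrite big_nat_recr//= -IH (@Rintegral_itv_split F a (a + N%:R * d))//.
  by rewrite lerDl mulr_ge0.
by rewrite lerD2l ler_wpM2r// ler_nat.
Qed.

(** On cells of length [d] the derivative enters with the factor [d ^+ 2], as small as desired, at
    the price of finitely many cell integrals. *)
Lemma Poincare_partition F G a (d : R) N : (forall x : R, is_derive x (1 : R) F (G x)) ->
  continuous G -> 0 < d ->
  \int[mu]_(x in `[a, a + N%:R * d]) (F x ^+ 2) <=
  d ^+ 2 * \int[mu]_(x in `[a, a + N%:R * d]) (G x ^+ 2) +
  d^-1 * \sum_(0 <= q < N) (\int[mu]_(x in `[a + q%:R * d, a + q.+1%:R * d]) F x) ^+ 2.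
Proof.
move=> dF cG d0.
have cF : continuous F.
  move=> x; apply: differentiable_continuous; apply/derivable1_diffP.
  by have [] := dF x.
have cG2 : continuous (fun x => G x ^+ 2) by exact: continuous_sqr.
have cF2 : continuous (fun x => F x ^+ 2) by exact: continuous_sqr.
rewrite !Rintegral_itv_sum ?(ltW d0)// !mulr_sumr -big_split /=.
apply: ler_sum => q _.
have E : a + q.+1%:R * d - (a + q%:R * d) = d by rewrite -natr1; ring.
have := @Poincare_itv F G (a + q%:R * d) (a + q.+1%:R * d) dF cG.
by rewrite E; apply; rewrite ltrD2l ltr_pM2r// ltr_nat.
Qed.

End interval.

Lemma Rintegral_sum d (T : measurableType d) (R : realType) (mu : {measure set T -> \bar R})
    (D : set T) (I : Type) (s : seq I) (F : I -> T -> R) : measurable D ->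
  (forall i, mu.-integrable D (EFin \o F i)) ->
  \int[mu]_(x in D) (\sum_(i <- s) F i x) = \sum_(i <- s) \int[mu]_(x in D) F i x.
Proof.
move=> mD iF.
have iS r : mu.-integrable D (EFin \o (fun x => \sum_(i <- r) F i x)).
  rewrite (_ : EFin \o _ = fun x => (\sum_(i <- r) (EFin \o F i) x)%E).
    exact: integrable_sum.
  by apply/funext => x /=; rewrite sumEFin.
elim: s => [|i s IH].
  by under eq_Rintegral do rewrite big_nil; rewrite Rintegral_cst// mul0r big_nil.
under eq_Rintegral do rewrite big_cons.
by rewrite RintegralD// big_cons IH.
Qed.

(** * Slices and Fubini's theorem for bounded functions of bounded support *)

Section bsupp.
Context {R : realType}.

(** A class closed under products and slices in which every function is integrable. *)
Definition bsupp n (rho : R) (f : 'rV[R]_n -> R) := [/\ measurable_fun setT f,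
  exists B, forall x, `|f x| <= B & forall x, ~ cube n rho x -> f x = 0].

Lemma bsupp_integrable n rho (f : 'rV[R]_n -> R) : bsupp rho f ->
  (lebesgue_row n).-integrable setT (EFin \o f).
Proof.
move=> [mf [B fB] f0].
have : (lebesgue_row n).-integrable (cube n rho) (EFin \o f).
  apply: measurable_bounded_integrable => //.
  - exact: measurable_cube.
  - exact: lebesgue_cube_fin.
  - exact: measurable_funTS.
  - by exists B; split; [exact: num_real|move=> M BM x _; apply: le_trans (fB x) (ltW BM)].
move=> /(integrable_mkcond (EFin \o f) (@measurable_cube R n rho)).1.
apply: eq_integrable => // x _; rewrite patchE; case: ifPn => //.
by rewrite notin_setE => /f0 fx; rewrite /= fx.
Qed.

Lemma bsuppM n rho (f g : 'rV[R]_n -> R) : bsupp rho f -> bsupp rho g ->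
  bsupp rho (fun x => f x * g x).
Proof.
move=> [mf [B fB] f0] [mg [C gC] g0]; split; first exact: measurable_funM.
- exists (B * C) => x; rewrite normrM; exact: ler_pM.
- by move=> x /f0 ->; rewrite mul0r.
Qed.

Lemma bsupp_sqint n rho (f : 'rV[R]_n -> R) : bsupp rho f -> sqint (lebesgue_row n) setT f.
Proof.
move=> bf; apply: sqintP; first by case: bf.
exact: (bsupp_integrable (bsuppM bf bf)).
Qed.

Lemma measurable_cons n (a : R) :
  measurable_fun setT (fun v : 'rV[R]_n => cons_row (a, v)).
Proof.
apply: (measurableT_comp (@measurable_cons_row R n)).
exact: (@measurable_pair1 _ _ (measurableTypeR R) _ a).
Qed.

Lemma cube_cons n rho (a : R) (v : 'rV[R]_n) :
  cube n.+1 rho (cons_row (a, v)) <-> `|a| <= rho /\ cube n rho v.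
Proof.
split=> [H|[ar H] i].
  split; first by have := H ord0; rewrite mxE unlift_none.
  by move=> i; have := H (lift ord0 i); rewrite mxE liftK.
by rewrite mxE; case: unliftP => [j _|_] //=; exact: H.
Qed.

Lemma bsupp_slice n rho (f : 'rV[R]_n.+1 -> R) (a : R) : bsupp rho f ->
  bsupp rho (fun v => f (cons_row (a, v))).
Proof.
move=> [mf [B fB] f0]; split.
- exact: (measurableT_comp mf (measurable_cons a)).
- by exists B => x; exact: fB.
- by move=> v nv; apply: f0 => /cube_cons[].
Qed.

Lemma bsupp_slice0 n rho (f : 'rV[R]_n.+1 -> R) (a : R) v : bsupp rho f -> rho < `|a| ->
  f (cons_row (a, v)) = 0.
Proof. by move=> [_ _ f0] ra; apply: f0 => /cube_cons[]; rewrite leNgt ra. Qed.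

Lemma compact_cube n rho : compact (cube n rho : set 'rV[R]_n).
Proof. by rewrite cube_cbox; exact: compact_cbox. Qed.

Lemma continuous_bsupp n rho (f : 'rV[R]_n -> R) : continuous f ->
  (forall x, ~ cube n rho x -> f x = 0) -> bsupp rho f.
Proof.
move=> cf f0; split=> //; first exact: continuous_measurable_row.
have /compact_bounded[M [_ HM]] : compact (f @` cube n rho).
  by apply: continuous_compact; [exact: continuous_subspaceT|exact: compact_cube].
exists (`|M| + 1) => x; have [xc|/f0 ->] := pselect (cube n rho x).
  apply: HM; last by exists x.
  by rewrite (le_lt_trans (ler_norm M))// ltrDl.
by rewrite normr0 addr_ge0.
Qed.

Lemma fubini_row n rho (f : 'rV[R]_n.+1 -> R) : bsupp rho f ->
  (@lebesgue_measure R).-integrable setT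
    (EFin \o (fun a : R => \int[lebesgue_row n]_v f (cons_row (a, v)))) /\
  \int[lebesgue_row n.+1]_x f x =
    \int[@lebesgue_measure R]_a \int[lebesgue_row n]_v f (cons_row (a, v)).
Proof.
move=> bf; have [mf _ _] := bf.
have iS := bsupp_integrable bf.
have iP : (@lebesgue_measure R \x lebesgue_row n)%E.-integrable setT
    ((EFin \o f) \o @cons_row R n).
  apply/integrableP; split.
    apply: measurableT_comp (@measurable_cons_row R n); exact/measurable_EFinP.
  move/integrableP : iS => [_]; apply: le_lt_trans.
  have := @ge0_integral_pushforward _ _ _ _ R _ (@measurable_cons_row R n)
     (@lebesgue_measure R \x lebesgue_row n)%E setT (abse \o (EFin \o f)) measurableT.
  rewrite preimage_setT => <- //.
    by apply: measurableT_comp => //; exact/measurable_EFinP.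
  by move=> y _; exact: abse_ge0.
have E : (\int[lebesgue_row n.+1]_x (f x)%:E =
    \int[@lebesgue_measure R \x lebesgue_row n]_p (f (cons_row p))%:E)%E.
  have mfE : measurable_fun setT (EFin \o f) by exact/measurable_EFinP.
  exact: (integral_pushforward (@measurable_cons_row R n) mfE iP measurableT).
have F := integrable_fubini_F iP.
have FE a : fubini_F (lebesgue_row n) ((EFin \o f) \o @cons_row R n) a =
    (\int[lebesgue_row n]_v f (cons_row (a, v)))%:E.
  rewrite /fubini_F /Rintegral fineK//.
  exact/integrable_fin_num/(bsupp_integrable (bsupp_slice a bf)).
split; first by move: F; apply: eq_integrable => // a _; rewrite FE.
rewrite [LHS]/Rintegral E -(integral12_prod_meas1 iP).
by under eq_integral do rewrite FE.
Qed.

End bsupp.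

Section slices.
Context {R : realType} {n : nat}.
Implicit Types f : 'rV[R]_n.+1 -> R.

Lemma cons_row_shift0 (t a : R) (v : 'rV[R]_n) :
  t *: delta_mx ord0 ord0 + cons_row (a, v) = cons_row (t + a, v).
Proof.
apply/rowP => i; rewrite !mxE eqxx /=.
by case: unliftP => [j ->|->] /=; rewrite ?eqxx ?mulr1 ?mulr0 ?add0r.
Qed.

Lemma cons_row_shiftS (t a : R) (v : 'rV[R]_n) (i : 'I_n) :
  t *: delta_mx ord0 (lift ord0 i) + cons_row (a, v) = cons_row (a, t *: delta_mx ord0 i + v).
Proof.
apply/rowP => j; rewrite !mxE eqxx /=.
case: unliftP => [k ->|->] /=; rewrite ?mxE ?eqxx ?(inj_eq lift_inj) //=.
by rewrite mulr0 add0r.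
Qed.

Lemma continuous_cons (a : R) : continuous (fun v : 'rV[R]_n => cons_row (a, v)).
Proof.
move=> v A [P HP sPA].
exists (fun i j => P i (lift ord0 j)) => [i j|w Hw].
  by have := HP i (lift ord0 j); rewrite mxE liftK (ord1 i).
apply: sPA => i j; rewrite mxE; case: unliftP => [k ->|->] /=.
  by have := Hw i k; rewrite (ord1 i).
by have := nbhs_singleton (HP i ord0); rewrite mxE unlift_none.
Qed.

Lemma continuous_cons1 (v : 'rV[R]_n) : continuous (fun a : R => cons_row (a, v)).
Proof.
move=> a A [P HP sPA].
have : nbhs a (P ord0 ord0) by have := HP ord0 ord0; rewrite mxE unlift_none.
apply: filterS => c Pc; apply: sPA => i j; rewrite mxE.
case: unliftP => [k ->|->] /=; last by rewrite (ord1 i).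
by have := nbhs_singleton (HP i (lift ord0 k)); rewrite mxE liftK.
Qed.

Lemma is_derive_slice0 f (a : R) v : derivable f (cons_row (a, v)) (delta_mx ord0 ord0) ->
  is_derive a (1 : R) (fun a : R => f (cons_row (a, v))) (partial ord0 f (cons_row (a, v))).
Proof.
move=> df; apply: is_derive_line.
have := derive_is_line (DeriveDef df erefl).
by under eq_fun do rewrite cons_row_shift0 -[X in X + a]mulr1.
Qed.

Lemma is_derive_sliceS f (a : R) v (i : 'I_n) :
  derivable f (cons_row (a, v)) (delta_mx ord0 (lift ord0 i)) ->
  is_derive v (delta_mx ord0 i) (fun v => f (cons_row (a, v)))
    (partial (lift ord0 i) f (cons_row (a, v))).
Proof.
move=> df; apply: is_derive_line.
have := derive_is_line (DeriveDef df erefl).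
by under eq_fun do rewrite cons_row_shiftS.
Qed.

Lemma class_C1_slice f (a : R) : class_C 1 f -> class_C 1 (fun v => f (cons_row (a, v))).
Proof.
move=> [cf df]; split=> [|i].
  by move=> v A HA; exact: (continuous_cons (cf _ _ HA)).
have D v : is_derive v (delta_mx ord0 i) (fun v => f (cons_row (a, v)))
    (partial (lift ord0 i) f (cons_row (a, v))).
  by apply: is_derive_sliceS; have [+ _] := df (lift ord0 i); exact.
split=> [v|]; first by have [] := D v.
have -> : partial i (fun v => f (cons_row (a, v))) =
    fun v => partial (lift ord0 i) f (cons_row (a, v)).
  by apply/funext => v; have [_] := D v.
have [_ [c _]] := df (lift ord0 i); split=> // v A HA.
exact: (continuous_cons (c _ _ HA)).
Qed.

Lemma partial_slice f (a : R) v (i : 'I_n) : class_C 1 f ->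
  partial i (fun v => f (cons_row (a, v))) v = partial (lift ord0 i) f (cons_row (a, v)).
Proof.
move=> [_ df]; have [d _] := df (lift ord0 i).
by have [_] := is_derive_sliceS (d (cons_row (a, v))).
Qed.

End slices.

Lemma open_cubeC {R : realType} n (rho : R) : open (~` cube n rho).
Proof.
rewrite openC; apply: compact_closed; last exact: compact_cube.
exact: norm_hausdorff.
Qed.

Lemma partial_support {R : realType} n (K : set 'rV[R]_n) (f : 'rV[R]_n -> R) i : closed K ->
  (forall x, ~ K x -> f x = 0) -> forall x, ~ K x -> partial i f x = 0.
Proof.
move=> cK f0 x nx; rewrite /partial.
rewrite (@near_eq_derive R 'rV[R]_n R f (fun=> 0)); first exact: derive_cst.
have : nbhs x (~` K) by apply: open_nbhs_nbhs; split => //; exact: closed_openC.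
by apply: filterS => y /f0.
Qed.

Section step.
Context {R : realType} (n : nat) (rho : R).
Hypothesis rho0 : 0 < rho.
Notation leb := (@lebesgue_measure R).
Notation mu := (lebesgue_row n).
Notation mu1 := (lebesgue_row n.+1).

Section functional.
Variables (f : 'rV[R]_n.+1 -> R) (chi : 'rV[R]_n -> R).
Hypotheses (c1f : class_C 1 f) (f0 : forall x, ~ cube n.+1 rho x -> f x = 0).
Hypotheses (bchi : bsupp rho chi) (chi1 : forall x, `|chi x| <= 1).

Let bf : bsupp rho f.
Proof. by apply: continuous_bsupp => //; case: c1f. Qed.

Let d0 : 'rV[R]_n.+1 -> R := partial ord0 f.

Let cd0 : continuous d0. Proof. by case: c1f => _ /(_ ord0)[_ []]. Qed.

Let bd0 : bsupp rho d0.
Proof.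
apply: continuous_bsupp => //; apply: partial_support => //.
by rewrite -openC; exact: open_cubeC.
Qed.

(** One functional on slices becomes a function of the first coordinate alone, so that the
    one-dimensional Poincare inequality applies to it. *)
Definition slice_ip (g : 'rV[R]_n.+1 -> R) (a : R) : R := ip mu setT (fun v => g (cons_row (a, v))) chi.

(** An integrable majorant that does not depend on [a], for continuity and differentiation under the
    integral sign. *)
Let I_dom (g : 'rV[R]_n.+1 -> R) : bsupp rho g -> exists2 G : 'rV[R]_n -> R,
  mu.-integrable setT (EFin \o G) &
  (forall v, 0 <= G v) /\ forall a v, `|g (cons_row (a, v)) * chi v| <= G v.
Proof.
move=> [mg [B gB] g0].
have B0 : 0 <= B by apply: le_trans (gB 0).
exists (fun v => B * \1_(cube n rho) v).
  apply: (@bsupp_integrable R n rho); split.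
  - by apply: measurable_funM => //; apply: measurable_indic; exact: measurable_cube.
  - exists B => v; rewrite normrM ger0_norm// indicE ler_piMr//.
    by case: (v \in _); rewrite ?normr1 ?normr0.
  - by move=> v nv; rewrite indicE memNset// mulr0.
split=> [v|a v]; first by rewrite mulr_ge0// indicE.
have [cv|nv] := pselect (cube n rho v).
  rewrite indicE mem_set// mulr1 normrM -[leRHS]mulr1; exact: ler_pM.
by have [_ _ ->] := bchi; rewrite ?mulr0 ?normr0 ?mulr_ge0 ?indicE.
Qed.

Let slice_integrable (g : 'rV[R]_n.+1 -> R) (a : R) : bsupp rho g ->
  mu.-integrable setT (EFin \o (fun v => g (cons_row (a, v)) * chi v)).
Proof. by move=> bg; apply: (@bsupp_integrable R n rho); apply: bsuppM => //; exact: bsupp_slice. Qed.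

Lemma is_derive_slice_ip (a : R) : is_derive a (1 : R) (slice_ip f) (slice_ip d0 a).
Proof.
have [G iG [G0 HG]] := I_dom bd0.
pose h (x : R) (v : 'rV[R]_n) := f (cons_row (x, v)) * chi v.
have dh x v : is_derive x (1 : R) (h ^~ v) (d0 (cons_row (x, v)) * chi v).
  have := @is_derive_slice0 _ _ f x v; rewrite -/(d0 _) => /(_ _) D.
  have D1 : is_derive x (1 : R) (fun a : R => f (cons_row (a, v))) (d0 (cons_row (x, v))).
    by apply: D; case: c1f => _ /(_ ord0)[+ _]; exact.
  have := is_deriveM D1 (@is_derive_cst _ _ _ (chi v) x 1).
  by rewrite scaler0 add0r /GRing.scale /= [chi v * _]mulrC.
have E x v : partial1of2 h x v = d0 (cons_row (x, v)) * chi v.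
  by rewrite partial1of2E; have [_] := dh x v.
have Ia : [set` `]a - 1, a + 1[] a by rewrite /= in_itv /= ltrBlDr !ltrDl !ltr01.
have H1 x : [set` `]a - 1, a + 1[] x -> mu.-integrable setT (EFin \o h x).
  by move=> _; exact: slice_integrable.
have H2 x y : [set` `]a - 1, a + 1[] x -> setT y -> derivable (h ^~ y) x 1.
  by move=> _ _; have [] := dh x y.
have H3 x y : [set` `]a - 1, a + 1[] x -> setT y -> `|partial1of2 h x y| <= G y.
  by move=> _ _; rewrite E; exact: HG.
split.
  exact: (derivable_under_integral measurableT Ia H1 H2 G0 iG H3).
rewrite -derive1E.
rewrite (differentiation_under_integral measurableT Ia H1 H2 G0 iG H3).
by apply: eq_Rintegral => v _; rewrite E.
Qed.

Lemma continuous_slice_ip (g : 'rV[R]_n.+1 -> R) : continuous g -> bsupp rho g ->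
  continuous (slice_ip g).
Proof.
move=> cg bg a.
have [G iG [G0 HG]] := I_dom bg.
apply: (@continuity_under_integral R _ _ mu (fun (x : R) v => g (cons_row (x, v)) * chi v)
  setT measurableT (a - 1) (a + 1) (fun x _ => slice_integrable x bg) _ G iG).
- apply: aeW => v _ x _.
  have c : {for x, continuous (fun z : R => g (cons_row (z, v)))}.
    by move=> A HA; exact: (continuous_cons1 (cg _ _ HA)).
  exact: (cvgM c (@cst_continuous _ _ (chi v) x)).
- by move=> x _; apply: aeW => v _; exact: HG.
- by rewrite inE /= in_itv /= ltrBlDr !ltrDl !ltr01.
Qed.

Lemma slice_ip_out (g : 'rV[R]_n.+1 -> R) a : bsupp rho g -> rho < `|a| -> slice_ip g a = 0.
Proof.
move=> bg ra; rewrite /slice_ip /ip.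
under eq_Rintegral => v _ do rewrite (bsupp_slice0 v bg ra) mul0r.
by rewrite Rintegral_cst// mul0r.
Qed.

End functional.
End step.

Lemma integrable_Rsum d (T : measurableType d) (R : realType) (mu : {measure set T -> \bar R})
    (D : set T) (I : Type) (s : seq I) (F : I -> T -> R) : measurable D ->
  (forall i, mu.-integrable D (EFin \o F i)) ->
  mu.-integrable D (EFin \o (fun x => \sum_(i <- s) F i x)).
Proof.
move=> mD iF; rewrite (_ : EFin \o _ = fun x => (\sum_(i <- s) (EFin \o F i) x)%E).
  exact: integrable_sum.
by apply/funext => x /=; rewrite sumEFin.
Qed.

(** * Rellich's compactness as an estimate *)

Section Rellich.
Context {R : realType}.
Notation leb := (@lebesgue_measure R).

Lemma Rintegral_support (F : R -> R) (a b : R) : (forall x, ~ (a <= x <= b) -> F x = 0) ->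
  \int[leb]_x F x = \int[leb]_(x in `[a, b]) F x.
Proof.
move=> F0; rewrite [RHS]Rintegral_mkcond; apply: eq_Rintegral => x _.
rewrite patchE; case: ifPn => //; rewrite notin_setE /= in_itv /= => h.
exact: F0.
Qed.

Lemma mesh_exists (rho c : R) : 0 < rho -> 0 < c ->
  exists N d : _, [/\ 0 < d :> R, d <= c & N%:R * d = 2 * rho].
Proof.
move=> r0 c0; pose N := (Num.truncn (2 * rho / c)).+1.
have N0 : 0 < N%:R :> R by rewrite ltr0n.
exists N, (2 * rho / N%:R); split.
- by rewrite divr_gt0// mulr_gt0.
- have : 2 * rho / c <= N%:R by apply/ltW/truncnS_gt.
  by rewrite !ler_pdivrMr// => /le_trans; apply; rewrite mulrC.
- by rewrite mulrC divfK// gt_eqF.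
Qed.

(** Pairing with it integrates the slice functional of [chi] over the [q]-th cell, which is the term
    that [Poincare_partition] leaves over. *)
Definition strip_fun n (rho d : R) (N : nat) (chi : 'rV[R]_n -> R) (q : 'I_N)
    (x : 'rV[R]_n.+1) : R :=
  \1_(`[- rho + q%:R * d, - rho + q.+1%:R * d]%classic : set R) (uncons_row x).1 *
  chi (uncons_row x).2.

Lemma strip_fun_cons n (rho d : R) (N : nat) (chi : 'rV[R]_n -> R) (q : 'I_N) a v :
  strip_fun rho d chi q (cons_row (a, v)) =
  \1_(`[- rho + q%:R * d, - rho + q.+1%:R * d]%classic : set R) a * chi v.
Proof. by rewrite /strip_fun cons_rowK. Qed.

Lemma bsupp_strip_fun n (rho d : R) (N : nat) (chi : 'rV[R]_n -> R) (q : 'I_N) :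
  0 < rho -> 0 < d -> N%:R * d = 2 * rho -> bsupp rho chi -> (forall x, `|chi x| <= 1) ->
  bsupp rho (strip_fun rho d chi q) /\ forall x, `|strip_fun rho d chi q x| <= 1.
Proof.
move=> r0 d0 Nd [mchi _ chi0] chi1.
have B x : `|strip_fun rho d chi q x| <= 1.
  rewrite /strip_fun normrM -[leRHS]mulr1; apply: ler_pM => //.
  by rewrite indicE; case: (_ \in _); rewrite ?normr1 ?normr0.
split=> //; split; last 2 first.
- by exists 1.
- move=> x; rewrite -(uncons_rowK x); case: (uncons_row x) => a v.
  move=> H; rewrite strip_fun_cons.
  have [cv|/chi0 ->] := pselect (cube n rho v); last by rewrite mulr0.
  rewrite indicE memNset ?mul0r//= in_itv /= => /andP[h1 h2].
  apply: H; apply/cube_cons; split=> //.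
  have qN : q.+1%:R * d <= N%:R * d by rewrite ler_pM2r// ler_nat.
  have q0 : 0 <= q%:R * d by rewrite mulr_ge0// ltW.
  by rewrite ler_norml; apply/andP; split; lra.
apply: measurable_funM.
  have m1 : measurable_fun setT (\1_(`[- rho + q%:R * d, - rho + q.+1%:R * d]%classic : set R) :
      measurableTypeR R -> R).
    by apply: measurable_indic; exact: measurable_itv.
  exact: (measurableT_comp m1 (measurableT_comp measurable_fst (@measurable_uncons_row R n))).
apply: (measurableT_comp mchi).
exact: (measurableT_comp measurable_snd (@measurable_uncons_row R n)).
Qed.

Lemma Rintegral_dirac0 (f : 'rV[R]_0 -> R) : \int[lebesgue_row 0]_x f x = f 0.
Proof.
rewrite /Rintegral /= integral_dirac//.
  by rewrite diracT mul1e.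
rewrite (_ : (fun x : 'rV[R]_0 => (f x)%:E) = cst (f 0)%:E)//.
by apply/funext => x; rewrite (thinmx0 x).
Qed.

(** Up to a small part of the gradient, finitely many functionals control the norm. The induction
    applies the claim to slices, integrates over the first coordinate, and trades each squared slice
    functional for [d ^+ 2] times that of its derivative plus its integrals over cells. *)
Theorem Rellich_estimate n (rho eps : R) : 0 < rho -> 0 < eps ->
  exists (W : R) (I : finType) (chi : I -> 'rV[R]_n -> R),
  [/\ 0 <= W, forall l, bsupp rho (chi l) /\ (forall x, `|chi l x| <= 1) &
   forall f, class_C 1 f -> (forall x, ~ cube n rho x -> f x = 0) ->
     ip (lebesgue_row n) setT f f <=
     eps * \sum_i ip (lebesgue_row n) setT (partial i f) (partial i f) +
     W * \sum_l (ip (lebesgue_row n) setT f (chi l)) ^+ 2].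
Proof.
move=> rho0; elim: n eps => [|n IH] eps eps0.
  (* In dimension 0 the space is a single point of unit mass, and [f] equals its pairing with 1. *)
  exists 1, unit, (fun _ _ => 1); split=> //.
    move=> l; split=> [|x]; last by rewrite normr1.
    split; first exact: measurable_cst.
      by exists 1 => x; rewrite normr1.
    by move=> x []; case.
  move=> f _ _; rewrite big_ord0 mulr0 add0r mul1r (big_pred1 tt); last by case.
  by rewrite /ip !Rintegral_dirac0 mulr1 expr2.
have [W [I [chi [W0 Hchi H]]]] := IH eps eps0.
pose V := fine (lebesgue_row n (cube n rho)).
have V0 : 0 <= V by rewrite fine_ge0// measure_ge0.
(* The derivative in the new direction costs [W * #|I| * V * d ^+ 2]; with [d <= 1] and
   [d * K <= eps] this is at most [eps]. *)
pose K := W * #|I|%:R * V + 1.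
have K0 : 0 < K by rewrite ltr_wpDl// !mulr_ge0.
have c0 : 0 < Num.min 1 (eps / K) by rewrite lt_min ltr01 divr_gt0.
have [N [d [d0 dc Nd]]] := mesh_exists rho0 c0.
exists (W * d^-1), (I * 'I_N)%type, (fun p => strip_fun rho d (chi p.1) p.2); split.
- by rewrite mulr_ge0// invr_ge0 ltW.
- by move=> [l q]; have [h1 h2] := Hchi l; exact: bsupp_strip_fun.
move=> f c1f f0.
have bf : bsupp rho f by apply: continuous_bsupp => //; case: c1f.
have bdf i : bsupp rho (partial i f).
  apply: continuous_bsupp; first by case: c1f => _ /(_ i)[_ []].
  by apply: partial_support => //; rewrite -openC; exact: open_cubeC.
have [iff Eff] := fubini_row (bsuppM bf bf).
have idf i := (fubini_row (bsuppM (bdf i) (bdf i))).1.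
have Edf i := (fubini_row (bsuppM (bdf i) (bdf i))).2.
have cF l : continuous (slice_ip (chi l) f).
  by have [h1 h2] := Hchi l; apply: (@continuous_slice_ip R n rho) => //; case: c1f.
have cG l : continuous (slice_ip (chi l) (partial ord0 f)).
  have [h1 h2] := Hchi l; apply: (@continuous_slice_ip R n rho) => //.
  by case: c1f => _ /(_ ord0)[_ []].
have out (g : 'rV[R]_n.+1 -> R) l x : bsupp rho g ->
    ~ (- rho <= x <= - rho + N%:R * d) -> slice_ip (chi l) g x = 0.
  move=> bg xr; apply: (slice_ip_out (rho := rho)) => //.
  by rewrite ltNge; apply/negP; rewrite ler_norml => h; apply: xr; move: h; rewrite Nd; lra.
have iS2 (g : 'rV[R]_n.+1 -> R) l : bsupp rho g -> continuous (slice_ip (chi l) g) ->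
    leb.-integrable setT (EFin \o (fun a => slice_ip (chi l) g a ^+ 2)).
  move=> bg cg.
  have : leb.-integrable `[- rho, - rho + N%:R * d] (EFin \o (fun a => slice_ip (chi l) g a ^+ 2)).
    by apply: continuous_itv_integrable; exact: continuous_sqr.
  move=> h0; have mI : measurable (`[- rho, - rho + N%:R * d]%classic : set (measurableTypeR R)).
    exact: measurable_itv.
  have := iffLR (@integrable_mkcond _ (measurableTypeR R) R leb _ _ mI) h0.
  apply: eq_integrable => // x _; rewrite patchE; case: ifPn => //.
  by rewrite notin_setE /= in_itv /= => /(out g l x bg) ->; rewrite expr0n.
have iF2 l := iS2 f l bf (cF l).
have iSum : leb.-integrable setT (EFin \o (fun a => \sum_i \int[lebesgue_row n]_v
        (partial (lift ord0 i) f (cons_row (a, v)) * partial (lift ord0 i) f (cons_row (a, v))))).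
  by apply: integrable_Rsum => // i; exact: idf.
have iSumF : leb.-integrable setT (EFin \o (fun a => \sum_l slice_ip (chi l) f a ^+ 2)).
  exact: integrable_Rsum.
have i1 := integrableZl measurableT eps iSum.
have i2 := integrableZl measurableT W iSumF.
have step1 : ip (lebesgue_row n.+1) setT f f <=
    \int[leb]_a (eps * \sum_i \int[lebesgue_row n]_v
        (partial (lift ord0 i) f (cons_row (a, v)) * partial (lift ord0 i) f (cons_row (a, v))) +
      W * \sum_l (slice_ip (chi l) f a) ^+ 2).
  rewrite /ip Eff; apply: le_Rintegral => //.
    exact: (integrableD measurableT i1 i2).
  move=> a _; have := H (fun v => f (cons_row (a, v))) (class_C1_slice a c1f).
  move=> /(_ _)/le_trans; apply.
    by move=> v nv; apply: f0 => /cube_cons[].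
  apply: lerD; last by rewrite /slice_ip lexx.
  rewrite (ler_pM2l eps0); apply: ler_sum => i _; rewrite le_eqVlt; apply/predU1P; left.
  by rewrite /ip; apply: eq_Rintegral => v _; rewrite partial_slice.
apply: (le_trans step1).
rewrite RintegralD// !RintegralZl// !Rintegral_sum//.
rewrite [X in _ <= eps * X + _]big_ord_recl mulrDr.
rewrite [X in _ <= _ + X + _](_ : _ = eps * \sum_(i < n) \int[leb]_a \int[lebesgue_row n]_v
    (partial (lift ord0 i) f (cons_row (a, v)) * partial (lift ord0 i) f (cons_row (a, v)))); last first.
  by congr (_ * _); apply: eq_bigr => i _; rewrite /ip Edf.
rewrite addrAC [X in _ <= X]addrC lerD2l.
pose P0 := ip (lebesgue_row n.+1) setT (partial ord0 f) (partial ord0 f).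
have P00 : 0 <= P0 by exact: ip_ge0.
(* Cauchy-Schwarz on each slice: [chi l] is bounded by 1 and supported in the cube, so its squared
   norm is at most [V]. *)
have Gle l : \int[leb]_a (slice_ip (chi l) (partial ord0 f) a ^+ 2) <= V * P0.
  have [h1 h2] := Hchi l; have E0 : P0 = _ := Edf ord0.
  rewrite E0 -(RintegralZl V measurableT (idf ord0)).
  apply: le_Rintegral => //.
  - exact: iS2.
  - by have := integrableZl measurableT V (idf ord0).
  move=> a _.
  have sa := bsupp_sqint (bsupp_slice a (bdf ord0)); have sc := bsupp_sqint h1.
  have := CauchySchwarz measurableT sa sc.
  rewrite -(@ler_pXn2r _ 2) ?nnegrE ?mulr_ge0 ?nrm_ge0//.
  rewrite real_normK ?num_real// exprMn !nrm_sqr => /le_trans; apply.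
  rewrite mulrC ler_wpM2r ?ip_ge0//.
  have -> : V = \int[lebesgue_row n]_x \1_(cube n rho) x.
    rewrite /Rintegral integral_indic// ?setIT//; exact: measurable_cube.
  apply: le_Rintegral => //.
  - exact: (sqintM measurableT sc sc).
  - apply: (@bsupp_integrable R n rho); split.
    + by apply: measurable_indic; exact: measurable_cube.
    + by exists 1 => x; rewrite indicE; case: (_ \in _); rewrite ?normr1 ?normr0.
    + by move=> x nx; rewrite indicE memNset.
  - move=> x _; have [cx|nx] := pselect (cube n rho x).
      rewrite indicE mem_set// -expr2 -[leLHS]real_normK ?num_real//.
      by rewrite exprn_ile1.
    by have [_ _ ->] := h1; rewrite // mulr0 indicE.
have Fle l : \int[leb]_a (slice_ip (chi l) f a ^+ 2) <= d ^+ 2 * (V * P0) +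
    d^-1 * \sum_(q < N) (ip (lebesgue_row n.+1) setT f (strip_fun rho d (chi l) q)) ^+ 2.
  have [h1 h2] := Hchi l.
  rewrite (@Rintegral_support _ (- rho) (- rho + N%:R * d)); last first.
    by move=> x /(out f l x bf) ->; rewrite expr0n.
  have := @Poincare_partition R _ _ (- rho) d N
    (is_derive_slice_ip c1f f0 h1 h2) (cG l) d0.
  move=> /le_trans; apply; apply: lerD.
    rewrite ler_pM2l ?exprn_gt0// -Rintegral_support; first exact: Gle.
    by move=> x /(out _ l x (bdf ord0)) ->; rewrite expr0n.
  rewrite ler_pM2l ?invr_gt0// big_mkord; apply: ler_sum => q _.
  rewrite le_eqVlt; apply/predU1P; left; congr (_ ^+ 2).
  have [bs _] := bsupp_strip_fun q rho0 d0 Nd h1 h2.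
  have [_ E] := fubini_row (bsuppM bf bs).
  rewrite /ip E [LHS]Rintegral_mkcond; apply: eq_Rintegral => a _.
  rewrite patchE; under eq_Rintegral => v _ do rewrite strip_fun_cons mulrCA.
  rewrite RintegralZl//; last first.
    exact: (bsupp_integrable (bsuppM (bsupp_slice a bf) h1)).
  by rewrite indicE; case: ifP => _; rewrite ?mul1r ?mul0r.
apply: (@le_trans _ _ (W * \sum_l (d ^+ 2 * (V * P0) +
    d^-1 * \sum_(q < N) (ip (lebesgue_row n.+1) setT f (strip_fun rho d (chi l) q)) ^+ 2))).
  by rewrite ler_wpM2l//; apply: ler_sum => l _; exact: Fle.
rewrite big_split /= sumr_const -[X in _ *+ X]/#|I| -mulr_natl -[X in _ * (_ + X)]mulr_sumr pair_bigA /=.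
rewrite mulrDr [W * (d^-1 * _)]mulrA -/P0 lerD2r.
have d1 : d <= 1 by move: dc; rewrite le_min => /andP[].
have dK : d * K <= eps by move: dc; rewrite le_min ler_pdivlMr// => /andP[].
have -> : W * (#|I|%:R * (d ^+ 2 * (V * P0))) = d * (d * (W * #|I|%:R * V)) * P0 by ring.
rewrite ler_wpM2r//; apply: le_trans dK.
rewrite -[leRHS]mul1r; apply: (@le_trans _ _ (1 * (d * (W * #|I|%:R * V)))).
  by rewrite ler_wpM2r// mulr_ge0 ?(ltW d0)// !mulr_ge0.
by rewrite !mul1r ler_pM2l// lerDl.
Qed.

End Rellich.

Local Notation Re := (@complex.Re _).
Local Notation Im := (@complex.Im _).
Local Notation normc := (@Normc.normc _).

(** * The space H10 and the Rayleigh quotient *)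

Section complex_parts.
Context {R : realType}.
Implicit Types z w : R[i].

Lemma ReD z w : Re (z + w) = Re z + Re w. Proof. by case: z; case: w. Qed.
Lemma ImD z w : Im (z + w) = Im z + Im w. Proof. by case: z; case: w. Qed.
Lemma ReN z : Re (- z) = - Re z. Proof. by case: z. Qed.
Lemma ImN z : Im (- z) = - Im z. Proof. by case: z. Qed.
Lemma ReB z w : Re (z - w) = Re z - Re w. Proof. by rewrite ReD ReN. Qed.
Lemma ImB z w : Im (z - w) = Im z - Im w. Proof. by rewrite ImD ImN. Qed.
Lemma ReM z w : Re (z * w) = Re z * Re w - Im z * Im w. Proof. by case: z; case: w. Qed.
Lemma ImM z w : Im (z * w) = Re z * Im w + Im z * Re w.
Proof. by case: z; case: w. Qed.
Lemma Re_conj z : Re (z^*)%C = Re z. Proof. by case: z. Qed.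
Lemma Im_conj z : Im (z^*)%C = - Im z. Proof. by case: z. Qed.
Lemma Re_real (x : R) : Re (x%:C)%C = x. Proof. by []. Qed.
Lemma Im_real (x : R) : Im (x%:C)%C = 0. Proof. by []. Qed.
Lemma Re_0 : Re (0 : R[i]) = 0. Proof. by []. Qed.
Lemma Im_0 : Im (0 : R[i]) = 0. Proof. by []. Qed.
Lemma Re_1 : Re (1 : R[i]) = 1. Proof. by []. Qed.
Lemma Im_1 : Im (1 : R[i]) = 0. Proof. by []. Qed.

Lemma complexP z w : Re z = Re w -> Im z = Im w -> z = w.
Proof. by case: z => a b; case: w => c d /= -> ->. Qed.

Lemma normc_sqr z : normc z ^+ 2 = Re z ^+ 2 + Im z ^+ 2.
Proof. by case: z => a b /=; rewrite sqr_sqrtr// addr_ge0 ?sqr_ge0. Qed.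

Lemma normc_ge0 z : 0 <= normc z.
Proof. by case: z => a b /=; exact: sqrtr_ge0. Qed.

Lemma normc_Re z : `|Re z| <= normc z.
Proof.
rewrite -(@ler_pXn2r _ 2) ?nnegrE ?normc_ge0// real_normK ?num_real// normc_sqr.
by rewrite lerDl sqr_ge0.
Qed.

Lemma normc_Im z : `|Im z| <= normc z.
Proof.
rewrite -(@ler_pXn2r _ 2) ?nnegrE ?normc_ge0// real_normK ?num_real// normc_sqr.
by rewrite lerDr sqr_ge0.
Qed.

Lemma normc_le_ReIm z : normc z <= `|Re z| + `|Im z|.
Proof.
rewrite -(@ler_pXn2r _ 2) ?nnegrE ?normc_ge0 ?addr_ge0// normc_sqr sqrrD.
by rewrite !real_normK ?num_real// addrAC lerDl mulrn_wge0// mulr_ge0.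
Qed.

Lemma normcR (x : R) : normc (x%:C)%C = `|x|.
Proof. by rewrite /= expr0n /= addr0 sqrtr_sqr. Qed.

Lemma normc_eq0 z : normc z = 0 -> z = 0. Proof. exact: Normc.eq0_normc. Qed.

End complex_parts.

Definition reimE := (@ReD, @ImD, @ReN, @ImN, @ReM, @ImM, @Re_conj, @Im_conj,
  @Re_real, @Im_real, @Re_0, @Im_0, @Re_1, @Im_1).

Lemma CauchySchwarz2 (R : realType) (a b c d : R) : 0 <= a -> 0 <= b -> 0 <= c -> 0 <= d ->
  a * c + b * d <= Num.sqrt (a ^+ 2 + b ^+ 2) * Num.sqrt (c ^+ 2 + d ^+ 2).
Proof.
move=> a0 b0 c0 d0; rewrite -sqrtrM ?addr_ge0 ?sqr_ge0//.
rewrite -[leLHS]ger0_norm ?addr_ge0 ?mulr_ge0// -sqrtr_sqr ler_sqrt ?mulr_ge0 ?addr_ge0 ?sqr_ge0//.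
have := sqr_ge0 (a * d - b * c).
have -> : (a ^+ 2 + b ^+ 2) * (c ^+ 2 + d ^+ 2) = (a * c + b * d) ^+ 2 + (a * d - b * c) ^+ 2 by ring.
by rewrite lerDl.
Qed.

(** * Complex square-integrable functions *)

Section complex_L2.
Context {R : realType} {n : nat}.
Local Notation fn := ('rV[R]_n -> R[i]).
Variable Om : set 'rV[R]_n.
Hypothesis mOm : measurable Om.
Local Notation mu := (lebesgue_row n).
Implicit Types u v w : fn.

Definition fre v := fun x => Re (v x).
Definition fim v := fun x => Im (v x).

Lemma L2P v : L2 Om v <-> sqint mu Om (fre v) /\ sqint mu Om (fim v).
Proof.
split=> [[m1 m2 H]|[s1 s2]].
  have key (f : 'rV[R]_n -> R) : measurable_fun Om f -> (forall x, `|f x| <= normc (v x)) -> sqint mu Om f.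
    move=> mf fv; split=> //; apply: le_lt_trans H; apply: ge0_le_integral => //.
    - by move=> x _; rewrite lee_fin sqr_ge0.
    - by apply/measurable_EFinP; exact: measurable_funX.
    - apply/measurable_EFinP; rewrite (_ : (fun x => _) = fun x => fre v x ^+ 2 + fim v x ^+ 2).
        by apply: measurable_funD; exact: measurable_funX.
      by apply/funext => x; rewrite normc_sqr.
    - move=> x _; rewrite lee_fin -[f x ^+ 2]real_normK ?num_real//.
      by rewrite lerXn2r ?nnegrE ?normc_ge0.
  by split; apply: key => // x; [exact: normc_Re|exact: normc_Im].
have i1 := sqint_integrable s1; have i2 := sqint_integrable s2.
split; [by case: s1|by case: s2|].
have := integrable_lty mOm (integrableD mOm i1 i2).
by under eq_integral do rewrite /= -EFinD -normc_sqr.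
Qed.

Lemma L2_re v : L2 Om v -> sqint mu Om (fre v). Proof. by move=> /L2P[]. Qed.
Lemma L2_im v : L2 Om v -> sqint mu Om (fim v). Proof. by move=> /L2P[]. Qed.

Lemma l2norm_ge0 v : 0 <= l2norm Om v. Proof. exact: sqrtr_ge0. Qed.

Lemma l2norm_sqr v : L2 Om v ->
  l2norm Om v ^+ 2 = nrm mu Om (fre v) ^+ 2 + nrm mu Om (fim v) ^+ 2.
Proof.
move=> Lv; rewrite sqr_sqrtr; last by apply: Rintegral_ge0 => x _; exact: sqr_ge0.
rewrite !nrm_sqr /ip -(RintegralD mOm (sqintM mOm (L2_re Lv) (L2_re Lv)) (sqintM mOm (L2_im Lv) (L2_im Lv))).
by apply: eq_Rintegral => x _; rewrite normc_sqr !expr2.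
Qed.

Lemma l2normE v : L2 Om v ->
  l2norm Om v = Num.sqrt (nrm mu Om (fre v) ^+ 2 + nrm mu Om (fim v) ^+ 2).
Proof. by move=> Lv; rewrite -l2norm_sqr// sqrtr_sqr ger0_norm// l2norm_ge0. Qed.

Lemma nrm_re_le v : L2 Om v -> nrm mu Om (fre v) <= l2norm Om v.
Proof.
move=> Lv; rewrite -(@ler_pXn2r _ 2) ?nnegrE ?nrm_ge0 ?l2norm_ge0// l2norm_sqr//.
by rewrite lerDl sqr_ge0.
Qed.

Lemma nrm_im_le v : L2 Om v -> nrm mu Om (fim v) <= l2norm Om v.
Proof.
move=> Lv; rewrite -(@ler_pXn2r _ 2) ?nnegrE ?nrm_ge0 ?l2norm_ge0// l2norm_sqr//.
by rewrite lerDr sqr_ge0.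
Qed.

Lemma l2norm_le_sum v : L2 Om v -> l2norm Om v <= nrm mu Om (fre v) + nrm mu Om (fim v).
Proof.
move=> Lv; rewrite -(@ler_pXn2r _ 2) ?nnegrE ?addr_ge0 ?nrm_ge0 ?l2norm_ge0// l2norm_sqr//.
by rewrite sqrrD addrAC lerDl mulrn_wge0// mulr_ge0 ?nrm_ge0.
Qed.

Lemma L2D u v : L2 Om u -> L2 Om v -> L2 Om (fun x => u x + v x).
Proof.
move=> /L2P[u1 u2] /L2P[v1 v2]; apply/L2P; split.
  by have := sqintD mOm u1 v1; rewrite /fre; under eq_fun do rewrite -ReD.
by have := sqintD mOm u2 v2; rewrite /fim; under eq_fun do rewrite -ImD.
Qed.

Lemma L2Z (a : R[i]) u : L2 Om u -> L2 Om (fun x => a * u x).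
Proof.
move=> /L2P[u1 u2]; apply/L2P; split; rewrite /fre /fim.
  under eq_fun do rewrite ReM.
  exact: (sqintB mOm (sqintZ mOm (Re a) u1) (sqintZ mOm (Im a) u2)).
under eq_fun do rewrite ImM.
exact: (sqintD mOm (sqintZ mOm (Re a) u2) (sqintZ mOm (Im a) u1)).
Qed.

Lemma L2N u : L2 Om u -> L2 Om (fun x => - u x).
Proof. by move=> /(L2Z (-1)); under eq_fun do rewrite mulN1r. Qed.

Lemma L2B u v : L2 Om u -> L2 Om v -> L2 Om (fun x => u x - v x).
Proof. by move=> Lu /L2N; exact: L2D. Qed.

Lemma L2_real (f : 'rV[R]_n -> R) : sqint mu Om f -> L2 Om (fun x => (f x)%:C%C).
Proof. by move=> sf; apply/L2P; split => //; exact: sqint0. Qed.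

Lemma l2normZ (a : R[i]) u : L2 Om u -> l2norm Om (fun x => a * u x) = normc a * l2norm Om u.
Proof.
move=> Lu; rewrite /l2norm.
under eq_Rintegral do rewrite Normc.normcM exprMn.
rewrite RintegralZl//; last first.
  have := integrableD mOm (sqint_integrable (L2_re Lu)) (sqint_integrable (L2_im Lu)).
  by apply: eq_integrable => // x _; rewrite /= normc_sqr.
by rewrite sqrtrM ?sqr_ge0// sqrtr_sqr ger0_norm// normc_ge0.
Qed.

Lemma l2normN u : l2norm Om (fun x => - u x) = l2norm Om u.
Proof. by rewrite /l2norm; congr Num.sqrt; apply: eq_Rintegral => x _; rewrite normcN. Qed.

Lemma l2norm_distC u v : l2norm Om (fun x => u x - v x) = l2norm Om (fun x => v x - u x).
Proof. by rewrite -l2normN; congr l2norm; apply/funext => x; rewrite opprB. Qed.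

Lemma l2normD u v : L2 Om u -> L2 Om v ->
  l2norm Om (fun x => u x + v x) <= l2norm Om u + l2norm Om v.
Proof.
move=> Lu Lv; rewrite -(@ler_pXn2r _ 2) ?nnegrE ?addr_ge0 ?l2norm_ge0//.
have h1 : nrm mu Om (fre (fun x => u x + v x)) <= nrm mu Om (fre u) + nrm mu Om (fre v).
  have := nrmD mOm (L2_re Lu) (L2_re Lv); rewrite /fre.
  by under [X in _ -> nrm _ _ X <= _]eq_fun do rewrite ReD.
have h2 : nrm mu Om (fim (fun x => u x + v x)) <= nrm mu Om (fim u) + nrm mu Om (fim v).
  have := nrmD mOm (L2_im Lu) (L2_im Lv); rewrite /fim.
  by under [X in _ -> nrm _ _ X <= _]eq_fun do rewrite ImD.
rewrite (l2norm_sqr (L2D Lu Lv)).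
apply: (@le_trans _ _ ((nrm mu Om (fre u) + nrm mu Om (fre v)) ^+ 2 +
   (nrm mu Om (fim u) + nrm mu Om (fim v)) ^+ 2)).
  by apply: lerD; rewrite lerXn2r ?nnegrE ?addr_ge0 ?nrm_ge0.
rewrite [leRHS]sqrrD (l2norm_sqr Lu) (l2norm_sqr Lv) (l2normE Lu) (l2normE Lv).
have := CauchySchwarz2 (nrm_ge0 mu Om (fre u)) (nrm_ge0 mu Om (fim u))
  (nrm_ge0 mu Om (fre v)) (nrm_ge0 mu Om (fim v)).
by move=> h; rewrite !sqrrD !mulr2n; lra.
Qed.

Lemma l2normB_tri w u v : L2 Om u -> L2 Om v -> L2 Om w ->
  l2norm Om (fun x => u x - v x) <= l2norm Om (fun x => u x - w x) + l2norm Om (fun x => w x - v x).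
Proof.
move=> Lu Lv Lw; apply: le_trans (l2normD (L2B Lu Lw) (L2B Lw Lv)).
by under [X in l2norm _ X <= _]eq_fun => x do rewrite -(subrKA (w x)).
Qed.

Lemma l2normB_ge u v : L2 Om u -> L2 Om v ->
  `|l2norm Om u - l2norm Om v| <= l2norm Om (fun x => u x - v x).
Proof.
move=> Lu Lv; rewrite ler_norml.
have h1 := l2normD (L2B Lu Lv) Lv.
have h2 := l2normD (L2B Lv Lu) Lu.
have e1 : (fun x => u x - v x + v x) = u by apply/funext => x; rewrite subrK.
have e2 : (fun x => v x - u x + u x) = v by apply/funext => x; rewrite subrK.
rewrite e1 in h1; rewrite e2 l2norm_distC in h2.
by apply/andP; split; lra.
Qed.

Lemma l2norm_eq u v : L2 Om u -> L2 Om v -> l2norm Om (fun x => u x - v x) = 0 ->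
  l2norm Om u = l2norm Om v.
Proof.
move=> Lu Lv uv0; have := l2normB_ge Lu Lv.
by rewrite uv0 normr_le0 subr_eq0 => /eqP.
Qed.

Lemma l2norm_para u v : L2 Om u -> L2 Om v ->
  l2norm Om (fun x => u x + v x) ^+ 2 + l2norm Om (fun x => u x - v x) ^+ 2 =
  2 * l2norm Om u ^+ 2 + 2 * l2norm Om v ^+ 2.
Proof.
move=> Lu Lv; rewrite (l2norm_sqr (L2D Lu Lv)) (l2norm_sqr (L2B Lu Lv)) (l2norm_sqr Lu) (l2norm_sqr Lv).
have key (f g h k : 'rV[R]_n -> R) : sqint mu Om f -> sqint mu Om g ->
    (forall x, h x = f x + g x) -> (forall x, k x = f x - g x) ->
    nrm mu Om h ^+ 2 + nrm mu Om k ^+ 2 = 2 * nrm mu Om f ^+ 2 + 2 * nrm mu Om g ^+ 2.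
  move=> sf sg /funext -> /funext ->; rewrite !nrm_sqr.
  have sD := sqintD mOm sf sg; have sB := sqintB mOm sf sg.
  rewrite (ipDl mOm sf sg sD) (ipDr mOm sf sg sf) (ipDr mOm sf sg sg).
  rewrite (ipBl mOm sf sg sB) (ipBr mOm sf sg sf) (ipBr mOm sf sg sg); ring.
have h1 := key _ _ _ _ (L2_re Lu) (L2_re Lv) (fun x => ReD (u x) (v x)) (fun x => ReB (u x) (v x)).
have h2 := key _ _ _ _ (L2_im Lu) (L2_im Lv) (fun x => ImD (u x) (v x)) (fun x => ImB (u x) (v x)).
by rewrite addrACA h1 h2; ring.
Qed.

Lemma innerE u v : L2 Om u -> L2 Om v -> inner Om u v =
  ((ip mu Om (fre u) (fre v) + ip mu Om (fim u) (fim v)) +i*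
   (ip mu Om (fim u) (fre v) - ip mu Om (fre u) (fim v)))%C.
Proof.
move=> /L2P[u1 u2] /L2P[v1 v2]; rewrite /inner /cintegral; congr (_ +i* _)%C.
  rewrite /ip -(RintegralD mOm (sqintM mOm u1 v1) (sqintM mOm u2 v2)).
  by apply: eq_Rintegral => x _; rewrite ReM Re_conj Im_conj mulrN opprK.
rewrite /ip -(RintegralB mOm (sqintM mOm u2 v1) (sqintM mOm u1 v2)).
by apply: eq_Rintegral => x _; rewrite ImM Re_conj Im_conj mulrN addrC.
Qed.

Lemma innerC u v : L2 Om u -> L2 Om v -> inner Om v u = ((inner Om u v)^*)%C.
Proof.
move=> Lu Lv; rewrite (innerE Lu Lv) (innerE Lv Lu); apply: complexP => /=.
  by rewrite (ipC mu Om (fre v)) (ipC mu Om (fim v)).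
by rewrite (ipC mu Om (fre v)) (ipC mu Om (fim v)) opprB.
Qed.

Lemma innerDl u v w : L2 Om u -> L2 Om v -> L2 Om w ->
  inner Om (fun x => u x + v x) w = inner Om u w + inner Om v w.
Proof.
move=> Lu Lv Lw; rewrite (innerE (L2D Lu Lv) Lw) (innerE Lu Lw) (innerE Lv Lw).
have -> : fre (fun x => u x + v x) = fun x => fre u x + fre v x.
  by apply/funext => x; rewrite /fre ReD.
have -> : fim (fun x => u x + v x) = fun x => fim u x + fim v x.
  by apply/funext => x; rewrite /fim ImD.
have [u1 u2] := iffLR (L2P u) Lu; have [v1 v2] := iffLR (L2P v) Lv.
have [w1 w2] := iffLR (L2P w) Lw.
rewrite (ipDl mOm u1 v1 w1) (ipDl mOm u1 v1 w2) (ipDl mOm u2 v2 w1) (ipDl mOm u2 v2 w2).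
by apply: complexP => /=; ring.
Qed.

Lemma innerZl (a : R[i]) u w : L2 Om u -> L2 Om w ->
  inner Om (fun x => a * u x) w = a * inner Om u w.
Proof.
move=> Lu Lw; rewrite (innerE (L2Z a Lu) Lw) (innerE Lu Lw).
have -> : fre (fun x => a * u x) = fun x => Re a * fre u x - Im a * fim u x.
  by apply/funext => x; rewrite /fre ReM.
have -> : fim (fun x => a * u x) = fun x => Re a * fim u x + Im a * fre u x.
  by apply/funext => x; rewrite /fim ImM.
have [u1 u2] := iffLR (L2P u) Lu; have [w1 w2] := iffLR (L2P w) Lw.
have s1 := sqintZ mOm (Re a) u1; have s2 := sqintZ mOm (Im a) u2.
have s3 := sqintZ mOm (Re a) u2; have s4 := sqintZ mOm (Im a) u1.
rewrite (ipBl mOm s1 s2 w1) (ipBl mOm s1 s2 w2) (ipDl mOm s3 s4 w1) (ipDl mOm s3 s4 w2).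
rewrite !(ipZl mOm _ u1 w1) !(ipZl mOm _ u1 w2) !(ipZl mOm _ u2 w1) !(ipZl mOm _ u2 w2).
by apply: complexP; rewrite ?ReM ?ImM /=; ring.
Qed.

Lemma inner_lin (a : R[i]) u v w : L2 Om u -> L2 Om v -> L2 Om w ->
  inner Om (fun x => a * u x + v x) w = a * inner Om u w + inner Om v w.
Proof. by move=> Lu Lv Lw; rewrite innerDl ?innerZl//; exact: L2Z. Qed.

Lemma inner_self u : L2 Om u -> inner Om u u = ((l2norm Om u ^+ 2)%:C)%C.
Proof.
move=> Lu; rewrite (innerE Lu Lu) (l2norm_sqr Lu) !nrm_sqr; apply: complexP => //=.
by rewrite ipC subrr.
Qed.

(** The factor 2 comes from treating real and imaginary part separately; only continuity of the
    inner product is at stake. *)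
Lemma inner_bound u v : L2 Om u -> L2 Om v ->
  normc (inner Om u v) <= 2 * (l2norm Om u * l2norm Om v).
Proof.
move=> Lu Lv; apply: (le_trans (normc_le_ReIm _)); rewrite (innerE Lu Lv) [complex.Re _]/= [complex.Im _]/=.
have [u1 u2] := iffLR (L2P u) Lu; have [v1 v2] := iffLR (L2P v) Lv.
have nn := @nrm_ge0.
have c1 := CauchySchwarz2 (nn _ _ _ mu Om (fre u)) (nn _ _ _ mu Om (fim u))
  (nn _ _ _ mu Om (fre v)) (nn _ _ _ mu Om (fim v)).
have c2 := CauchySchwarz2 (nn _ _ _ mu Om (fre u)) (nn _ _ _ mu Om (fim u))
  (nn _ _ _ mu Om (fim v)) (nn _ _ _ mu Om (fre v)).
rewrite [X in _ <= _ * Num.sqrt X]addrC in c2.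
rewrite -(l2normE Lu) -(l2normE Lv) in c1 c2.
have := CauchySchwarz mOm u1 v1; have := CauchySchwarz mOm u2 v2.
have := CauchySchwarz mOm u1 v2; have := CauchySchwarz mOm u2 v1.
have := ler_normD (ip mu Om (fre u) (fre v)) (ip mu Om (fim u) (fim v)).
have := ler_normB (ip mu Om (fim u) (fre v)) (ip mu Om (fre u) (fim v)).
by move: c1 c2; lra.
Qed.

Lemma L2_complete (f_ : nat -> fn) : (forall k, L2 Om (f_ k)) ->
  (forall k, l2norm Om (fun x => f_ k.+1 x - f_ k x) <= (2^-1) ^+ k) ->
  exists2 f, L2 Om f & l2norm Om (fun x => f_ k x - f x) @[k --> \oo] --> 0.
Proof.
move=> Lf df.
have sB j k : L2 Om (fun x => f_ j x - f_ k x) by exact: L2B.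
have d1 k : nrm mu Om (fun x => fre (f_ k.+1) x - fre (f_ k) x) <= (2^-1) ^+ k.
  apply: le_trans (df k); apply: le_trans (nrm_re_le (sB _ _)).
  by rewrite /fre; under [X in _ <= nrm _ _ X]eq_fun do rewrite ReB.
have d2 k : nrm mu Om (fun x => fim (f_ k.+1) x - fim (f_ k) x) <= (2^-1) ^+ k.
  apply: le_trans (df k); apply: le_trans (nrm_im_le (sB _ _)).
  by rewrite /fim; under [X in _ <= nrm _ _ X]eq_fun do rewrite ImB.
have [g1 sg1 c1] := sqint_complete mOm (fun k => L2_re (Lf k)) d1.
have [g2 sg2 c2] := sqint_complete mOm (fun k => L2_im (Lf k)) d2.
have Lg : L2 Om (fun x => (g1 x +i* g2 x)%C) by apply/L2P.
exists (fun x => (g1 x +i* g2 x)%C) => //.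
apply: (@squeeze_cvgr _ _ _ _ (fun=> 0) (fun k =>
  nrm mu Om (fun x => fre (f_ k) x - g1 x) + nrm mu Om (fun x => fim (f_ k) x - g2 x))).
- apply: nearW => k; rewrite l2norm_ge0 /=.
  apply: (le_trans (l2norm_le_sum (L2B (Lf k) Lg))).
  rewrite /fre /fim; under [X in nrm _ _ X + _ <= _]eq_fun do rewrite ReB.
  by under [X in _ + nrm _ _ X <= _]eq_fun do rewrite ImB.
- exact: cvg_cst.
- by rewrite -[X in _ --> X](addr0 0); apply: cvgD.
Qed.

End complex_L2.

Section sobolev.
Context {R : realType} {n : nat}.
Local Notation fn := ('rV[R]_n -> R[i]).
Variables (Om : set 'rV[R]_n) (rho : R).
Hypotheses (oOm : open Om) (Omrho : Om `<=` cube n rho).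
Local Notation mu := (lebesgue_row n).
Let mOm : measurable Om := measurable_domain oOm.
Implicit Types (u v w : fn) (phi : 'rV[R]_n -> R).

Lemma bsupp_sqint_domain phi : bsupp rho phi -> sqint mu Om phi.
Proof.
move=> bf; apply: sqintP => //; first by case: bf => mf _ _; exact: measurable_funTS.
have := bsupp_integrable (bsuppM bf bf); apply: integrableS => //.
Qed.

Lemma compact_closed_row (K : set 'rV[R]_n) : compact K -> closed K.
Proof. by apply: compact_closed; exact: norm_hausdorff. Qed.

Lemma test_bsupp phi : test_function Om phi -> bsupp rho phi.
Proof.
move=> [Cp [K [cK KO p0]]]; apply: continuous_bsupp; first exact: class_C_continuous (Cp 0%N).
by move=> x nx; apply: p0 => /KO /Omrho.
Qed.

Lemma test_partial_bsupp phi i : test_function Om phi -> bsupp rho (partial i phi).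
Proof.
move=> [Cp [K [cK KO p0]]]; apply: continuous_bsupp.
  by have [_ /(_ i)[_ []]] := Cp 1%N.
move=> x nx; apply: (partial_support i (compact_closed_row cK) p0).
by move=> /KO /Omrho.
Qed.

Lemma testD phi psi (a b : R) : test_function Om phi -> test_function Om psi ->
  test_function Om (fun x => a * phi x + b * psi x).
Proof.
move=> [C1 [K1 [c1 k1 z1]]] [C2 [K2 [c2 k2 z2]]]; split.
  by move=> k; apply: class_CD; apply: class_CM => //; exact: class_C_cst.
exists (K1 `|` K2); split; first exact: compactU.
- by move=> x [/k1|/k2].
- by move=> x nx; rewrite z1 ?z2 ?mulr0 ?addr0// => h; apply: nx; [right|left].
Qed.

Lemma test_partialD phi psi (a b : R) i x : test_function Om phi -> test_function Om psi ->
  partial i (fun x => a * phi x + b * psi x) x = a * partial i phi x + b * partial i psi x.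
Proof.
move=> [C1 _] [C2 _]; have [_ /(_ i)[d1 _]] := C1 1%N; have [_ /(_ i)[d2 _]] := C2 1%N.
rewrite /partial.
have h1 := is_deriveZ a (DeriveDef (d1 x) erefl).
have h2 := is_deriveZ b (DeriveDef (d2 x) erefl).
by have [_ ->] := is_deriveD h1 h2.
Qed.

Definition Cfun phi : fn := fun x => (phi x)%:C%C.

Lemma L2_test phi : test_function Om phi -> L2 Om (Cfun phi).
Proof. by move=> tp; apply: (L2_real mOm); exact/bsupp_sqint_domain/test_bsupp. Qed.

Lemma L2_test_partial phi i : test_function Om phi -> L2 Om (Cfun (partial i phi)).
Proof. by move=> tp; apply: (L2_real mOm); exact/bsupp_sqint_domain/test_partial_bsupp. Qed.

Lemma cintegral_Cfun v phi : cintegral Om (fun x => v x * (phi x)%:C%C) = inner Om v (Cfun phi).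
Proof.
by rewrite /inner; congr cintegral; apply/funext => x; rewrite /Cfun conjc_real.
Qed.

Lemma weak_gradientP v (G : 'I_n -> fn) : weak_gradient Om v G <->
  forall i, L2 Om (G i) /\ forall phi, test_function Om phi ->
    inner Om v (Cfun (partial i phi)) = - inner Om (G i) (Cfun phi).
Proof.
by split=> H i; have [LG HG] := H i; split=> // phi tp; have := HG phi tp; rewrite !cintegral_Cfun.
Qed.

Lemma weak_gradient_lin (a : R[i]) u v (G H : 'I_n -> fn) : L2 Om u -> L2 Om v ->
  weak_gradient Om u G -> weak_gradient Om v H ->
  weak_gradient Om (fun x => a * u x + v x) (fun i x => a * G i x + H i x).
Proof.
move=> Lu Lv /weak_gradientP wG /weak_gradientP wH; apply/weak_gradientP => i.
have [LG HG] := wG i; have [LH HH] := wH i.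
split; first exact: (L2D mOm (L2Z mOm a LG) LH).
move=> phi tp; rewrite (inner_lin mOm a Lu Lv (L2_test_partial i tp)).
by rewrite (inner_lin mOm a LG LH (L2_test tp)) HG// HH// mulrN -opprD.
Qed.

Lemma fundamental_complex v : L2 Om v ->
  (forall phi, test_function Om phi -> inner Om v (Cfun phi) = 0) -> l2norm Om v = 0.
Proof.
move=> Lv H; have [s1 s2] := iffLR (L2P mOm v) Lv.
have E phi : test_function Om phi -> ip mu Om (fre v) phi = 0 /\ ip mu Om (fim v) phi = 0.
  move=> tp; have := H phi tp; rewrite (innerE mOm Lv (L2_test tp)).
  have z f : ip mu Om f (fim (Cfun phi)) = 0.
    rewrite /ip; under eq_Rintegral do rewrite mulr0.
    by rewrite Rintegral_cst// mul0r.
  by rewrite !z addr0 subr0 => -[-> ->].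
rewrite (l2normE mOm Lv).
rewrite (fundamental_nrm oOm Omrho s1 (fun phi tp => (E phi tp).1)).
rewrite (fundamental_nrm oOm Omrho s2 (fun phi tp => (E phi tp).2)).
by rewrite expr0n /= addr0 sqrtr0.
Qed.

(** The difference of two candidates is orthogonal to every test function. *)
Lemma weak_gradient_unique v (G H : 'I_n -> fn) i : 
  weak_gradient Om v G -> weak_gradient Om v H -> l2norm Om (fun x => G i x - H i x) = 0.
Proof.
move=> /weak_gradientP wG /weak_gradientP wH.
have [LG HG] := wG i; have [LH HH] := wH i.
apply: fundamental_complex; first exact: L2B.
move=> phi tp; have Lp := L2_test tp.
have -> : (fun x => G i x - H i x) = fun x => -1 * H i x + G i x.
  by apply/funext => x; rewrite mulN1r addrC.
rewrite (inner_lin mOm _ LH LG Lp) mulN1r.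
by have := HG phi tp; rewrite (HH phi tp) => /oppr_inj ->; rewrite addNr.
Qed.

Lemma H1_L2 v : H1 Om v -> L2 Om v. Proof. by case. Qed.

Lemma gradP v : H1 Om v -> weak_gradient Om v (grad Om v).
Proof. by move=> [_ H]; exact: xgetPex. Qed.

Lemma L2_grad v i : H1 Om v -> L2 Om (grad Om v i).
Proof. by move=> /gradP /(_ i)[]. Qed.

Lemma H1_lin (a : R[i]) u v : H1 Om u -> H1 Om v -> H1 Om (fun x => a * u x + v x).
Proof.
move=> Hu Hv; split; first exact: (L2D mOm (L2Z mOm a (H1_L2 Hu)) (H1_L2 Hv)).
exists (fun i x => a * grad Om u i x + grad Om v i x).
by apply: weak_gradient_lin; [exact: H1_L2|exact: H1_L2|exact: gradP|exact: gradP].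
Qed.

Lemma grad_unique v (G : 'I_n -> fn) i : H1 Om v -> weak_gradient Om v G ->
  l2norm Om (fun x => grad Om v i x - G i x) = 0.
Proof. by move=> Hv wG; apply: weak_gradient_unique wG; exact: gradP. Qed.

(** [grad] selects one weak gradient among those equal almost everywhere, so it is linear only up to
    a null function. *)
Lemma grad_lin (a : R[i]) u v i : H1 Om u -> H1 Om v ->
  l2norm Om (fun x => grad Om (fun x => a * u x + v x) i x -
    (a * grad Om u i x + grad Om v i x)) = 0.
Proof.
move=> Hu Hv; apply: (@grad_unique _ (fun i x => a * grad Om u i x + grad Om v i x)).
  exact: H1_lin.
by apply: weak_gradient_lin; [exact: H1_L2|exact: H1_L2|exact: gradP|exact: gradP].
Qed.

Lemma H10norm_sqr v : H1 Om v -> H10norm Om v ^+ 2 = \sum_i l2norm Om (grad Om v i) ^+ 2.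
Proof.
move=> Hv; rewrite sqr_sqrtr; last first.
  by apply: Rintegral_ge0 => x _; apply: sumr_ge0 => i _; exact: sqr_ge0.
rewrite Rintegral_sum//.
  apply: eq_bigr => i _; rewrite sqr_sqrtr//.
  by apply: Rintegral_ge0 => x _; exact: sqr_ge0.
move=> i; have Lg := L2_grad i Hv.
have := integrableD mOm (sqint_integrable (L2_re mOm Lg)) (sqint_integrable (L2_im mOm Lg)).
by apply: eq_integrable => // x _; rewrite /= normc_sqr.
Qed.

Lemma H10norm_ge0 v : 0 <= H10norm Om v. Proof. exact: sqrtr_ge0. Qed.

Lemma grad_le_H10norm v i : H1 Om v -> l2norm Om (grad Om v i) <= H10norm Om v.
Proof.
move=> Hv; rewrite -(@ler_pXn2r _ 2) ?nnegrE ?H10norm_ge0 ?l2norm_ge0// H10norm_sqr//.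
by rewrite (bigD1 i)//= lerDl; apply: sumr_ge0 => j _; exact: sqr_ge0.
Qed.

Lemma ctest_L2 w : ctest_function Om w -> L2 Om w.
Proof.
move=> [t1 t2]; apply/(L2P mOm); split; apply: bsupp_sqint_domain; exact: test_bsupp.
Qed.

Lemma ctest_partial_L2 w i : ctest_function Om w -> L2 Om (cpartial i w).
Proof.
move=> [t1 t2]; apply/(L2P mOm); split; apply: bsupp_sqint_domain; exact: test_partial_bsupp.
Qed.

Lemma ctest_lin (a : R[i]) u v : ctest_function Om u -> ctest_function Om v ->
  ctest_function Om (fun x => a * u x + v x).
Proof.
move=> [u1 u2] [v1 v2]; split.
  have := testD 1 1 (testD (Re a) (- Im a) u1 u2) v1.
  by congr test_function; apply/funext => x; rewrite !reimE !mul1r mulNr.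
have := testD 1 1 (testD (Re a) (Im a) u2 u1) v2.
by congr test_function; apply/funext => x; rewrite !reimE !mul1r.
Qed.

Lemma cpartial_lin (a : R[i]) u v i x : ctest_function Om u -> ctest_function Om v ->
  cpartial i (fun x => a * u x + v x) x = a * cpartial i u x + cpartial i v x.
Proof.
move=> [u1 u2] [v1 v2].
have E1 : (fun y => Re (a * u y + v y)) =
    fun y => 1 * (Re a * Re (u y) + - Im a * Im (u y)) + 1 * Re (v y).
  by apply/funext => y; rewrite !reimE !mul1r mulNr.
have E2 : (fun y => Im (a * u y + v y)) =
    fun y => 1 * (Re a * Im (u y) + Im a * Re (u y)) + 1 * Im (v y).
  by apply/funext => y; rewrite !reimE !mul1r.
rewrite /cpartial E1 E2.
rewrite (test_partialD 1 1 i x (testD (Re a) (- Im a) u1 u2) v1).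
rewrite (test_partialD (Re a) (- Im a) i x u1 u2).
rewrite (test_partialD 1 1 i x (testD (Re a) (Im a) u2 u1) v2).
rewrite (test_partialD (Re a) (Im a) i x u2 u1).
by apply: complexP; rewrite !reimE !mul1r ?mulNr.
Qed.

Definition approx v w (e : R) := l2norm Om (fun x => v x - w x) <= e /\
  forall i, l2norm Om (fun x => grad Om v i x - cpartial i w x) <= e.

(** A separate tolerance for the function and each derivative, instead of a sum of squares, lets
    errors be added by the triangle inequality. *)
Lemma H10P v : H10 Om v <-> H1 Om v /\
  forall e : R, 0 < e -> exists2 w, ctest_function Om w & approx v w e.
Proof.
split=> -[Hv H]; split=> // e e0.
  have [w [tw Hw]] := H e e0; exists w => //.
  have S0 : 0 <= \sum_i l2norm Om (fun x => grad Om v i x - cpartial i w x) ^+ 2.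
    by apply: sumr_ge0 => i _; exact: sqr_ge0.
  split=> [|i]; rewrite -(@ler_pXn2r _ 2) ?nnegrE ?l2norm_ge0 ?(ltW e0)//.
    by apply: le_trans (ltW Hw); rewrite lerDl.
  apply: le_trans (ltW Hw); rewrite (bigD1 i)//= addrCA lerDl addr_ge0 ?sqr_ge0//.
  by apply: sumr_ge0 => j _; exact: sqr_ge0.
(* The [n.+1] squares of [e / n.+2] add up to less than [e ^+ 2], strictly even when [n] is 0. *)
have n2 : 0 < n.+2%:R :> R by rewrite ltr0n.
have [w tw [w1 w2]] := H (e / n.+2%:R) (divr_gt0 e0 n2).
exists w; split=> //.
have d0 : 0 <= e / n.+2%:R by rewrite divr_ge0 ?(ltW e0).
apply: (@le_lt_trans _ _ ((e / n.+2%:R) ^+ 2 + \sum_(i < n) (e / n.+2%:R) ^+ 2)).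
  apply: lerD; first by rewrite lerXn2r ?nnegrE ?l2norm_ge0.
  by apply: ler_sum => i _; rewrite lerXn2r ?nnegrE ?l2norm_ge0.
rewrite sumr_const card_ord -mulrS -[X in X < _]mulr_natl expr_div_n.
rewrite mulrCA gtr_pMr ?exprn_gt0// ltr_pdivrMr ?exprn_gt0// mul1r -natrX ltr_nat.
by rewrite expnS expn1 mulSn; rewrite -addSnnS ltn_addr.
Qed.

Lemma H10_H1 v : H10 Om v -> H1 Om v. Proof. by case. Qed.
Lemma H10_L2 v : H10 Om v -> L2 Om v. Proof. by move=> [/H1_L2]. Qed.

Lemma H10_lin (a : R[i]) u v : H10 Om u -> H10 Om v -> H10 Om (fun x => a * u x + v x).
Proof.
move=> /H10P[Hu Au] /H10P[Hv Av]; apply/H10P; split; first exact: H1_lin.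
move=> e e0.
have a0 : 0 < normc a + 1 by rewrite ltr_wpDl// normc_ge0.
(* The added 1 keeps the tolerance well defined when [a] is 0. *)
pose e1 := e / 2 / (normc a + 1).
have e10 : 0 < e1 by rewrite !divr_gt0.
have e20 : 0 < e / 2 by rewrite divr_gt0.
have ae : normc a * e1 + e / 2 <= e.
  have : normc a * e1 <= e / 2.
    rewrite /e1 mulrCA ger_pMr// ler_pdivrMr// mul1r lerDl//.
  by lra.
have [w1 t1 [A1 B1]] := Au e1 e10.
have [w2 t2 [A2 B2]] := Av (e / 2) e20.
exists (fun x => a * w1 x + w2 x); first exact: ctest_lin.
have comb (f g h k : fn) : L2 Om f -> L2 Om g -> L2 Om h -> L2 Om k ->
    l2norm Om (fun x => f x - h x) <= e1 -> l2norm Om (fun x => g x - k x) <= e / 2 ->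
    l2norm Om (fun x => (a * f x + g x) - (a * h x + k x)) <= e.
  move=> Lf Lg Lh Lk fh gk.
  have -> : (fun x => (a * f x + g x) - (a * h x + k x)) =
    fun x => a * (f x - h x) + (g x - k x).
    by apply/funext => x; ring.
  apply: le_trans (l2normD mOm (L2Z mOm a (L2B mOm Lf Lh)) (L2B mOm Lg Lk)) _.
  rewrite (l2normZ mOm a (L2B mOm Lf Lh)); apply: le_trans ae; apply: lerD => //.
  by rewrite ler_wpM2l// normc_ge0.
split; first exact: (comb _ _ _ _ (H1_L2 Hu) (H1_L2 Hv) (ctest_L2 t1) (ctest_L2 t2) A1 A2).
move=> i.
have LG := L2_grad i (H1_lin a Hu Hv).
have Lab : L2 Om (fun x => a * grad Om u i x + grad Om v i x).
  exact: (L2D mOm (L2Z mOm a (L2_grad i Hu)) (L2_grad i Hv)).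
have Lt : L2 Om (cpartial i (fun x => a * w1 x + w2 x)).
  exact: (ctest_partial_L2 i (ctest_lin a t1 t2)).
apply: le_trans (l2normB_tri mOm LG Lt Lab) _.
rewrite (grad_lin a i Hu Hv) add0r.
under [X in l2norm _ X]eq_fun => x do rewrite (cpartial_lin a i x t1 t2).
exact: (comb _ _ _ _ (L2_grad i Hu) (L2_grad i Hv) (ctest_partial_L2 i t1) (ctest_partial_L2 i t2) (B1 i) (B2 i)).
Qed.

End sobolev.

Lemma le0_of_cvg0 (R : realType) (x : R) (s : nat -> R) :
  (forall k, x <= s k) -> s k @[k --> \oo] --> 0 -> x <= 0.
Proof.
move=> xs s0; rewrite -(cvg_lim _ s0)//; apply: limr_ge; first by apply/cvg_ex; exists 0.
exact: nearW.
Qed.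

Lemma ultra_fmap (T U : Type) (f : T -> U) (F : set_system T) :
  UltraFilter F -> UltraFilter (f @ F).
Proof.
move=> UF; split; first exact: fmap_proper_filter.
move=> G GF FG; rewrite predeqE => B; split; last exact: FG.
have [//|nB] := in_ultra_setVsetC (f @^-1` B) UF.
move=> GB; exfalso; have /FG GC : (f @ F) (~` B) by [].
by have /(@filter_ex _ _ GF)[x []] := @filterI _ _ GF _ _ GB GC.
Qed.

Lemma sum2_le (R : realDomainType) (I : finType) (a b : I -> R) (S : R) :
  \sum_i a i <= S -> \sum_i b i <= S -> \sum_i (2 * a i + 2 * b i) <= 4 * S.
Proof. by move=> ha hb; rewrite big_split /= -!mulr_sumr; lra. Qed.

(** * Completeness and compactness in H^1_0 *)

Section sobolev.
Context {R : realType} {n : nat}.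
Local Notation fn := ('rV[R]_n -> R[i]).
Variables (Om : set 'rV[R]_n) (rho : R).
Hypotheses (rho0 : 0 < rho) (oOm : open Om) (Omrho : Om `<=` cube n rho).
Local Notation mu := (lebesgue_row n).
Let mOm : measurable Om := measurable_domain oOm.
Implicit Types (u v w : fn) (phi : 'rV[R]_n -> R).

(** The defining identity of a weak gradient survives the limit, since for a fixed test function
    both sides are continuous in [L^2]; test functions close to a late [v_ k] are then close to
    [u]. *)
Lemma H10_complete (v_ : nat -> fn) : (forall k, H10 Om (v_ k)) ->
  (forall k, l2norm Om (fun x => v_ k.+1 x - v_ k x) <= (2^-1) ^+ k) ->
  (forall k i, l2norm Om (fun x => grad Om (v_ k.+1) i x - grad Om (v_ k) i x) <= (2^-1) ^+ k) ->
  exists u, [/\ H10 Om u, l2norm Om (fun x => v_ k x - u x) @[k --> \oo] --> 0 &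
    forall i, l2norm Om (fun x => grad Om (v_ k) i x - grad Om u i x) @[k --> \oo] --> 0].
Proof.
move=> Hv dv dg.
have H1v k : H1 Om (v_ k) by exact: H10_H1.
have [u Lu cu] := L2_complete mOm (fun k => H1_L2 (H1v k)) dv.
have HG i : exists G : fn, L2 Om G /\ l2norm Om (fun x => grad Om (v_ k) i x - G x) @[k --> \oo] --> 0.
  have [G LG cG] := L2_complete mOm (fun k => L2_grad i (H1v k)) (fun k => dg k i).
  by exists G.
have [G HG'] := choice HG.
have wG : weak_gradient Om u G.
  apply/weak_gradientP => i; have [LG cG] := HG' i; split=> // phi tp.
  have Lp := L2_test oOm Omrho tp; have Lq := L2_test_partial oOm Omrho i tp.
  apply/eqP; rewrite -subr_eq0 opprK; apply/eqP/normc_eq0/eqP.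
  rewrite eq_le normc_ge0 andbT.
  apply: (@le0_of_cvg0 _ _ (fun k =>
    2 * (l2norm Om (fun x => v_ k x - u x) * l2norm Om (Cfun (partial i phi))) +
    2 * (l2norm Om (fun x => grad Om (v_ k) i x - G i x) * l2norm Om (Cfun phi)))); last first.
    rewrite -[X in _ --> X](addr0 0); apply: cvgD.
      rewrite -[X in _ --> X](mulr0 2) -[X in 2 * X](mul0r (l2norm Om (Cfun (partial i phi)))).
      by apply: cvgMr; apply: cvgMl.
    rewrite -[X in _ --> X](mulr0 2) -[X in 2 * X](mul0r (l2norm Om (Cfun phi))).
    by apply: cvgMr; apply: cvgMl.
  move=> k; have Lgk := L2_grad i (H1v k); have Lvk := H1_L2 (H1v k).
  have wk := (iffLR (@weak_gradientP _ _ _ _ _) (gradP (H1v k)) i).2 phi tp.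
  have -> : inner Om u (Cfun (partial i phi)) + inner Om (G i) (Cfun phi) =
      - (inner Om (fun x => v_ k x - u x) (Cfun (partial i phi)) +
         inner Om (fun x => grad Om (v_ k) i x - G i x) (Cfun phi)).
    have e1 : inner Om (fun x => v_ k x - u x) (Cfun (partial i phi)) =
        inner Om (v_ k) (Cfun (partial i phi)) - inner Om u (Cfun (partial i phi)).
      rewrite -mulN1r -(innerZl mOm _ Lu Lq) -(innerDl mOm Lvk (L2Z mOm _ Lu) Lq).
      by congr inner; apply/funext => x; rewrite mulN1r.
    have e2 : inner Om (fun x => grad Om (v_ k) i x - G i x) (Cfun phi) =
        inner Om (grad Om (v_ k) i) (Cfun phi) - inner Om (G i) (Cfun phi).
      rewrite -[- inner Om (G i) _]mulN1r -(innerZl mOm _ LG Lp) -(innerDl mOm Lgk (L2Z mOm _ LG) Lp).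
      by congr inner; apply/funext => x; rewrite mulN1r.
    by rewrite e1 e2 wk; ring.
  rewrite normcN; apply: (le_trans (le_normcD _ _)).
  exact: lerD (inner_bound mOm (L2B mOm Lvk Lu) Lq) (inner_bound mOm (L2B mOm Lgk LG) Lp).
have H1u : H1 Om u by split=> //; exists G.
have cg i : l2norm Om (fun x => grad Om (v_ k) i x - grad Om u i x) @[k --> \oo] --> 0.
  have [LG cG] := HG' i.
  apply: (@squeeze_cvgr _ _ _ _ (fun=> 0) (fun k => l2norm Om (fun x => grad Om (v_ k) i x - G i x))) => //.
    apply: nearW => k; rewrite l2norm_ge0 /=.
    apply: (le_trans (l2normB_tri mOm (L2_grad i (H1v k)) (L2_grad i H1u) LG)).
    by rewrite (l2norm_distC _ (G i)) (grad_unique oOm Omrho i H1u wG) addr0.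
  exact: cvg_cst.
exists u; split=> //; apply/H10P; split=> // e e0.
have e2 : 0 < e / 2 by rewrite divr_gt0.
have small (s : nat -> R) : (forall k, 0 <= s k) -> s k @[k --> \oo] --> 0 ->
    \forall k \near \oo, s k <= e / 2.
  move=> s0 /cvgrPdist_le /(_ _ e2); apply: filterS => k.
  by rewrite sub0r normrN ger0_norm.
have [k _ Hk] : \forall k \near \oo, l2norm Om (fun x => v_ k x - u x) <= e / 2 /\
    forall i, l2norm Om (fun x => grad Om (v_ k) i x - grad Om u i x) <= e / 2.
  apply: filterI; first by apply: small => // k; exact: l2norm_ge0.
  have h i : \forall k \near \oo,
      l2norm Om (fun x => grad Om (v_ k) i x - grad Om u i x) <= e / 2.
    by apply: small => // k; exact: l2norm_ge0.
  exact: (@filter_forall _ _ _ (nbhs \oo) _ h).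
have {Hk} [h1 h2] := Hk k (leqnn k).
have [w tw [A1 A2]] := (iffLR (@H10P _ _ _ _) (Hv k)).2 _ e2.
exists w => //; split.
  apply: le_trans (l2normB_tri mOm Lu (ctest_L2 oOm Omrho tw) (H1_L2 (H1v k))) _.
  by rewrite l2norm_distC; have := lerD h1 A1; rewrite -splitr.
move=> i.
apply: le_trans (l2normB_tri mOm (L2_grad i H1u) (ctest_partial_L2 oOm Omrho i tw) (L2_grad i (H1v k))) _.
by rewrite l2norm_distC; have := lerD (h2 i) (A2 i); rewrite -splitr.
Qed.

Lemma ip_sub_le d (T : measurableType d) (nu : {measure set T -> \bar R}) (D : set T)
    (f g : T -> R) : measurable D -> sqint nu D f -> sqint nu D g ->
  ip nu D (fun x => f x - g x) (fun x => f x - g x) <= 2 * ip nu D f f + 2 * ip nu D g g.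
Proof.
move=> mD sf sg; have sD := sqintD mD sf sg; have sB := sqintB mD sf sg.
have := ip_ge0 nu D (fun x => f x + g x).
rewrite (ipDl mD sf sg sD) (ipDr mD sf sg sf) (ipDr mD sf sg sg).
rewrite (ipBl mD sf sg sB) (ipBr mD sf sg sf) (ipBr mD sf sg sg).
by lra.
Qed.

Lemma ip_setT_domain phi psi : (forall x, ~ Om x -> phi x = 0) ->
  ip mu setT phi psi = ip mu Om phi psi.
Proof.
move=> p0; rewrite /ip [RHS]Rintegral_mkcond; apply: eq_Rintegral => x _.
rewrite patchE; case: ifPn => //; rewrite notin_setE => /p0 ->.
by rewrite mul0r.
Qed.

(** The finitely many functionals of [Rellich_estimate] are bounded along the sequence, hence
    converge along the ultrafilter; applied to differences, the estimate yields the Cauchy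
    property. *)
Lemma test_compact (phi_ : nat -> 'rV[R]_n -> R) (S : R) (F : set_system nat) :
  UltraFilter F -> (forall k, test_function Om (phi_ k)) ->
  (forall k, ip mu setT (phi_ k) (phi_ k) <= S) ->
  (forall k, \sum_i ip mu setT (partial i (phi_ k)) (partial i (phi_ k)) <= S) ->
  forall e : R, 0 < e -> exists E, F E /\
    forall j k, E j -> E k -> nrm mu Om (fun x => phi_ j x - phi_ k x) <= e.
Proof.
move=> UF tp S1 S2 e e0.
have S0 : 0 <= S by apply: le_trans (S1 0%N); exact: ip_ge0.
have bp k := test_bsupp Omrho (tp k).
have bd k i := test_partial_bsupp Omrho i (tp k).
have sp k := bsupp_sqint (bp k).
(* A difference has squared gradient norm at most [4 * S], so the gradient term takes one half of
   [e ^+ 2]; [eta] leaves the other half to the functionals. *)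
have eps0 : 0 < e ^+ 2 / 2 / (4 * S + 1).
  by rewrite !divr_gt0 ?exprn_gt0// ltr_wpDl// mulr_ge0.
have [W [I [chi [W0 Hchi HR]]]] := Rellich_estimate n rho0 eps0.
pose eta := Num.min 1 (e ^+ 2 / 2 / (W * #|I|%:R + 1)).
have K0 : 0 < W * #|I|%:R + 1 by rewrite ltr_wpDl// mulr_ge0.
have eta0 : 0 < eta by rewrite lt_min ltr01 !divr_gt0// exprn_gt0.
have eta1 : eta <= 1 by rewrite ge_min lexx.
have etaK : (W * #|I|%:R + 1) * eta <= e ^+ 2 / 2.
  by rewrite mulrC -ler_pdivlMr// ge_min lexx orbT.
have conv l : exists c : R, (fun k => ip mu setT (phi_ k) (chi l)) @ F --> c.
  have sc := bsupp_sqint (Hchi l).1.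
  pose M := Num.sqrt S * nrm mu setT (chi l).
  have bM k : `[- M, M]%classic (ip mu setT (phi_ k) (chi l)).
    rewrite /= in_itv /= -ler_norml; apply: (le_trans (CauchySchwarz measurableT (sp k) sc)).
    by rewrite ler_wpM2r ?nrm_ge0// /nrm ler_sqrt.
  have := @segment_compact R (- M) M; rewrite compact_ultra.
  move=> /(_ ((fun k => ip mu setT (phi_ k) (chi l)) @ F) (ultra_fmap _ UF)) [].
    by apply: (@filterS _ F _ setT) => [k _|]; [exact: (bM k)|exact: filterT].
  by move=> c [_ Hc]; exists c.
have [c Hc] := choice conv.
exists [set k | forall l, `|c l - ip mu setT (phi_ k) (chi l)| <= eta / 2]; split.
  apply: filter_forall => l; have := Hc l => /cvgrPdist_le; apply.
  by rewrite divr_gt0.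
move=> j k Ej Ek.
have tf := testD 1 (-1) (tp j) (tp k).
have bf := test_bsupp Omrho tf.
pose f : 'rV[R]_n -> R := fun x => 1 * phi_ j x + -1 * phi_ k x.
have fE : f = fun x => phi_ j x - phi_ k x by apply/funext => x; rewrite /f mul1r mulN1r.
have f0 x : ~ Om x -> f x = 0.
  have [_ [K [_ KO K0']]] := tf; move=> nx; apply: K0' => h; apply: nx; exact: KO.
have := HR f (tf.1 1%N) _; move=> /(_ _) HRf.
have {HRf} : ip mu setT f f <= e ^+ 2.
  apply: le_trans (HRf _) _; first by move=> x nx; case: bf => _ _; exact.
  rewrite [leRHS]splitr.
  apply: lerD.
    have : \sum_i ip mu setT (partial i f) (partial i f) <= 4 * S.
      apply: (@le_trans _ _ (\sum_i (2 * ip mu setT (partial i (phi_ j)) (partial i (phi_ j)) +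
         2 * ip mu setT (partial i (phi_ k)) (partial i (phi_ k))))).
        apply: ler_sum => i _.
        have -> : partial i f = fun x => partial i (phi_ j) x - partial i (phi_ k) x.
          by apply/funext => x; rewrite /f (test_partialD 1 (-1) i x (tp j) (tp k)) mul1r mulN1r.
        exact: (ip_sub_le measurableT (bsupp_sqint (bd j i)) (bsupp_sqint (bd k i))).
      exact: (sum2_le (S2 j) (S2 k)).
    move=> h; apply: (@le_trans _ _ (e ^+ 2 / 2 / (4 * S + 1) * (4 * S))).
      by rewrite ler_wpM2l// ltW.
    rewrite mulrAC ler_pdivrMr; last by rewrite ltr_wpDl// mulr_ge0.
    by rewrite ler_wpM2l ?lerDl// divr_ge0// sqr_ge0.
  apply: le_trans etaK.
  apply: (@le_trans _ _ (W * (#|I|%:R * eta))).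
    rewrite ler_wpM2l//.
    apply: (@le_trans _ _ (\sum_(l : I) eta)); last by rewrite sumr_const mulr_natl.
    apply: ler_sum => l _.
    have sc := bsupp_sqint (Hchi l).1.
    rewrite fE (ipBl measurableT (sp j) (sp k) sc).
    have : `|ip mu setT (phi_ j) (chi l) - ip mu setT (phi_ k) (chi l)| <= eta.
      rewrite (splitr eta); apply: (le_trans _ (lerD (Ej l) (Ek l))).
      rewrite (distrC (c l)); apply: (le_trans _ (ler_normD _ _)).
      by rewrite addrA subrK.
    move=> h; rewrite -real_normK ?num_real// expr2.
    by rewrite -[leRHS]mulr1; apply: ler_pM => //; exact: le_trans eta1.
  by rewrite mulrA ler_wpM2r ?(ltW eta0)// lerDl.
rewrite (ip_setT_domain _ f0) fE => h.
by rewrite -(@ler_pXn2r _ 2) ?nnegrE ?nrm_ge0 ?(ltW e0)// nrm_sqr.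
Unshelve. all: by end_near. Qed.

End sobolev.

Lemma eq_leL (R : realDomainType) (x y : R) : x = y -> x <= y. Proof. by move->. Qed.

Lemma near_harmonic_le (R : realType) (e : R) : 0 < e ->
  \forall k \near \oo, k.+1%:R^-1 <= e.
Proof.
move=> e0; have := @cvg_harmonic R; move=> /cvgrPdist_le /(_ _ e0); apply: filterS => k.
by rewrite sub0r normrN ger0_norm ?harmonic_ge0.
Qed.

Lemma cvg_sum_sqr0 (R : realType) (I : finType) (s : I -> nat -> R) :
  (forall i, s i m @[m --> \oo] --> 0) -> (\sum_i s i m ^+ 2) @[m --> \oo] --> 0.
Proof.
move=> cs; have e0 : \sum_(i : I) (0 : R) = 0 by rewrite big1.
rewrite -[X in _ --> X]e0; apply: cvg_big => [|i _]; first exact: add_continuous.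
by rewrite -[X in _ --> X](mulr0 (0 : R)); apply: cvgM.
Qed.

Section compactness.
Context {R : realType} {n : nat}.
Local Notation fn := ('rV[R]_n -> R[i]).
Variables (Om : set 'rV[R]_n) (rho : R).
Hypotheses (rho0 : 0 < rho) (oOm : open Om) (Omrho : Om `<=` cube n rho).
Local Notation mu := (lebesgue_row n).
Let mOm : measurable Om := measurable_domain oOm.
Implicit Types (u v w : fn) (phi : 'rV[R]_n -> R).

Lemma H10B u v : H10 Om u -> H10 Om v -> H10 Om (fun x => u x - v x).
Proof.
move=> Hu Hv; have := H10_lin oOm Omrho (-1) Hv Hu.
by congr H10; apply/funext => x; rewrite mulN1r addrC.
Qed.

Lemma H10Z (a : R[i]) u : H10 Om u -> H10 Om (fun x => a * u x).
Proof.
move=> Hu; have := H10_lin oOm Omrho (a - 1) Hu Hu.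
by congr H10; apply/funext => x; rewrite mulrBl mul1r subrK.
Qed.

Lemma gradB u v i : H10 Om u -> H10 Om v ->
  l2norm Om (grad Om (fun x => u x - v x) i) =
  l2norm Om (fun x => grad Om u i x - grad Om v i x).
Proof.
move=> Hu Hv; have [Hu1 Hv1] := (H10_H1 Hu, H10_H1 Hv).
apply: (l2norm_eq mOm (L2_grad i (H10_H1 (H10B Hu Hv))) (L2B mOm (L2_grad i Hu1) (L2_grad i Hv1))).
rewrite -[RHS](grad_lin oOm Omrho (-1) i Hv1 Hu1); congr l2norm; apply/funext => x.
congr (grad Om _ i x - _); last by rewrite mulN1r addrC.
by apply/funext => y; rewrite mulN1r addrC.
Qed.

Lemma fre_support w : ctest_function Om w ->
  (forall x, ~ Om x -> fre w x = 0) /\ (forall i x, ~ Om x -> partial i (fre w) x = 0).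
Proof.
move=> [[_ [K [cK KO K0]]] _]; split; first by move=> x nx; apply: K0 => /KO.
move=> i x nx; apply: (@partial_support _ _ K _ _ (compact_closed_row cK)) => //.
by move=> /KO.
Qed.

Lemma fim_support w : ctest_function Om w ->
  (forall x, ~ Om x -> fim w x = 0) /\ (forall i x, ~ Om x -> partial i (fim w) x = 0).
Proof.
move=> [_ [_ [K [cK KO K0]]]]; split; first by move=> x nx; apply: K0 => /KO.
move=> i x nx; apply: (@partial_support _ _ K _ _ (compact_closed_row cK)) => //.
by move=> /KO.
Qed.

Lemma ip_support_le (f : 'rV[R]_n -> R) (c : R) : (forall x, ~ Om x -> f x = 0) ->
  nrm mu Om f <= c -> ip mu setT f f <= c ^+ 2.
Proof.
move=> f0 h; rewrite (ip_setT_domain _ f0) -nrm_sqr.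
apply: lerXn2r => //; rewrite nnegrE; first exact: nrm_ge0.
exact: le_trans (nrm_ge0 _ _ _) h.
Qed.

(** Each [v_ k] is replaced by a test function within [k.+1%:R^-1]; this error is small along [F]
    because [F] refines the filter at infinity. *)
Lemma H10_compact (v_ : nat -> fn) (B : R) (F : set_system nat) :
  UltraFilter F -> nbhs \oo `<=` F -> (forall k, H10 Om (v_ k)) ->
  (forall k, l2norm Om (v_ k) <= 1) -> (forall k, H10norm Om (v_ k) <= B) ->
  forall e : R, 0 < e -> exists E, F E /\
    forall j k, E j -> E k -> l2norm Om (fun x => v_ j x - v_ k x) <= e.
Proof.
move=> UF Foo Hv v1 vB e e0.
have B0 : 0 <= B by apply: le_trans (vB 0%N); exact: H10norm_ge0.
have h k : exists w, ctest_function Om w /\ approx Om (v_ k) w (k.+1%:R^-1).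
  have [w tw aw] := (iffLR (@H10P _ _ _ _) (Hv k)).2 (k.+1%:R^-1) ltac:(by []).
  by exists w.
have [w_ Hw] := choice h.
have Lw k := ctest_L2 oOm Omrho (Hw k).1.
have Lv k := H10_L2 (Hv k).
have k1 k : k.+1%:R^-1 <= 1 :> R by rewrite invf_le1// ler1n.
have w2 k : l2norm Om (w_ k) <= 2.
  have [_ [a1 _]] := Hw k; have := l2normB_ge mOm (Lv k) (Lw k); rewrite ler_norml => /andP[h1 _].
  have h2 := v1 k; have h3 := le_trans a1 (k1 k).
  by move: h1 h2 h3; move: (l2norm _ _) (l2norm _ _) (l2norm _ _) => p q r; lra.
have dw k i : l2norm Om (cpartial i (w_ k)) <= B + 1.
  have [tw [_ a2]] := Hw k; have Lg := L2_grad i (H10_H1 (Hv k)).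
  have := l2normB_ge mOm Lg (ctest_partial_L2 oOm Omrho i tw); rewrite ler_norml => /andP[h1 _].
  have := grad_le_H10norm oOm i (H10_H1 (Hv k)); have := vB k.
  have := le_trans (a2 i) (k1 k); move: h1.
  by move: (l2norm _ _) (l2norm _ _) (l2norm _ _) (H10norm _ _) => p q r s; lra.
pose S := 2 ^+ 2 + \sum_(i < n) (B + 1) ^+ 2.
have sum0 : 0 <= \sum_(i < n) (B + 1) ^+ 2 by apply: sumr_ge0 => i _; exact: sqr_ge0.
have sumS : \sum_(i < n) (B + 1) ^+ 2 <= S by rewrite /S lerDr sqr_ge0.
have S2 : 2 ^+ 2 <= S by rewrite /S lerDl.
have e4 : 0 < e / 4 by rewrite divr_gt0.
have Sre k : \sum_i ip mu setT (partial i (fre (w_ k))) (partial i (fre (w_ k))) <= S.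
  apply: le_trans sumS; apply: ler_sum => i _.
  apply: (ip_support_le ((fre_support (Hw k).1).2 i)).
  exact: le_trans (nrm_re_le mOm (ctest_partial_L2 oOm Omrho i (Hw k).1)) (dw k i).
have Sim k : \sum_i ip mu setT (partial i (fim (w_ k))) (partial i (fim (w_ k))) <= S.
  apply: le_trans sumS; apply: ler_sum => i _.
  apply: (ip_support_le ((fim_support (Hw k).1).2 i)).
  exact: le_trans (nrm_im_le mOm (ctest_partial_L2 oOm Omrho i (Hw k).1)) (dw k i).
have [E1 [FE1 HE1]] := test_compact rho0 Omrho UF (fun k => (Hw k).1.1)
  (fun k => le_trans (ip_support_le (fre_support (Hw k).1).1 (le_trans (nrm_re_le mOm (Lw k)) (w2 k))) S2)
  Sre e4.
have [E2 [FE2 HE2]] := test_compact rho0 Omrho UF (fun k => (Hw k).1.2)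
  (fun k => le_trans (ip_support_le (fim_support (Hw k).1).1 (le_trans (nrm_im_le mOm (Lw k)) (w2 k))) S2)
  Sim e4.
have FE3 : F [set k | k.+1%:R^-1 <= e / 4].
  by apply: Foo; exact: near_harmonic_le.
exists (E1 `&` E2 `&` [set k | k.+1%:R^-1 <= e / 4]); split.
  by apply: filterI => //; exact: filterI.
move=> j k [[j1 j2] j3] [[k1' k2] k3].
have Ljk := L2B mOm (Lw j) (Lw k).
have hw : l2norm Om (fun x => w_ j x - w_ k x) <= e / 4 + e / 4.
  apply: le_trans (l2norm_le_sum mOm Ljk) _; apply: lerD.
    apply: le_trans (HE1 _ _ j1 k1'); rewrite le_eqVlt; apply/orP; left; apply/eqP.
    by congr nrm; apply/funext => x; rewrite /fre ReB.
  apply: le_trans (HE2 _ _ j2 k2); rewrite le_eqVlt; apply/orP; left; apply/eqP.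
  by congr nrm; apply/funext => x; rewrite /fim ImB.
apply: le_trans (l2normB_tri mOm (Lv j) (Lv k) (Lw j)) _.
have h2 := l2normB_tri mOm (Lw j) (Lv k) (Lw k).
have h1 := (Hw j).2.1; have h3 := (Hw k).2.1; rewrite l2norm_distC in h3.
have h1' := le_trans h1 j3; have h3' := le_trans h3 k3.
move: h1' hw h2 h3'; move: (l2norm _ _) (l2norm _ _) (l2norm _ _) (l2norm _ _) => p q r s.
by lra.
Qed.

End compactness.

Section hermitian.
Context {R : realType} {T : Type}.
Local Notation fn := (T -> R[i]).
Variables (P : set fn) (B : fn -> fn -> R[i]).
Hypothesis Plin : forall (a : R[i]) u v, P u -> P v -> P (fun x => a * u x + v x).
Hypothesis Blin : forall (a : R[i]) u v w, P u -> P v -> P w ->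
  B (fun x => a * u x + v x) w = a * B u w + B v w.
Hypothesis Bherm : forall v w, P v -> P w -> B v w = ((B w v)^*)%C.

(** Abstract in the form [B] because it expands both the energy and the squared [L^2] norm. *)
Lemma herm_expand (a : R[i]) u v : P u -> P v ->
  Re (B (fun x => a * u x + v x) (fun x => a * u x + v x)) =
  normc a ^+ 2 * Re (B u u) + 2 * Re (a * B u v) + Re (B v v).
Proof.
move=> Pu Pv; have Pw := Plin a Pu Pv.
rewrite Blin// (Bherm Pu Pw) (Bherm Pv Pw) !Blin//.
have := congr1 (@complex.Im R) (Bherm Pu Pu); rewrite (Bherm Pv Pu) normc_sqr.
rewrite !(ReD, ReM, Re_conj, ImD, ImM, Im_conj) => h.
have -> : Im (B u u) = 0 by lra.
by ring.
Qed.

End hermitian.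

(** * The Rayleigh quotient and its minimiser *)

Section rayleigh.
Context {R : realType} {n : nat}.
Local Notation fn := ('rV[R]_n -> R[i]).
Variables (Om : set 'rV[R]_n) (rho : R).
Hypotheses (rho0 : 0 < rho) (oOm : open Om) (Omrho : Om `<=` cube n rho).
Let mOm : measurable Om := measurable_domain oOm.
Variable A : fn -> fn -> R[i].
Hypothesis hA : hermitian_coercive_bounded Om A.
Implicit Types (u v w : fn).

Local Notation a v := (Re (A v v)).
Let H10l := H10_lin oOm Omrho.

Lemma form_expand (c : R[i]) u v : H10 Om u -> H10 Om v ->
  a (fun x => c * u x + v x) = normc c ^+ 2 * a u + 2 * Re (c * A u v) + a v.
Proof.
exact: (herm_expand (P := H10 Om) H10l (form_linear hA) (form_hermitian hA)).
Qed.

Lemma l2norm_expand (c : R[i]) u v : L2 Om u -> L2 Om v ->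
  l2norm Om (fun x => c * u x + v x) ^+ 2 =
  normc c ^+ 2 * l2norm Om u ^+ 2 + 2 * Re (c * inner Om u v) + l2norm Om v ^+ 2.
Proof.
move=> Lu Lv; have Lc := L2D mOm (L2Z mOm c Lu) Lv.
have hS w : L2 Om w -> l2norm Om w ^+ 2 = Re (inner Om w w).
  by move=> Lw; rewrite (inner_self mOm Lw).
rewrite (hS _ Lc) (hS _ Lu) (hS _ Lv).
apply: (herm_expand (P := L2 Om)) => //.
- by move=> b f g Lf Lg; exact: (L2D mOm (L2Z mOm b Lf) Lg).
- by move=> b f g h Lf Lg Lh; exact: inner_lin.
- by move=> f g Lf Lg; exact: innerC.
Qed.

Lemma form_coerciveR : exists2 c0 : R, 0 < c0 &
  forall v, H10 Om v -> c0 * H10norm Om v ^+ 2 <= a v.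
Proof.
have [c0 c00 hc] := form_coercive hA; exists c0 => // v /hc.
by rewrite lecE => /andP[_].
Qed.

Lemma form_ge0 v : H10 Om v -> 0 <= a v.
Proof.
have [c0 c00 hc] := form_coerciveR => Hv; apply: le_trans (hc v Hv).
by rewrite mulr_ge0 ?(ltW c00)// sqr_ge0.
Qed.

Lemma form_boundedR : exists2 c1 : R, 0 < c1 &
  forall v w, H10 Om v -> H10 Om w -> `|Re (A v w)| <= c1 * H10norm Om v * H10norm Om w.
Proof.
have [c1 c10 hc] := form_bounded hA; exists c1 => // v w Hv Hw.
exact: le_trans (normc_Re _) (hc v w Hv Hw).
Qed.

(** [form_linear] only covers combinations [a * u + v]. The function [0 * v] serves as the zero
    vector, and writing it as [-1 * 0 + 0] shows that the form vanishes on it. *)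
Lemma formZl (c : R[i]) v w : H10 Om v -> H10 Om w -> A (fun x => c * v x) w = c * A v w.
Proof.
move=> Hv Hw; have H0 := H10Z oOm Omrho 0 Hv.
have := form_linear hA c Hv H0 Hw.
have -> : (fun x => c * v x + 0 * v x) = (fun x => c * v x).
  by apply/funext => x; rewrite mul0r addr0.
move=> ->; have := form_linear hA (-1) H0 H0 Hw.
have -> : (fun x => -1 * (0 * v x) + 0 * v x) = (fun x => 0 * v x).
  by apply/funext => x; rewrite mul0r mulr0 addr0.
by rewrite mulN1r addNr => ->; rewrite addr0.
Qed.

Lemma form_scale (c : R[i]) v : H10 Om v -> a (fun x => c * v x) = normc c ^+ 2 * a v.
Proof.
move=> Hv; have Hc := H10Z oOm Omrho c Hv.
rewrite (formZl _ Hv Hc) (form_hermitian hA Hv Hc) (formZl _ Hv Hv) normc_sqr.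
by rewrite !(ReM, Re_conj, Im_conj, ImM); ring.
Qed.

Lemma form_para u v : H10 Om u -> H10 Om v ->
  a (fun x => u x + v x) + a (fun x => u x - v x) = 2 * a u + 2 * a v.
Proof.
move=> Hu Hv.
have h1 := form_expand 1 Hv Hu; have h2 := form_expand (-1) Hv Hu.
have -> : (fun x => u x + v x) = (fun x => 1 * v x + u x).
  by apply/funext => x; rewrite mul1r addrC.
have -> : (fun x => u x - v x) = (fun x => -1 * v x + u x).
  by apply/funext => x; rewrite mulN1r addrC.
rewrite h1 h2 !normc_sqr mulN1r !mul1r ReN /= oppr0; lra.
Qed.

Variable mu : R.
Hypothesis mu_le : forall v, H10 Om v -> mu * l2norm Om v ^+ 2 <= a v.

(** For real [t] the energy of [t v + u] minus [mu] times its squared norm is nonnegative and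
    vanishes at [t = 0], so its linear coefficient is zero. Taking [v] and ['i v] yields the real
    and the imaginary part of the weak eigenvalue equation. *)
Lemma minimizer_eigenvalue u : H10 Om u -> l2norm Om u = 1 -> a u = mu ->
  L_eigenvalue Om A mu%:C%C.
Proof.
move=> Hu u1 au; have Lu := H10_L2 Hu.
have key v : H10 Om v -> Re (A v u) = mu * Re (inner Om v u).
  move=> Hv; have Lv := H10_L2 Hv.
  pose b := Re (A v u) - mu * Re (inner Om v u).
  have h0 : 0 <= a v - mu * l2norm Om v ^+ 2 by rewrite subr_ge0; exact: mu_le.
  have : b ^+ 2 <= 0 * (a v - mu * l2norm Om v ^+ 2).
    apply: discriminant_le => // t.
    have := mu_le (H10l t%:C%C Hv Hu).
    rewrite (form_expand _ Hv Hu) (l2norm_expand _ Lv Lu) u1 au normc_sqr.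
    rewrite /b !ReM Re_real Im_real !mul0r !subr0 => h; nra.
  rewrite mul0r => hb; have /eqP : b ^+ 2 = 0 by apply/eqP; rewrite eq_le hb sqr_ge0.
  by rewrite sqrf_eq0 subr_eq0 => /eqP.
exists u; rewrite u1 oner_neq0; split=> //; split; first exact: (L2Z mOm _ Lu).
split=> // v Hv; have Lv := H10_L2 Hv.
rewrite (innerZl mOm _ Lu Lv) (form_hermitian hA Hu Hv) (innerC mOm Lv Lu).
have k1 := key v Hv; have k2 := key _ (H10Z oOm Omrho 'i%C Hv).
have [Rei Imi] : Re ('i%C : R[i]) = 0 /\ Im ('i%C : R[i]) = 1 by [].
move: k2; rewrite (formZl _ Hv Hu) (innerZl mOm _ Lv Lu) !ReM Rei Imi !mul0r !mul1r !sub0r => k2.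
apply: complexP; rewrite ?ReM ?ImM ?Re_conj ?Im_conj Re_real Im_real !mul0r ?subr0 ?addr0.
  by rewrite k1.
exact: k2.
Qed.

End rayleigh.

Section minimisation.
Context {R : realType} {n : nat}.
Local Notation fn := ('rV[R]_n -> R[i]).
Variables (Om : set 'rV[R]_n) (rho : R).
Hypotheses (rho0 : 0 < rho) (oOm : open Om) (Omrho : Om `<=` cube n rho).
Let mOm : measurable Om := measurable_domain oOm.
Variable A : fn -> fn -> R[i].
Hypothesis hA : hermitian_coercive_bounded Om A.
Implicit Types (u v w : fn).
Local Notation a v := (Re (A v v)).

Let quotients : set R := [set a v | v in [set v | H10 Om v /\ l2norm Om v = 1]].

Hypothesis nontrivial : exists2 v, H10 Om v & l2norm Om v != 0.

Lemma normalize v : H10 Om v -> l2norm Om v != 0 ->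
  H10 Om (fun x => ((l2norm Om v)^-1)%:C%C * v x) /\
  l2norm Om (fun x => ((l2norm Om v)^-1)%:C%C * v x) = 1.
Proof.
move=> Hv v0; split; first exact: (H10Z oOm Omrho).
rewrite (l2normZ mOm _ (H10_L2 Hv)) normcR ger0_norm ?invr_ge0 ?l2norm_ge0//.
exact: mulVf.
Qed.

Let quotients0 : quotients !=set0.
Proof.
have [v Hv v0] := nontrivial; have [h1 h2] := normalize Hv v0.
by eexists; eexists; first by split; [exact: h1|exact: h2].
Qed.

Let quotients_lb : lbound quotients 0.
Proof. by move=> _ [v [Hv _] <-]; exact: (form_ge0 hA). Qed.

Let mu := inf quotients.

Let mu_ge0 : 0 <= mu. Proof. exact: lb_le_inf. Qed.

Lemma rayleigh_inf v : H10 Om v -> mu * l2norm Om v ^+ 2 <= a v.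
Proof.
move=> Hv; have [v0|v0] := eqVneq (l2norm Om v) 0.
  by rewrite v0 expr0n mulr0; exact: (form_ge0 hA).
have [h1 h2] := normalize Hv v0.
have : mu <= a (fun x => ((l2norm Om v)^-1)%:C%C * v x).
  apply: ge_inf; first by exists 0.
  by eexists; first by split; [exact: h1|exact: h2].
rewrite (form_scale oOm Omrho hA _ Hv) normcR ger0_norm ?invr_ge0 ?l2norm_ge0//.
by rewrite exprVn mulrC ler_pdivlMr// exprn_gt0// lt_neqAle eq_sym v0 l2norm_ge0.
Qed.

(** Compactness makes a minimising sequence Cauchy in [L^2] along an ultrafilter. The parallelogram
    identity and coercivity upgrade this to the [H10norm], so the limit keeps norm 1 and has energy
    [mu]. *)
Lemma minimizer : exists u, [/\ H10 Om u, l2norm Om u = 1 & a u = mu].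
Proof.
have [c0 c00 hc0] := form_coerciveR hA; have [c1 c10 hc1] := form_boundedR hA.
have hv k : exists v, [/\ H10 Om v, l2norm Om v = 1 & a v <= mu + k.+1%:R^-1].
  have k0 : 0 < k.+1%:R^-1 :> R by [].
  have [_ [v [Hv v1] <-] h] := inf_adherent k0 (conj quotients0 (ex_intro _ _ quotients_lb)).
  by exists v; split=> //; exact: ltW.
have [v_ Hv_] := choice hv.
have Hv k : H10 Om (v_ k) by case: (Hv_ k).
have v1 k : l2norm Om (v_ k) = 1 by case: (Hv_ k).
have av k : a (v_ k) <= mu + k.+1%:R^-1 by case: (Hv_ k).
have Lv k := H10_L2 (Hv k).
pose B := Num.sqrt ((mu + 1) / c0).
have vB k : H10norm Om (v_ k) <= B.
  rewrite -[leLHS]ger0_norm ?H10norm_ge0// -sqrtr_sqr ler_wsqrtr// ler_pdivlMr// mulrC.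
  apply: le_trans (hc0 _ (Hv k)) _; apply: le_trans (av k) _.
  by rewrite lerD2l invf_le1// ler1n.
have [F [UF ooF]] := ultraFilterLemma (@eventually_filter).
have hE (e : R) : 0 < e -> exists E, F E /\ forall j k, E j -> E k ->
    [/\ j.+1%:R^-1 <= e :> R, l2norm Om (fun x => v_ j x - v_ k x) <= e &
      H10norm Om (fun x => v_ j x - v_ k x) <= e].
  (* Coercivity and the parallelogram identity bound [c0 * H10norm ^+ 2] of a difference by
     [4 * z + mu * d ^+ 2]; the choice of [d] and [z] gives each summand at most half of
     [c0 * e ^+ 2]. *)
  move=> e0; pose d := Num.min e (Num.sqrt (c0 * e ^+ 2 / 2 / (mu + 1))).
  have mu1 : 0 < mu + 1 by rewrite ltr_wpDl.
  have p0 : 0 < c0 * e ^+ 2 by rewrite mulr_gt0// exprn_gt0.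
  have q0 : 0 < c0 * e ^+ 2 / 2 / (mu + 1) by rewrite !divr_gt0.
  have d0 : 0 < d by rewrite lt_min e0 sqrtr_gt0.
  have de : d <= e by rewrite ge_min lexx.
  have dmu : mu * d ^+ 2 <= c0 * e ^+ 2 / 2.
    have : d ^+ 2 <= c0 * e ^+ 2 / 2 / (mu + 1).
      rewrite -[leRHS]sqr_sqrtr ?(ltW q0)//; apply: lerXn2r; rewrite ?nnegrE ?sqrtr_ge0 ?(ltW d0)//.
      by rewrite ge_min lexx orbT.
    rewrite ler_pdivlMr// => h; have := sqr_ge0 d; nra.
  pose z := Num.min e (c0 * e ^+ 2 / 8).
  have z0 : 0 < z by rewrite lt_min e0 divr_gt0.
  have [E [FE HE]] := H10_compact rho0 oOm Omrho UF ooF Hv (fun k => eq_leL (v1 k)) vB d0.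
  exists (E `&` [set k | k.+1%:R^-1 <= z]); split.
    by apply: filterI => //; apply: ooF; exact: near_harmonic_le.
  move=> j k [Ej /= zj] [Ek /= zk]; have hjk := HE _ _ Ej Ek.
  split; [by apply: le_trans zj _; rewrite ge_min lexx|exact: le_trans hjk de|].
  have Hd := H10B oOm Omrho (Hv j) (Hv k).
  have Hs : H10 Om (fun x => v_ j x + v_ k x).
    have := H10_lin oOm Omrho 1 (Hv j) (Hv k).
    by congr H10; apply/funext => x; rewrite mul1r.
  have p1 := l2norm_para mOm (Lv j) (Lv k); have p2 := form_para oOm Omrho hA (Hv j) (Hv k).
  have p3 := rayleigh_inf Hs; rewrite !v1 expr1n !mulr1 in p1.
  have p4 := hc0 _ Hd; have zz : z <= c0 * e ^+ 2 / 8 by rewrite ge_min lexx orbT.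
  have p5 := le_trans (av j) (lerD (lexx mu) (le_trans zj zz)).
  have p6 := le_trans (av k) (lerD (lexx mu) (le_trans zk zz)).
  have p7 : l2norm Om (fun x => v_ j x - v_ k x) ^+ 2 <= d ^+ 2.
    by apply: lerXn2r; rewrite ?nnegrE ?l2norm_ge0 ?(ltW d0).
  have p8 : c0 * H10norm Om (fun x => v_ j x - v_ k x) ^+ 2 <= c0 * e ^+ 2.
    have p9 : mu * l2norm Om (fun x => v_ j x - v_ k x) ^+ 2 <= mu * d ^+ 2 by rewrite ler_wpM2l.
    have p10 : mu * l2norm Om (fun x => v_ j x + v_ k x) ^+ 2 =
       mu * 4 - mu * l2norm Om (fun x => v_ j x - v_ k x) ^+ 2.
      by rewrite -mulrBr; congr (_ * _); move: p1; lra.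
    move: p2 p3 p4 p5 p6 p9 p10 dmu.
    move: (a _) (a _) (a _) (a _) (H10norm _ _ ^+ 2) (l2norm _ _ ^+ 2) (l2norm _ _ ^+ 2) => ? ? ? ? ? ? ?.
    move: (mu * _) (mu * _) (mu * _) => ? ? ?; lra.
  rewrite -(@ler_pXn2r _ 2) ?nnegrE ?H10norm_ge0 ?(ltW e0)//.
  by rewrite -(ler_pM2l c00).
have pw m : 0 < (2^-1 : R) ^+ m by rewrite exprn_gt0.
have [E_ HE_] := choice (fun m => hE _ (pw m)).
(* An index common to the sets [E_ 0], ..., [E_ m] makes the increments at most [(2^-1) ^+ m], the
   form that [H10_complete] expects. *)
have hK m : exists k, forall p, (p <= m)%N -> E_ p k.
  have FI : F (\bigcap_(p in [set p | (p <= m)%N]) E_ p).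
    elim: m => [|m IHm].
      apply: filterS (HE_ 0%N).1 => k Ek p /=; rewrite leqn0 => /eqP -> //.
    apply: filterS (filterI IHm (HE_ m.+1).1) => k [h1 h2] p /=.
    by rewrite leq_eqVlt => /orP[/eqP -> //|]; rewrite ltnS; exact: h1.
  have [k hk] := filter_ex FI; by exists k => p pm; exact: hk.
have [k_ Hk] := choice hK.
have step m j k : (m <= j)%N -> (m <= k)%N ->
  [/\ (k_ j).+1%:R^-1 <= (2^-1) ^+ m :> R, l2norm Om (fun x => v_ (k_ j) x - v_ (k_ k) x) <= (2^-1) ^+ m &
      H10norm Om (fun x => v_ (k_ j) x - v_ (k_ k) x) <= (2^-1) ^+ m].
  by move=> mj mk; apply: (HE_ m).2; exact: Hk.
have [u [Hu cu cg]] := H10_complete oOm Omrho (fun m => Hv (k_ m))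
  (fun m => let: And3 _ h _ := step m m.+1 m (leqnSn m) (leqnn m) in h)
  (fun m i => le_trans (eq_leL (esym (gradB oOm Omrho i (Hv (k_ m.+1)) (Hv (k_ m)))))
     (le_trans (grad_le_H10norm oOm i (H10_H1 (H10B oOm Omrho (Hv _) (Hv _))))
      (let: And3 _ _ h := step m m.+1 m (leqnSn m) (leqnn m) in h))).
have Lu := H10_L2 Hu.
have u1 : l2norm Om u = 1.
  apply/eqP; rewrite -subr_eq0 -normr_eq0 eq_le normr_ge0 andbT; apply: le0_of_cvg0 cu => m.
  rewrite distrC -(v1 (k_ m)); exact: (l2normB_ge mOm (Lv _) Lu).
exists u; split=> //; apply/eqP; rewrite eq_le; apply/andP; split; last first.
  by have := rayleigh_inf Hu; rewrite u1 expr1n mulr1.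
pose r m := H10norm Om (fun x => u x - v_ (k_ m) x).
have cr : r m @[m --> \oo] --> 0.
  have rE m : r m = Num.sqrt (\sum_i l2norm Om (fun x => grad Om (v_ (k_ m)) i x - grad Om u i x) ^+ 2).
    rewrite /r -[LHS]ger0_norm ?H10norm_ge0// -sqrtr_sqr; congr Num.sqrt.
    rewrite (H10norm_sqr oOm (H10_H1 (H10B oOm Omrho Hu (Hv _)))); apply: eq_bigr => i _.
    by rewrite (gradB oOm Omrho i Hu (Hv _)) l2norm_distC.
  have cs : (fun m => \sum_i l2norm Om (fun x => grad Om (v_ (k_ m)) i x - grad Om u i x) ^+ 2) @ \oo --> (0 : R).
    exact: cvg_sum_sqr0.
  rewrite (funext rE) -[X in _ --> X](@sqrtr0 R).
  exact: (continuous_cvg _ (@sqrt_continuous R 0) cs).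
rewrite -subr_le0.
(* The energy of [u] is expanded around [v_ (k_ m)]: the excess over [mu], the cross term and the
   energy of the difference all vanish in the limit. *)
apply: (@le0_of_cvg0 _ _ (fun m => ((2^-1) ^+ m + (2 * (c1 * B)) * r m) + c1 * (r m * r m))); last first.
  rewrite -[X in _ --> X](addr0 0); apply: cvgD.
    rewrite -[X in _ --> X](addr0 0); apply: cvgD.
      by apply: cvg_expr; rewrite ger0_norm// invf_lt1// ltr1n.
    by rewrite -[X in _ --> X](mulr0 (2 * (c1 * B))); apply: cvgMr.
  by rewrite -[X in _ --> X](mulr0 c1) -[X in c1 * X](mulr0 0); apply: cvgMr; exact: cvgM.
move=> m; have Hd := H10B oOm Omrho Hu (Hv (k_ m)).
have := form_expand oOm Omrho hA 1 Hd (Hv (k_ m)).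
have -> : (fun x => 1 * (u x - v_ (k_ m) x) + v_ (k_ m) x) = u.
  by apply/funext => x; rewrite mul1r subrK.
rewrite normc_sqr /= expr1n expr0n addr0 !mul1r => ->.
have [s1 _ _] := step m m m (leqnn m) (leqnn m).
have h1 := le_trans (av (k_ m)) (lerD (lexx mu) s1).
have h2 := le_trans (ler_norm _) (hc1 _ _ Hd Hd).
have h3 := le_trans (ler_norm _) (hc1 _ _ Hd (Hv (k_ m))).
have r0 : 0 <= r m by exact: H10norm_ge0.
have h4 : c1 * r m * H10norm Om (v_ (k_ m)) <= c1 * B * r m.
  have := vB (k_ m); move: (H10norm _ _) r0 => p; move: (r m) => q q0 pB.
  rewrite -!mulrA (mulrC B); apply: ler_wpM2l; first exact: ltW.
  exact: ler_wpM2l.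
rewrite -/(r m) in h2 h3; move: h1 h2 (le_trans h3 h4).
rewrite -!mulrA; move: (a _) (a _) (Re _) => p q s.
move: (B * r m) (r m * r m) => y z; move: (c1 * y) (c1 * z) => y' z'; lra.
Qed.

Lemma smallest_eigenvalue_rayleigh (lambda1 : R) :
  smallest_eigenvalue Om A lambda1 ->
  forall v, H10 Om v -> lambda1 * l2norm Om v ^+ 2 <= a v.
Proof.
move=> [_ hmin] v Hv; have [u [Hu u1 au]] := minimizer.
have := hmin _ (minimizer_eigenvalue oOm Omrho hA rayleigh_inf Hu u1 au).
rewrite lecE => /andP[_ /= h]; apply: le_trans (rayleigh_inf Hv).
by rewrite ler_wpM2r// sqr_ge0.
Qed.

End minimisation.

(** * The discrete operator *)

Section linear_extension.
Context {R : realType} {T : Type}.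
Local Notation fn := (T -> R[i]).
Variables (V : set fn) (F : fn -> R[i]).
Hypothesis V0 : V (fun=> 0).
Hypothesis Vlin : forall (a : R[i]) u v, V u -> V v -> V (fun x => a * u x + v x).
Hypothesis Flin : forall (a : R[i]) u v, V u -> V v ->
  F (fun x => a * u x + v x) = a * F u + F v.
Variables (M : nat) (psi : 'I_M -> fn).
Hypothesis Vpsi : forall j, V (psi j).

Lemma lin_sum (c : 'I_M -> R[i]) (r : seq 'I_M) :
  V (fun x => \sum_(j <- r) c j * psi j x) /\
  F (fun x => \sum_(j <- r) c j * psi j x) = \sum_(j <- r) c j * F (psi j).
Proof.
elim: r => [|j r [IH1 IH2]].
  have -> : (fun x => \sum_(j <- [::]) c j * psi j x) = fun=> 0.
    by apply/funext => x; rewrite big_nil.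
  (* The zero function is [-1 * 0 + 0], which forces [F] to vanish on it. *)
  rewrite big_nil; split=> //; have := Flin (-1) V0 V0.
  have -> : (fun x : T => -1 * 0 + 0) = fun=> (0 : R[i]).
    by apply/funext => x; rewrite mulr0 addr0.
  by rewrite mulN1r addNr.
have -> : (fun x => \sum_(j <- j :: r) c j * psi j x) =
    fun x => c j * psi j x + \sum_(j <- r) c j * psi j x.
  by apply/funext => x; rewrite big_cons.
by rewrite big_cons; split; [exact: Vlin|rewrite Flin// IH2].
Qed.

End linear_extension.

Section fe_space.
Context {R : realType} {n : nat}.
Variables (Om : set 'rV[R]_n) (rho : R).
Hypotheses (oOm : open Om) (Omrho : Om `<=` cube n rho).

Lemma fe_space_lin (T : seq (n.+1.-tuple 'rV[R]_n)) (a : R[i]) u v :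
  fe_space Om T u -> fe_space Om T v -> fe_space Om T (fun x => a * u x + v x).
Proof.
move=> [Hu [cu1 cu2] u0 ua] [Hv [cv1 cv2] v0 va]; split.
- exact: (H10_lin oOm Omrho).
- split=> x.
    have -> : (fun x => Re (a * u x + v x)) = (fun x => Re a * Re (u x) - Im a * Im (u x) + Re (v x)).
      by apply/funext => y; rewrite ReD ReM.
    exact: (cvgD (cvgB (cvgM (@cst_continuous _ _ (Re a) x) (cu1 x)) (cvgM (@cst_continuous _ _ (Im a) x) (cu2 x))) (cv1 x)).
  have -> : (fun x => Im (a * u x + v x)) = (fun x => Re a * Im (u x) + Im a * Re (u x) + Im (v x)).
    by apply/funext => y; rewrite ImD ImM.
  exact: (cvgD (cvgD (cvgM (@cst_continuous _ _ (Re a) x) (cu2 x)) (cvgM (@cst_continuous _ _ (Im a) x) (cu1 x))) (cv2 x)).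
- by move=> x nx; rewrite u0// v0// mulr0 addr0.
- move=> s sT; have [c [f hu]] := ua s sT; have [c' [f' hv]] := va s sT.
  exists (a * c + c'), (fun i => a * f i + f' i) => x sx.
  rewrite (hu x sx) (hv x sx) mulrDr mulr_sumr addrACA -big_split; congr (_ + _).
  by apply: eq_bigr => i _; rewrite mulrDl mulrA.
Qed.

End fe_space.

Section spectral.
Context {R : realType} {n : nat}.
Local Notation fn := ('rV[R]_n -> R[i]).
Variables (Om : set 'rV[R]_n) (rho : R).
Hypotheses (oOm : open Om) (Omrho : Om `<=` cube n rho).
Let mOm : measurable Om := measurable_domain oOm.
Variable A : fn -> fn -> R[i].
Hypothesis hA : hermitian_coercive_bounded Om A.
Variable Vh : set fn.
Hypothesis V0 : Vh (fun=> 0).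
Hypothesis Vlin : forall (a : R[i]) u v, Vh u -> Vh v -> Vh (fun x => a * u x + v x).
Hypothesis VH : Vh `<=` H10 Om.
Variables (M : nat) (psi : 'I_M -> fn) (lam : 'I_M -> R).
Hypothesis hpsi : discrete_eigenbasis Om A Vh psi lam.
Implicit Types (u v w : fn) (c : 'I_M -> R[i]).

Let VL v : Vh v -> L2 Om v. Proof. by move=> /VH; exact: H10_L2. Qed.
Let Vpsi j : Vh (psi j). Proof. exact: (eigenbasis_in hpsi). Qed.

Definition expansion c : fn := fun x => \sum_j c j * psi j x.

Lemma Vh_expansion c : Vh (expansion c).
Proof.
by have [] := @lin_sum _ _ Vh (fun=> 0) V0 Vlin (fun _ _ _ _ _ => ltac:(by rewrite mulr0 addr0)) _ _ Vpsi c (index_enum 'I_M).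
Qed.

Lemma inner_expansion c w : Vh w ->
  inner Om (expansion c) w = \sum_j c j * inner Om (psi j) w.
Proof.
move=> Vw; apply: (@lin_sum _ _ Vh (fun v => inner Om v w) V0 Vlin _ _ _ Vpsi c (index_enum 'I_M)).2.
by move=> a u v Vu Vv; apply: (inner_lin mOm); exact: VL.
Qed.

Lemma form_expansion c w : Vh w -> A (expansion c) w = \sum_j c j * A (psi j) w.
Proof.
move=> Vw; apply: (@lin_sum _ _ Vh (fun v => A v w) V0 Vlin _ _ _ Vpsi c (index_enum 'I_M)).2.
by move=> a u v Vu Vv; apply: (form_linear hA); exact: VH.
Qed.

Lemma inner_expansion_psi c j : inner Om (expansion c) (psi j) = c j.
Proof.
rewrite (inner_expansion c (Vpsi j)) (bigD1 j)//= (eigenbasis_orthonormal hpsi) eqxx mulr1.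
by rewrite big1 ?addr0// => i ij; rewrite (eigenbasis_orthonormal hpsi) (negbTE ij) mulr0.
Qed.

Lemma expansionE v : Vh v -> v = expansion (fun j => inner Om v (psi j)).
Proof.
move=> Vv; have [c vE] := eigenbasis_span hpsi Vv.
have -> : (fun j => inner Om v (psi j)) = c.
  by apply/funext => j; rewrite vE; exact: inner_expansion_psi.
exact: vE.
Qed.

Lemma inner_inj u v : Vh u -> Vh v -> (forall j, inner Om u (psi j) = inner Om v (psi j)) -> u = v.
Proof.
move=> Vu Vv h; rewrite (expansionE Vu) (expansionE Vv).
by congr expansion; apply/funext => j; exact: h.
Qed.

Lemma l2norm_expansion c : l2norm Om (expansion c) ^+ 2 = \sum_j normc (c j) ^+ 2.
Proof.
have Vc := Vh_expansion c.
have := inner_self mOm (VL Vc); rewrite (inner_expansion c Vc).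
have -> : \sum_j c j * inner Om (psi j) (expansion c) = \sum_j (normc (c j) ^+ 2)%:C%C.
  apply: eq_bigr => j _; rewrite (innerC mOm (VL Vc) (VL (Vpsi j))) inner_expansion_psi.
  by apply: complexP; rewrite ?ReM ?ImM ?Re_conj ?Im_conj ?Re_real ?Im_real ?normc_sqr; ring.
by rewrite -rmorph_sum => -[].
Qed.

(** [discrete_op] returns 0 when its defining problem has no solution. That case is excluded: the
    eigenvalue equation with [lam j > 0] would then make [psi j] zero, against its norm 1. *)
Let psi_spec j : Vh (discrete_op Om A Vh (psi j)) /\
  forall w, Vh w -> inner Om (discrete_op Om A Vh (psi j)) w = A (psi j) w.
Proof.
rewrite /discrete_op; case: xgetP => [u -> //|nu].
exfalso; have := eigenbasis_eigen hpsi j; rewrite /discrete_op; case: xgetP => [u _ hu _|_ e].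
  exact: (nu _ hu).
have p0 : psi j = fun=> 0.
  apply/funext => x; have /esym/eqP := congr1 (@^~ x) e.
  rewrite mulf_eq0 => /orP[|/eqP//]; rewrite eq_complex /= eqxx andbT => /eqP l0.
  by have := eigenbasis_gt0 hpsi j; rewrite l0 ltxx.
have := eigenbasis_orthonormal hpsi j j; rewrite eqxx.
have := inner_self mOm (VL (Vpsi j)); have := l2normZ mOm 0 (VL (Vpsi j)).
have -> : (fun x => 0 * psi j x) = psi j by apply/funext => x; rewrite p0 mul0r.
rewrite Normc.normc0 mul0r => -> ->; rewrite expr0n /= => /(congr1 (@complex.Re R)) /= /eqP.
by rewrite eq_sym oner_eq0.
Qed.

Lemma form_psi j w : Vh w -> A (psi j) w = (lam j)%:C%C * inner Om (psi j) w.
Proof.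
move=> Vw; have [_ <-//] := psi_spec j; rewrite (eigenbasis_eigen hpsi j).
exact: (innerZl mOm _ (VL (Vpsi j)) (VL Vw)).
Qed.

Lemma eigenvalue_form j : l2norm Om (psi j) = 1 /\ Re (A (psi j) (psi j)) = lam j.
Proof.
split; last by rewrite (form_psi j (Vpsi j)) (eigenbasis_orthonormal hpsi) eqxx mulr1.
have := inner_self mOm (VL (Vpsi j)); rewrite (eigenbasis_orthonormal hpsi) eqxx.
move=> /(congr1 (@complex.Re R)) /= /esym/eqP.
by rewrite sqrf_eq1 => /orP[/eqP//|/eqP h]; have := l2norm_ge0 Om (psi j); rewrite h; lra.
Qed.

Lemma discrete_op_expansion c :
  discrete_op Om A Vh (expansion c) = expansion (fun j => (lam j)%:C%C * c j).
Proof.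
rewrite /discrete_op; case: xgetP => [u _ [Vu hu]|nu].
  apply: inner_inj => //; first exact: Vh_expansion.
  move=> j; rewrite hu// form_expansion// inner_expansion//; apply: eq_bigr => i _.
  by rewrite form_psi// mulrCA mulrA.
exfalso; apply: (nu (expansion (fun j => (lam j)%:C%C * c j))); split; first exact: Vh_expansion.
move=> w Vw; rewrite form_expansion// inner_expansion//; apply: eq_bigr => i _.
by rewrite form_psi// mulrCA mulrA.
Qed.

(** In the eigenbasis [z - L_h] is diagonal with nonzero entries, so the solution to be chosen
    exists and is the only one. *)
Lemma discrete_resolvent_expansion (z : R[i]) c : (forall j, z != (lam j)%:C%C) ->
  discrete_resolvent Om A Vh z (expansion c) = expansion (fun j => (z - (lam j)%:C%C)^-1 * c j).
Proof.
move=> zl; have zl0 j : z - (lam j)%:C%C != 0 by rewrite subr_eq0.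
have app c' : (fun x => z * expansion c' x - discrete_op Om A Vh (expansion c') x) =
    expansion (fun j => (z - (lam j)%:C%C) * c' j).
  rewrite discrete_op_expansion; apply/funext => x; rewrite /expansion mulr_sumr -sumrB.
  by apply: eq_bigr => j _; rewrite !mulrBl !mulrA.
rewrite /discrete_resolvent; case: xgetP => [u _ [Vu]|nu].
  have e := app (fun j => inner Om u (psi j)); rewrite -(expansionE Vu) in e.
  rewrite e => h.
  rewrite (expansionE Vu); congr expansion; apply/funext => j.
  have := congr1 (fun v => inner Om v (psi j)) h; rewrite !inner_expansion_psi => <-.
  by rewrite mulKf.
exfalso; apply: (nu (expansion (fun j => (z - (lam j)%:C%C)^-1 * c j))).
split; first exact: Vh_expansion.
by rewrite app; congr expansion; apply/funext => j; rewrite mulVKf.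
Qed.

(** The eigenvalue of the error operator at [lambda]. The sum is added because the quadrature
    formula carries a minus sign. *)
Definition quadrature_error (b beta : R) (N : nat) (k t lambda : R) : R[i] :=
  (expR (- (t * lambda `^ beta)))%:C%C + (k%:C%C / (2 * pi%:C%C * 'i%C)) *
  \sum_(0 <= j < N.*2.+1) g_fun b beta lambda (sinc_node N k j)%:C%C t.

Lemma semigroup_error (b beta : R) (N : nat) (k t : R) w : Vh w ->
  (forall i j, gamma b (sinc_node N k i)%:C%C != (lam j)%:C%C) ->
  (fun x => discrete_semigroup Om psi lam beta t w x -
            sinc_quadrature Om A Vh b beta N k t w x) =
  expansion (fun j => quadrature_error b beta N k t (lam j) * inner Om w (psi j)).
Proof.
move=> Vw hg; apply/funext => x; rewrite /discrete_semigroup /sinc_quadrature.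
rewrite {2}(expansionE Vw) mulNr opprK.
under [X in _ + _ * X]eq_bigr => i _ do rewrite (discrete_resolvent_expansion _ (hg i)) /expansion mulr_sumr.
rewrite exchange_big mulr_sumr -big_split; apply: eq_bigr => j _ /=.
rewrite /quadrature_error !mulrDl; congr (_ + _).
rewrite -!mulrA; congr (_ * _); congr (_ * _); rewrite mulr_suml; apply: eq_bigr => i _.
by rewrite /g_fun; ring.
Qed.

(** By Parseval, the norm of a diagonal operator is at most the largest modulus of its entries. *)
Lemma op_norm_le (b beta : R) (N : nat) (k t : R) (X : \bar R) : (0 <= X)%E ->
  (forall i j, gamma b (sinc_node N k i)%:C%C != (lam j)%:C%C) ->
  (forall j, ((normc (quadrature_error b beta N k t (lam j)))%:E <= X)%E) ->
  (op_norm Om Vh (fun w x => discrete_semigroup Om psi lam beta t w x -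
            sinc_quadrature Om A Vh b beta N k t w x)%R <= X)%E.
Proof.
move=> X0 hg hX; apply: ub_ereal_sup => _ [w [Vw w1] <-]; rewrite (semigroup_error beta t Vw hg).
case: X X0 hX => [K|_ _|//]; last by rewrite leey.
rewrite !lee_fin => K0 hX.
have {hX}hX j : normc (quadrature_error b beta N k t (lam j)) <= K by rewrite -lee_fin; exact: hX.
apply: (@le_trans _ _ (K * l2norm Om w)); last by rewrite -[leRHS]mulr1 ler_wpM2l.
rewrite -(@ler_pXn2r _ 2) ?nnegrE ?l2norm_ge0 ?mulr_ge0 ?l2norm_ge0//.
rewrite exprMn [in leRHS](expansionE Vw) !l2norm_expansion mulr_sumr; apply: ler_sum => j _.
rewrite Normc.normcM exprMn ler_wpM2r ?sqr_ge0//.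
by apply: lerXn2r; rewrite ?nnegrE ?normc_ge0.
Qed.

End spectral.

(** * Complex differentiation and Cauchy's theorem on rectangles *)

Section complex_limits.
Context {R : realType}.
Implicit Types (z w l : R[i]).

Lemma ReV z : Re z^-1 = Re z / (Re z ^+ 2 + Im z ^+ 2). Proof. by case: z. Qed.
Lemma ImV z : Im z^-1 = - Im z / (Re z ^+ 2 + Im z ^+ 2).
Proof. by case: z => x y /=; rewrite mulNr. Qed.

Lemma sqr_norm_gt0 z : z != 0 -> 0 < Re z ^+ 2 + Im z ^+ 2.
Proof.
case: z => x y; rewrite eq_complex /= negb_and => /orP[h|h].
  by rewrite ltr_wpDr ?sqr_ge0// lt_neqAle sqr_ge0 andbT eq_sym sqrf_eq0.
by rewrite ltr_wpDl ?sqr_ge0// lt_neqAle sqr_ge0 andbT eq_sym sqrf_eq0.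
Qed.

Lemma cvg_near_eq (T : Type) (F : set_system T) (FF : Filter F) (f g : T -> R) (l : R) :
  (\forall x \near F, f x = g x) -> f @ F --> l -> g @ F --> l.
Proof. by move=> fg; apply: cvg_trans; apply: near_eq_cvg; exact: fg. Qed.

Lemma near_is_derive (f g : R -> R) (x l : R) : (\forall y \near x, f y = g y) ->
  is_derive x (1 : R) f l -> is_derive x (1 : R) g l.
Proof.
move=> fg h; apply: (@near_eq_is_derive R R R f) => //; exact: oner_neq0.
Qed.

(** Componentwise, so that the results on real limits apply along any filter without going through
    the topology of [R[i]]. *)
Definition ccvg {T : Type} (F : set_system T) (u : T -> R[i]) (l : R[i]) : Prop :=
  (Re (u x) @[x --> F] --> Re l) /\ (Im (u x) @[x --> F] --> Im l).

Section ccvg.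
Context {T : Type} {F : set_system T} {FF : Filter F}.
Implicit Types u v : T -> R[i].

Lemma ccvg_cst l : ccvg F (fun=> l) l. Proof. by split; exact: cvg_cst. Qed.

Lemma ccvgD u v l m : ccvg F u l -> ccvg F v m -> ccvg F (fun x => u x + v x) (l + m).
Proof.
move=> [u1 u2] [v1 v2]; split.
  by rewrite ReD; under eq_fun do rewrite ReD; exact: cvgD.
by rewrite ImD; under eq_fun do rewrite ImD; exact: cvgD.
Qed.

Lemma ccvgN u l : ccvg F u l -> ccvg F (fun x => - u x) (- l).
Proof.
move=> [u1 u2]; split.
  by rewrite ReN; under eq_fun do rewrite ReN; exact: cvgN.
by rewrite ImN; under eq_fun do rewrite ImN; exact: cvgN.
Qed.

Lemma ccvgM u v l m : ccvg F u l -> ccvg F v m -> ccvg F (fun x => u x * v x) (l * m).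
Proof.
move=> [u1 u2] [v1 v2]; split.
  by rewrite ReM; under eq_fun do rewrite ReM; apply: cvgB; exact: cvgM.
by rewrite ImM; under eq_fun do rewrite ImM; apply: cvgD; exact: cvgM.
Qed.

Lemma cvg_sqr_norm u l : ccvg F u l ->
  Re (u x) ^+ 2 + Im (u x) ^+ 2 @[x --> F] --> Re l ^+ 2 + Im l ^+ 2.
Proof.
move=> [u1 u2]; under eq_fun do rewrite !expr2; rewrite !expr2.
by apply: cvgD; exact: cvgM.
Qed.

Lemma near_neq0 u l : ccvg F u l -> l != 0 -> \forall x \near F, u x != 0.
Proof.
move=> /cvg_sqr_norm hu /sqr_norm_gt0 l0.
apply: (@filterS T F FF _ _ _ (cvgr_gt _ hu _ l0)) => x.
by apply: contraTneq => ->; rewrite /= expr0n addr0 ltxx.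
Qed.

Lemma ccvgV u l : l != 0 -> ccvg F u l -> ccvg F (fun x => (u x)^-1) l^-1.
Proof.
move=> l0 hu; have [u1 u2] := hu; have hs := cvg_sqr_norm hu.
have s0 : Re l ^+ 2 + Im l ^+ 2 != 0 by rewrite gt_eqF// sqr_norm_gt0.
split.
  rewrite ReV; under eq_fun do rewrite ReV.
  by apply: cvgM => //; exact: cvgV.
rewrite ImV; under eq_fun do rewrite ImV.
by apply: cvgM; [exact: cvgN|exact: cvgV].
Qed.

Lemma ccvg_cexp u l : ccvg F u l -> ccvg F (fun x => cexp (u x)) (cexp l).
Proof.
move=> [u1 u2]; have he := continuous_cvg FF (@continuous_expR R (Re l)) u1.
split=> /=; apply: cvgM => //.
  exact: (continuous_cvg FF (@continuous_cos R (Im l)) u2).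
exact: (continuous_cvg FF (@continuous_sin R (Im l)) u2).
Qed.

Lemma cvg_normc u l : ccvg F u l -> normc (u x) @[x --> F] --> normc l.
Proof.
move=> hu; have h := continuous_cvg FF (@sqrt_continuous R _) (cvg_sqr_norm hu).
have e z : normc z = Num.sqrt (Re z ^+ 2 + Im z ^+ 2) by case: z.
by rewrite e; under eq_fun do rewrite e.
Qed.

End ccvg.

(** The plane cut along the closed negative real axis, on which the principal logarithm is
    holomorphic. *)
Definition slit z := (0 < Re z) || (Im z != 0).

Lemma slit_neq0 z : slit z -> z != 0.
Proof. by apply: contraTneq => ->; rewrite /slit /= ltxx eqxx. Qed.

Lemma normc_gt0 z : z != 0 -> 0 < normc z.
Proof.
move=> z0; rewrite lt_neqAle normc_ge0 andbT eq_sym.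
by apply: contra z0 => /eqP /normc_eq0 ->.
Qed.

Lemma sin_atan (x : R) : sin (atan x) = x / Num.sqrt (1 + x ^+ 2).
Proof.
have h := atanK x; move: h; rewrite /tan => h.
have c0 : cos (atan x) != 0.
  by rewrite cos_atan invr_eq0 sqrtr_eq0 -ltNge ltr_pwDl// sqr_ge0.
by rewrite -cos_atan -[X in _ = X * _]h mulfVK.
Qed.

Lemma sqrt_ratio (x y : R) : 0 < x -> Num.sqrt (1 + (y / x) ^+ 2) = Num.sqrt (x ^+ 2 + y ^+ 2) / x.
Proof.
move=> x0; have -> : 1 + (y / x) ^+ 2 = (x ^+ 2 + y ^+ 2) * (x^-1) ^+ 2.
  by field; exact: lt0r_neq0.
by rewrite sqrtrM ?addr_ge0 ?sqr_ge0// sqrtr_sqr ger0_norm// invr_ge0 ltW.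
Qed.

Lemma normcE z : normc z = Num.sqrt (Re z ^+ 2 + Im z ^+ 2). Proof. by case: z. Qed.

(** [carg] is given by [acos], which is not differentiable at 1, its argument on the positive axis.
    On the right, upper and lower half-planes, which cover [slit], it is an arctangent up to a
    constant and a sign. *)
Lemma carg_right z : 0 < Re z -> carg z = atan (Im z / Re z).
Proof.
move=> z0; rewrite /carg.
have -> : Re z / normc z = cos (atan (Im z / Re z)).
  by rewrite cos_atan sqrt_ratio// -normcE invfM invrK mulrC.
have lo := atan_gtNpi2 (Im z / Re z); have hi := atan_ltpi2 (Im z / Re z).
have p0 := @pi_gt0 R.
case: ifPn => i0.
  rewrite cosK// in_itv /=; apply/andP; split; last by lra.
  by rewrite -(@atan0 R); apply: le_atan; rewrite divr_ge0// ltW.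
rewrite -ltNge in i0.
rewrite cosKN ?opprK//; apply/andP; split; first by lra.
by rewrite -(@atan0 R); apply: le_atan; rewrite pmulr_lle0 ?invr_gt0// ltW.
Qed.

Lemma carg_upper z : 0 < Im z -> carg z = pi / 2 - atan (Re z / Im z).
Proof.
move=> z0; rewrite /carg ltW//.
have -> : Re z / normc z = cos (pi / 2 - atan (Re z / Im z)).
  rewrite cosB cos_pihalf sin_pihalf mul0r add0r mul1r sin_atan sqrt_ratio// addrC -normcE.
  by rewrite invf_div mulrA mulfVK// gt_eqF.
have lo := atan_gtNpi2 (Re z / Im z); have hi := atan_ltpi2 (Re z / Im z).
by rewrite cosK// in_itv /=; apply/andP; split; lra.
Qed.

Lemma carg_lower z : Im z < 0 -> carg z = - (pi / 2) - atan (Re z / Im z).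
Proof.
move=> z0; rewrite /carg leNgt z0 /=.
have -> : Re z / normc z = cos (pi / 2 + atan (Re z / Im z)).
  have -> : Re z / Im z = - (Re z / - Im z) by rewrite invrN mulrN opprK.
  rewrite atanN cosB cos_pihalf sin_pihalf mul0r add0r mul1r sin_atan sqrt_ratio ?oppr_gt0//.
  rewrite sqrrN addrC -normcE.
  by rewrite invf_div mulrA mulfVK// oppr_eq0 lt_eqF.
have lo := atan_gtNpi2 (Re z / Im z); have hi := atan_ltpi2 (Re z / Im z).
by rewrite cosK ?opprD// in_itv /=; apply/andP; split; lra.
Qed.

Section ccvg_log.
Context {T : Type} {F : set_system T} {FF : Filter F}.
Implicit Types u v : T -> R[i].

Lemma cvg_carg u l : slit l -> ccvg F u l -> carg (u x) @[x --> F] --> carg l.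
Proof.
move=> sl [u1 u2].
have [l0|l0] := ltP 0 (Re l).
  rewrite (carg_right l0); apply: (cvg_near_eq FF _ (continuous_cvg FF (@continuous_atan R _)
    (cvgM u2 (cvgV (lt0r_neq0 l0) u1)))).
  exact: (@filterS T F FF _ _ (fun x x0 => esym (carg_right x0)) (cvgr_gt _ u1 _ l0)).
have {sl l0} : Im l != 0 by move: sl; rewrite /slit ltNge l0.
have cc (c : R) : (fun _ : T => c) @ F --> c by exact: cvg_cst.
rewrite neq_lt => /orP[l0|l0].
  rewrite (carg_lower l0); apply: (cvg_near_eq FF _ (cvgB (cc _)
    (continuous_cvg FF (@continuous_atan R _) (cvgM u1 (cvgV (ltr0_neq0 l0) u2))))).
  exact: (@filterS T F FF _ _ (fun x x0 => esym (carg_lower x0)) (cvgr_lt _ u2 _ l0)).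
rewrite (carg_upper l0); apply: (cvg_near_eq FF _ (cvgB (cc _)
  (continuous_cvg FF (@continuous_atan R _) (cvgM u1 (cvgV (lt0r_neq0 l0) u2))))).
exact: (@filterS T F FF _ _ (fun x x0 => esym (carg_upper x0)) (cvgr_gt _ u2 _ l0)).
Qed.

Lemma ccvg_cln u l : slit l -> ccvg F u l -> ccvg F (fun x => cln (u x)) (cln l).
Proof.
move=> sl hu; split=> /=; last exact: cvg_carg.
exact: (continuous_cvg FF (continuous_ln (normc_gt0 (slit_neq0 sl))) (cvg_normc hu)).
Qed.

Lemma ccvg_cpow u l (beta : R) : slit l -> ccvg F u l ->
  ccvg F (fun x => cpow (u x) beta) (cpow l beta).
Proof.
move=> sl hu; apply: ccvg_cexp; apply: ccvgM; [exact: ccvg_cst|exact: ccvg_cln].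
Qed.

End ccvg_log.

Section real_derivatives.
Implicit Types (f g : R -> R) (x a : R).

Lemma der_eq f x a a' : is_derive x (1 : R) f a -> a = a' -> is_derive x (1 : R) f a'.
Proof. by move=> h <-. Qed.

Lemma der_ext f g x a : (forall y, f y = g y) -> is_derive x (1 : R) f a -> is_derive x (1 : R) g a.
Proof. by move=> /funext ->. Qed.

Lemma derD f g x a b : is_derive x (1 : R) f a -> is_derive x (1 : R) g b ->
  is_derive x (1 : R) (fun y => f y + g y) (a + b).
Proof. by move=> hf hg; exact: is_deriveD. Qed.

Lemma derN f x a : is_derive x (1 : R) f a -> is_derive x (1 : R) (fun y => - f y) (- a).
Proof. by move=> hf; exact: is_deriveN. Qed.

Lemma derB f g x a b : is_derive x (1 : R) f a -> is_derive x (1 : R) g b ->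
  is_derive x (1 : R) (fun y => f y - g y) (a - b).
Proof. by move=> hf hg; exact: is_deriveB. Qed.

Lemma derM f g x a b : is_derive x (1 : R) f a -> is_derive x (1 : R) g b ->
  is_derive x (1 : R) (fun y => f y * g y) (a * g x + f x * b).
Proof.
move=> hf hg; apply: der_eq (is_deriveM hf hg) _.
by rewrite /GRing.scale /= addrC mulrC.
Qed.

Lemma derZ f x a c : is_derive x (1 : R) f a -> is_derive x (1 : R) (fun y => c * f y) (c * a).
Proof.
by move=> hf; apply: der_eq (derM (is_derive_cst c x 1) hf) _; rewrite mul0r add0r.
Qed.

Lemma derV f x a : is_derive x (1 : R) f a -> f x != 0 ->
  is_derive x (1 : R) (fun y => (f y)^-1) (- a / f x ^+ 2).
Proof.
move=> hf f0; apply: der_eq (is_deriveV f0 hf) _.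
by rewrite /GRing.scale /= mulNr mulNr mulrC.
Qed.

Lemma der_comp f g x a b : is_derive x (1 : R) g b -> is_derive (g x) (1 : R) f a ->
  is_derive x (1 : R) (fun y => f (g y)) (a * b).
Proof. by move=> hg hf; exact: (is_derive1_comp hf hg). Qed.

End real_derivatives.

Definition cder (c : R -> R[i]) (x : R) (l : R[i]) : Prop :=
  is_derive x (1 : R) (fun y => Re (c y)) (Re l) /\
  is_derive x (1 : R) (fun y => Im (c y)) (Im l).

Lemma cder_cst l x : cder (fun=> l) x 0.
Proof. by split; exact: is_derive_cst. Qed.

Lemma cder_eq c x l m : cder c x l -> l = m -> cder c x m. Proof. by move=> h <-. Qed.

Lemma cderD c d x l m : cder c x l -> cder d x m -> cder (fun y => c y + d y) x (l + m).
Proof.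
move=> [c1 c2] [d1 d2]; split.
  by rewrite ReD; apply: der_ext (derD c1 d1) => y; rewrite ReD.
by rewrite ImD; apply: der_ext (derD c2 d2) => y; rewrite ImD.
Qed.

Lemma cderN c x l : cder c x l -> cder (fun y => - c y) x (- l).
Proof.
move=> [c1 c2]; split.
  by rewrite ReN; apply: der_ext (derN c1) => y; rewrite ReN.
by rewrite ImN; apply: der_ext (derN c2) => y; rewrite ImN.
Qed.

Lemma cderB c d x l m : cder c x l -> cder d x m -> cder (fun y => c y - d y) x (l - m).
Proof. by move=> hc hd; apply: cderD => //; exact: cderN. Qed.

Lemma cderM c d x l m : cder c x l -> cder d x m ->
  cder (fun y => c y * d y) x (l * d x + c x * m).
Proof.
move=> [c1 c2] [d1 d2]; split.
  apply: (der_ext (fun y => esym (ReM (c y) (d y)))).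
  by apply: der_eq (derB (derM c1 d1) (derM c2 d2)) _; rewrite !(ReD, ReM); ring.
apply: (der_ext (fun y => esym (ImM (c y) (d y)))).
by apply: der_eq (derD (derM c1 d2) (derM c2 d1)) _; rewrite !(ImD, ImM); ring.
Qed.

Lemma cderZ c x l a : cder c x l -> cder (fun y => a * c y) x (a * l).
Proof. by move=> hc; apply: cder_eq (cderM (cder_cst a x) hc) _; rewrite mul0r add0r. Qed.

Lemma cder_cexp c x l : cder c x l -> cder (fun y => cexp (c y)) x (cexp (c x) * l).
Proof.
move=> [c1 c2].
have he := der_comp c1 (is_derive_expR (Re (c x))).
split.
  apply: der_eq (derM he (der_comp c2 (is_derive_cos (Im (c x))))) _.
  by rewrite ReM /=; ring.
apply: der_eq (derM he (der_comp c2 (is_derive_sin (Im (c x))))) _.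
by rewrite ImM /=; ring.
Qed.

Lemma is_derive_sqr_norm c x l : cder c x l ->
  is_derive x (1 : R) (fun y => Re (c y) ^+ 2 + Im (c y) ^+ 2)
    (2 * (Re (c x) * Re l + Im (c x) * Im l)).
Proof. by move=> [c1 c2]; apply: der_eq (derD (derM c1 c1) (derM c2 c2)) _; ring. Qed.

Lemma cderV c x l : c x != 0 -> cder c x l -> cder (fun y => (c y)^-1) x (- l / c x ^+ 2).
Proof.
move=> c0 hc; have [c1 c2] := hc; have s0 := lt0r_neq0 (sqr_norm_gt0 c0).
have hs := derV (is_derive_sqr_norm hc) s0.
have e : (c x ^+ 2)^-1 = (c x)^-1 * (c x)^-1 by rewrite expr2 invfM.
rewrite e; split.
  apply: (der_ext (fun y => esym (ReV (c y)))); apply: der_eq (derM c1 hs) _.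
  by rewrite !(ReM, ImM, ReN, ImN, ReV, ImV); field.
apply: (der_ext (fun y => esym (ImV (c y)))); apply: der_eq (derM (derN c2) hs) _.
by rewrite !(ReM, ImM, ReN, ImN, ReV, ImV); field.
Qed.

Lemma cder_continuous c x l : cder c x l -> ccvg (nbhs x) c (c x).
Proof.
by move=> [[d1 _] [d2 _]]; split; apply: differentiable_continuous; exact/derivable1_diffP.
Qed.

Lemma is_derive_carg c x l : slit (c x) -> cder c x l ->
  is_derive x (1 : R) (fun y => carg (c y)) (Im (l / c x)).
Proof.
move=> sl hc; have [u1 u2] := cder_continuous hc; have [c1 c2] := hc.
have s0 := lt0r_neq0 (sqr_norm_gt0 (slit_neq0 sl)).
have [l0|l0] := ltP 0 (Re (c x)).
  have h := der_comp (derM c2 (derV c1 (lt0r_neq0 l0))) (is_derive1_atan (Im (c x) * (Re (c x))^-1)).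
  apply: (@near_is_derive (fun y => atan (Im (c y) / Re (c y)))).
    exact: (@filterS _ (nbhs x) _ _ _ (fun y y0 => esym (carg_right y0)) (cvgr_gt _ u1 _ l0)).
  apply: der_eq h _; have {}l0 := lt0r_neq0 l0.
  by rewrite !(ImM, ReV, ImV); field; rewrite s0 l0.
have {l0} i0 : Im (c x) != 0 by move: sl; rewrite /slit ltNge l0.
have h := der_comp (derM c1 (derV c2 i0)) (is_derive1_atan (Re (c x) * (Im (c x))^-1)).
have e (p : R) : is_derive x (1 : R) (fun y => p - atan (Re (c y) / Im (c y))) (Im (l / c x)).
  apply: der_eq (derB (is_derive_cst p x 1) h) _.
  by rewrite !(ImM, ReV, ImV); field; rewrite s0 i0.
move: (i0); rewrite neq_lt => /orP[l0|l0].
  apply: near_is_derive (e (- (pi / 2))).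
  exact: (@filterS _ (nbhs x) _ _ _ (fun y y0 => esym (carg_lower y0)) (cvgr_lt _ u2 _ l0)).
apply: near_is_derive (e (pi / 2)).
exact: (@filterS _ (nbhs x) _ _ _ (fun y y0 => esym (carg_upper y0)) (cvgr_gt _ u2 _ l0)).
Qed.

Lemma half_ln_sqr (x : R) : 0 < x -> 2^-1 * ln (x ^+ 2) = ln x.
Proof. by move=> x0; rewrite expr2 lnM ?posrE// mulrDr !(mulrC 2^-1) -splitr. Qed.

Lemma cder_cln c x l : slit (c x) -> cder c x l -> cder (fun y => cln (c y)) x (l / c x).
Proof.
move=> sl hc; split; last exact: is_derive_carg.
have s0 := sqr_norm_gt0 (slit_neq0 sl).
have h := derZ 2^-1 (der_comp (is_derive_sqr_norm hc) (is_derive1_ln s0)).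
have n0 : \forall y \near x, c y != 0.
  exact: near_neq0 (cder_continuous hc) (slit_neq0 sl).
(* Half the logarithm of the squared modulus avoids differentiating a square root. *)
apply: (@near_is_derive (fun y => 2^-1 * ln (Re (c y) ^+ 2 + Im (c y) ^+ 2))).
  by apply: filterS n0 => y y0; rewrite -normc_sqr half_ln_sqr ?normc_gt0.
apply: der_eq h _; have {}s0 := lt0r_neq0 s0.
by rewrite !(ReM, ReV, ImV); field.
Qed.

Lemma cder_cpow c x l (beta : R) : slit (c x) -> cder c x l ->
  cder (fun y => cpow (c y) beta) x (cpow (c x) beta * (beta%:C%C * (l / c x))).
Proof. by move=> sl hc; exact: (cder_cexp (cderZ beta%:C%C (cder_cln sl hc))). Qed.

End complex_limits.

(** * Cauchy's theorem on rectangles *)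

Section strips.
Context {R : realType}.
Local Notation mu := (@lebesgue_measure R).

Lemma itv_integrable_bounded (g : R -> R) (a b K : R) : measurable_fun `[a, b] g ->
  (forall x, a <= x <= b -> `|g x| <= K) -> mu.-integrable `[a, b] (EFin \o g).
Proof.
move=> mg gK; apply: measurable_bounded_integrable => //.
  exact: (compact_finite_measure (@segment_compact _ a b)).
exists K; split; first exact: num_real.
by move=> M KM x /=; rewrite in_itv /= => /gK h; apply: le_trans h (ltW KM).
Qed.

(** Bounded convergence off a null set [S]. Requiring [g] to be 0 on [S] makes it an everywhere
    limit of [g_ n] times an indicator, hence measurable. *)
Lemma dominated_itv (g_ : nat -> R -> R) (g : R -> R) (S : set R) (a b K : R) :
  (forall n, measurable_fun `[a, b] (g_ n)) ->
  (forall n x, a <= x <= b -> `|g_ n x| <= K) ->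
  measurable S -> mu S = 0%E -> (forall x, S x -> g x = 0) ->
  (forall x, a <= x <= b -> ~ S x -> g_ n x @[n --> \oo] --> g x) ->
  measurable_fun `[a, b] g /\
  \int[mu]_(x in `[a, b]) g_ n x @[n --> \oo] --> \int[mu]_(x in `[a, b]) g x.
Proof.
move=> mg gK mS S0 gS gg.
have mg0 : measurable_fun `[a, b] g.
  apply: (@measurable_fun_cvg _ _ _ _ (fun n x => g_ n x * \1_(~` S) x)).
    by move=> n; apply: measurable_funM => //; apply: measurable_indic; exact: measurableC.
  move=> x /=; rewrite in_itv /= => xab; rewrite indicE; have [Sx|Sx] := pselect (S x).
    rewrite gS// memNset; last by apply.
    by under eq_fun do rewrite mulr0; exact: cvg_cst.
  by rewrite mem_set//; under eq_fun do rewrite mulr1; exact: gg.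
split=> //.
have iK : mu.-integrable `[a, b] (EFin \o cst K).
  apply: (@itv_integrable_bounded _ _ _ `|K|); first exact: measurable_cst.
  by move=> x _.
have cae : {ae mu, forall x, `[a, b]%classic x -> (EFin \o g_ n) x @[n --> \oo] --> (EFin \o g) x}.
  exists S; split=> // x /= h; apply: contrapT => nS; apply: h; rewrite in_itv /= => xab.
  by apply: cvg_EFin; [exact: nearW|exact: gg].
have dom : {ae mu, forall x n, `[a, b]%classic x -> (`|(EFin \o g_ n) x| <= (EFin \o cst K) x)%E}.
  by apply: aeW => x n /=; rewrite in_itv /= => xab; rewrite lee_fin; exact: gK.
have [ig _ cv] := @dominated_convergence _ _ _ mu `[a, b]%classic (measurable_itv _)
  (fun n => EFin \o g_ n) (EFin \o g) (EFin \o cst K)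
  (fun n => iffRL (measurable_EFinP _ _) (mg n)) (iffRL (measurable_EFinP _ _) mg0) cae iK dom.
have ign n : mu.-integrable `[a, b] (EFin \o g_ n) by exact: (itv_integrable_bounded (mg n) (gK n)).
apply: fine_cvg; rewrite fineK; last exact: integrable_fin_num.
exact: cv.
Qed.

Lemma rectangle_bounded (w : R -> R -> R) (a b s0 s1 : R) :
  (forall x s, a <= x <= b -> s0 <= s <= s1 -> {for (x, s), continuous (fun p : R * R => w p.1 p.2)}) ->
  exists K, forall x s, a <= x <= b -> s0 <= s <= s1 -> `|w x s| <= K.
Proof.
move=> cw; pose D : set (R * R) := `[a, b]%classic `*` `[s0, s1]%classic.
have cD : compact D by apply: compact_setX; exact: segment_compact.
have wD : {within D, continuous (fun p : R * R => w p.1 p.2)}.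
  apply: continuous_in_subspaceT => -[x s]; rewrite inE => -[/= xab ss].
  by apply: cw; [move: xab|move: ss]; rewrite in_itv.
have [M [_ HM]] := compact_bounded (continuous_compact wD cD).
exists (M + 1) => x s xab ss; apply: (HM (M + 1)); first by rewrite ltrDl.
by exists (x, s) => //; split; rewrite /= in_itv.
Qed.

Lemma continuous_section (w : R -> R -> R) (x s : R) :
  {for (x, s), continuous (fun p : R * R => w p.1 p.2)} -> {for x, continuous (w ^~ s)}.
Proof.
have h : {for x, continuous (fun y : R => (y, s))}.
  exact: (cvg_pair (@cvg_id R (nbhs x)) (cvg_cst s)).
move=> cw; exact: (continuous_comp h cw).
Qed.

Lemma cvg_shiftr_nat (u_ : nat -> R) (l : R) N : u_ n @[n --> \oo] --> l ->
  u_ (n + N)%N @[n --> \oo] --> l.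
Proof. by rewrite -(cvg_shiftn N). Qed.

(** The real core of Cauchy's theorem. As [w] is both the [s]-derivative of [u] and the
    [x]-derivative of [v], the integral of [u] over [[a, b]] has [s]-derivative [v b s - v a s].
    Smoothness is asked only for [s0 < s < s1]; on the horizontal edges bounded convergence
    suffices, so a null set may be exempted there. *)
Lemma strip_integral (u v w : R -> R -> R) (a b s0 s1 K : R) (S0 S1 : set R) :
  a < b -> s0 < s1 ->
  (forall x s, a <= x <= b -> s0 < s < s1 -> is_derive s (1 : R) (u x) (w x s)) ->
  (forall x s, a <= x <= b -> s0 < s < s1 -> is_derive x (1 : R) (v ^~ s) (w x s)) ->
  (forall x s, a <= x <= b -> s0 < s < s1 ->
    {for (x, s), continuous (fun p : R * R => w p.1 p.2)}) ->
  (forall x s, a <= x <= b -> s0 < s < s1 -> {for x, continuous (u ^~ s)}) ->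
  (forall x s, a <= x <= b -> s0 < s < s1 -> `|u x s| <= K) ->
  measurable S0 -> mu S0 = 0%E -> (forall x, S0 x -> u x s0 = 0) ->
  (forall x, a <= x <= b -> ~ S0 x -> u x s @[s --> s0^'+] --> u x s0) ->
  measurable S1 -> mu S1 = 0%E -> (forall x, S1 x -> u x s1 = 0) ->
  (forall x, a <= x <= b -> ~ S1 x -> u x s @[s --> s1^'-] --> u x s1) ->
  {within `[s0, s1], continuous (fun s => v b s - v a s)} ->
  \int[mu]_(x in `[a, b]) u x s1 - \int[mu]_(x in `[a, b]) u x s0 =
  \int[mu]_(s in `[s0, s1]) (v b s - v a s).
Proof.
move=> ab s01 du dv cw cu uK mS0 S00 uS0 cu0 mS1 S10 uS1 cu1 cv.
pose J s := \int[mu]_(x in `[a, b]) u x s.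
have mu_ s : s0 < s < s1 -> measurable_fun `[a, b] (u ^~ s).
  move=> ss; apply: subspace_continuous_measurable_fun => //.
  by apply: continuous_in_subspaceT => x; rewrite inE /= in_itv /= => xab; exact: cu.
have iu s : s0 < s < s1 -> mu.-integrable `[a, b] (EFin \o u ^~ s).
  by move=> ss; apply: (itv_integrable_bounded (mu_ s ss)) => x xab; exact: uK.
have dJ s : s0 < s < s1 -> is_derive s (1 : R) J (v b s - v a s).
  move=> /andP[ss0 ss1].
  (* A compact interval around [s] inside the open strip: [w] is bounded on it, though perhaps not
     up to the edges. *)
  pose e0 := (s0 + s) / 2; pose e1 := (s + s1) / 2.
  have e00 : s0 < e0 by rewrite /e0; lra.
  have e01 : e0 < s by rewrite /e0; lra.
  have e10 : s < e1 by rewrite /e1; lra.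
  have e11 : e1 < s1 by rewrite /e1; lra.
  have se x : x \in `]e0, e1[ -> s0 < x < s1.
    by rewrite in_itv /= => /andP[h1 h2]; rewrite (lt_trans e00 h1) (lt_trans h2 e11).
  have [Kw HKw] : exists K, forall x s, a <= x <= b -> e0 <= s <= e1 -> `|w x s| <= K.
    apply: rectangle_bounded => x y xab /andP[h1 h2]; apply: cw => //.
    by rewrite (lt_le_trans e00 h1) (le_lt_trans h2 e11).
  have Is : `]e0, e1[%classic s by rewrite /= in_itv /= e01 e10.
  have h1 x : `]e0, e1[%classic x -> mu.-integrable `[a, b] (EFin \o u ^~ x).
    by move=> /se; exact: iu.
  have h2 x y : `]e0, e1[%classic x -> `[a, b]%classic y -> derivable (u y) x 1.
    by move=> /se xs; rewrite /= in_itv /= => yab; case: (du y x yab xs).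
  have dE x y : `]e0, e1[%classic x -> a <= y <= b -> partial1of2 (fun s y => u y s) x y = w y x.
    move=> /se xs yab; rewrite partial1of2E; by have [_ <-] := du y x yab xs.
  have Kw0 : 0 <= Kw.
    apply: le_trans (normr_ge0 _) (HKw a s _ _); first by rewrite lexx ltW.
    by rewrite !ltW.
  have iK : mu.-integrable `[a, b] (EFin \o cst Kw).
    apply: (@itv_integrable_bounded _ _ _ Kw); first exact: measurable_cst.
    by move=> x _; rewrite ger0_norm.
  have h3 x y : `]e0, e1[%classic x -> `[a, b]%classic y ->
      `|partial1of2 (fun s y => u y s) x y| <= cst Kw y.
    move=> xs; rewrite /= in_itv /= => yab; rewrite dE//; apply: HKw => //.
    by move: xs; rewrite /= in_itv /= => /andP[/ltW -> /ltW ->].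
  have D1 := @derivable_under_integral R _ _ mu (fun s y => u y s) `[a, b]%classic (measurable_itv _)
    s e0 e1 Is h1 h2 (cst Kw) (fun _ => Kw0) iK h3.
  have D2 := @differentiation_under_integral R _ _ mu (fun s y => u y s) `[a, b]%classic (measurable_itv _)
    s e0 e1 Is h1 h2 (cst Kw) (fun _ => Kw0) iK h3.
  apply: DeriveDef => //; rewrite -derive1E D2.
  have -> : \int[mu]_(y in `[a, b]) partial1of2 (fun s y => u y s) ^~ y s = \int[mu]_(y in `[a, b]) w y s.
    by apply: eq_Rintegral => y; rewrite inE /= in_itv /= => yab; rewrite dE.
  have ss : s0 < s < s1 by rewrite ss0 ss1.
  have cws : {within `[a, b], continuous (w ^~ s)}.
    apply: continuous_in_subspaceT => x; rewrite inE /= in_itv /= => xab.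
    exact: continuous_section (cw x s xab ss).
  have vd : derivable_oo_LRcontinuous (v ^~ s) a b.
    have cvx x : a <= x <= b -> {for x, continuous (v ^~ s)}.
      move=> xab; apply: differentiable_continuous; apply/derivable1_diffP.
      by case: (dv x s xab ss).
    split.
    - by move=> x; rewrite in_itv /= => /andP[/ltW h /ltW h']; case: (dv x s _ ss) => //; rewrite h h'.
    - by apply: cvg_at_right_filter; apply: cvx; rewrite lexx ltW.
    - by apply: cvg_at_left_filter; apply: cvx; rewrite lexx ltW.
  have ve : {in `]a, b[, ((v ^~ s)^`())%classic =1 w ^~ s}.
    move=> x; rewrite in_itv /= => /andP[/ltW h /ltW h'].
    by have [_ <-] := dv x s (introT andP (conj h h')) ss; rewrite derive1E.
  by rewrite /Rintegral (continuous_FTC2 ab cws vd ve).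
(* [J] is continuous at the edges along sequences; dropping the first [N] terms keeps the heights
   inside the strip, where [K] bounds [u]. *)
have ends (p : R) (S : set R) : measurable S -> mu S = 0%E -> (forall x, S x -> u x p = 0) ->
    forall t_ : nat -> R, (\forall n \near \oo, s0 < t_ n < s1) ->
    (forall x, a <= x <= b -> ~ S x -> u x (t_ n) @[n --> \oo] --> u x p) ->
    J (t_ n) @[n --> \oo] --> J p.
  move=> mS Sp0 uS t_ [N _ HN] cS.
  have HN' n : s0 < t_ (n + N)%N < s1 by apply: HN => /=; exact: leq_addl.
  have [_ cJ] := @dominated_itv (fun n x => u x (t_ (n + N)%N)) (u ^~ p) S a b K
    (fun n => mu_ _ (HN' n)) (fun n x xab => uK _ _ xab (HN' n)) mS Sp0 uS
    (fun x xab nS => cvg_shiftr_nat N (cS x xab nS)).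
  by rewrite -(cvg_shiftn N).
have Jd : derivable_oo_LRcontinuous J s0 s1.
  split.
  - by move=> s; rewrite in_itv /= => ss; case: (dJ s ss).
  - apply/cvg_at_rightP => t_ [t0 tc]; apply: (ends s0 S0) => //.
      have h : \forall n \near \oo, t_ n < s1 by apply: (cvgr_lt _ tc).
      by apply: filterS h => n ->; rewrite andbT; exact: t0.
    by move=> x xab nS; exact: (iffLR (cvg_at_rightP _ _ _) (cu0 x xab nS)).
  - apply/cvg_at_leftP => t_ [t0 tc]; apply: (ends s1 S1) => //.
      have h : \forall n \near \oo, s0 < t_ n by apply: (cvgr_gt _ tc).
      by apply: filterS h => n ->; exact: t0.
    by move=> x xab nS; exact: (iffLR (cvg_at_leftP _ _ _) (cu1 x xab nS)).
have JE : {in `]s0, s1[, (J^`())%classic =1 (fun s => v b s - v a s)}.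
  by move=> s; rewrite in_itv /= => ss; have [_ <-] := dJ s ss; rewrite derive1E.
by rewrite -/(J s1) -/(J s0) /Rintegral (continuous_FTC2 s01 cv Jd JE).
Qed.

End strips.

Section cauchy.
Context {R : realType}.
Local Notation mu := (@lebesgue_measure R).
Implicit Types (f F : R[i] -> R[i]) (z l : R[i]).

Definition cint (a b : R) (f : R -> R[i]) : R[i] :=
  ((\int[mu]_(x in `[a, b]) Re (f x)) +i* (\int[mu]_(x in `[a, b]) Im (f x)))%C.

(** Admitting all filters makes composition immediate and yields vertical, one-sided and joint
    limits from one definition. *)
Definition ccont f z := forall (T : Type) (F : set_system T) (u : T -> R[i]),
  Filter F -> ccvg F u z -> ccvg F (f \o u) (f z).

(* Complex differentiability is only used along real curves, which makes the
   chain rule definitional. *)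
Definition hol f z l := forall (c : R -> R[i]) (x : R) m,
  c x = z -> cder c x m -> cder (f \o c) x (l * m).

Lemma cder_horizontal (x s : R) : cder (fun y => (y +i* s)%C) x 1.
Proof. by split; [exact: is_derive_id|exact: is_derive_cst]. Qed.

Lemma cder_vertical (x s : R) : cder (fun y => (x +i* y)%C) s 'i%C.
Proof. by split; [exact: is_derive_cst|exact: is_derive_id]. Qed.

Lemma hol_horizontal f (x s : R) l : hol f (x +i* s)%C l -> cder (fun y => f (y +i* s)%C) x l.
Proof. by move=> h; have := h _ x _ erefl (cder_horizontal x s); rewrite mulr1. Qed.

Lemma hol_vertical f (x s : R) l : hol f (x +i* s)%C l -> cder (fun y => f (x +i* y)%C) s (l * 'i%C).
Proof. by move=> h; exact: (h _ s _ erefl (cder_vertical x s)). Qed.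

Lemma ccont_joint f (x s : R) : ccont f (x +i* s)%C ->
  ccvg (nbhs (x, s)) (fun p : R * R => f (p.1 +i* p.2)%C) (f (x +i* s)%C).
Proof.
move=> h; apply: (h _ (nbhs (x, s)) (fun p : R * R => (p.1 +i* p.2)%C)).
by split; [exact: cvg_fst|exact: cvg_snd].
Qed.

Lemma ccont_vertical f (x s : R) (G : set_system R) {FG : Filter G} : ccont f (x +i* s)%C -> G --> s ->
  ccvg G (fun y => f (x +i* y)%C) (f (x +i* s)%C).
Proof.
move=> h Gs; apply: (h _ G (fun y : R => (x +i* y)%C)).
by split; [exact: cvg_cst|exact: Gs].
Qed.

Lemma Rintegral_itvN (g : R -> R) (a b : R) : {within `[a, b], continuous g} ->
  \int[mu]_(x in `[a, b]) - g x = - \int[mu]_(x in `[a, b]) g x.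
Proof.
move=> cg; have ig : mu.-integrable `[a, b] (EFin \o g).
  by apply: continuous_compact_integrable => //; exact: segment_compact.
rewrite -mulN1r -(RintegralZl _ _ ig)//.
by apply: eq_Rintegral => x _; rewrite mulN1r.
Qed.

(** The Cauchy-Riemann equations turn each component into an instance of [strip_integral]. The sets
    [S0] and [S1] accommodate points of the horizontal edges where a quotient is singular and its
    formula evaluates to 0. *)
Lemma cauchy_rectangle F F' (a b s0 s1 K : R) (S0 S1 : set R) :
  a < b -> s0 < s1 ->
  (forall x s, a <= x <= b -> s0 < s < s1 -> hol F (x +i* s)%C (F' (x +i* s)%C)) ->
  (forall x s, a <= x <= b -> s0 < s < s1 -> ccont F' (x +i* s)%C) ->
  (forall x s, a <= x <= b -> s0 < s < s1 -> normc (F (x +i* s)%C) <= K) ->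
  measurable S0 -> mu S0 = 0%E -> (forall x, S0 x -> F (x +i* s0)%C = 0) ->
  (forall x, a <= x <= b -> ~ S0 x -> ccvg s0^'+ (fun s => F (x +i* s)%C) (F (x +i* s0)%C)) ->
  measurable S1 -> mu S1 = 0%E -> (forall x, S1 x -> F (x +i* s1)%C = 0) ->
  (forall x, a <= x <= b -> ~ S1 x -> ccvg s1^'- (fun s => F (x +i* s)%C) (F (x +i* s1)%C)) ->
  {within `[s0, s1], continuous (fun s => Re (F (b +i* s)%C - F (a +i* s)%C))} ->
  {within `[s0, s1], continuous (fun s => Im (F (b +i* s)%C - F (a +i* s)%C))} ->
  cint a b (fun x => F (x +i* s1)%C) - cint a b (fun x => F (x +i* s0)%C) =
  'i%C * cint s0 s1 (fun s => F (b +i* s)%C - F (a +i* s)%C).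
Proof.
move=> ab s01 hF cF' FK mS0 S00 FS0 l0 mS1 S10 FS1 l1 cr ci.
have [Rei Imi] : Re ('i%C : R[i]) = 0 /\ Im ('i%C : R[i]) = 1 by [].
have hv x s (xab : a <= x <= b) (ss : s0 < s < s1) := hol_vertical (hF x s xab ss).
have hh x s (xab : a <= x <= b) (ss : s0 < s < s1) := hol_horizontal (hF x s xab ss).
have cj x s (xab : a <= x <= b) (ss : s0 < s < s1) := ccont_joint (cF' x s xab ss).
have cx x s (xab : a <= x <= b) (ss : s0 < s < s1) := cder_continuous (hh x s xab ss).
have h1 : \int[mu]_(x in `[a, b]) Re (F (x +i* s1)%C) - \int[mu]_(x in `[a, b]) Re (F (x +i* s0)%C) =
    \int[mu]_(s in `[s0, s1]) (- Im (F (b +i* s)%C) - - Im (F (a +i* s)%C)).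
  apply: (@strip_integral R (fun x s => Re (F (x +i* s)%C)) (fun x s => - Im (F (x +i* s)%C))
    (fun x s => - Im (F' (x +i* s)%C)) a b s0 s1 K S0 S1) => //.
  - move=> x s xab ss; have [h _] := hv x s xab ss; apply: der_eq h _.
    by rewrite ReM Rei Imi; ring.
  - by move=> x s xab ss; have [_ h] := hh x s xab ss; exact: derN.
  - by move=> x s xab ss; have [_ h] := cj x s xab ss; apply: cvgN; exact: h.
  - by move=> x s xab ss; have [h _] := cx x s xab ss; exact: h.
  - by move=> x s xab ss; exact: le_trans (normc_Re _) (FK x s xab ss).
  - by move=> x /FS0 ->.
  - by move=> x xab /(l0 x xab)[].
  - by move=> x /FS1 ->.
  - by move=> x xab /(l1 x xab)[].
  - have -> : (fun s => - Im (F (b +i* s)%C) - - Im (F (a +i* s)%C)) =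
        (fun s => - Im (F (b +i* s)%C - F (a +i* s)%C)).
      by apply/funext => s; rewrite ImB; ring.
    by move=> x; apply: continuousN; exact: ci.
have h2 : \int[mu]_(x in `[a, b]) Im (F (x +i* s1)%C) - \int[mu]_(x in `[a, b]) Im (F (x +i* s0)%C) =
    \int[mu]_(s in `[s0, s1]) (Re (F (b +i* s)%C) - Re (F (a +i* s)%C)).
  apply: (@strip_integral R (fun x s => Im (F (x +i* s)%C)) (fun x s => Re (F (x +i* s)%C))
    (fun x s => Re (F' (x +i* s)%C)) a b s0 s1 K S0 S1) => //.
  - move=> x s xab ss; have [_ h] := hv x s xab ss; apply: der_eq h _.
    by rewrite ImM Rei Imi; ring.
  - by move=> x s xab ss; have [h _] := hh x s xab ss.
  - by move=> x s xab ss; have [h _] := cj x s xab ss; exact: h.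
  - by move=> x s xab ss; have [_ h] := cx x s xab ss; exact: h.
  - by move=> x s xab ss; exact: le_trans (normc_Im _) (FK x s xab ss).
  - by move=> x /FS0 ->.
  - by move=> x xab /(l0 x xab)[].
  - by move=> x /FS1 ->.
  - by move=> x xab /(l1 x xab)[].
  - have -> : (fun s => Re (F (b +i* s)%C) - Re (F (a +i* s)%C)) =
        (fun s => Re (F (b +i* s)%C - F (a +i* s)%C)) by apply/funext => s; rewrite ReB.
    exact: cr.
apply: complexP.
  rewrite ReB ReM Rei Imi mul0r mul1r sub0r [LHS]h1 -Rintegral_itvN//.
  by apply: eq_Rintegral => s _; rewrite ImB; ring.
rewrite ImB ImM Rei Imi mul0r mul1r add0r [LHS]h2.
by apply: eq_Rintegral => s _; rewrite ReB.
Qed.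

End cauchy.

Section C1_calculus.
Context {R : realType}.
Implicit Types (D : set R[i]) (F G : R[i] -> R[i]) (z l : R[i]).

Lemma ccont_cst z l : ccont (fun=> l) z. Proof. by move=> T F u FF _; exact: ccvg_cst. Qed.
Lemma ccont_id z : ccont id z. Proof. by move=> T F u FF. Qed.
Lemma ccontD F G z : ccont F z -> ccont G z -> ccont (fun w => F w + G w) z.
Proof. by move=> hF hG T A u FA hu; apply: ccvgD; [exact: hF|exact: hG]. Qed.
Lemma ccontN F z : ccont F z -> ccont (fun w => - F w) z.
Proof. by move=> hF T A u FA hu; apply: ccvgN; exact: hF. Qed.
Lemma ccontM F G z : ccont F z -> ccont G z -> ccont (fun w => F w * G w) z.
Proof. by move=> hF hG T A u FA hu; apply: ccvgM; [exact: hF|exact: hG]. Qed.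
Lemma ccontV F z : ccont F z -> F z != 0 -> ccont (fun w => (F w)^-1) z.
Proof. by move=> hF F0 T A u FA hu; apply: ccvgV => //; exact: hF. Qed.
Lemma ccont_comp F G z : ccont F z -> ccont G (F z) -> ccont (fun w => G (F w)) z.
Proof. by move=> hF hG T A u FA hu; apply: hG; exact: hF. Qed.
Lemma ccont_cexp z : ccont cexp z.
Proof. by move=> T A u FA hu; exact: ccvg_cexp. Qed.
Lemma ccont_cpow (beta : R) z : slit z -> ccont (fun w => cpow w beta) z.
Proof. by move=> sz T A u FA hu; exact: ccvg_cpow. Qed.

Definition C1 D F := exists F', forall z, D z -> [/\ hol F z (F' z), ccont F z & ccont F' z].

Lemma C1_sub D D' F : D' `<=` D -> C1 D F -> C1 D' F.
Proof. by move=> DD [F' h]; exists F' => z /DD /h. Qed.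

Lemma C1_ext D F G : (forall z, F z = G z) -> C1 D F -> C1 D G.
Proof. by move=> /funext ->. Qed.

Lemma C1_cst D l : C1 D (fun=> l).
Proof.
exists (fun=> 0) => z _; split; [|exact: ccont_cst|exact: ccont_cst].
by move=> c x m cx hc; rewrite mul0r; exact: cder_cst.
Qed.

Lemma C1_id D : C1 D id.
Proof.
exists (fun=> 1) => z _; split; [|exact: ccont_id|exact: ccont_cst].
by move=> c x m cx hc; rewrite mul1r.
Qed.

Lemma C1D D F G : C1 D F -> C1 D G -> C1 D (fun z => F z + G z).
Proof.
move=> [F' hF] [G' hG]; exists (fun z => F' z + G' z) => z Dz.
have [F1 F2 F3] := hF z Dz; have [G1 G2 G3] := hG z Dz; split; [|exact: ccontD|exact: ccontD].
move=> c x m cx hc; rewrite mulrDl.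
by apply: cderD; [exact: F1|exact: G1].
Qed.

Lemma C1N D F : C1 D F -> C1 D (fun z => - F z).
Proof.
move=> [F' hF]; exists (fun z => - F' z) => z Dz.
have [F1 F2 F3] := hF z Dz; split; [|exact: ccontN|exact: ccontN].
by move=> c x m cx hc; rewrite mulNr; apply: cderN; exact: F1.
Qed.

Lemma C1B D F G : C1 D F -> C1 D G -> C1 D (fun z => F z - G z).
Proof. by move=> hF hG; apply: C1D => //; exact: C1N. Qed.

Lemma C1M D F G : C1 D F -> C1 D G -> C1 D (fun z => F z * G z).
Proof.
move=> [F' hF] [G' hG]; exists (fun z => F' z * G z + F z * G' z) => z Dz.
have [F1 F2 F3] := hF z Dz; have [G1 G2 G3] := hG z Dz; split.
- move=> c x m cx hc; apply: cder_eq (cderM (F1 _ _ _ cx hc) (G1 _ _ _ cx hc)) _.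
  by rewrite /= cx; ring.
- exact: ccontM.
- by apply: ccontD; exact: ccontM.
Qed.

Lemma C1V D F : C1 D F -> (forall z, D z -> F z != 0) -> C1 D (fun z => (F z)^-1).
Proof.
move=> [F' hF] F0; exists (fun z => - F' z * ((F z)^-1 * (F z)^-1)) => z Dz.
have [F1 F2 F3] := hF z Dz; have Fz := F0 z Dz; split.
- move=> c x m cx hc; have Fcx : (F \o c) x != 0 by rewrite /= cx.
  apply: cder_eq (cderV Fcx (F1 _ _ _ cx hc)) _.
  by rewrite /= cx expr2 invfM; ring.
- exact: ccontV.
- by apply: ccontM; [exact: ccontN|apply: ccontM; exact: ccontV].
Qed.

Lemma C1_comp D (D' : set R[i]) F G : C1 D F -> C1 D' G -> (forall z, D z -> D' (F z)) ->
  C1 D (fun z => G (F z)).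
Proof.
move=> [F' hF] [G' hG] FD; exists (fun z => G' (F z) * F' z) => z Dz.
have [F1 F2 F3] := hF z Dz; have [G1 G2 G3] := hG _ (FD z Dz); split.
- move=> c x m cx hc; rewrite -mulrA; apply: (G1 (F \o c)); first by rewrite /= cx.
  exact: F1.
- exact: ccont_comp.
- by apply: ccontM => //; exact: ccont_comp.
Qed.

Lemma C1_cexp D : C1 D cexp.
Proof.
exists cexp => z _; split; [|exact: ccont_cexp|exact: ccont_cexp].
by move=> c x m cx hc; rewrite -cx; exact: cder_cexp.
Qed.

Lemma C1_cpow (beta : R) : C1 slit (fun z => cpow z beta).
Proof.
exists (fun z => cpow z beta * (beta%:C%C * z^-1)) => z sz; split.
- move=> c x m cx hc; have sc : slit (c x) by rewrite cx.
  by apply: cder_eq (cder_cpow beta sc hc) _; rewrite cx; ring.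
- exact: ccont_cpow.
- apply: ccontM; first exact: ccont_cpow.
  by apply: ccontM; [exact: ccont_cst|apply: ccontV; [exact: ccont_id|exact: slit_neq0]].
Qed.

(** The mean value theorem holds for real functions only, so it is applied to both components; hence
    the factor 2. *)
Lemma cder_lipschitz (f f' : R -> R[i]) (M : R) : (forall t : R, 0 <= t <= 1 -> cder f t (f' t)) ->
  (forall t : R, 0 <= t <= 1 -> normc (f' t) <= M) -> normc (f 1 - f 0) <= 2 * M.
Proof.
move=> hf hM.
have key (g g' : R -> R) : (forall t : R, 0 <= t <= 1 -> is_derive t (1 : R) g (g' t)) ->
    (forall t : R, 0 <= t <= 1 -> `|g' t| <= M) -> `|g 1 - g 0| <= M.
  move=> hg hg'.
  have H1 (t : R) : t \in `]0, 1[ -> is_derive t (1 : R) g (g' t).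
    by rewrite in_itv /= => /andP[/ltW t0 /ltW t1]; apply: hg; rewrite t0 t1.
  have H2 : {within `[0, 1], continuous g}.
    apply: continuous_in_subspaceT => t; rewrite inE /= in_itv /= => t01.
    by apply: differentiable_continuous; apply/derivable1_diffP; case: (hg t t01).
  have [t] := MVT (@ltr01 R) H1 H2.
  rewrite in_itv /= => /andP[/ltW t0 /ltW t1] ->; rewrite subr0 mulr1.
  by apply: hg'; rewrite t0 t1.
have h1 := key (fun t => Re (f t)) (fun t => Re (f' t)) (fun t ht => (hf t ht).1)
  (fun t ht => le_trans (normc_Re _) (hM t ht)).
have h2 := key (fun t => Im (f t)) (fun t => Im (f' t)) (fun t ht => (hf t ht).2)
  (fun t ht => le_trans (normc_Im _) (hM t ht)).
apply: le_trans (normc_le_ReIm _) _; rewrite ReB ImB.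
by move: (lerD h1 h2); rewrite mulrDl mul1r.
Qed.

End C1_calculus.

(** * The exponential and the derivative of gamma *)

Section exponential.
Context {R : realType}.
Implicit Types (z w h : R[i]).

Lemma cexpD z w : cexp (z + w) = cexp z * cexp w.
Proof.
apply: complexP; rewrite ?ReM ?ImM /= ReD ImD expRD ?cosD ?sinD; ring.
Qed.

Lemma cexp0 : cexp (0 : R[i]) = 1.
Proof. by apply: complexP => /=; rewrite expR0 ?cos0 ?sin0 ?mulr1 ?mulr0. Qed.

Lemma normc_cexp z : normc (cexp z) = expR (Re z).
Proof.
have h : normc (cexp z) ^+ 2 = expR (Re z) ^+ 2.
  by rewrite normc_sqr /= !exprMn -mulrDr cos2Dsin2 mulr1.
by apply/eqP; rewrite -(@eqrXn2 _ 2) ?normc_ge0 ?expR_ge0// h.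
Qed.

Lemma cder_ray h (t : R) : cder (fun t => t%:C%C * h) t h.
Proof.
have h1 : cder (fun t : R => (t%:C)%C) t 1 by split; [exact: is_derive_id|exact: is_derive_cst].
by apply: cder_eq (cderM h1 (cder_cst h t)) _; rewrite mul1r mulr0 addr0.
Qed.

(** The mean value bound is used twice along the ray to [h]: for [cexp w - 1], and then for
    [cexp h - h], whose derivative contains that difference. *)
Lemma cexp_lin h : normc h <= 1 -> normc (cexp h - 1 - h) <= 4 * expR 1 * normc h ^+ 2.
Proof.
move=> h1.
have e1 w : normc w <= 1 -> normc (cexp w - 1) <= 2 * (expR 1 * normc w).
  move=> w1; have := @cder_lipschitz R (fun t => cexp (t%:C%C * w)) (fun t => cexp (t%:C%C * w) * w)
    (expR 1 * normc w) (fun t _ => cder_cexp (cder_ray w t)).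
  rewrite mul1r mul0r cexp0; apply=> t /andP[t0 t1].
  rewrite Normc.normcM ler_wpM2r ?normc_ge0// normc_cexp ler_expR ReM /= mul0r subr0.
  apply: le_trans (ler_norm _) _; rewrite normrM ger0_norm//.
  by apply: mulr_ile1 => //; exact: le_trans (normc_Re _) w1.
have := @cder_lipschitz R (fun t => cexp (t%:C%C * h) - t%:C%C * h) (fun t => cexp (t%:C%C * h) * h - h)
    (2 * (expR 1 * normc h) * normc h) (fun t _ => cderB (cder_cexp (cder_ray h t)) (cder_ray h t)).
rewrite mul1r mul0r cexp0 subr0 => H.
have -> : cexp h - 1 - h = cexp h - h - 1 by ring.
apply: le_trans (H _) _; last by rewrite expr2; lra.
move=> t /andP[t0 t1]; rewrite -[X in _ - X]mul1r -mulrBl Normc.normcM ler_wpM2r ?normc_ge0//.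
have th : normc (t%:C%C * h) <= normc h.
  by rewrite Normc.normcM normcR ger0_norm// ler_piMl// normc_ge0.
apply: le_trans (e1 _ (le_trans th h1)) _.
by rewrite ler_pM2l// ler_pM2l ?expR_gt0.
Qed.

Lemma ccoshE z : ccosh z = ((rcosh (Re z) * cos (Im z)) +i* (rsinh (Re z) * sin (Im z)))%C.
Proof.
have h2 : (2 : R[i])^-1 = (2^-1 : R)%:C%C by rewrite -(rmorph_nat (@real_complex R)) -fmorphV.
apply: complexP; rewrite /ccosh h2 /rcosh /rsinh ?ReM ?ImM ReD ImD /= ReN ImN cosN sinN; ring.
Qed.

Lemma csinhE z : csinh z = ((rsinh (Re z) * cos (Im z)) +i* (rcosh (Re z) * sin (Im z)))%C.
Proof.
have h2 : (2 : R[i])^-1 = (2^-1 : R)%:C%C by rewrite -(rmorph_nat (@real_complex R)) -fmorphV.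
apply: complexP; rewrite /csinh h2 /rcosh /rsinh ?ReM ?ImM ReB ImB /= ReN ImN cosN sinN; ring.
Qed.

Definition dgamma (b : R) z : R[i] := b%:C%C * (csinh z + 'i%C * ccosh z).

Lemma gammaE (b y s : R) : gamma b (y +i* s)%C =
  ((b * (rcosh y * (cos s - sin s))) +i* (b * (rsinh y * (cos s + sin s))))%C.
Proof. rewrite /gamma ccoshE csinhE; apply: complexP; rewrite ?ReM ?ImM ?ReD ?ImD ?ReM ?ImM /=; ring. Qed.

Lemma dgammaE (b y s : R) : dgamma b (y +i* s)%C =
  ((b * (rsinh y * (cos s - sin s))) +i* (b * (rcosh y * (cos s + sin s))))%C.
Proof. rewrite /dgamma ccoshE csinhE; apply: complexP; rewrite ?ReM ?ImM ?ReD ?ImD ?ReM ?ImM /=; ring. Qed.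

(** [gamma] is the combination of [cexp z] and [cexp (- z)] with coefficients [b (1 + i) / 2] and
    [b (1 - i) / 2]. *)
Lemma gamma_increment (b : R) z h : gamma b (h + z) - gamma b z - h * dgamma b z =
  b%:C%C / 2 * ((1 + 'i%C) * cexp z * (cexp h - 1 - h) + (1 - 'i%C) * cexp (- z) * (cexp (- h) - 1 - - h)).
Proof. by rewrite /gamma /dgamma /ccosh /csinh opprD !cexpD; field. Qed.

(** [gamma'] is a derivative over the field [R[i]], whereas estimates are made on the closed form
    [dgamma]. The quadratic remainder in [gamma_increment] settles the limit. *)
Lemma gamma'E (b : R) z : gamma' b z = dgamma b z.
Proof.
rewrite /gamma' /derive1; apply: (cvg_lim (@norm_hausdorff _ R[i]^o)).
pose K := normc (b%:C%C / 2) * (normc ((1 + 'i%C) * cexp z) + normc ((1 - 'i%C) * cexp (- z))) * (4 * expR 1).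
have K0 : 0 <= K.
  by rewrite !mulr_ge0 ?addr_ge0 ?mulr_ge0 ?normc_ge0// expR_ge0.
have hK h : normc h <= 1 -> normc (gamma b (h + z) - gamma b z - h * dgamma b z) <= K * normc h ^+ 2.
  move=> h1; rewrite gamma_increment Normc.normcM /K -(mulrA _ (4 * expR 1)) -(mulrA (normc (b%:C%C / 2))).
  rewrite ler_wpM2l ?normc_ge0//.
  apply: le_trans (le_normcD _ _) _; rewrite [leRHS]mulrDl; apply: lerD.
    rewrite Normc.normcM ler_wpM2l ?normc_ge0//; exact: cexp_lin.
  rewrite Normc.normcM ler_wpM2l ?normc_ge0//.
  by have := @cexp_lin (- h); rewrite normcN; apply.
apply/cvgrPdist_le => e e0.
(* A positive element of [R[i]] is a positive real. *)
have [er er0 eE] : exists2 r : R, 0 < r & e = r%:C%C.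
  by move: e0; case: e => x y; rewrite ltcE /= => /andP[/eqP -> x0]; exists x.
pose d := Num.min 1 (er / (K + 1)).
have K1 : 0 < K + 1 by rewrite ltr_wpDl.
have d0 : 0 < d by rewrite lt_min ltr01 divr_gt0.
have d0c : 0 < (d%:C%C : R[i]) by rewrite ltcR.
have nz : \forall h \near (0 : R[i]^o)^', h != 0 /\ `|h| < (d%:C)%C.
  by apply: filterI; [exact: (@nbhs_dnbhs_neq R[i]^o 0)|exact: (@dnbhs0_lt _ R[i]^o _ d0c)].
apply: filterS nz => h [h0 hd].
have {hd} hd : normc h < d by move: hd; rewrite normc_def -normcE ltcR.
have h1 : normc h <= 1 by apply: le_trans (ltW hd) _; rewrite ge_min lexx.
have nh : 0 < normc h := normc_gt0 h0.
rewrite eE normc_def -normcE lecR.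
have -> : dgamma b z - h^-1 *: (gamma b (h + z) - gamma b z) =
    - (h^-1 * (gamma b (h + z) - gamma b z - h * dgamma b z)).
  by rewrite /GRing.scale /= [in RHS]mulrBr mulKf// opprB.
rewrite normcN Normc.normcM Normc.normcV mulrC ler_pdivrMr//.
apply: le_trans (hK h h1) _; rewrite expr2 mulrA ler_pM2r//.
have : normc h <= er / (K + 1) by apply: le_trans (ltW hd) _; rewrite ge_min lexx orbT.
rewrite ler_pdivlMr// => h2; apply: le_trans h2; rewrite mulrC ler_pM2l//.
by rewrite lerDl.
Qed.

Lemma C1_gamma (b : R) D : C1 D (gamma b).
Proof.
have hp : C1 D (fun z => cexp z) by exact: C1_cexp.
have hm : C1 D (fun z => cexp (- z)).
  by apply: (C1_comp (D' := setT) (C1N (C1_id D)) (C1_cexp _)).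
apply: C1M; first exact: C1_cst.
apply: C1D; first by apply: C1M; [exact: C1D|exact: C1_cst].
apply: C1M; first exact: C1_cst.
by apply: C1M; [exact: C1B|exact: C1_cst].
Qed.

Lemma C1_dgamma (b : R) D : C1 D (dgamma b).
Proof.
have hp : C1 D (fun z => cexp z) by exact: C1_cexp.
have hm : C1 D (fun z => cexp (- z)).
  by apply: (C1_comp (D' := setT) (C1N (C1_id D)) (C1_cexp _)).
apply: C1M; first exact: C1_cst.
apply: C1D; first by apply: C1M; [exact: C1B|exact: C1_cst].
apply: C1M; first exact: C1_cst.
by apply: C1M; [exact: C1D|exact: C1_cst].
Qed.

Lemma cder_gamma (b : R) (y : R) : cder (fun y : R => gamma b (y +i* 0)%C) y (dgamma b (y +i* 0)%C).
Proof.
have -> : (fun y : R => gamma b (y +i* 0)%C) = (fun y : R => ((b * rcosh y) +i* (b * rsinh y))%C).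
  by apply/funext => x; rewrite gammaE cos0 sin0 subr0 addr0 !mulr1.
have hp : is_derive y (1 : R) (fun y => expR y) (expR y) := is_derive_expR y.
have hn : is_derive y (1 : R) (fun y => expR (- y)) (expR (- y) * -1).
  exact: (der_comp (derN (is_derive_id y 1)) (is_derive_expR (- y))).
rewrite dgammaE cos0 sin0 subr0 addr0 !mulr1; split => /=.
  apply: derZ; apply: der_eq (derM (derD hp hn) (is_derive_cst (2^-1 : R) y 1)) _.
  by rewrite /rsinh /cst /=; ring.
apply: derZ; apply: der_eq (derM (derB hp hn) (is_derive_cst (2^-1 : R) y 1)) _.
by rewrite /rcosh /cst /=; ring.
Qed.

End exponential.

(** * The integration path *)

Section trigonometry.
Context {R : realType}.
Implicit Types (x y s d : R).

Let s2 : 0 < Num.sqrt 2 :> R. Proof. by rewrite sqrtr_gt0. Qed.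
Let p0 : 0 < (pi : R). Proof. exact: pi_gt0. Qed.

Lemma cos_piquarter_gt0 : 0 < cos (pi / 4) :> R.
Proof.
have h (x : R) : 0 < x -> - (x / 2) < x / 4 < x / 2 by move=> x0; apply/andP; split; lra.
by apply: cos_gt0_pihalf; exact: h.
Qed.

Lemma sqrt2_cos_piquarter : Num.sqrt 2 * cos (pi / 4) = 1 :> R.
Proof.
have c0 := cos_piquarter_gt0.
have e : pi / 4 *+ 2 = pi / 2 :> R by rewrite mulr2n; lra.
have := cos_mulr2n (pi / 4 : R); rewrite e cos_pihalf => /esym/eqP; rewrite subr_eq0 => /eqP h.
have : (Num.sqrt 2 * cos (pi / 4)) ^+ 2 = 1 :> R by rewrite exprMn sqr_sqrtr// mulr_natl.
by move=> /eqP; rewrite sqrf_eq1 => /orP[/eqP//|/eqP h2]; have := mulr_gt0 s2 c0; rewrite h2; lra.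
Qed.

Lemma sqrt2_sin_piquarter : Num.sqrt 2 * sin (pi / 4) = 1 :> R.
Proof.
have c0 := cos_piquarter_gt0.
have e := @tan_piquarter R; rewrite /tan in e.
have -> : sin (pi / 4) = cos (pi / 4) :> R by rewrite -[LHS](divfK (lt0r_neq0 c0)) e mul1r.
exact: sqrt2_cos_piquarter.
Qed.

(** [gamma] maps the line of height [s] onto a branch of a hyperbola with semi-axes
    [b * (cos s - sin s)] and [b * (cos s + sin s)]. *)
Lemma cosBsin s : cos s - sin s = Num.sqrt 2 * sin (pi / 4 - s).
Proof.
by rewrite sinB mulrBr !mulrA sqrt2_cos_piquarter sqrt2_sin_piquarter !mul1r.
Qed.

Lemma cosDsin s : cos s + sin s = Num.sqrt 2 * cos (pi / 4 - s).
Proof.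
by rewrite cosB mulrDr !mulrA sqrt2_cos_piquarter sqrt2_sin_piquarter !mul1r.
Qed.

Lemma cosBsin_gt0 s : - (pi / 4) <= s < pi / 4 -> 0 < cos s - sin s.
Proof.
move=> /andP[h1 h2]; rewrite cosBsin mulr_gt0//; apply: sin_gt0_pi.
by apply/andP; split; lra.
Qed.

Lemma cosDsin_gt0 s : - (pi / 4) < s <= pi / 4 -> 0 < cos s + sin s.
Proof.
move=> /andP[h1 h2]; rewrite cosDsin mulr_gt0//; apply: cos_gt0_pihalf.
by apply/andP; split; lra.
Qed.

Lemma le_sin x y : - (pi / 2) <= x -> x <= y -> y <= pi / 2 -> sin x <= sin y.
Proof.
move=> h1 h2 h3; move: (h2); rewrite le_eqVlt => /orP[/eqP ->//|xy].
by apply: ltW; rewrite ltr_sin// in_itv /=; apply/andP; split; lra.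
Qed.

Lemma le_cos x y : 0 <= x -> x <= y -> y <= pi -> cos y <= cos x.
Proof.
move=> h1 h2 h3; move: (h2); rewrite le_eqVlt => /orP[/eqP ->//|xy].
by apply: ltW; rewrite ltr_cos// in_itv /=; apply/andP; split; lra.
Qed.

Lemma cosBsin_ge s d : `|s| <= d -> d < pi / 4 -> Num.sqrt 2 * sin (pi / 4 - d) <= cos s - sin s.
Proof.
rewrite ler_norml => /andP[h1 h2] d4; rewrite cosBsin ler_wpM2l ?(ltW s2)//.
by apply: le_sin; lra.
Qed.

Lemma cosDsin_ge s d : `|s| <= d -> d < pi / 4 -> Num.sqrt 2 * sin (pi / 4 - d) <= cos s + sin s.
Proof.
move=> h1 h2; have := @cosBsin_ge (- s) d; rewrite normrN cosN sinN opprK.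
exact.
Qed.

(** The angle between the real axis and the asymptotes of the hyperbola traced by [gamma] at height
    [s]. *)
Lemma atan_ratio s : - (pi / 4) <= s < pi / 4 ->
  atan ((cos s + sin s) / (cos s - sin s)) = pi / 4 + s.
Proof.
move=> /andP[h1 h2].
have -> : (cos s + sin s) / (cos s - sin s) = tan (pi / 4 + s).
  rewrite cosBsin cosDsin /tan -mulf_div divff ?gt_eqF// mul1r.
  have e : pi / 4 - s = pi / 2 - (pi / 4 + s) by lra.
  by rewrite e sinB cosB cos_pihalf sin_pihalf !mul0r !mul1r subr0 add0r.
by rewrite tanK// in_itv /=; apply/andP; split; lra.
Qed.

Lemma rcosh_ge1 y : 1 <= rcosh y.
Proof.
rewrite /rcosh; have e : expR y * expR (- y) = 1 by rewrite -expRD subrr expR0.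
have h1 := expR_gt0 y; have h2 := expR_gt0 (- y).
have := sqr_ge0 (expR y - expR (- y)); move: e h1 h2; move: (expR y) (expR (- y)) => u v; nra.
Qed.

Lemma rcosh_sqr y : rcosh y ^+ 2 = 1 + rsinh y ^+ 2.
Proof.
rewrite /rcosh /rsinh; have e : expR y * expR (- y) = 1 by rewrite -expRD subrr expR0.
move: e; move: (expR y) (expR (- y)) => u v; nra.
Qed.

Lemma rcoshN y : rcosh (- y) = rcosh y. Proof. by rewrite /rcosh opprK addrC. Qed.
Lemma rsinhN y : rsinh (- y) = - rsinh y. Proof. by rewrite /rsinh opprK; lra. Qed.

Lemma rcosh_ge_exp y : expR `|y| / 2 <= rcosh y.
Proof.
rewrite /rcosh ler_pM2r//; have [y0|y0] := lerP 0 y.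
  by rewrite (ger0_norm y0) lerDl expR_ge0.
by rewrite (ltr0_norm y0) lerDr expR_ge0.
Qed.

Lemma rsinh_le_rcosh y : `|rsinh y| <= rcosh y.
Proof.
rewrite /rsinh /rcosh normrM [`|2^-1|]ger0_norm// ler_pM2r//.
by apply: le_trans (ler_normB _ _) _; rewrite !ger0_norm ?expR_ge0.
Qed.

Lemma rsinh_gt0 y : 0 < y -> 0 < rsinh y.
Proof. by move=> y0; rewrite /rsinh divr_gt0// subr_gt0 ltr_expR; lra. Qed.

Lemma rsinh_eq0 y : rsinh y = 0 -> y = 0.
Proof.
move=> h; case: (ltgtP y 0) => // y0; last by have := rsinh_gt0 y0; rewrite h ltxx.
by have := @rsinh_gt0 (- y); rewrite rsinhN h oppr0 ltxx oppr_gt0 y0 => /(_ isT).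
Qed.

End trigonometry.

Section gamma_bounds.
Context {R : realType}.
Variables (b : R).
Hypothesis b0 : 0 < b.
Implicit Types (y s d : R) (w : R[i]).

Let s2 : 0 < Num.sqrt 2 :> R. Proof. by rewrite sqrtr_gt0. Qed.
Let p0 : 0 < (pi : R). Proof. exact: pi_gt0. Qed.

Lemma Re_gamma y s : Re (gamma b (y +i* s)%C) = b * (rcosh y * (cos s - sin s)).
Proof. by rewrite gammaE. Qed.
Lemma Im_gamma y s : Im (gamma b (y +i* s)%C) = b * (rsinh y * (cos s + sin s)).
Proof. by rewrite gammaE. Qed.

Lemma Re_dgamma y s : Re (dgamma b (y +i* s)%C) = b * (rsinh y * (cos s - sin s)).
Proof. by rewrite dgammaE. Qed.
Lemma Im_dgamma y s : Im (dgamma b (y +i* s)%C) = b * (rcosh y * (cos s + sin s)).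
Proof. by rewrite dgammaE. Qed.

Lemma rcosh_gt0 y : 0 < rcosh y. Proof. exact: lt_le_trans ltr01 (rcosh_ge1 y). Qed.

Lemma Re_gamma_gt0 y s : - (pi / 4) <= s < pi / 4 -> 0 < Re (gamma b (y +i* s)%C).
Proof. by move=> /cosBsin_gt0 h; rewrite Re_gamma; exact: (mulr_gt0 b0 (mulr_gt0 (rcosh_gt0 y) h)). Qed.

Lemma slit_gamma y s : - (pi / 4) <= s < pi / 4 -> slit (gamma b (y +i* s)%C).
Proof. by move=> h; rewrite /slit Re_gamma_gt0. Qed.

(** The hyperbola stays between its asymptotes because [|sinh y| <= cosh y]. *)
Lemma carg_gamma y s : - (pi / 4) <= s < pi / 4 -> `|carg (gamma b (y +i* s)%C)| <= pi / 4 + s.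
Proof.
move=> ss; have pp := cosBsin_gt0 ss; rewrite (carg_right (Re_gamma_gt0 y ss)) Re_gamma Im_gamma.
have q0 : 0 <= cos s + sin s.
  by move: ss => /andP[h1 h2]; rewrite cosDsin mulr_ge0 ?(ltW s2)//; apply: cos_ge0_pihalf; apply/andP; split; lra.
rewrite -mulf_div divff ?gt_eqF// mul1r -(atan_ratio ss).
have c0 := rcosh_gt0 y; have := rsinh_le_rcosh y; rewrite ler_norml => /andP[h1 h2].
rewrite -mulf_div; set r := (cos s + sin s) / (cos s - sin s).
have r0 : 0 <= r by rewrite divr_ge0// ltW.
have t1 : rsinh y / rcosh y <= 1 by rewrite ler_pdivrMr// mul1r.
have t2 : -1 <= rsinh y / rcosh y by rewrite ler_pdivlMr// mulN1r.
rewrite ler_norml -atanN; apply/andP; split; apply: le_atan.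
  by rewrite -mulN1r ler_wpM2r.
by rewrite -[leRHS]mul1r ler_wpM2r.
Qed.

Lemma Re_cpow w (beta : R) : Re (cpow w beta) = expR (beta * ln (normc w)) * cos (beta * carg w).
Proof. by rewrite /cpow -[LHS]/(expR (Re _) * cos (Im _)) ReM ImM /= !mul0r subr0 addr0. Qed.

(** The modulus is bounded below through the real part, the cosine through the argument;
    [a <= pi / 2] keeps the cosine nonnegative. *)
Lemma Re_cpow_ge w (beta X a : R) : 0 < beta < 1 -> 0 < X -> X <= Re w -> `|carg w| <= a -> a <= pi / 2 ->
  cos (beta * a) * X `^ beta <= Re (cpow w beta).
Proof.
move=> /andP[be0 be1] X0 Xw ca a2.
have a0 : 0 <= a by apply: le_trans ca; exact: normr_ge0.
have ba : 0 <= beta * a by rewrite mulr_ge0// ltW.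
have ba2 : beta * a <= pi / 2 by apply: le_trans a2; rewrite ler_piMl// ltW.
have c0 : 0 <= cos (beta * a) by apply: cos_ge0_pihalf; apply/andP; split; lra.
rewrite Re_cpow mulrC; apply: ler_pM => //; first exact: powR_ge0.
  rewrite /powR gt_eqF// ler_expR ler_wpM2l ?(ltW be0)// ler_ln ?posrE//.
    by apply: le_trans Xw _; apply: le_trans (ler_norm _) (normc_Re _).
  by apply: lt_le_trans X0 _; apply: le_trans Xw _; apply: le_trans (ler_norm _) (normc_Re _).
rewrite -[leRHS]cos_norm normrM (gtr0_norm be0); apply: le_cos.
- by rewrite mulr_ge0// ltW.
- by rewrite ler_wpM2l// ltW.
- lra.
Qed.

Lemma powR_cosh_ge y (beta : R) : 0 < beta -> 2 `^ (- beta) * expR (`|y| * beta) <= rcosh y `^ beta.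
Proof.
move=> be0; have e0 := expR_gt0 `|y|.
have -> : 2 `^ (- beta) * expR (`|y| * beta) = (expR `|y| / 2) `^ beta.
  rewrite /powR !gt_eqF ?divr_gt0// lnM ?posrE// lnV ?posrE// expRK -expRD.
  by congr expR; ring.
apply: ge0_ler_powR; last exact: rcosh_ge_exp.
- exact: ltW.
- by rewrite nnegrE divr_ge0// ltW.
- by rewrite nnegrE ltW// rcosh_gt0.
Qed.

(** The origin of [kappa] and of the power of 2: the argument of [gamma] is at most [pi / 4 + d],
    its real part is at least [sqrt 2 * b * sin (pi / 4 - d) * cosh y], and [cosh y] is at least
    [expR |y| / 2]. *)
Lemma Re_gamma_pow_ge (beta d : R) y s : 0 < beta < 1 -> 0 < d < pi / 4 -> `|s| <= d ->
  kappa b beta d * 2 `^ (- beta) * expR (`|y| * beta) <= Re (cpow (gamma b (y +i* s)%C) beta).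
Proof.
move=> be /andP[d0 d4] sd; have [be0 be1] := andP be.
have X0 : 0 < Num.sqrt 2 * b * sin (pi / 4 - d).
  by rewrite !mulr_gt0//; apply: sin_gt0_pi; apply/andP; split; lra.
have ss : - (pi / 4) <= s < pi / 4.
  by move: sd; rewrite ler_norml => /andP[h1 h2]; apply/andP; split; lra.
have c0 : 0 <= cos (beta * (pi / 4 + d)).
  apply: cos_ge0_pihalf; have : 0 <= beta * (pi / 4 + d) by rewrite mulr_ge0 ?ltW//; lra.
  have : beta * (pi / 4 + d) <= pi / 2 by have : beta * (pi / 4 + d) <= pi / 4 + d; [rewrite ler_piMl//; lra|lra].
  by move=> h1 h2; apply/andP; split; lra.
have := @Re_cpow_ge (gamma b (y +i* s)%C) beta (Num.sqrt 2 * b * sin (pi / 4 - d) * rcosh y) (pi / 4 + d) be.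
rewrite mulr_gt0 ?rcosh_gt0// => /(_ isT) H.
apply: le_trans (H _ _ _).
- rewrite /kappa (powRM _ (ltW X0) (ltW (rcosh_gt0 y))) [leRHS]mulrA -mulrA ler_wpM2l//.
    by rewrite mulr_ge0// powR_ge0.
  exact: powR_cosh_ge.
- rewrite Re_gamma [leRHS](_ : _ = b * (cos s - sin s) * rcosh y); last by ring.
  rewrite ler_wpM2r ?(ltW (rcosh_gt0 y))// [leLHS](_ : _ = b * (Num.sqrt 2 * sin (pi / 4 - d))); last by ring.
  by rewrite ler_wpM2l ?(ltW b0)//; exact: cosBsin_ge.
- apply: le_trans (carg_gamma y ss) _; rewrite lerD2l; exact: le_trans (ler_norm _) sd.
- lra.
Qed.

Lemma kappa_gt0 (beta d : R) : 0 < beta < 1 -> 0 < d < pi / 4 -> 0 < kappa b beta d.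
Proof.
move=> /andP[be0 be1] /andP[d0 d4]; rewrite mulr_gt0//; last first.
  by rewrite powR_gt0// !mulr_gt0//; apply: sin_gt0_pi; apply/andP; split; lra.
apply: cos_gt0_pihalf; have : 0 <= beta * (pi / 4 + d) by rewrite mulr_ge0 ?ltW//; lra.
have : beta * (pi / 4 + d) <= pi / 4 + d by rewrite ler_piMl//; lra.
by move=> h1 h2; apply/andP; split; lra.
Qed.

Lemma dgamma_le y s : normc (dgamma b (y +i* s)%C) <= b * (4 * rcosh y).
Proof.
apply: le_trans (normc_le_ReIm _) _; rewrite Re_dgamma Im_dgamma !(normrM b) (normrM (rsinh y)) (normrM (rcosh y)) (gtr0_norm b0) -mulrDr ler_pM2l//.
have h1 : `|rsinh y| * `|cos s - sin s| <= rcosh y * 2.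
  apply: ler_pM; rewrite ?normr_ge0 ?rsinh_le_rcosh//.
  by apply: le_trans (ler_normB _ _) _; have := cos_max s; have := sin_max s; lra.
have h2 : `|rcosh y| * `|cos s + sin s| <= rcosh y * 2.
  rewrite (gtr0_norm (rcosh_gt0 y)) ler_pM2l ?rcosh_gt0//.
  by apply: le_trans (ler_normD _ _) _; have := cos_max s; have := sin_max s; lra.
lra.
Qed.

(* When cosh y is close to 1 the distance of lambda to gamma is bounded below
   through the real part; otherwise the imaginary part is comparable to cosh y. *)
Lemma dgamma_ratio (lambda1 d : R) : b < lambda1 / Num.sqrt 2 -> 0 < d < pi / 4 ->
  exists2 C0 : R, 0 < C0 & forall lambda y s, lambda1 <= lambda -> `|s| <= d ->
    normc (dgamma b (y +i* s)%C) <= C0 * normc (gamma b (y +i* s)%C - lambda%:C%C).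
Proof.
move=> bl /andP[d0 d4].
have bl' : b * Num.sqrt 2 < lambda1 by rewrite -ltr_pdivlMr.
pose B := b * Num.sqrt 2; have B0 : 0 < B by rewrite mulr_gt0.
(* [B * m] is the midpoint of [B] and [lambda1], so where [cosh y <= m] the real part of [gamma]
   stays below [lambda1] by a fixed amount. *)
pose m := (1 + lambda1 / B) / 2.
have r1 : 1 < lambda1 / B by rewrite ltr_pdivlMr// mul1r.
have m1 : 1 < m by rewrite /m; lra.
have BmE : B * m = (B + lambda1) / 2 by rewrite /m; field; exact: lt0r_neq0.
have Bl : B < lambda1 := bl'.
have Bm : B * m < lambda1 by rewrite BmE; lra.
pose c1 := (lambda1 - B * m) / m; have c10 : 0 < c1 by rewrite divr_gt0 ?subr_gt0//; lra.
pose q := Num.sqrt 2 * sin (pi / 4 - d).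
have q0 : 0 < q by rewrite mulr_gt0//; apply: sin_gt0_pi; apply/andP; split; lra.
(* [|sinh y| >= r * cosh y] as soon as [cosh y >= m]. *)
pose r := Num.sqrt (1 - (m ^+ 2)^-1).
have mm : (m ^+ 2)^-1 < 1 by rewrite invf_lt1 ?exprn_gt0 ?exprn_egt1//; lra.
have r0 : 0 < r by rewrite sqrtr_gt0 subr_gt0.
pose c2 := b * (r * q); have c20 : 0 < c2 by exact: (mulr_gt0 b0 (mulr_gt0 r0 q0)).
pose c := Num.min c1 c2; have c0 : 0 < c by rewrite lt_min c10 c20.
exists (b * 4 / c); first by rewrite divr_gt0// mulr_gt0.
move=> lambda y s ll sd; have ch := rcosh_gt0 y.
suff H : c * rcosh y <= normc (gamma b (y +i* s)%C - lambda%:C%C).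
  apply: le_trans (dgamma_le y s) _; rewrite -[leRHS]mulrA [leLHS]mulrA ler_pM2l ?mulr_gt0//.
  by rewrite mulrC ler_pdivlMr// mulrC.
have [hm|hm] := lerP (rcosh y) m.
  apply: le_trans (normc_Re _); rewrite ReB Re_gamma /= distrC; apply: le_trans (ler_norm _).
  have pl : cos s - sin s <= Num.sqrt 2 by rewrite cosBsin -[leRHS]mulr1 ler_wpM2l ?(ltW s2)// sin_le1.
  have h1 : b * (rcosh y * (cos s - sin s)) <= B * m.
    rewrite /B -mulrA ler_pM2l// mulrC; apply: le_trans (_ : Num.sqrt 2 * rcosh y <= _).
      by rewrite ler_pM2r.
    by rewrite ler_pM2l.
  apply: (@le_trans _ _ (c1 * m)); last by rewrite /c1 mulfVK ?gt_eqF//; lra.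
  by apply: ler_pM => //; rewrite ?(ltW c0) ?(ltW ch)// ge_min lexx.
apply: le_trans (normc_Im _); rewrite ImB Im_gamma Im_real subr0 (normrM b) (normrM (rsinh y)) (gtr0_norm b0).
have qs : q <= `|cos s + sin s| by apply: le_trans (ler_norm _); exact: cosDsin_ge.
have sh : r * rcosh y <= `|rsinh y|.
  rewrite -(@ler_pXn2r _ 2) ?nnegrE ?normr_ge0 ?mulr_ge0 ?(ltW r0) ?(ltW ch)//.
  rewrite exprMn sqr_sqrtr; last by rewrite subr_ge0 ltW.
  rewrite real_normK ?num_real// mulrBl mul1r rcosh_sqr.
  have : 1 <= (m ^+ 2)^-1 * rcosh y ^+ 2.
    rewrite mulrC ler_pdivlMr ?exprn_gt0// ?mul1r; last by lra.
    by rewrite ler_pXn2r ?nnegrE ?ltW//; lra.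
  by rewrite rcosh_sqr; lra.
apply: (@le_trans _ _ (c2 * rcosh y)).
  by rewrite ler_pM2r// ge_min lexx orbT.
rewrite /c2 -(mulrA b) ler_pM2l// (mulrAC r).
exact: (ler_pM (mulr_ge0 (ltW r0) (ltW ch)) (ltW q0) sh qs).
Qed.

End gamma_bounds.

Section real_values.
Context {R : realType}.
Implicit Types (z w : R[i]).

Lemma Im0M z w : Im z = 0 -> Im w = 0 -> Im (z * w) = 0.
Proof. by move=> h1 h2; rewrite ImM h1 h2 mulr0 mul0r addr0. Qed.
Lemma Im0B z w : Im z = 0 -> Im w = 0 -> Im (z - w) = 0.
Proof. by move=> h1 h2; rewrite ImB h1 h2 subr0. Qed.
Lemma Im0V z : Im z = 0 -> Im z^-1 = 0.
Proof. by move=> h1; rewrite ImV h1 oppr0 mul0r. Qed.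
Lemma Re0M z w : Im z = 0 -> Re w = 0 -> Re (z * w) = 0.
Proof. by move=> h1 h2; rewrite ReM h1 h2 mulr0 mul0r subr0. Qed.

Lemma complex_real z : Im z = 0 -> z = (Re z)%:C%C.
Proof. by case: z => x y /= ->. Qed.

Lemma cpow_real (x beta : R) : 0 < x -> cpow x%:C%C beta = (x `^ beta)%:C%C.
Proof.
move=> x0; have ca : carg (x%:C)%C = 0 :> R by rewrite carg_right//= mul0r atan0.
rewrite /cpow /cexp ReM ImM -[Im (cln _)]/(carg _) -[Re (cln _)]/(ln (normc _)) ca Re_real Im_real.
rewrite !mul0r mulr0 subr0 addr0 cos0 sin0 mulr1 mulr0 normcR gtr0_norm//.
by rewrite /powR gt_eqF.
Qed.

Lemma Rintegral_itv_bound (g : R -> R) (a b M : R) : a <= b ->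
  {within `[a, b], continuous g} -> (forall x, a <= x <= b -> `|g x| <= M) ->
  `|\int[@lebesgue_measure R]_(x in `[a, b]) g x| <= M * (b - a).
Proof.
move=> ab cg gM.
have ig : (@lebesgue_measure R).-integrable `[a, b] (EFin \o g).
  by apply: continuous_compact_integrable => //; exact: segment_compact.
have iM : (@lebesgue_measure R).-integrable `[a, b] (EFin \o cst M).
  by apply: continuous_itv_integrable; exact: cst_continuous.
apply: le_trans (le_normr_Rintegral _ ig) _ => //.
apply: (@le_trans _ _ (\int[@lebesgue_measure R]_(x in `[a, b]) cst M x)).
  apply: le_Rintegral => //.
  exact: (integrable_norm ig).
rewrite Rintegral_cst//= lebesgue_measure_itv /= lte_fin; move: ab.
by rewrite le_eqVlt => /predU1P[->|->]//; rewrite ltxx subrr mulr0.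
Qed.

End real_values.

Lemma le_rcosh (R : realType) (x y : R) : 0 <= x -> x <= y -> rcosh x <= rcosh y.
Proof.
move=> x0 xy; rewrite /rcosh ler_pM2r// !expRN.
have h : expR x <= expR y by rewrite ler_expR.
have ex : 1 <= expR x by rewrite -expR0 ler_expR.
have ux : 0 < expR x := expR_gt0 x; have uy : 0 < expR y := expR_gt0 y.
have e : expR y + (expR y)^-1 - (expR x + (expR x)^-1) = (expR y - expR x) * (1 - (expR x * expR y)^-1).
  by field; rewrite !gt_eqF.
rewrite -subr_ge0 e mulr_ge0 ?subr_ge0// invf_le1 ?mulr_gt0//.
by rewrite -[leLHS]mulr1; apply: ler_pM => //; exact: le_trans h.
Qed.


Lemma mem_itvcc (R : realType) (a b x : R) : x \in `[a, b]%classic -> a <= x <= b.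
Proof. by rewrite inE /= in_itv. Qed.

(** * The contour integral of the semigroup symbol *)

Section semigroup_symbol.
#[local] Arguments gamma {R} b z : simpl never.
#[local] Arguments dgamma {R} b z : simpl never.
#[local] Arguments g_fun {R} b beta lambda z t : simpl never.
#[local] Arguments carg {R} z : simpl never.
Context {R : realType}.
Variables (b beta t lambda : R).
Hypotheses (b0 : 0 < b) (be : 0 < beta < 1) (t0 : 0 < t) (bl : b * Num.sqrt 2 < lambda).
Local Notation mu := (@lebesgue_measure R).
Implicit Types (y s Y : R) (z w : R[i]).

Definition symbol (beta t : R) (w : R[i]) : R[i] := cexp (- (t%:C%C * cpow w beta)).

#[local] Arguments symbol beta t w : simpl never.

Local Notation E := (symbol beta t).
Local Notation el := (expR (- (t * lambda `^ beta))).
Local Notation lc := (lambda%:C%C : R[i]).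

Lemma g_funE z : g_fun b beta lambda z t = E (gamma b z) * (gamma b z - lc)^-1 * dgamma b z.
Proof. by rewrite /g_fun gamma'E. Qed.

Lemma C1_symbol : C1 slit E.
Proof.
apply: (C1_comp (D' := setT) _ (C1_cexp _)) => //.
by apply: C1N; apply: C1M; [exact: C1_cst|exact: C1_cpow].
Qed.

Lemma symbol_real (x : R) : 0 < x -> E x%:C%C = (expR (- (t * x `^ beta)))%:C%C.
Proof.
by move=> x0; rewrite /symbol cpow_real// -rmorphM -rmorphN /cexp /= cos0 sin0 mulr1 mulr0.
Qed.

Lemma normc_symbol w : normc (E w) = expR (- (t * Re (cpow w beta))).
Proof. by rewrite /symbol normc_cexp ReN ReM Re_real Im_real mul0r subr0. Qed.

Let l0 : 0 < lambda. Proof. by apply: lt_trans bl; rewrite mulr_gt0// sqrtr_gt0. Qed.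
Let p0 : 0 < (pi : R). Proof. exact: pi_gt0. Qed.
Let s2 : 0 < Num.sqrt 2 :> R. Proof. by rewrite sqrtr_gt0. Qed.
Let p4 : 0 < (pi / 4 : R). Proof. by rewrite divr_gt0. Qed.

(** Closed below, since the path is moved down to [Im z = - pi / 4]; open above, where [gamma]
    becomes imaginary and passes through 0. *)
Definition regular z := - (pi / 4) <= Im z < pi / 4 /\ gamma b z != lc.

Lemma C1_gamma_part D (G : R[i] -> R[i]) : C1 slit G ->
  (forall z, D z -> - (pi / 4) <= Im z < pi / 4) -> C1 D (fun z => G (gamma b z)).
Proof.
move=> hG hD; apply: (C1_comp (C1_gamma b D) hG) => z /hD.
by case: z => x y /= h; exact: slit_gamma.
Qed.

Lemma C1_g : C1 regular (fun z => g_fun b beta lambda z t).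
Proof.
apply: (C1_ext (fun z => esym (g_funE z))); apply: C1M; last exact: C1_dgamma.
apply: C1M; first by apply: C1_gamma_part C1_symbol _ => z [].
apply: C1V; first by apply: C1B; [exact: C1_gamma|exact: C1_cst].
by move=> z [_ h]; rewrite subr_eq0.
Qed.

(* The symbol minus a multiple of 1/w vanishing together with it at lambda: the
   quotient is bounded near lambda, and its total integral can be computed by
   pushing the path onto the real axis, where it becomes real. *)
Definition reduced z : R[i] :=
  (E (gamma b z) - el%:C%C * lc / gamma b z) * (gamma b z - lc)^-1 * dgamma b z.

#[local] Arguments reduced z : simpl never.

Lemma C1_reduced : C1 regular reduced.
Proof.
apply: C1M; last exact: C1_dgamma.
apply: C1M; last first.
  apply: C1V; first by apply: C1B; [exact: C1_gamma|exact: C1_cst].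
  by move=> z [_ h]; rewrite subr_eq0.
apply: C1B; first by apply: C1_gamma_part C1_symbol _ => z [].
apply: C1M; first exact: C1_cst.
apply: C1_gamma_part (C1V (C1_id _) slit_neq0) _ => z [].
by [].
Qed.

(** Inside the strip [gamma] is real only at [y = 0], where it is at most [b * sqrt 2], less than
    [lambda]. *)
Lemma gamma_neq y s : - (pi / 4) < s < pi / 4 -> gamma b (y +i* s)%C != lc.
Proof.
move=> /andP[h1 h2]; rewrite gammaE eq_complex /=; apply/negP => /andP[/eqP hr /eqP hi].
have q0 : 0 < cos s + sin s by apply: cosDsin_gt0; rewrite h1 ltW.
have y0 : y = 0.
  move/eqP: hi; rewrite mulf_eq0 gt_eqF//= mulf_eq0 (gt_eqF q0) orbF => /eqP.
  exact: rsinh_eq0.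
move: hr; rewrite y0 /rcosh oppr0 expR0 (_ : (1 + 1) / 2 = 1 :> R); last by lra.
rewrite mul1r => hr; move: bl; rewrite -hr ltNge => /negP; apply.
by rewrite ler_pM2l// cosBsin -[leRHS]mulr1 ler_wpM2l ?(ltW s2)// sin_le1.
Qed.

Lemma regular_strip y s : - (pi / 4) < s < pi / 4 -> regular (y +i* s)%C.
Proof.
by move=> ss; split; [case/andP: ss => h1 h2 /=; rewrite (ltW h1) h2|exact: gamma_neq].
Qed.

Let cq : cos (- (pi / 4)) + sin (- (pi / 4)) = 0 :> R.
Proof. by rewrite cosDsin opprK (_ : pi / 4 + pi / 4 = pi / 2 :> R) ?cos_pihalf ?mulr0//; lra. Qed.
Let cp : cos (- (pi / 4)) - sin (- (pi / 4)) = Num.sqrt 2 :> R.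
Proof. by rewrite cosBsin opprK (_ : pi / 4 + pi / 4 = pi / 2 :> R) ?sin_pihalf ?mulr1//; lra. Qed.

(** At height [- pi / 4] both [gamma] and [dgamma] are real. A pole is harmless: inverting 0 gives
    0, again real. *)
Lemma Im_reduced_bottom y : Im (reduced (y +i* (- (pi / 4)))%C) = 0.
Proof.
have hg : Im (gamma b (y +i* (- (pi / 4)))%C) = 0 by rewrite Im_gamma cq !mulr0.
have hr : 0 < Re (gamma b (y +i* (- (pi / 4)))%C) by rewrite Re_gamma cp; exact: (mulr_gt0 b0 (mulr_gt0 (rcosh_gt0 y) s2)).
have hd : Im (dgamma b (y +i* (- (pi / 4)))%C) = 0 by rewrite Im_dgamma cq !mulr0.
rewrite /reduced; apply: Im0M => //; apply: Im0M; last by apply: Im0V; exact: Im0B.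
apply: Im0B; first by rewrite (complex_real hg) symbol_real.
by apply: Im0M; [exact: Im0M|exact: Im0V].
Qed.

(** On the imaginary axis [gamma] is real and [dgamma] purely imaginary. *)
Lemma Re_reduced_left s : - (pi / 4) <= s < pi / 4 -> Re (reduced (0 +i* s)%C) = 0.
Proof.
move=> ss; have sh0 : rsinh 0 = 0 :> R by rewrite /rsinh oppr0 subrr mul0r.
have hg : Im (gamma b (0 +i* s)%C) = 0 by rewrite Im_gamma sh0 mul0r mulr0.
have hr := Re_gamma_gt0 b0 0 ss.
have hd : Re (dgamma b (0 +i* s)%C) = 0 by rewrite Re_dgamma sh0 mul0r mulr0.
rewrite /reduced; apply: Re0M => //; apply: Im0M; last by apply: Im0V; exact: Im0B.
apply: Im0B; first by rewrite (complex_real hg) symbol_real.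
by apply: Im0M; [exact: Im0M|exact: Im0V].
Qed.

Let p_ge1 s : - (pi / 4) <= s <= 0 -> 1 <= cos s - sin s.
Proof.
move=> /andP[h1 h2]; rewrite cosBsin -[leLHS]sqrt2_sin_piquarter ler_wpM2l ?(ltW s2)//.
by apply: le_sin; lra.
Qed.

Lemma Re_gamma_ge y s : - (pi / 4) <= s <= 0 -> b * rcosh y <= Re (gamma b (y +i* s)%C).
Proof.
by move=> /p_ge1 h; rewrite Re_gamma ler_pM2l// ler_pMr// rcosh_gt0.
Qed.

Lemma gamma_le y s : `|Re (gamma b (y +i* s)%C)| <= b * (2 * rcosh y) /\
  `|Im (gamma b (y +i* s)%C)| <= b * (2 * rcosh y).
Proof.
rewrite Re_gamma Im_gamma !(normrM b) (normrM (rsinh y)) (normrM (rcosh y)) (gtr0_norm b0) !ler_pM2l//.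
rewrite (gtr0_norm (rcosh_gt0 y)) mulrC; split.
  rewrite ler_pM2r ?rcosh_gt0//; apply: le_trans (ler_normB _ _) _.
  by have := cos_max s; have := sin_max s; lra.
rewrite mulrC; apply: ler_pM; rewrite ?normr_ge0 ?rsinh_le_rcosh//.
apply: le_trans (ler_normD _ _) _.
by have := cos_max s; have := sin_max s; lra.
Qed.

(** The rectangle is convex and lies in the right half-plane, so the segment from [lambda] to [w]
    stays in it and a compactness bound on the derivative applies. *)
Lemma symbol_lipschitz (X : R) : lambda <= X -> exists2 K, 0 <= K & forall w, b <= Re w <= X -> `|Im w| <= X ->
  normc (E w - el%:C%C) <= K * normc (w - lc).
Proof.
move=> lX; have [E' hE] := C1_symbol.
have bb : b < lambda.
  apply: le_lt_trans bl; rewrite ler_pMr// -[leLHS]sqrtr1 ler_wsqrtr// ler1n//.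
have sl x y : b <= x <= X -> - X <= y <= X -> slit (x +i* y)%C.
  by move=> /andP[h _] _; rewrite /slit /= (lt_le_trans b0 h).
have cE x y (hx : b <= x <= X) (hy : - X <= y <= X) : ccvg (nbhs (x, y)) (fun p : R * R => E' (p.1 +i* p.2)%C) (E' (x +i* y)%C).
  by apply: ccont_joint; have [] := hE _ (sl x y hx hy).
have [K1 HK1] := rectangle_bounded (w := fun x y => Re (E' (x +i* y)%C)) (fun x y hx hy => (cE x y hx hy).1).
have [K2 HK2] := rectangle_bounded (w := fun x y => Im (E' (x +i* y)%C)) (fun x y hx hy => (cE x y hx hy).2).
have X0 : 0 <= X by apply: le_trans lX; exact: ltW.
have KK : 0 <= K1 + K2.
  have hl : b <= lambda <= X by rewrite (ltW bb) lX.
  have h0 : - X <= 0 <= X by rewrite oppr_le0 X0.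
  by apply: addr_ge0; [apply: le_trans (HK1 lambda 0 hl h0)|apply: le_trans (HK2 lambda 0 hl h0)]; exact: normr_ge0.
exists (2 * (K1 + K2)); first by rewrite mulr_ge0.
move=> w wr wi; have hw : forall tau, 0 <= tau <= 1 ->
    b <= Re (lc + tau%:C%C * (w - lc)) <= X /\ - X <= Im (lc + tau%:C%C * (w - lc)) <= X.
  move=> tau /andP[h0 h1]; move: wr wi; rewrite ler_norml => /andP[r1 r2] /andP[i1 i2].
  rewrite ReD ImD ReM ImM ReB ImB /= !mul0r !subr0 addr0 add0r.
  have bw : b <= lambda by exact: ltW.
  by split; apply/andP; split; nra.
have e0 : E lc = el%:C%C by rewrite symbol_real.
have := @cder_lipschitz R (fun tau => E (lc + tau%:C%C * (w - lc)))
  (fun tau => E' (lc + tau%:C%C * (w - lc)) * (w - lc)) ((K1 + K2) * normc (w - lc)).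
rewrite mul1r mul0r addr0 (addrC lc) subrK e0 => H; rewrite -mulrA; apply: H.
  move=> tau ht; have [hr hi] := hw tau ht.
  have sw : slit (lc + tau%:C%C * (w - lc)).
    by move: (sl _ _ hr hi); case: (lc + _).
  have [h _ _] := hE _ sw; apply: (h _ _ _ erefl).
  by apply: cder_eq (cderD (cder_cst lc tau) (cder_ray (w - lc) tau)) _; rewrite add0r.
move=> tau ht; have [hr hi] := hw tau ht; rewrite Normc.normcM ler_wpM2r ?normc_ge0//.
apply: le_trans (normc_le_ReIm _) _.
have := lerD (HK1 _ _ hr hi) (HK2 _ _ hr hi).
by case: (lc + _).
Qed.

(** The numerator vanishes where [gamma = lambda] and is Lipschitz there, which cancels the pole
    uniformly up to the lower edge. *)
Lemma reduced_bounded Y : exists K, forall y s, 0 <= y <= Y -> - (pi / 4) < s <= 0 ->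
  normc (reduced (y +i* s)%C) <= K.
Proof.
pose X := b * (2 * rcosh Y) + lambda.
have Y0 : 0 <= b * (2 * rcosh Y) by rewrite mulr_ge0 ?(ltW b0)// mulr_ge0// ltW// rcosh_gt0.
have lX : lambda <= X by rewrite /X lerDr.
have [K K0 HK] := symbol_lipschitz lX.
exists ((K + el / b) * (b * (4 * rcosh Y))) => y s /andP[y0 yY] /andP[h1 h2].
have ss : - (pi / 4) <= s <= 0 by rewrite ltW.
have ss' : - (pi / 4) < s < pi / 4 by rewrite h1 (le_lt_trans h2).
have cy : rcosh y <= rcosh Y by exact: le_rcosh.
have bg : b <= Re (gamma b (y +i* s)%C).
  by apply: le_trans (Re_gamma_ge y ss); rewrite ler_pMr// rcosh_ge1.
have [g1 g2] := gamma_le y s.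
have gX : b * (2 * rcosh y) <= X.
  by rewrite /X; apply: ler_wpDr; [exact: ltW|rewrite ler_pM2l// ler_pM2l].
have gn : gamma b (y +i* s)%C - lc != 0 by rewrite subr_eq0; exact: gamma_neq.
have gn0 : gamma b (y +i* s)%C != 0.
  by apply/eqP => e; move: bg; rewrite e /= leNgt b0.
rewrite /reduced Normc.normcM; apply: ler_pM; rewrite ?normc_ge0//; last first.
  by apply: le_trans (dgamma_le b0 y s) _; rewrite ler_pM2l// ler_pM2l.
rewrite Normc.normcM Normc.normcV ler_pdivrMr ?normc_gt0// mulrDl.
(* The first summand is Lipschitz in [gamma - lambda], the second contains that factor. *)
have -> : E (gamma b (y +i* s)%C) - el%:C%C * lc / gamma b (y +i* s)%C =
  (E (gamma b (y +i* s)%C) - el%:C%C) + el%:C%C / gamma b (y +i* s)%C * (gamma b (y +i* s)%C - lc).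
  by field.
apply: le_trans (le_normcD _ _) _; apply: lerD.
  apply: HK; last exact: le_trans g2 gX.
  by rewrite bg; apply: le_trans gX; apply: le_trans (ler_norm _) g1.
rewrite Normc.normcM ler_wpM2r ?normc_ge0// Normc.normcM Normc.normcV normcR ger0_norm ?expR_ge0//.
rewrite ler_pM2l ?expR_gt0// lef_pV2 ?posrE ?normc_gt0//.
by apply: le_trans bg _; apply: le_trans (ler_norm _) (normc_Re _).
Qed.

(** The right edge has fixed length, so decay of order [1 / Y] is enough:
    [dgamma / (gamma - lambda)] is at most 8 in modulus, and the exponential and [1 / gamma] are
    both at most of that order. *)
Lemma reduced_decay : exists C Y0, forall Y s, Y0 <= Y -> - (pi / 4) <= s <= 0 ->
  regular (Y +i* s)%C /\ normc (reduced (Y +i* s)%C) <= C / Y.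
Proof.
have [be0 be1] := andP be.
have cb : 0 < cos (beta * (pi / 4)).
  apply: cos_gt0_pihalf; have h1 : 0 < beta * (pi / 4) by rewrite mulr_gt0.
  have h2 : beta * (pi / 4) < pi / 4 by rewrite gtr_pMl.
  by apply/andP; split; lra.
pose A := t * (cos (beta * (pi / 4)) * (b `^ beta * (2 `^ (- beta) * beta))).
have A0 : 0 < A by rewrite !mulr_gt0// powR_gt0.
(* From this [Y] on, [b * cosh Y >= b * Y / 2 >= 2 * lambda], so [gamma] is far from [lambda]. *)
exists (8 * (A^-1 + el * lambda * (2 / b))), (1 + 4 * lambda / b) => Y s hY ss.
have lb0 : 0 <= lambda / b by rewrite divr_ge0 ?ltW.
have Y0 : 0 < Y by apply: lt_le_trans hY; rewrite ltr_pwDl// -mulrA mulr_ge0.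
have ch := rcosh_gt0 Y.
have chY : Y / 2 <= rcosh Y.
  apply: le_trans (rcosh_ge_exp Y); rewrite ler_pM2r// (gtr0_norm Y0).
  by apply: le_trans (expR_ge1Dx Y); rewrite lerDr.
have bch : 2 * lambda <= b * rcosh Y.
  apply: le_trans (_ : b * (Y / 2) <= _); last by rewrite ler_pM2l.
  have : b * (4 * lambda / b) <= b * Y by rewrite ler_pM2l//; apply: le_trans hY; rewrite lerDr.
  by rewrite mulrCA divff ?gt_eqF// mulr1; lra.
have gr := Re_gamma_ge Y ss; have gr0 : 0 < b * rcosh Y by rewrite mulr_gt0.
have gn : b * rcosh Y <= normc (gamma b (Y +i* s)%C).
  by apply: le_trans gr _; apply: le_trans (ler_norm _) (normc_Re _).
have gl : b * rcosh Y / 2 <= normc (gamma b (Y +i* s)%C - lc).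
  apply: le_trans (normc_Re _); rewrite ReB Re_real.
  by apply: le_trans (ler_norm (Re (gamma b (Y +i* s)%C) - lambda)); lra.
have sp : - (pi / 4) <= s < pi / 4 by case/andP: ss => -> h; rewrite (le_lt_trans h).
have gn0 : 0 < normc (gamma b (Y +i* s)%C - lc) by apply: lt_le_trans gl; rewrite divr_gt0.
have rg : regular (Y +i* s)%C.
  split=> //; apply/eqP => e; move: gn0; rewrite e subrr Normc.normc0 ltxx.
  by [].
split=> //; rewrite /reduced -mulrA Normc.normcM mulrC -[leRHS]mulrA; apply: ler_pM; rewrite ?normc_ge0//.
  rewrite Normc.normcM Normc.normcV mulrC ler_pdivrMr//; apply: le_trans (dgamma_le b0 Y s) _.
  have : 8 * (b * rcosh Y / 2) <= 8 * normc (gamma b (Y +i* s)%C - lc) by rewrite ler_pM2l.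
  by move: (normc _) => p; rewrite !mulrA; lra.
apply: le_trans (le_normcD _ _) _; rewrite normcN mulrDl; apply: lerD.
  rewrite normc_symbol expRN -invfM lef_pV2 ?posrE ?expR_gt0 ?mulr_gt0 ?powR_gt0//.
  apply: le_trans (expR_ge1Dx _); apply: ler_wpDl => //.
  rewrite /A -mulrA ler_pM2l//.
  have sa : `|carg (gamma b (Y +i* s)%C)| <= pi / 4.
    by apply: le_trans (carg_gamma b0 Y sp) _; case/andP: ss => _ h; lra.
  apply: le_trans (Re_cpow_ge be gr0 gr sa _); last by lra.
  rewrite -[leLHS]mulrA ler_pM2l// (powRM _ (ltW b0) (ltW ch)) -[leLHS]mulrA (ler_pM2l (powR_gt0 _ b0)).
  apply: le_trans (powR_cosh_ge Y be0); rewrite -[leLHS]mulrA ler_pM2l ?powR_gt0// (gtr0_norm Y0) mulrC.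
  by apply: le_trans (expR_ge1Dx _); rewrite lerDr.
rewrite Normc.normcM Normc.normcM Normc.normcV !normcR ger0_norm ?expR_ge0// gtr0_norm//.
rewrite -[leRHS]mulrA ler_pM2l ?mulr_gt0 ?expR_gt0//.
apply: (@le_trans _ _ (b * rcosh Y)^-1); first by rewrite lef_pV2 ?posrE//; exact: lt_le_trans gn.
apply: (@le_trans _ _ (b * (Y / 2))^-1).
  by rewrite lef_pV2 ?posrE// ?mulr_gt0 ?divr_gt0// ler_pM2l.
by rewrite !invfM invrK; rewrite [leLHS](_ : _ = 2 / b / Y)//; ring.
Qed.

(** [cosh] is injective on the half-line, so at most one point of the lower edge is a pole; if there
    is none, any value serves. *)
Lemma cosh_level Y : exists x0, forall x, 0 <= x <= Y -> x != x0 ->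
  gamma b (x +i* (- (pi / 4)))%C != lc.
Proof.
pose Z := [set x | 0 <= x /\ gamma b (x +i* (- (pi / 4)))%C = lc].
exists (xget 0 Z) => x /andP[h0 _]; apply: contraNneq => gx.
have zx : Z x by [].
case: xgetP => [z _ [z0 gz]|/(_ x)//].
have e : rcosh x = rcosh z.
  have := congr1 (@complex.Re R) (etrans gx (esym gz)); rewrite !Re_gamma cp.
  by move=> /(mulfI (lt0r_neq0 b0)) /(mulIf (lt0r_neq0 s2)).
have : rsinh x ^+ 2 = rsinh z ^+ 2.
  by have := rcosh_sqr x; have := rcosh_sqr z; rewrite e => ->; lra.
have sx : 0 <= rsinh x by rewrite /rsinh divr_ge0// subr_ge0 ler_expR; lra.
have sz : 0 <= rsinh z by rewrite /rsinh divr_ge0// subr_ge0 ler_expR; lra.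
move=> /eqP; rewrite eqrXn2// => /eqP es.
have E1 (u : R) : expR u = rcosh u + rsinh u by rewrite /rcosh /rsinh; lra.
by apply/eqP/expR_inj; rewrite !E1 e es.
Qed.

(** In this component of Cauchy's theorem the lower edge enters through an imaginary part and the
    left edge through a real part, both of which vanish; only the right edge remains. *)
Lemma reduced_integral Y : 0 < Y -> (forall s, - (pi / 4) <= s <= 0 -> regular (Y +i* s)%C) ->
  \int[mu]_(y in `[0, Y]) Im (reduced (y +i* 0)%C) =
  \int[mu]_(s in `[- (pi / 4), 0]) Re (reduced (Y +i* s)%C) /\
  {within `[- (pi / 4), 0], continuous (fun s => Re (reduced (Y +i* s)%C))}.
Proof.
move=> Y0 rY; have [Rei Imi] : Re ('i%C : R[i]) = 0 /\ Im ('i%C : R[i]) = 1 by [].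
have [F' hF] := C1_reduced; have [K HK] := reduced_bounded Y.
have [x0 Hx0] := cosh_level Y.
have np4 : - (pi / 4) < 0 :> R by rewrite oppr_lt0.
have rg x s : - (pi / 4) < s <= 0 -> regular (x +i* s)%C.
  by move=> /andP[h1 h2]; apply: regular_strip; rewrite h1 (le_lt_trans h2).
have rg' x s : - (pi / 4) < s < 0 -> regular (x +i* s)%C.
  by move=> /andP[h1 h2]; apply: rg; rewrite h1 ltW.
have cY : {within `[- (pi / 4), 0], continuous (fun s => Re (reduced (Y +i* s)%C))}.
  apply: continuous_in_subspaceT => s /mem_itvcc ss.
  have [_ h _] := hF _ (rY s ss).
  by have [] := ccont_vertical h (@cvg_id _ (nbhs s)).
split=> //.
(* Only the component with [u] the imaginary and [v] the real part is needed; [x0] is the exempted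
   point of the lower edge. *)
have := @strip_integral R (fun x s => Im (reduced (x +i* s)%C)) (fun x s => Re (reduced (x +i* s)%C))
    (fun x s => Re (F' (x +i* s)%C)) 0 Y (- (pi / 4)) 0 K [set x0] set0 Y0 np4.
rewrite (_ : \int[mu]_(x in `[0, Y]) Im (reduced (x +i* (- (pi / 4)))%C) = 0); last first.
  by under eq_Rintegral do rewrite Im_reduced_bottom; rewrite Rintegral_cst// mul0r.
rewrite subr0 => H; etransitivity; first apply: H.
- move=> x s xY ss; have [h _ _] := hF _ (rg' x s ss).
  by have [_ h2] := hol_vertical h; apply: der_eq h2 _; rewrite ImM Rei Imi; ring.
- move=> x s xY ss; have [h _ _] := hF _ (rg' x s ss).
  by have [h2 _] := hol_horizontal h.
- move=> x s xY ss; have [_ _ h] := hF _ (rg' x s ss).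
  by have [h2 _] := ccont_joint h.
- move=> x s xY ss; have [h _ _] := hF _ (rg' x s ss).
  by have [_ h2] := cder_continuous (hol_horizontal h).
- move=> x s xY /andP[h1 h2]; apply: le_trans (normc_Im _) _; apply: HK => //.
  by rewrite h1 ltW.
- exact: measurable_set1.
- exact: lebesgue_measure_set1.
- by move=> x _; exact: Im_reduced_bottom.
- move=> x xY /eqP xx0; have rx : regular (x +i* (- (pi / 4)))%C.
    by split; [rewrite /= lexx (lt_trans np4)|exact: Hx0].
  have [_ h _] := hF _ rx.
  by have [] := @ccont_vertical _ _ _ _ (- (pi / 4))^'+ _ h (cvg_within _).
- exact: measurable0.
- exact: measure0.
- by [].
- move=> x xY _; have [_ h _] := hF _ (rg x 0 (introT andP (conj np4 (lexx 0)))).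
  by have [] := @ccont_vertical _ _ _ _ 0^'- _ h (cvg_within _).
- apply: continuous_in_subspaceT => s /mem_itvcc ss.
  have [_ h _] := hF _ (rY s ss).
  have r0 : regular (0 +i* s)%C.
    have s4 : - (pi / 4) <= s < pi / 4 by case/andP: ss => h1 h2; rewrite h1 (le_lt_trans h2).
    split=> //; apply/eqP => e; have := congr1 (@complex.Re R) e; rewrite Re_gamma.
    have -> : rcosh 0 = 1 :> R by rewrite /rcosh oppr0 expR0; lra.
    rewrite mul1r /= => h2; move: bl; rewrite -h2 ltNge => /negP; apply.
    by rewrite ler_pM2l// cosBsin -[leRHS]mulr1 ler_wpM2l ?(ltW s2)// sin_le1.
  have [_ h0 _] := hF _ r0.
  have [c1 _] := ccont_vertical h (@cvg_id _ (nbhs s)).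
  have [c2 _] := ccont_vertical h0 (@cvg_id _ (nbhs s)).
  exact: (cvgB c1 c2).
apply: eq_Rintegral => s /mem_itvcc /andP[h1 h2].
have e := Re_reduced_left (introT andP (conj h1 (le_lt_trans h2 p4))).
by rewrite e; exact: subr0.
Qed.

(** [lambda - gamma] is real only at [y = 0], where it is [lambda - b > 0]; so its argument is
    smooth along the path. *)
Lemma slit_opp y : slit (lc - gamma b (y +i* 0)%C).
Proof.
rewrite /slit ReB ImB Re_gamma Im_gamma cos0 sin0 subr0 addr0 !mulr1 /= sub0r oppr_eq0.
have [->|y0] := eqVneq y 0.
  have -> : rcosh 0 = 1 :> R by rewrite /rcosh oppr0 expR0; lra.
  rewrite mulr1 subr_gt0; apply/orP; left.
  apply: le_lt_trans bl; rewrite ler_pMr// -[leLHS]sqrtr1 ler_wsqrtr// ler1n//.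
apply/orP; right; apply: mulf_neq0; first by rewrite gt_eqF.
by apply: contra y0 => /eqP /rsinh_eq0 ->.
Qed.

Let strip0 : - (pi / 4) < (0 : R) < pi / 4.
Proof. by rewrite oppr_lt0 p4. Qed.

Lemma continuous_g : continuous (fun y : R => Re (g_fun b beta lambda (y +i* 0)%C t)) /\
  continuous (fun y : R => Im (g_fun b beta lambda (y +i* 0)%C t)).
Proof.
have [F' hF] := C1_g; split=> y; have [h _ _] := hF _ (regular_strip y strip0).
  by have [] := cder_continuous (hol_horizontal h).
by have [] := cder_continuous (hol_horizontal h).
Qed.

(** Partial fractions of [lambda / (gamma * (gamma - lambda))] leave logarithmic derivatives, whose
    imaginary parts are derivatives of arguments. *)
Lemma g_split y : Im (g_fun b beta lambda (y +i* 0)%C t) = Im (reduced (y +i* 0)%C) +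
  el * Im (- dgamma b (y +i* 0)%C / (lc - gamma b (y +i* 0)%C) -
           dgamma b (y +i* 0)%C / gamma b (y +i* 0)%C).
Proof.
have [_ h] := regular_strip y strip0.
have g0 : gamma b (y +i* 0)%C != 0 by apply: slit_neq0; apply: slit_gamma => //; rewrite oppr_le0 ltW.
have h1 : gamma b (y +i* 0)%C - lc != 0 by rewrite subr_eq0.
have h2 : lc - gamma b (y +i* 0)%C != 0 by rewrite subr_eq0 eq_sym.
have -> (z : R[i]) : el * Im z = Im (el%:C%C * z) by rewrite ImM /= mul0r addr0.
rewrite -ImD g_funE /reduced; congr (Im _); field.
by rewrite g0 h1 h2.
Qed.

Lemma explicit_part y : is_derive y (1 : R)
  (fun y => carg (lc - gamma b (y +i* 0)%C) - carg (gamma b (y +i* 0)%C))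
  (Im (- dgamma b (y +i* 0)%C / (lc - gamma b (y +i* 0)%C) -
           dgamma b (y +i* 0)%C / gamma b (y +i* 0)%C)).
Proof.
have hg := cder_gamma b y.
have sg : slit (gamma b (y +i* 0)%C) by apply: slit_gamma => //; rewrite oppr_le0 ltW.
rewrite ImB; apply: derB; last exact: (is_derive_carg sg hg).
apply: (@is_derive_carg _ (fun y => lc - gamma b (y +i* 0)%C) y _ (slit_opp y)).
by apply: cder_eq (cderB (cder_cst lc y) hg) _; rewrite sub0r.
Qed.

Lemma half_line_integral Y : 0 < Y -> \int[mu]_(y in `[0, Y]) Im (g_fun b beta lambda (y +i* 0)%C t) =
  \int[mu]_(y in `[0, Y]) Im (reduced (y +i* 0)%C) +
  el * (carg (lc - gamma b (Y +i* 0)%C) - carg (gamma b (Y +i* 0)%C)).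
Proof.
move=> Y0.
have [F' hF] := C1_reduced.
have cr : continuous (fun y : R => Im (reduced (y +i* 0)%C)).
  by move=> y; have [h _ _] := hF _ (regular_strip y strip0); have [] := cder_continuous (hol_horizontal h).
have cg := continuous_g.2.
pose D y := Im (- dgamma b (y +i* 0)%C / (lc - gamma b (y +i* 0)%C) -
           dgamma b (y +i* 0)%C / gamma b (y +i* 0)%C).
have e0 : 0 < el := expR_gt0 _.
have cD : continuous D.
  (* Continuity of the explicit part is read off [g_split], whose other two terms are continuous. *)
  have -> : D = fun y => el^-1 * (Im (g_fun b beta lambda (y +i* 0)%C t) - Im (reduced (y +i* 0)%C)).
    by apply/funext => y; rewrite g_split -/(D y) addrC addKr mulKf// gt_eqF.
  by move=> y; apply: cvgM; [exact: cvg_cst|apply: cvgB; [exact: cg|exact: cr]].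
have := @Rintegral_FTC R _ D 0 Y explicit_part cD (ltW Y0).
have -> : carg (lc - gamma b (0 +i* 0)%C) - carg (gamma b (0 +i* 0)%C) = 0.
  rewrite gammaE cos0 sin0 subr0 addr0 !mulr1 /rsinh oppr0 subrr mul0r mulr0.
  have -> : rcosh 0 = 1 :> R by rewrite /rcosh oppr0 expR0; lra.
  have bb : b < lambda by apply: le_lt_trans bl; rewrite ler_pMr// -[leLHS]sqrtr1 ler_wsqrtr// ler1n//.
  by rewrite mulr1 !carg_right/= ?subr_gt0// subrr !mul0r atan0 subrr.
rewrite subr0 => <-.
rewrite -(RintegralZl _ _ (continuous_itv_integrable 0 Y cD))// -RintegralD//.
- by apply: eq_Rintegral => y _; exact: g_split.
- exact: continuous_itv_integrable.
- by apply: continuous_itv_integrable => y; apply: cvgM; [exact: cvg_cst|exact: cD].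
Qed.

(** In the limit [gamma] points in the direction [pi / 4] and [lambda - gamma] in the direction
    [- 3 pi / 4]. The difference [- pi] is half of the residue term; the other half comes from
    negative [y]. *)
Lemma carg_limit :
  carg (lc - gamma b (Y +i* 0)%C) - carg (gamma b (Y +i* 0)%C) @[Y --> +oo] --> - (pi : R).
Proof.
have cx := @cvgr_expR R.
have csq : expR (- Y) * expR (- Y) @[Y --> +oo] --> (0 * 0 : R) by exact: cvgM.
have c1 (c : R) : (fun _ : R => c) @ +oo --> c by exact: cvg_cst.
have cd : 1 - expR (- Y) * expR (- Y) @[Y --> +oo] --> (1 - 0 * 0 : R) by apply: cvgB.
have d0 : 1 - 0 * 0 != 0 :> R by rewrite mulr0 subr0 oner_neq0.
(* Both ratios are written in terms of [expR (- Y)], which tends to 0. *)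
have L1 : (1 + expR (- Y) * expR (- Y) - 2 * (lambda / b) * expR (- Y)) / (1 - expR (- Y) * expR (- Y))
    @[Y --> +oo] --> ((1 + 0 * 0 - 2 * (lambda / b) * 0) / (1 - 0 * 0) : R).
  apply: cvgM; last exact: cvgV.
  apply: cvgB; first exact: cvgD.
  exact: cvgM.
have L2 : (1 - expR (- Y) * expR (- Y)) / (1 + expR (- Y) * expR (- Y))
    @[Y --> +oo] --> (1 - 0 * 0) / (1 + 0 * 0 : R).
  apply: cvgM => //; apply: cvgV; first by rewrite mulr0 addr0 oner_neq0.
  exact: cvgD.
have FF : Filter (+oo%R : set_system R) by exact: _.
have A1 := continuous_cvg FF (@continuous_atan R _) L1.
have A2 := continuous_cvg FF (@continuous_atan R _) L2.
rewrite !(mulr0, subr0, addr0) !divr1 atan1 in A1 A2.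
have L : (fun Y => - (pi / 2) - atan ((1 + expR (- Y) * expR (- Y) - 2 * (lambda / b) * expR (- Y)) /
    (1 - expR (- Y) * expR (- Y))) - atan ((1 - expR (- Y) * expR (- Y)) / (1 + expR (- Y) * expR (- Y))))
    @ +oo --> - (pi / 2) - pi / 4 - pi / 4.
  by apply: cvgB => //; apply: cvgB.
rewrite (_ : - (pi / 2) - pi / 4 - pi / 4 = - pi :> R) in L; last by lra.
apply: (cvg_near_eq FF _ L); near=> Y.
have Y0 : 0 < Y by near: Y; exact: nbhs_pinfty_gt.
have sh := rsinh_gt0 Y0; have ch := rcosh_gt0 Y.
have hI : Im (lc - gamma b (Y +i* 0)%C) < 0.
  by rewrite ImB Im_gamma cos0 sin0 addr0 mulr1 /= sub0r oppr_lt0 mulr_gt0.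
have hR : 0 < Re (gamma b (Y +i* 0)%C).
  by rewrite Re_gamma cos0 sin0 subr0 mulr1 mulr_gt0.
rewrite (carg_lower hI) (carg_right hR) ReB ImB Re_gamma Im_gamma cos0 sin0 subr0 addr0 !mulr1 /= sub0r.
have ex : expR Y != 0 by rewrite gt_eqF ?expR_gt0.
have bn : b != 0 by rewrite gt_eqF.
have e1 : (lambda - b * rcosh Y) / - (b * rsinh Y) =
  (1 + expR (- Y) * expR (- Y) - 2 * (lambda / b) * expR (- Y)) / (1 - expR (- Y) * expR (- Y)).
  move: sh; rewrite /rsinh /rcosh expRN; move: (expR Y) ex => u un sh.
  have h1 : u ^+ 2 - 1 != 0.
    apply/eqP => h; move: sh; have -> : (u - u^-1) / 2 = (u ^+ 2 - 1) / (2 * u) by field.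
    by rewrite h mul0r ltxx.
  field; rewrite un bn /=.
  by rewrite -expr2 h1.
have e2 : b * rsinh Y / (b * rcosh Y) =
  (1 - expR (- Y) * expR (- Y)) / (1 + expR (- Y) * expR (- Y)).
  move: ch; rewrite /rsinh /rcosh expRN; move: (expR Y) ex => u un ch.
  have h1 : u ^+ 2 + 1 != 0 by rewrite gt_eqF// ltr_wpDl// sqr_ge0.
  field; rewrite un bn /=.
  by rewrite -expr2 h1.
by rewrite e1 e2.
Unshelve. all: by end_near. Qed.

Lemma half_line_limit :
  \int[mu]_(y in `[0, Y]) Im (g_fun b beta lambda (y +i* 0)%C t) @[Y --> +oo] --> - pi * el.
Proof.
have [C [Y0 HC]] := reduced_decay.
have h0 : \int[mu]_(y in `[0, Y]) Im (reduced (y +i* 0)%C) @[Y --> +oo] --> (0 : R).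
  apply/cvgrPdist_le => e e0; near=> Y.
  have Yp : 0 < Y by near: Y; exact: nbhs_pinfty_gt.
  have YY : Y0 <= Y by near: Y; apply: nbhs_pinfty_ge; exact: num_real.
  (* The right edge has length [pi / 4], so its integral is at most [|C| / Y * (pi / 4)]. *)
  have Ye : `|C| * (pi / 4) / e <= Y by near: Y; apply: nbhs_pinfty_ge; exact: num_real.
  have [-> cI] := reduced_integral Yp (fun s hs => (HC Y s YY hs).1).
  rewrite sub0r normrN.
  have hM x : - (pi / 4) <= x <= 0 -> `|Re (reduced (Y +i* x)%C)| <= `|C| / Y.
    move=> hx; apply: le_trans (normc_Re _) _; apply: le_trans (HC Y x YY hx).2 _.
    by rewrite ler_pM2r ?invr_gt0// ler_norm.
  have np : - (pi / 4) <= 0 :> R by rewrite oppr_le0 ltW.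
  apply: le_trans (Rintegral_itv_bound np cI hM) _.
  by rewrite sub0r opprK mulrAC ler_pdivrMr//; move: Ye; rewrite ler_pdivrMr// [Y * e]mulrC.
have L : (fun Y => \int[mu]_(y in `[0, Y]) Im (reduced (y +i* 0)%C) +
  el * (carg (lc - gamma b (Y +i* 0)%C) - carg (gamma b (Y +i* 0)%C))) @ +oo --> 0 + el * - pi.
  by apply: cvgD => //; apply: cvgM; [exact: cvg_cst|exact: carg_limit].
rewrite add0r [el * - pi]mulrC in L.
apply: (cvg_near_eq _ _ L); near=> Y.
have Yp : 0 < Y by near: Y; exact: nbhs_pinfty_gt.
by rewrite half_line_integral.
Unshelve. all: by end_near. Qed.

End semigroup_symbol.

(** * The trapezoidal rule *)

Section complex_integrals.
Context {R : realType}.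
Local Notation mu := (@lebesgue_measure R).
Implicit Types (f g : R -> R[i]) (a b : R).

Definition ccontinuous f := continuous (fun x => Re (f x)) /\ continuous (fun x => Im (f x)).

Lemma ccontinuousP f : (forall x, ccvg (nbhs x) f (f x)) -> ccontinuous f.
Proof. by move=> h; split=> x; have [] := h x. Qed.

Lemma cintB f g a b : ccontinuous f -> ccontinuous g ->
  cint a b (fun x => f x - g x) = cint a b f - cint a b g.
Proof.
move=> [f1 f2] [g1 g2]; apply: complexP; rewrite ?ReB ?ImB /cint /=.
  under eq_Rintegral do rewrite ReB.
  by rewrite RintegralB//; exact: continuous_itv_integrable.
under eq_Rintegral do rewrite ImB.
by rewrite RintegralB//; exact: continuous_itv_integrable.
Qed.

Lemma cintZ (z : R[i]) f a b : ccontinuous f -> cint a b (fun x => z * f x) = z * cint a b f.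
Proof.
move=> [f1 f2]; have i1 := continuous_itv_integrable a b f1; have i2 := continuous_itv_integrable a b f2.
have cZ (c : R) (h : R -> R) : continuous h -> continuous (fun x => c * h x).
  by move=> ch x; apply: cvgM; [exact: cvg_cst|exact: ch].
apply: complexP; rewrite ?ReM ?ImM /cint /=.
  under eq_Rintegral do rewrite ReM.
  by rewrite RintegralB// ?RintegralZl//; apply: continuous_itv_integrable; exact: cZ.
under eq_Rintegral do rewrite ImM.
by rewrite RintegralD// ?RintegralZl//; apply: continuous_itv_integrable; exact: cZ.
Qed.

Lemma continuous_normc f : ccontinuous f -> continuous (fun x => normc (f x)).
Proof. by move=> [f1 f2] x; apply: cvg_normc; split; [exact: f1|exact: f2]. Qed.

Lemma normc_cint_le f (h : R -> R) a b : ccontinuous f -> continuous h ->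
  (forall x, a <= x <= b -> normc (f x) <= h x) ->
  normc (cint a b f) <= 2 * \int[mu]_(x in `[a, b]) h x.
Proof.
move=> [f1 f2] ch fh.
have key (u : R -> R) : continuous u -> (forall x, `|u x| <= normc (f x)) ->
    `|\int[mu]_(x in `[a, b]) u x| <= \int[mu]_(x in `[a, b]) h x.
  move=> cu uf; have iu := continuous_itv_integrable a b cu.
  apply: le_trans (le_normr_Rintegral _ iu) _ => //; apply: le_Rintegral => //.
  - exact: (integrable_norm iu).
  - exact: continuous_itv_integrable.
  - by move=> x /=; rewrite in_itv /= => xab; exact: le_trans (uf x) (fh x xab).
apply: le_trans (normc_le_ReIm _) _; rewrite /cint /=.
have -> : 2 * \int[mu]_(x in `[a, b]) h x = \int[mu]_(x in `[a, b]) h x + \int[mu]_(x in `[a, b]) h x.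
  by rewrite mulrDl mul1r.
by apply: lerD; apply: key => // x; [exact: normc_Re|exact: normc_Im].
Qed.

Lemma normc_cint_bound f a b (M : R) : a <= b ->
  {within `[a, b], continuous (fun x => Re (f x))} ->
  {within `[a, b], continuous (fun x => Im (f x))} ->
  (forall x, a <= x <= b -> normc (f x) <= M) -> normc (cint a b f) <= 2 * (M * (b - a)).
Proof.
move=> ab c1 c2 fM; apply: le_trans (normc_le_ReIm _) _; rewrite /cint /= mulrDl mul1r.
apply: lerD; apply: Rintegral_itv_bound => // x xab.
  exact: le_trans (normc_Re _) (fM x xab).
exact: le_trans (normc_Im _) (fM x xab).
Qed.

End complex_integrals.

Section star.
Context {R : realType}.
Implicit Types (f : R[i] -> R[i]) (z : R[i]) (D : set R[i]).

(** Schwarz reflection. On the real axis it is the conjugate of [f], and it interchanges the upper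
    and lower halves of the strip. *)
Definition star f z : R[i] := ((f z^*%C)^*)%C.

Lemma ccvg_conj (T : Type) (F : set_system T) (FF : Filter F) (u : T -> R[i]) l :
  ccvg F u l -> ccvg F (fun x => ((u x)^*)%C) (l^*)%C.
Proof.
move=> [u1 u2]; split; first by rewrite Re_conj; under eq_fun do rewrite Re_conj.
by rewrite Im_conj; under eq_fun do rewrite Im_conj; exact: cvgN.
Qed.

Lemma cder_conj (c : R -> R[i]) x l : cder c x l -> cder (fun y => ((c y)^*)%C) x (l^*)%C.
Proof.
move=> [c1 c2]; split.
  by rewrite Re_conj; apply: der_ext c1 => y; rewrite Re_conj.
by rewrite Im_conj; apply: der_ext (derN c2) => y; rewrite Im_conj.
Qed.

Lemma C1_star D f : C1 D f -> C1 [set z | D (z^*)%C] (star f).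
Proof.
move=> [f' hf]; exists (star f') => z Dz; have [h1 h2 h3] := hf _ Dz.
have cc g : ccont g (z^*)%C -> ccont (star g) z.
  move=> hg T F u FF hu; apply: ccvg_conj; apply: (hg _ F (fun x => ((u x)^*)%C)).
  exact: ccvg_conj.
split; [|exact: cc|exact: cc].
move=> c x m cx hc; have := h1 (fun y => ((c y)^*)%C) x (m^*)%C _ (cder_conj hc).
rewrite cx => /(_ erefl) /cder_conj; rewrite /comp /star rmorphM /= conjcK.
exact.
Qed.

Lemma normc_conj z : normc (z^*)%C = normc z.
Proof. by rewrite !normcE Re_conj Im_conj sqrrN. Qed.

End star.

(** * The kernel of the trapezoidal rule *)

Section kernel.
Context {R : realType}.
Local Notation mu := (@lebesgue_measure R).

(** [sin x = 2 * sin (x / 2) * cos (x / 2)], and on [[0, pi / 4]] the cosine is at least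
    [cos (pi / 4)], whose square is 1/2; the mean value theorem handles [sin (x / 2)]. *)
Lemma sin_ge_half (x : R) : 0 <= x <= pi / 2 -> x / 2 <= sin x.
Proof.
move=> /andP[x0 x2]; have s2 : 0 < Num.sqrt 2 :> R by rewrite sqrtr_gt0.
have c4 := @cos_piquarter_gt0 R.
have e : Num.sqrt 2 * cos (pi / 4) = 1 :> R := sqrt2_cos_piquarter.
have h1 (y : R) : 0 <= y <= pi / 4 -> cos (pi / 4) <= cos y.
  by move=> /andP[y0 y4]; apply: le_cos => //; lra.
have h2 : x / 2 * cos (pi / 4) <= sin (x / 2).
  have xx : 0 <= x / 2 by rewrite divr_ge0.
  have dd (y : R) : y \in `]0, x / 2[ -> is_derive y 1 sin (cos y).
    by move=> _; exact: is_derive_sin.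
  have cc : {within `[0, x / 2], continuous (@sin R)}.
    by apply: continuous_subspaceT; exact: continuous_sin.
  have [y] := MVT_segment xx dd cc.
  rewrite in_itv /= => /andP[y0 y1]; rewrite sin0 !subr0 => ->.
  rewrite mulrC ler_wpM2r ?divr_ge0//; apply: h1; rewrite y0 /=; lra.
have h3 : cos (pi / 4) <= cos (x / 2) by apply: h1; apply/andP; split; lra.
have -> : sin x = 2 * (sin (x / 2) * cos (x / 2)).
  by rewrite {1}(splitr x) sinD; ring.
have c2 : cos (pi / 4) * cos (pi / 4) = 2^-1 :> R.
  have : (Num.sqrt 2 * cos (pi / 4)) ^+ 2 = 1 :> R by rewrite e expr1n.
  by rewrite exprMn sqr_sqrtr// expr2; lra.
have h4 : x / 2 * cos (pi / 4) * cos (pi / 4) <= sin (x / 2) * cos (x / 2).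
  by apply: ler_pM => //; rewrite ?mulr_ge0 ?divr_ge0// ltW.
by rewrite -mulrA c2 in h4; lra.
Qed.

Variable w : R.
Hypothesis w0 : 0 < w.

(** In the application [w] is [2 * pi / k], so that [rot] equals 1 exactly at the integer multiples
    of [k]. *)
Definition rot (z : R[i]) : R[i] := cexp (- ('i%C * w%:C%C * z)).
Definition kern (z : R[i]) : R[i] := (1 - rot z)^-1.

Lemma rotE (x s : R) : rot (x +i* s)%C =
  ((expR (w * s) * cos (w * x)) -i* (expR (w * s) * sin (w * x)))%C.
Proof.
rewrite /rot (_ : - ('i%C * w%:C%C * (x +i* s)%C) = ((w * s) +i* (- (w * x)))%C).
  by rewrite /cexp /= cosN sinN mulrN.
by apply: complexP; rewrite ?ReN ?ImN !(ReM, ImM) /=; ring.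
Qed.

Lemma rot_sqr (x s : R) : normc (1 - rot (x +i* s)%C) ^+ 2 =
  (expR (w * s) - 1) ^+ 2 + 2 * expR (w * s) * (1 - cos (w * x)).
Proof.
rewrite normc_sqr ReB ImB rotE /=.
have -> : (1 - expR (w * s) * cos (w * x)) ^+ 2 + (0 - - (expR (w * s) * sin (w * x))) ^+ 2 =
  1 - 2 * expR (w * s) * cos (w * x) + expR (w * s) ^+ 2 * (cos (w * x) ^+ 2 + sin (w * x) ^+ 2) by ring.
by rewrite cos2Dsin2; ring.
Qed.

(** Within one period [1 - rot] has only a simple zero, at 0. The bound in terms of [normc z] is
    what cancels a numerator that vanishes there. *)
Lemma kern_lower (x s : R) : `|w * x| <= pi -> 0 <= s ->
  w / 2 * normc (x +i* s)%C <= normc (1 - rot (x +i* s)%C).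
Proof.
move=> xk s0; have nn := @normc_ge0 R.
rewrite -(@ler_pXn2r _ 2) ?nnegrE// ?mulr_ge0// ?divr_ge0 ?(ltW w0)//.
rewrite exprMn rot_sqr normc_sqr [complex.Re _]/= [complex.Im _]/=.
pose th := `|w * x| / 2.
have th2 : th <= pi / 2 by rewrite /th ler_pM2r.
have th0 : 0 <= th by rewrite divr_ge0.
have hs : th / 2 <= sin th by apply: sin_ge_half; rewrite th0.
have hc : 1 - cos (w * x) = 2 * sin th ^+ 2.
  rewrite -cos_norm {1}(splitr `|w * x|) -/th cosD -!expr2 cos2sin2; ring.
have he : 1 + w * s <= expR (w * s) := expR_ge1Dx _.
have ws : 0 <= w * s by rewrite mulr_ge0 ?(ltW w0).
have hx : (w * x) ^+ 2 = 4 * th ^+ 2.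
  by rewrite -(real_normK (num_real (w * x))) /th; field.
have h3 : (th / 2) ^+ 2 <= sin th ^+ 2.
  by apply: lerXn2r; rewrite ?nnegrE ?divr_ge0//; apply: le_trans hs; rewrite divr_ge0.
have -> : (w / 2) ^+ 2 * (x ^+ 2 + s ^+ 2) = ((w * x) ^+ 2 + (w * s) ^+ 2) / 4 by field.
rewrite hx hc; move: (expR (w * s)) he => E; move: (w * s) ws h3 => v ws h3 he; move: ws h3 he; move: (sin th ^+ 2) => S v0 h3 he.
rewrite expr_div_n in h3.
have h4 : v ^+ 2 <= (E - 1) ^+ 2.
  apply: lerXn2r; rewrite ?nnegrE; lra.
have E1 : 1 <= E by lra.
have S0 : 0 <= S by apply: le_trans h3; rewrite mulr_ge0 ?exprn_ge0.
have h5 : S <= E * S by rewrite ler_peMl.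
have h6 : th ^+ 2 <= 4 * S.
  by move: h3; rewrite ler_pdivrMr ?exprn_gt0// => h3; lra.
have h7 := sqr_ge0 v; lra.
Qed.

Lemma kern_height (x s : R) : 0 < s -> normc (kern (x +i* s)%C) <= (expR (w * s) - 1)^-1.
Proof.
move=> s0; have E1 : 0 < expR (w * s) - 1 by rewrite subr_gt0 expR_gt1 mulr_gt0.
have nn := @normc_ge0 R.
have h : expR (w * s) - 1 <= normc (1 - rot (x +i* s)%C).
  rewrite -(@ler_pXn2r _ 2) ?nnegrE// ?(ltW E1)// rot_sqr lerDl; apply: mulr_ge0; last by rewrite subr_ge0 cos_le1.
  by apply: mulr_ge0 => //; exact: expR_ge0.
rewrite /kern Normc.normcV lef_pV2 ?posrE//; exact: lt_le_trans E1 h.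
Qed.

Lemma kern_edge (x s : R) : `|w * x| = pi -> 0 <= s ->
  kern (x +i* s)%C = ((1 + expR (w * s))^-1)%:C%C.
Proof.
move=> xk s0; rewrite /kern rotE.
have -> : cos (w * x) = -1 by rewrite -cos_norm xk cospi.
have -> : sin (w * x) = 0.
  by apply/eqP; rewrite -sqrf_eq0 sin2cos2 -cos_norm xk cospi sqrrN expr1n subrr.
have e : (1 - ((expR (w * s) * -1) -i* (expR (w * s) * 0))%C : R[i]) = (1 + expR (w * s))%:C%C.
  by apply: complexP; rewrite ?ReB ?ImB /=; ring.
by rewrite e fmorphV.
Qed.

Lemma rot_neq1 (x s : R) : `|w * x| <= pi -> 0 <= s -> (x +i* s)%C != 0 ->
  1 - rot (x +i* s)%C != 0.
Proof.
move=> xk s0 z0; apply: contraTneq (kern_lower xk s0) => e.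
by rewrite e Normc.normc0 -ltNge mulr_gt0 ?divr_gt0// normc_gt0.
Qed.

Lemma C1_kern (D : set R[i]) : (forall z, D z -> 1 - rot z != 0) -> C1 D kern.
Proof.
move=> h; apply: C1V => //; apply: C1B; first exact: C1_cst.
apply: (C1_comp (D' := setT) (F := fun z => - ('i%C * w%:C%C * z))) => //; last exact: C1_cexp.
by apply: C1N; apply: C1M; [exact: C1_cst|exact: C1_id].
Qed.

Lemma inv_pair (F : fieldType) (r q : F) : r * q = 1 -> r != 1 -> (1 - r)^-1 + (1 - q)^-1 = 1.
Proof.
move=> e r1; have r0 : r != 0 by apply: contra_eq_neq e => ->; rewrite mul0r eq_sym oner_neq0.
have a1 : 1 - r != 0 by rewrite subr_eq0 eq_sym.
have -> : q = r^-1 by apply: (mulfI r0); rewrite e mulfV.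
by field; rewrite a1 r0 subr_eq0 r1.
Qed.

(** On the real axis [rot] has modulus 1, and [(1 - r)^-1 + (1 - r^-1)^-1 = 1]. *)
Lemma kern_mid (x : R) : rot (x +i* 0)%C != 1 -> kern (x +i* 0)%C + ((kern (x +i* 0)%C)^*)%C = 1.
Proof.
move=> r1; have c1 := cos2Dsin2 (w * x).
rewrite /kern conjc_inv rmorphB rmorph1.
have e : rot (x +i* 0)%C * ((rot (x +i* 0)%C)^*)%C = 1.
  rewrite rotE mulr0 expR0 !mul1r; apply: complexP; rewrite ?ReM ?ImM /= -?c1; ring.
exact: inv_pair.
Qed.

Lemma cint_FTC (f f' : R -> R[i]) (a b : R) : a < b -> (forall x, cder f x (f' x)) ->
  ccontinuous f' -> cint a b f' = f b - f a.
Proof.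
move=> ab h [c1 c2].
have key (g g' : R -> R) : (forall x : R, is_derive x 1 g (g' x)) -> continuous g' ->
    \int[mu]_(x in `[a, b]) g' x = g b - g a.
  move=> hg cg; rewrite /Rintegral (@continuous_FTC2 _ g' g a b ab)//.
  - by apply: continuous_subspaceT.
  - split=> [x _||]; first exact: ex_derive.
      by apply: cvg_at_right_filter; apply: differentiable_continuous; apply/derivable1_diffP; exact: ex_derive.
    by apply: cvg_at_left_filter; apply: differentiable_continuous; apply/derivable1_diffP; exact: ex_derive.
  - by move=> x _; rewrite derive1E; exact: derive_val.
apply: complexP; rewrite ?ReB ?ImB /cint /=.
  by apply: (key (fun x => Re (f x))) => // x; have [] := h x.
by apply: (key (fun x => Im (f x))) => // x; have [] := h x.
Qed.

Lemma C1_continuous (D : set R[i]) F (s : R) : C1 D F -> (forall x : R, D (x +i* s)%C) ->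
  ccontinuous (fun x => F (x +i* s)%C).
Proof.
move=> [F' hF] h; apply: ccontinuousP => x; have [_ hc _] := hF _ (h x).
by apply: hc; split=> /=; [exact: cvg_id|exact: cvg_cst].
Qed.

Lemma kern_upper_neq (x s : R) : 0 < s -> 1 - rot (x +i* s)%C != 0.
Proof.
move=> s0; apply/eqP => e0; have := rot_sqr x s.
rewrite e0 Normc.normc0 expr0n /= => /esym/eqP; rewrite gt_eqF// ltr_pwDl//.
  by rewrite exprn_gt0// subr_gt0 expR_gt1 mulr_gt0.
by apply: mulr_ge0; [apply: mulr_ge0 => //; exact: expR_ge0|rewrite subr_ge0 cos_le1].
Qed.

(** The function [cln (1 - cexp (i w z)) / (i w)] is a primitive, smooth because [1 - cexp (i w z)]
    stays in the right half-plane, and it is periodic. *)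
Lemma cint_kern (a s : R) : w * a = pi -> 0 < s -> cint (- a) a (fun x => kern (x +i* s)%C) = 0.
Proof.
move=> wa s0; have a0 : 0 < a by rewrite -(pmulr_rgt0 _ w0) wa pi_gt0.
pose c : R[i] := 'i%C * w%:C%C.
have c0 : c != 0.
  by rewrite /c mulf_neq0//; [rewrite eq_complex /= oner_eq0 andbF|rewrite (_ : 0 = 0%:C%C)// (inj_eq (@complexI _)) gt_eqF].
have cE (x : R) : c * (x +i* s)%C = ((- (w * s)) +i* (w * x))%C.
  by apply: complexP; rewrite /c !(ReM, ImM) /=; ring.
have cs (x : R) : slit (1 - cexp (c * (x +i* s)%C)).
  apply/orP; left; rewrite ReB cE /= subr_gt0; apply: le_lt_trans (_ : expR (- (w * s)) < 1); last first.
    by rewrite expR_lt1 oppr_lt0 mulr_gt0.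
  by rewrite ler_piMr ?expR_ge0 ?cos_le1.
have hd (x : R) : cder (fun y => c^-1 * cln (1 - cexp (c * (y +i* s)%C))) x (kern (x +i* s)%C).
  have h1 := cder_cexp (cderM (cder_cst c x) (cder_horizontal x s)).
  have h2 := cderB (cder_cst 1 x) h1.
  have h3 := cderM (cder_cst c^-1 x) (cder_cln (cs x) h2).
  refine (cder_eq h3 _).
  have e : rot (x +i* s)%C * cexp (c * (x +i* s)%C) = 1.
    by rewrite /rot -cexpD -/c addNr cexp0.
  have n1 := slit_neq0 (cs x); have n2 := kern_upper_neq x s0.
  rewrite /kern; move: (rot _) (cexp _) e n1 n2 => r q e n1 n2.
  rewrite !mul0r !add0r mulr1; apply: (mulfI n2); rewrite mulfV//.
  have r0 : r != 0 by apply: contra_eq_neq e => ->; rewrite mul0r eq_sym oner_neq0.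
  have qE : q = r^-1 by apply: (mulfI r0); rewrite e mulfV.
  have n3 : r - 1 != 0 by rewrite -opprB oppr_eq0.
  by rewrite qE; field; rewrite c0 r0 n3.
rewrite (cint_FTC _ hd); last 2 first.
- by rewrite gtrN.
- apply: (@C1_continuous [set z | 0 < Im z] kern) => //; apply: C1_kern => -[x y] /= y0.
  exact: kern_upper_neq.
by rewrite !cE mulrN wa /cexp /= cosN sinN sinpi mulr0 mulrN mulr0 oppr0 subrr.
Qed.
End kernel.

(** * Quadrature on one cell *)

Section cell.
Context {R : realType}.
Local Notation mu := (@lebesgue_measure R).
Variables (w a d : R).
Hypotheses (w0 : 0 < w) (d0 : 0 < d) (wa : w * a = pi).

Let a0 : 0 < a. Proof. by rewrite -(pmulr_rgt0 _ w0) wa pi_gt0. Qed.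
Let nn := @normc_ge0 R.

Let wx (x : R) : - a <= x <= a -> `|w * x| <= pi.
Proof. by move=> xa; rewrite normrM (gtr0_norm w0) -wa ler_pM2l// ler_norml. Qed.

Lemma within_ccont F (x s0 s1 : R) : (forall s, s0 <= s <= s1 -> ccont F (x +i* s)%C) ->
  {within `[s0, s1], continuous (fun s => Re (F (x +i* s)%C))} /\
  {within `[s0, s1], continuous (fun s => Im (F (x +i* s)%C))}.
Proof.
move=> h; split; apply: continuous_in_subspaceT => s; rewrite inE /= in_itv /= => /h hs.
  by have [] := ccont_vertical hs (@cvg_id R (nbhs s)).
by have [] := ccont_vertical hs (@cvg_id R (nbhs s)).
Qed.

(** The constant [U 0] makes the integrand bounded at the node and drops out on the upper line by
    [cint_kern]. On the vertical edges the kernels agree, so only the increment of [U] across the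
    cell remains. *)
Lemma half_cell (U : R[i] -> R[i]) (W : R) : C1 [set z | 0 <= Im z <= d] U ->
  (forall s, 0 <= s <= d -> normc (U (a +i* s)%C - U (- a +i* s)%C) <= W) ->
  normc (cint (- a) a (fun x => (U (x +i* 0)%C - U 0) * kern w (x +i* 0)%C)) <=
    2 * ((expR (w * d) - 1)^-1 * \int[mu]_(x in `[- a, a]) normc (U (x +i* d)%C)) + 2 * (W * d).
Proof.
move=> cU hW; have [U' hU] := cU.
have [M hM] : exists M, forall x s, - a <= x <= a -> 0 <= s <= d -> normc (U' (x +i* s)%C) <= M.
  have hj x s : - a <= x <= a -> 0 <= s <= d -> _ := fun xa sd => ccont_joint (let: And3 _ _ h := hU (x +i* s)%C sd in h).
  have [K1 h1] := @rectangle_bounded R (fun x s => Re (U' (x +i* s)%C)) (- a) a 0 d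
    (fun x s xa sd => let: conj h _ := hj x s xa sd in h).
  have [K2 h2] := @rectangle_bounded R (fun x s => Im (U' (x +i* s)%C)) (- a) a 0 d
    (fun x s xa sd => let: conj _ h := hj x s xa sd in h).
  exists (K1 + K2) => x s xa sd; apply: le_trans (normc_le_ReIm _) _.
  by apply: lerD; [exact: h1|exact: h2].
(* The half cell is star-shaped about 0, so the bound on [U'] can be used along rays. *)
have lip x s : - a <= x <= a -> 0 <= s <= d -> normc (U (x +i* s)%C - U 0) <= 2 * (M * normc (x +i* s)%C).
  move=> xa sd; pose z : R[i] := (x +i* s)%C.
  have tz (t : R) : t%:C%C * z = ((t * x) +i* (t * s))%C.
    by apply: complexP; rewrite ?ReM ?ImM /=; ring.
  have ht (t : R) : 0 <= t <= 1 -> (- a <= t * x <= a) /\ 0 <= t * s <= d.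
    move=> /andP[t0 t1]; move: xa sd => /andP[x0 x1] /andP[s0 s1]; split; nra.
  have h1 (t : R) : 0 <= t <= 1 -> cder (fun t => U (t%:C%C * z)) t (U' (t%:C%C * z) * z).
    move=> /ht[_ t1]; have [hh _ _] : [/\ hol U (t%:C%C * z) (U' (t%:C%C * z)), ccont U (t%:C%C * z) & ccont U' (t%:C%C * z)].
      by rewrite tz; exact: hU.
    exact: (hh (fun t => t%:C%C * z) t z erefl (cder_ray z t)).
  have := cder_lipschitz h1 (M := M * normc z); rewrite mul1r mul0r; apply => t /ht[t1 t2].
  by rewrite Normc.normcM ler_wpM2r// tz; exact: hM.
pose F (z : R[i]) : R[i] := (U z - U 0) * kern w z.
pose D := [set z : R[i] | [/\ `|w * Re z| <= pi, 0 <= Im z <= d & z != 0]].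
have [F' hF] : C1 D F.
  apply: C1M.
    apply: C1B; last exact: C1_cst.
    by apply: C1_sub cU => z [].
  by apply: C1_kern => -[x s] [/= xa /andP[sd _] z0]; exact: rot_neq1.
have Dedge s : 0 <= s <= d -> D (a +i* s)%C /\ D (- a +i* s)%C.
  move=> sd; have aa : - a <= a by have := a0; lra.
  split; split=> //=; try by apply: wx; rewrite ?lexx ?aa.
    by rewrite eq_complex /= (gt_eqF a0).
  by rewrite eq_complex /= oppr_eq0 (gt_eqF a0).
have Din x s : - a <= x <= a -> 0 < s < d -> D (x +i* s)%C.
  move=> xa /andP[s0 s1]; split=> /=; [exact: wx|by rewrite !ltW|].
  by rewrite eq_complex /= (gt_eqF s0) andbF.
have ce1 s : 0 <= s <= d -> ccont F (a +i* s)%C by move=> /Dedge[/hF[]].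
have ce2 s : 0 <= s <= d -> ccont F (- a +i* s)%C by move=> /Dedge[_ /hF[]].
have [a1 a2] := within_ccont ce1.
have [b1 b2] := within_ccont ce2.
have wr : {within `[0, d], continuous (fun s => Re (F (a +i* s)%C - F (- a +i* s)%C))}.
  have -> : (fun s : R => Re (F (a +i* s)%C - F (- a +i* s)%C)) =
      (fun s => Re (F (a +i* s)%C) - Re (F (- a +i* s)%C)) by apply/funext => s; rewrite ReB.
  by move=> x; apply: continuousB; [exact: a1|exact: b1].
have wi : {within `[0, d], continuous (fun s => Im (F (a +i* s)%C - F (- a +i* s)%C))}.
  have -> : (fun s : R => Im (F (a +i* s)%C - F (- a +i* s)%C)) =
      (fun s => Im (F (a +i* s)%C) - Im (F (- a +i* s)%C)) by apply/funext => s; rewrite ImB.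
  by move=> x; apply: continuousB; [exact: a2|exact: b2].
have M0 : 0 <= M.
  by apply: le_trans (hM 0 0 _ _) => //; rewrite ?lexx ?(ltW d0)//; apply/andP; split; have := a0; lra.
have cauchy : cint (- a) a (fun x => F (x +i* d)%C) - cint (- a) a (fun x => F (x +i* 0)%C) =
    'i%C * cint 0 d (fun s => F (a +i* s)%C - F (- a +i* s)%C).
  (* [4 * M / w] is the Lipschitz constant [2 * M] divided by the constant [w / 2] of [kern_lower];
     the node 0 is the exempted point. *)
  apply: (@cauchy_rectangle R F F' (- a) a 0 d (4 * M / w) [set 0] set0) => //.
  - by rewrite gtrN.
  - by move=> x s xa sd; have [] := hF _ (Din x s xa sd).
  - by move=> x s xa sd; have [] := hF _ (Din x s xa sd).
  - move=> x s xa sd; have [_ sd' z0] := Din x s xa sd.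
    have l1 := lip x s xa sd'; have l2 := kern_lower w0 (wx xa) (proj1 (andP sd')).
    have zp := normc_gt0 z0; rewrite /F Normc.normcM /kern Normc.normcV.
    have kp : 0 < normc (1 - rot w (x +i* s)%C) by apply: lt_le_trans l2; rewrite mulr_gt0// divr_gt0.
    rewrite ler_pdivrMr//; apply: le_trans l1 _.
    have h4 : 0 <= 4 * M / w by apply: divr_ge0; [exact: mulr_ge0|exact: ltW].
    apply: le_trans (ler_wpM2l h4 l2).
    rewrite le_eqVlt; apply/orP; left; apply/eqP; move: (normc _) => N; field; exact: lt0r_neq0.
  - exact: lebesgue_measure_set1.
  - by move=> x ->; rewrite /F subrr mul0r.
  - move=> x xa /eqP x0.
    have DD : D (x +i* 0)%C.
      by split=> /=; [exact: wx|rewrite lexx ltW|rewrite eq_complex /= negb_and x0].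
    have [_ hc _] := hF _ DD; apply: ccont_vertical => //; exact: cvg_within.
  - by move=> x xa _; have [_ hc _] : [/\ hol F (x +i* d)%C (F' (x +i* d)%C), ccont F (x +i* d)%C & ccont F' (x +i* d)%C]; [
       apply: hF; split=> /=; [exact: wx|rewrite lexx ltW|rewrite eq_complex /= (gt_eqF d0) andbF]
      |apply: ccont_vertical => //; exact: cvg_within].
have W0 : 0 <= W by apply: le_trans (nn _) (hW 0 _); rewrite lexx ltW.
have bs : normc (cint 0 d (fun s => F (a +i* s)%C - F (- a +i* s)%C)) <= 2 * (W * d).
  rewrite -[in leRHS](subr0 d); apply: normc_cint_bound => //; first exact: ltW.
  move=> s sd; have /andP[s0 _] := sd; rewrite /F !kern_edge//; last 2 first.
  - by rewrite mulrN normrN wa gtr0_norm// pi_gt0.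
  - by rewrite wa gtr0_norm// pi_gt0.
  rewrite -mulrBl opprB addrA subrK Normc.normcM normcR -[leRHS]mulr1.
  apply: ler_pM => //; first exact: hW.
  have e := expR_ge0 (w * s); rewrite ger0_norm ?invr_ge0; last by rewrite addr_ge0.
  by rewrite invf_le1 ?lerDl// ltr_pwDl.
have cK : ccontinuous (fun x => kern w (x +i* d)%C).
  apply: (@C1_continuous R [set z | 0 < Im z] (kern w)) => //.
  by apply: C1_kern => -[x y] /= y0; exact: kern_upper_neq.
have cUd : ccontinuous (fun x => U (x +i* d)%C).
  by apply: (@C1_continuous R _ U d cU) => x /=; rewrite lexx ltW.
have cUK : ccontinuous (fun x => U (x +i* d)%C * kern w (x +i* d)%C).
  apply: (@C1_continuous R [set z | Im z = d] (fun z => U z * kern w z)) => //.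
  apply: C1M; first by apply: C1_sub cU => z /= ->; rewrite lexx ltW.
  by apply: C1_kern => -[x y] /= ->; exact: kern_upper_neq.
have top : normc (cint (- a) a (fun x => F (x +i* d)%C)) <=
    2 * ((expR (w * d) - 1)^-1 * \int[mu]_(x in `[- a, a]) normc (U (x +i* d)%C)).
  have -> : (fun x => F (x +i* d)%C) = (fun x => U (x +i* d)%C * kern w (x +i* d)%C - U 0 * kern w (x +i* d)%C).
    by apply/funext => x; rewrite /F mulrBl.
  rewrite cintB//; last first.
    apply: (@C1_continuous R [set z | 0 < Im z] (fun z => U 0 * kern w z)) => //.
    apply: C1M; first exact: C1_cst.
    by apply: C1_kern => -[x y] /= y0; exact: kern_upper_neq.
  rewrite cintZ// cint_kern// mulr0 subr0.
  have cn := continuous_normc cUd.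
  have e : (expR (w * d) - 1)^-1 * \int[mu]_(x in `[- a, a]) normc (U (x +i* d)%C) =
    \int[mu]_(x in `[- a, a]) ((expR (w * d) - 1)^-1 * normc (U (x +i* d)%C)).
    by rewrite RintegralZl//; exact: continuous_itv_integrable.
  rewrite e; apply: normc_cint_le => //.
    by move=> x; apply: cvgM; [exact: cvg_cst|exact: cn].
  by move=> x _; rewrite Normc.normcM mulrC ler_wpM2r//; exact: kern_height.
have -> : cint (- a) a (fun x => (U (x +i* 0)%C - U 0) * kern w (x +i* 0)%C) =
    cint (- a) a (fun x => F (x +i* d)%C) - 'i%C * cint 0 d (fun s => F (a +i* s)%C - F (- a +i* s)%C).
  by rewrite -cauchy subKr.
apply: le_trans (le_normcD _ _) _; rewrite normcN Normc.normcM.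
rewrite (_ : normc ('i%C : R[i]) = 1) ?mul1r; first exact: lerD.
by rewrite normcE /= expr0n /= add0r expr1n sqrtr1.
Qed.

(** [half_cell] sees only the upper half of the strip. It is applied to [S + star S] and
    [S - star S], which on the axis are [2 Re S] and [2 i Im S]. As the kernel has real part 1/2
    there, the real part of the first integral and the imaginary part of the second are the two
    components of the error. *)
Lemma cell_quadrature (S : R[i] -> R[i]) (W : R) : C1 [set z | - d <= Im z <= d] S ->
  (forall s, - d <= s <= d -> normc (S (a +i* s)%C - S (- a +i* s)%C) <= W) ->
  normc (cint (- a) a (fun x => S (x +i* 0)%C) - (2 * a)%:C%C * S 0) <=
    4 * ((expR (w * d) - 1)^-1 *
      \int[mu]_(x in `[- a, a]) (normc (S (x +i* d)%C) + normc (S (x -i* d)%C))) + 8 * (W * d).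
Proof.
move=> cS hW.
have cT : C1 [set z | - d <= Im z <= d] (star S).
  by apply: C1_sub (C1_star cS) => -[x s] /= /andP[s0 s1]; rewrite lerNl opprK s1 lerNl s0.
have up : [set z : R[i] | 0 <= Im z <= d] `<=` [set z : R[i] | - d <= Im z <= d].
  by move=> z /= /andP[z0 z1]; rewrite z1 andbT (le_trans _ z0)// oppr_le0 ltW.
have dd : - d <= d by have := d0; lra.
have starE (x s : R) : star S (x +i* s)%C = ((S (x -i* s)%C)^*)%C by [].
have conj0 (x : R) : (x -i* 0)%C = (x +i* 0)%C by rewrite oppr0.
have cont s : - d <= s <= d -> ccontinuous (fun x => S (x +i* s)%C).
  by move=> sd; apply: (@C1_continuous R _ S s cS).
have hdd : - d <= d <= d by rewrite dd lexx.
have hnd : - d <= - d <= d by rewrite dd lexx.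
have h00 : - d <= 0 <= d by rewrite oppr_le0 (ltW d0).
have I2 : \int[mu]_(x in `[- a, a]) (normc (S (x +i* d)%C) + normc (S (x -i* d)%C)) =
    \int[mu]_(x in `[- a, a]) normc (S (x +i* d)%C) + \int[mu]_(x in `[- a, a]) normc (S (x -i* d)%C).
  by rewrite RintegralD//; apply: continuous_itv_integrable; apply: continuous_normc; exact: cont.
have half (e : R[i]) : normc e = 1 ->
    normc (cint (- a) a (fun x => ((S (x +i* 0)%C + e * star S (x +i* 0)%C) -
       (S 0 + e * star S 0)) * kern w (x +i* 0)%C)) <=
    2 * ((expR (w * d) - 1)^-1 *
      \int[mu]_(x in `[- a, a]) (normc (S (x +i* d)%C) + normc (S (x -i* d)%C))) + 2 * (2 * W * d).
  move=> e1; pose U z := S z + e * star S z.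
  have cU : C1 [set z | - d <= Im z <= d] U by apply: C1D => //; apply: C1M => //; exact: C1_cst.
  apply: le_trans (half_cell (U := U) (W := 2 * W) (C1_sub up cU) _) _.
    move=> s sd; have sd' := up (0 +i* s)%C sd.
    have -> : U (a +i* s)%C - U (- a +i* s)%C =
        (S (a +i* s)%C - S (- a +i* s)%C) + e * ((S (a -i* s)%C - S (- a -i* s)%C)^*)%C.
      by rewrite /U !starE rmorphB /=; ring.
    apply: le_trans (le_normcD _ _) _; rewrite mulrDl mul1r; apply: lerD; first exact: hW.
    rewrite Normc.normcM e1 mul1r normc_conj; apply: hW.
    by move: sd' => /= /andP[s0 s1]; rewrite lerN2 s1 lerNl.
  rewrite lerD2r ler_pM2l// ler_pM2l ?invr_gt0 ?subr_gt0 ?expR_gt1 ?mulr_gt0//.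
  have cs : ccontinuous (fun x => U (x +i* d)%C) by apply: (@C1_continuous R _ U d cU).
  apply: le_Rintegral => //.
  - by apply: continuous_itv_integrable; exact: continuous_normc.
  - apply: continuous_itv_integrable => x; apply: cvgD.
      exact: (continuous_normc (cont _ hdd)).
    exact: (continuous_normc (cont _ hnd)).
  - move=> x _; apply: le_trans (le_normcD _ _) _.
    by rewrite Normc.normcM e1 mul1r starE normc_conj.
have krn x : - a <= x <= a -> x != 0 -> Re (kern w (x +i* 0)%C) = 2^-1.
  move=> xa x0; have n1 : 1 - rot w (x +i* 0)%C != 0.
    by apply: rot_neq1 => //; [exact: wx|rewrite eq_complex /= negb_and x0].
  have := @kern_mid R w x; rewrite subr_eq0 eq_sym in n1; move=> /(_ n1) /(congr1 (@complex.Re R)).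
  by rewrite ReD Re_conj /=; lra.
have i1 := continuous_itv_integrable (- a) a (cont _ h00).1.
have i2 := continuous_itv_integrable (- a) a (cont _ h00).2.
have S0E : star S 0 = ((S 0)^*)%C.
  by have := starE 0 0; rewrite conj0.
have hsum : (8 * (W * d)) = 2 * (2 * W * d) + 2 * (2 * W * d) by ring.
have hsum' (X : R) : 4 * X = 2 * X + 2 * X by ring.
rewrite hsum hsum' addrACA.
have icst (c : R) : mu.-integrable `[- a, a] (EFin \o cst c).
  by apply: continuous_itv_integrable; exact: cst_continuous.
have aa : - a <= a by have := a0; lra.
have z00 : (0 +i* 0)%C = 0 :> R[i] by [].
have cstE (c : R) : \int[mu]_(x in `[- a, a]) (cst c x) = 2 * a * c.
  rewrite Rintegral_cst//= lebesgue_measure_itv /= lte_fin gtrN// mulrC; congr (_ * _) => /=; ring.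
apply: le_trans (normc_le_ReIm _) _; apply: lerD.
- apply: le_trans (half 1 (Normc.normc1 R)); apply: le_trans (normc_Re _).
  rewrite le_eqVlt; apply/orP; left; apply/eqP; congr (`| _ |).
  rewrite ReB ReM /= mul0r subr0 -cstE -RintegralB//; apply: eq_Rintegral => x.
  rewrite inE /= in_itv /= => xa; rewrite starE S0E conj0 !mul1r.
  have [->|x0] := eqVneq x 0; first by rewrite z00 !subrr mul0r.
  rewrite ReM krn// !(ReB, ImB, ReD, ImD, Re_conj, Im_conj) addrN addrN.
  by move: (complex.Re _) (complex.Re _) (complex.Im _) => p q r; field.
- have n1 : normc (-1 : R[i]) = 1 by rewrite normcN Normc.normc1.
  apply: le_trans (half (-1) n1); apply: le_trans (normc_Im _).
  rewrite le_eqVlt; apply/orP; left; apply/eqP; congr (`| _ |).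
  rewrite ImB ImM /= mul0r addr0 -cstE -RintegralB//; apply: eq_Rintegral => x.
  rewrite inE /= in_itv /= => xa; rewrite starE S0E conj0 !mulN1r.
  have [->|x0] := eqVneq x 0; first by rewrite z00 !subrr mul0r.
  rewrite ImM krn// !(ReB, ImB, ReN, ImN, ReD, ImD, Re_conj, Im_conj).
  by move: (complex.Re _) (complex.Re _) (complex.Im _) (complex.Im _) (complex.Im _) => p q r u v; field.
Qed.

End cell.

Section translation.
Context {R : realType}.
Local Notation mu := (@lebesgue_measure R).

Lemma Rintegral_shift (F : R -> R) (a b c : R) : continuous F -> a <= b ->
  \int[mu]_(x in `[a, b]) F (x + c) = \int[mu]_(x in `[a + c, b + c]) F x.
Proof.
move=> cF ab; rewrite /Rintegral; congr fine.
have D1 : ((fun x : R => x + c)^`())%classic = cst 1.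
  apply/funext => x; rewrite derive1E.
  have h : is_derive x (1 : R) (fun x : R => x + c) 1.
    by apply: der_eq (derD (is_derive_id x 1) (is_derive_cst c x 1)) _; rewrite addr0.
  exact: (@derive_val _ _ _ _ _ _ _ h).
have cc : continuous (fun x : R => x + c).
  by move=> x; apply: cvgD; [exact: cvg_id|exact: cvg_cst].
rewrite (@integration_by_substitution_increasing R (fun x => x + c) F a b ab).
- by apply: eq_integral => x _; rewrite D1 /= mulr1.
- by move=> x y _ _ xy; rewrite ltrD2r.
- by rewrite D1 => x _; exact: cst_continuous.
- by rewrite D1; exact: is_cvg_cst.
- by rewrite D1; exact: is_cvg_cst.
- split; first by move=> x _; apply: derivableD; [exact: derivable_id|exact: derivable_cst].
    by apply: cvg_at_right_filter; exact: cc.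
  by apply: cvg_at_left_filter; exact: cc.
- exact: continuous_subspaceT.
Qed.

Lemma continuous_sum (I : Type) (r : seq I) (F : I -> R -> R) : (forall q, continuous (F q)) ->
  continuous (fun x => \sum_(q <- r) F q x).
Proof.
move=> cF x; elim: r => [|q r IH].
  by rewrite (_ : (fun _ => _) = cst 0); [exact: cst_continuous|apply/funext => y; rewrite big_nil].
rewrite (_ : (fun _ => _) = (fun y => F q y + \sum_(q <- r) F q y)).
  by apply: cvgD; [exact: cF|exact: IH].
by apply/funext => y; rewrite big_cons.
Qed.

Lemma natr_doubleS (m : nat) : m.*2.+1%:R = m%:R + m%:R + 1 :> R.
Proof. by rewrite -natr1 -addnn natrD. Qed.

Variables (m : nat) (k : R).
Hypothesis k0 : 0 < k.
Local Notation Y := ((m%:R + 2^-1) * k).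

(** [Y] exceeds the last node by half a step, so the cells centred at the nodes tile [[- Y, Y]]. *)
Lemma periodized_integral (F : R -> R) : continuous F ->
  \int[mu]_(x in `[- (k / 2), k / 2]) (\sum_(0 <= q < m.*2.+1) F (x + sinc_node m k q)) =
  \int[mu]_(x in `[- Y, Y]) F x.
Proof.
move=> cF; rewrite Rintegral_sum//; last first.
  move=> q; apply: continuous_itv_integrable => x.
  by apply: (continuous_comp (f := fun x => x + sinc_node m k q)); [apply: cvgD; [exact: cvg_id|exact: cvg_cst]|exact: cF].
have YE : Y = - Y + m.*2.+1%:R * k by rewrite natr_doubleS; field.
rewrite [in RHS](_ : `[- Y, Y] = `[- Y, - Y + m.*2.+1%:R * k]); last by rewrite -YE.
rewrite Rintegral_itv_sum ?(ltW k0)//; apply: eq_bigr => q _.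
rewrite Rintegral_shift//; last by have := k0; lra.
have e1 : - (k / 2) + sinc_node m k q = - Y + q%:R * k by rewrite /sinc_node; field.
have e2 : k / 2 + sinc_node m k q = - Y + q.+1%:R * k by rewrite /sinc_node -natr1; field.
by rewrite e1 e2.
Qed.

End translation.

Section complex_sums.
Context {R : realType} (I : Type) (r : seq I) (F : I -> R[i]).

Lemma Re_sum : Re (\sum_(q <- r) F q) = \sum_(q <- r) Re (F q).
Proof. by apply: (big_morph (@complex.Re R)); [exact: ReD|]. Qed.

Lemma Im_sum : Im (\sum_(q <- r) F q) = \sum_(q <- r) Im (F q).
Proof. by apply: (big_morph (@complex.Im R)); [exact: ImD|]. Qed.

Lemma normc_sum : normc (\sum_(q <- r) F q) <= \sum_(q <- r) normc (F q).
Proof.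
apply: (big_ind2 (fun u v => normc u <= v)) => //; first by rewrite Normc.normc0.
by move=> u v u' v' h h'; apply: le_trans (le_normcD _ _) _; exact: lerD.
Qed.

End complex_sums.

Section trapezoid.
Context {R : realType}.
Local Notation mu := (@lebesgue_measure R).
Variables (m : nat) (k d W : R) (f : R[i] -> R[i]).
Hypotheses (k0 : 0 < k) (d0 : 0 < d).
Local Notation Y := ((m%:R + 2^-1) * k).
Hypothesis cf : C1 [set z | - d <= Im z <= d] f.
Hypothesis fW : forall s, - d <= s <= d -> normc (f (Y +i* s)%C - f (- Y +i* s)%C) <= W.

Let S z := \sum_(0 <= q < m.*2.+1) f (z + (sinc_node m k q)%:C%C).

Let addE (x s c : R) : (x +i* s)%C + c%:C%C = ((x + c) +i* s)%C.
Proof. by apply: complexP; rewrite ?ReD ?ImD /= ?addr0. Qed.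

Let C1_S : C1 [set z | - d <= Im z <= d] S.
Proof.
rewrite /S; elim: (index_iota _ _) => [|q r IH].
  by apply: C1_ext (C1_cst _ 0) => z; rewrite big_nil.
apply: C1_ext (fun z => f (z + (sinc_node m k q)%:C%C) + \sum_(q <- r) f (z + (sinc_node m k q)%:C%C)) _ _ _.
  by move=> z; rewrite big_cons.
apply: C1D => //; apply: (C1_comp (F := fun z => z + (sinc_node m k q)%:C%C) _ cf).
  by apply: C1D; [exact: C1_id|exact: C1_cst].
by move=> z /= h; rewrite ImD /= addr0.
Qed.

(** The right edge of one translate is the left edge of the next, so the sum telescopes. *)
Let S_edge s : S (k / 2 +i* s)%C - S (- (k / 2) +i* s)%C = f (Y +i* s)%C - f (- Y +i* s)%C.
Proof.
rewrite /S -sumrB.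
transitivity (\sum_(0 <= q < m.*2.+1) (f ((- Y + q.+1%:R * k) +i* s)%C - f ((- Y + q%:R * k) +i* s)%C)).
  apply: eq_bigr => q _; rewrite !addE; congr (f (_ +i* _)%C - f (_ +i* _)%C).
    by rewrite /sinc_node -natr1; field.
  by rewrite /sinc_node; field.
rewrite (telescope_sumr (fun q => f ((- Y + q%:R * k) +i* s)%C))// mul0r addr0.
by congr (f (_ +i* _)%C - _); rewrite natr_doubleS; field.
Qed.

Lemma trapezoid :
  normc (cint (- Y) Y (fun x => f (x +i* 0)%C) -
      k%:C%C * \sum_(0 <= q < m.*2.+1) f (sinc_node m k q)%:C%C) <=
  4 * ((expR (2 * pi * d / k) - 1)^-1 *
    \int[mu]_(x in `[- Y, Y]) (normc (f (x +i* d)%C) + normc (f (x -i* d)%C))) + 8 * (W * d).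
Proof.
have w0 : 0 < 2 * pi / k by rewrite divr_gt0// mulr_gt0// pi_gt0.
have wa : 2 * pi / k * (k / 2) = pi by field; exact: lt0r_neq0.
have dd : - d <= d by have := d0; lra.
have hdd : - d <= d <= d by rewrite dd lexx.
have hnd : - d <= - d <= d by rewrite dd lexx.
have h00 : - d <= 0 <= d by rewrite oppr_le0 (ltW d0).
have cont s : - d <= s <= d -> ccontinuous (fun x => f (x +i* s)%C).
  by move=> sd; apply: (@C1_continuous R _ f s cf).
have contS s : - d <= s <= d -> ccontinuous (fun x => S (x +i* s)%C).
  by move=> sd; apply: (@C1_continuous R _ S s C1_S).
have h1 s : - d <= s <= d -> normc (S (k / 2 +i* s)%C - S (- (k / 2) +i* s)%C) <= W.
  by move=> sd; rewrite S_edge; exact: fW.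
have := cell_quadrature w0 d0 wa C1_S h1.
have -> : 2 * (k / 2) = k by field.
have -> : S 0 = \sum_(0 <= q < m.*2.+1) f (sinc_node m k q)%:C%C.
  by apply: eq_bigr => q _; rewrite add0r.
have -> : cint (- (k / 2)) (k / 2) (fun x => S (x +i* 0)%C) = cint (- Y) Y (fun x => f (x +i* 0)%C).
  have [c1 c2] := cont 0 h00.
  apply: complexP; rewrite /cint /= -periodized_integral//; apply: eq_Rintegral => x _.
    by rewrite /S Re_sum; apply: eq_bigr => q _; rewrite addE.
  by rewrite /S Im_sum; apply: eq_bigr => q _; rewrite addE.
have -> : 2 * pi / k * d = 2 * pi * d / k by field; exact: lt0r_neq0.
move=> /le_trans; apply; rewrite lerD2r ler_pM2l//.
have e0 : 0 < expR (2 * pi * d / k) - 1.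
  by rewrite subr_gt0 expR_gt1 mulrAC mulr_gt0.
rewrite ler_pM2l ?invr_gt0//.
have cn s (sd : - d <= s <= d) := continuous_normc (cont s sd).
have cf2 : continuous (fun x => normc (f (x +i* d)%C) + normc (f (x -i* d)%C)).
  by move=> x; apply: cvgD; apply: cn.
rewrite -periodized_integral//; apply: le_Rintegral => //.
- apply: continuous_itv_integrable => x; apply: cvgD; apply: continuous_normc; exact: contS.
- apply: continuous_itv_integrable; apply: continuous_sum => q x.
  apply: (continuous_comp (f := fun x => x + sinc_node m k q) _ (cf2 _)).
  by apply: cvgD; [exact: cvg_id|exact: cvg_cst].
- move=> x _; rewrite big_split /=; apply: lerD.
    apply: le_trans (normc_sum _ _) _; apply: ler_sum => q _; by rewrite addE.
  apply: le_trans (normc_sum _ _) _; apply: ler_sum => q _; by rewrite addE.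
Qed.

End trapezoid.

(** * Decay of the integrand *)

Section logistic.
Context {R : realType}.
Local Notation mu := (@lebesgue_measure R).
Variables (beta q : R).
Hypotheses (be : 0 < beta) (q0 : 0 < q).

Definition logistic (y : R) : R := (1 + q * expR (beta * y))^-1.
(** The integral of [logistic] from [y] to infinity. *)
Definition softplus (y : R) : R := beta^-1 * ln (1 + expR (- (beta * y)) / q).

Let den_gt0 y : 0 < 1 + q * expR (beta * y).
Proof. by rewrite ltr_pwDl// mulr_ge0 ?(ltW q0) ?expR_ge0. Qed.

Lemma logistic_gt0 y : 0 < logistic y.
Proof. by rewrite /logistic invr_gt0. Qed.

Lemma logistic_le x y : x <= y -> logistic y <= logistic x.
Proof.
move=> xy; rewrite /logistic lef_pV2 ?posrE// lerD2l ler_pM2l// ler_expR ler_pM2l//.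
Qed.

Lemma continuous_logistic : continuous logistic.
Proof.
move=> y; apply: cvgV; first exact: lt0r_neq0.
apply: cvgD; first exact: cvg_cst.
apply: cvgM; first exact: cvg_cst.
apply: (continuous_comp (f := fun y => beta * y)); last exact: continuous_expR.
by apply: cvgM; [exact: cvg_cst|exact: cvg_id].
Qed.

Lemma is_derive_softplus y : is_derive y (1 : R) softplus (- logistic y).
Proof.
have ep := expR_gt0 (beta * y).
have d1 := derN (derM (is_derive_cst beta y 1) (is_derive_id y 1)).
have d2 := derM (der_comp d1 (is_derive_expR (- (beta * y)))) (is_derive_cst q^-1 y 1).
have d3 := derD (is_derive_cst (1 : R) y 1) d2.
have pp : 0 < 1 + expR (- (beta * y)) / q.
  by rewrite ltr_pwDl// divr_ge0 ?expR_ge0// ltW.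
have d4 := derM (is_derive_cst beta^-1 y 1) (der_comp d3 (is_derive1_ln pp)).
apply: der_eq d4 _; rewrite /logistic expRN.
have dn := den_gt0 y; rewrite expRN in pp.
move: (expR _) ep pp dn => E ep pp dn.
rewrite /cst; field.
rewrite !gt_eqF//; nra.
Qed.

Lemma continuous_softplus : continuous softplus.
Proof.
move=> y; apply: differentiable_continuous; apply/derivable1_diffP.
exact: (@ex_derive _ _ _ _ _ _ _ (is_derive_softplus y)).
Qed.

Lemma softplus_step y k : 0 < k -> k * logistic (y + k) <= softplus y - softplus (y + k).
Proof.
move=> k0; have yk : y < y + k by rewrite ltrDl.
have [c] := MVT yk (fun x _ => is_derive_softplus x) (continuous_subspaceT continuous_softplus).
rewrite in_itv /= => /andP[c1 c2] e.
rewrite -opprB e mulNr opprK (_ : y + k - y = k); last by ring.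
by rewrite mulrC ler_pM2r// logistic_le// ltW.
Qed.

Lemma softplus_ge0 y : 0 <= softplus y.
Proof.
rewrite /softplus; apply: mulr_ge0; first by rewrite invr_ge0 ltW.
by apply: ln_ge0; rewrite lerDl; apply: divr_ge0; [exact: expR_ge0|exact: ltW].
Qed.

(** A right-endpoint sum of a decreasing function is at most its integral, whatever the step; hence
    the uniformity in [k]. *)
Lemma logistic_sum k n : 0 < k -> \sum_(0 <= i < n) k * logistic (i.+1%:R * k) <= softplus 0.
Proof.
move=> k0; apply: (@le_trans _ _ (softplus 0 - softplus (n%:R * k))); last first.
  by rewrite lerBlDr lerDl softplus_ge0.
elim: n => [|n IH]; first by rewrite big_geq// mul0r subrr.
rewrite big_nat_recr//=; have := softplus_step (n%:R * k) k0.
have -> : n%:R * k + k = n.+1%:R * k by rewrite -natr1; ring.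
by lra.
Qed.

Lemma logistic_integral : (\int[mu]_(y in `[0%R, +oo[) (logistic y)%:E = (softplus 0)%:E)%E.
Proof.
rewrite (@ge0_continuous_FTC2y _ logistic (fun y => - softplus y) 0 0)%R.
- by rewrite -EFinB opprK add0r.
- by move=> x _; exact: ltW (logistic_gt0 x).
- exact: continuous_subspaceT continuous_logistic.
- rewrite -[X in _ --> X]oppr0; apply: cvgN.
  rewrite -[X in _ --> X](mulr0 beta^-1); apply: cvgM; first exact: cvg_cst.
  rewrite -[X in _ --> X](@ln1 R).
  have h1 : beta * y @[y --> +oo] --> +oo by apply: gt0_cvgMry => //; exact: cvg_id.
  have h2 : expR (- (beta * y)) @[y --> +oo] --> (0 : R).
    by apply: (@cvg_comp _ _ _ (fun y => beta * y) (fun z => expR (- z)) _ _ _ h1); exact: cvgr_expR.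
  have h3 : 1 + expR (- (beta * y)) / q @[y --> +oo] --> (1 : R).
    rewrite -[X in _ --> X]addr0 -[X in _ --> _ + X](mul0r q^-1).
    by apply: cvgD; [exact: cvg_cst|apply: cvgM; [exact: h2|exact: cvg_cst]].
  have FF : Filter (+oo%R : set_system R) by exact: _.
  exact: (continuous_cvg FF (continuous_ln (@ltr01 R)) h3).
- by move=> x _; apply: derivableN; exact: (@ex_derive _ _ _ _ _ _ _ (is_derive_softplus x)).
- apply: cvgN; apply: cvg_at_right_filter.
  exact: continuous_softplus.
- move=> x _; rewrite derive1E -[RHS]opprK.
  exact: (@derive_val _ _ _ _ _ _ _ (derN (is_derive_softplus x))).
Qed.

(** Put [E = expR (beta * y)]. As [q <= p] and [q <= 1], the number [p * (E - 1)] is at least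
    [q * E - 1]; then [expR (- x) <= (1 + x)^-1]. *)
Lemma exp_le_logistic (p y : R) : q <= p -> q <= 1 -> 0 <= y ->
  expR (- (p * (expR (beta * y) - 1))) <= expR 1 * logistic y.
Proof.
move=> qp q1 y0; have E1 : 1 <= expR (beta * y) by rewrite -expR0 ler_expR mulr_ge0// ltW.
have dn := den_gt0 y; move: E1 dn; rewrite /logistic; move: (expR (beta * y)) => E E1 dn.
apply: (@le_trans _ _ (expR (1 + - (q * E)))).
  rewrite ler_expR; nra.
rewrite expRD ler_pM2l ?expR_gt0// expRN lef_pV2 ?posrE ?expR_gt0//.
exact: expR_ge1Dx.
Qed.

Lemma softplus0 : softplus 0 = beta^-1 * ln (1 + q^-1).
Proof. by rewrite /softplus mulr0 oppr0 expR0 mul1r. Qed.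

End logistic.

(** If the minimum is 1 the left side is [ln 2]. Otherwise it is [- ln x] up to multiples of [ln 2],
    and [1 - expR (- x) <= x] compares this with [L_fun]. *)
Lemma log_bound {R : realType} (beta x : R) : 0 < beta < 1 -> 0 < x ->
  ln (1 + (Num.min 1 (x * 2 `^ (- beta)))^-1) <= 1 + L_fun x.
Proof.
move=> /andP[be0 be1] x0; rewrite /L_fun.
have ln2 : ln 2 <= 1 :> R by have := @le_ln1Dx R 1; rewrite ?ltrN10// -[1 + 1]/(2%:R) => ->//; lra.
have [h|h] := leP 1 (x * 2 `^ (- beta)).
  rewrite invr1; have := normr_ge0 (ln (1 - expR (- x))); rewrite -[1 + 1]/(2%:R); lra.
set p := x * 2 `^ (- beta) in h *.
have p0 : 0 < p by rewrite mulr_gt0// powR_gt0.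
have -> : 1 + p^-1 = (1 + p) / p by field; exact: lt0r_neq0.
have p1 : 0 < 1 + p by rewrite addr_gt0.
rewrite ln_div ?posrE// /p lnM ?posrE ?powR_gt0// ln_powR.
have h2 : ln (1 + p) <= ln 2 by rewrite ler_ln ?posrE//; lra.
have h3 : 0 < 1 - expR (- x) by rewrite subr_gt0 expR_lt1 oppr_lt0.
have h4 : 1 - expR (- x) <= x by have := expR_ge1Dx (- x); lra.
have h5 : ln (1 - expR (- x)) <= ln x by rewrite ler_ln ?posrE.
have h6 := ler_norm (- ln (1 - expR (- x))); rewrite normrN in h6.
have h7 : 0 <= ln 2 :> R by rewrite ln_ge0//; lra.
rewrite /p in h2; move: (ln 2) ln2 h2 h5 h6 h7 => l l1 h2 h5 h6 h7; nra.
Qed.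

Section symmetric_integrals.
Context {R : realType}.
Local Notation mu := (@lebesgue_measure R).
Implicit Types G : R -> R.

Lemma Rintegral_neg G Y : continuous G -> 0 <= Y ->
  \int[mu]_(x in `[- Y, 0]) G x = \int[mu]_(x in `[0, Y]) G (- x).
Proof.
move=> cG Y0; have := @integration_by_substitution_oppr R G 0 Y Y0; rewrite oppr0 => h.
by rewrite /Rintegral h//; exact: continuous_subspaceT.
Qed.

Lemma continuous_neg G : continuous G -> continuous (fun x => G (- x)).
Proof. by move=> cG x; apply: (continuous_comp (f := -%R)); [exact: continuousN|exact: cG]. Qed.

Lemma Rintegral_sym G Y : continuous G -> 0 <= Y ->
  \int[mu]_(x in `[- Y, Y]) G x = \int[mu]_(x in `[0, Y]) (G (- x) + G x).
Proof.
move=> cG Y0; rewrite (@Rintegral_itv_split _ G (- Y) 0 Y)// ?oppr_le0// Rintegral_neg//.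
rewrite RintegralD//; apply: continuous_itv_integrable => //; exact: continuous_neg.
Qed.
End symmetric_integrals.

Section decay.
Context {R : realType}.
Local Notation mu := (@lebesgue_measure R).
Variables (b beta lambda1 d : R).
Hypotheses (b0 : 0 < b) (be : 0 < beta < 1) (bl : b < lambda1 / Num.sqrt 2) (dd : 0 < d < pi / 4).

Definition rate (t : R) := kappa b beta d * 2 `^ (- beta) * t.

Lemma rate_gt0 t : 0 < t -> 0 < rate t.
Proof. by move=> t0; rewrite mulr_gt0// mulr_gt0 ?powR_gt0// kappa_gt0. Qed.

Lemma bl_sqrt lambda : lambda1 <= lambda -> b * Num.sqrt 2 < lambda.
Proof. by apply: lt_le_trans; rewrite -ltr_pdivlMr// sqrtr_gt0. Qed.

(** [dgamma_ratio] absorbs the resolvent uniformly in [lambda]; what is left is the modulus of the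
    symbol, controlled by [Re_gamma_pow_ge]. *)
Lemma g_decay : exists2 C0 : R, 0 < C0 & forall lambda t y s, lambda1 <= lambda -> 0 < t -> `|s| <= d ->
  normc (g_fun b beta lambda (y +i* s)%C t) <= C0 * expR (- (rate t * expR (beta * `|y|))).
Proof.
have [C0 C00 hC] := dgamma_ratio b0 bl dd; exists C0 => // lambda t y s ll t0 sd.
have ss : - (pi / 4) < s < pi / 4.
  by move: sd dd; rewrite ler_norml => /andP[s1 s2] /andP[d1 d2]; apply/andP; split; lra.
have n1 : 0 < normc (gamma b (y +i* s)%C - lambda%:C%C).
  by apply: normc_gt0; rewrite subr_eq0; exact: (gamma_neq b0 (bl_sqrt ll) y ss).
rewrite g_funE -mulrA Normc.normcM normc_symbol mulrC; apply: ler_pM.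
- exact: normc_ge0.
- exact: expR_ge0.
- by rewrite Normc.normcM Normc.normcV mulrC ler_pdivrMr//; exact: hC.
- rewrite ler_expR lerN2 /rate mulrAC [beta * _]mulrC [_ * t]mulrC.
  by rewrite ler_pM2l//; exact: (Re_gamma_pow_ge b0 _ be dd sd).
Qed.

Lemma C1_g_strip lambda t : lambda1 <= lambda ->
  C1 [set z | - d <= Im z <= d] (fun z => g_fun b beta lambda z t).
Proof.
move=> ll; apply: C1_sub (C1_g beta t lambda b0) => -[x s] /= /andP[s1 s2].
by apply: (regular_strip b0 (bl_sqrt ll)); move: dd => /andP[d1 d2]; apply/andP; split; lra.
Qed.

(** The rate capped at 1, as [exp_le_logistic] demands. *)
Definition qmin t := Num.min 1 (rate t).

Lemma qmin_gt0 t : 0 < t -> 0 < qmin t.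
Proof. by move=> t0; rewrite /qmin lt_min ltr01 rate_gt0. Qed.

Lemma qmin_le1 t : qmin t <= 1. Proof. by rewrite /qmin ge_min lexx. Qed.
Lemma qmin_le t : qmin t <= rate t. Proof. by rewrite /qmin ge_min lexx orbT. Qed.

Lemma M_fun_bound t : 0 < t -> ln (1 + (qmin t)^-1) <= M_fun b beta d t.
Proof.
move=> t0; have := @log_bound R beta (kappa b beta d * t) be; rewrite /qmin /rate /M_fun.
by rewrite [in X in _ -> X]mulrAC; apply; rewrite mulr_gt0// kappa_gt0.
Qed.

(** The factor [expR (- p)] is split off because the tail estimate takes
    [p = rate t * expR (beta * N * k)], which carries the decay in [N]. *)
Lemma decay_le_logistic t y p : 0 < t -> rate t <= p -> 0 <= y ->
  expR (- (p * expR (beta * y))) <= expR (- p) * (expR 1 * logistic beta (qmin t) y).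
Proof.
move=> t0 tp y0; have [be0 _] := andP be.
have := exp_le_logistic be0 (qmin_gt0 t0) (le_trans (qmin_le t) tp) (qmin_le1 t) y0.
rewrite -(ler_pM2l (expR_gt0 (- p))) -expRD (_ : - p + _ = - (p * expR (beta * y)))//; ring.
Qed.

(** The bound depends on [t] only through [qmin t], which is nondecreasing; so it serves both for
    [t] away from 0 and for [t] tending to 0. *)
Lemma N_fun_bound : exists2 C : R, 0 < C & forall t, 0 < t ->
  (N_fun b beta lambda1 d t <= (C * ln (1 + (qmin t)^-1))%:E)%E.
Proof.
have [C0 C00 hC] := g_decay; have [be0 be1] := andP be; have [d0 d1] := andP dd.
exists (2 * (2 * C0 * expR 1 * beta^-1)); first by rewrite !mulr_gt0 ?expR_gt0 ?invr_gt0.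
move=> t t0; apply: ub_ereal_sup => _ [lambda /= ll <-].
have q0 := qmin_gt0 t0.
pose F (y : R) : R := 2 * C0 * expR 1 * logistic beta (qmin t) `|y|.
have F0 y : 0 <= F y.
  by rewrite /F !mulr_ge0 ?expR_ge0 ?(ltW C00)//; apply: ltW; apply: logistic_gt0.
have cF : continuous F.
  move=> y; apply: cvgM; first exact: cvg_cst.
  by apply: (continuous_comp (f := fun y : R => `|y|)); [exact: norm_continuous|exact: continuous_logistic].
have gF y s : `|s| <= d -> normc (g_fun b beta lambda (y +i* s)%C t) <= C0 * expR 1 * logistic beta (qmin t) `|y|.
  move=> sd; apply: le_trans (hC lambda t y s ll t0 sd) _; rewrite -mulrA ler_pM2l//.
  apply: le_trans (decay_le_logistic t0 (lexx _) (normr_ge0 y)) _.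
  rewrite ler_piMl//; last by rewrite -expR0 ler_expR oppr_le0 ltW// rate_gt0.
  by rewrite mulr_ge0 ?expR_ge0//; apply: ltW; apply: logistic_gt0.
have cg s : - d <= s <= d -> continuous (fun y => normc (g_fun b beta lambda (y +i* s)%C t)).
  by move=> sd; apply: continuous_normc; apply: (@C1_continuous R _ (fun z => g_fun b beta lambda z t) s (C1_g_strip t ll)).
have hdd : - d <= d <= d by apply/andP; split; lra.
have hnd : - d <= - d <= d by apply/andP; split; lra.
apply: (@le_trans _ _ (\int[mu]_y (F y)%:E)%E).
  apply: ge0_le_integral => //.
  - by move=> y _; rewrite lee_fin addr_ge0 ?normc_ge0.
  - apply/measurable_EFinP; apply: continuous_measurable_fun => y.
    by apply: cvgD; [exact: (cg d)|exact: (cg (- d))].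
  - by apply/measurable_EFinP; exact: continuous_measurable_fun.
  - move=> y _; rewrite lee_fin /F.
    have dN : `|d| <= d by rewrite gtr0_norm.
    have dN' : `|- d| <= d by rewrite normrN.
    apply: le_trans (lerD (gF y d dN) (gF y (- d) dN')) _.
    by rewrite -!mulrA [leRHS]mulrDl !mul1r.
rewrite ge0_symfun_integralT//; last by move=> y; rewrite /F /= normrN.
rewrite (_ : [set x | _] = `[0, +oo[%classic); last first.
  by apply/seteqP; split => x /=; rewrite in_itv /= andbT.
under eq_integral => y.
  rewrite inE /= in_itv /= andbT => y0; rewrite /F ger0_norm// EFinM.
  over.
rewrite ge0_integralZl//; last 3 first.
- apply/measurable_EFinP; apply: measurable_funTS; apply: continuous_measurable_fun.
  exact: continuous_logistic.
- by move=> y _; rewrite lee_fin ltW// logistic_gt0.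
- by rewrite lee_fin !mulr_ge0 ?expR_ge0 ?(ltW C00).
by rewrite logistic_integral// softplus0 -!EFinM lee_fin !mulrA.
Qed.

End decay.

Section symmetry.
Context {R : realType}.
Implicit Types z : R[i].

Lemma conjM z1 z2 : ((z1 * z2)^*)%C = (z1^*)%C * (z2^*)%C. Proof. exact: rmorphM. Qed.
Lemma conjN z : ((- z)^*)%C = - (z^*)%C. Proof. exact: rmorphN. Qed.
Lemma conjB z1 z2 : ((z1 - z2)^*)%C = (z1^*)%C - (z2^*)%C. Proof. exact: rmorphB. Qed.
Lemma conjR (x : R) : ((x%:C)^*)%C = x%:C%C.
Proof. by apply: complexP; rewrite ?Re_conj ?Im_conj // oppr0. Qed.

Lemma cexp_conj z : cexp (z^*)%C = ((cexp z)^*)%C.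
Proof. by rewrite /cexp Re_conj Im_conj; apply: complexP; rewrite ?Re_conj ?Im_conj /= ?cosN ?sinN ?mulrN. Qed.

Lemma cln_conj z : 0 < Re z -> cln (z^*)%C = ((cln z)^*)%C.
Proof.
move=> z0; have h : 0 < Re (z^*)%C by rewrite Re_conj.
rewrite /cln normc_conj (carg_right h) (carg_right z0) Re_conj Im_conj mulNr atanN.
by apply: complexP; rewrite ?Re_conj ?Im_conj.
Qed.

Lemma cpow_conj (beta : R) z : 0 < Re z -> cpow (z^*)%C beta = ((cpow z beta)^*)%C.
Proof. by move=> z0; rewrite /cpow -cexp_conj conjM conjR cln_conj. Qed.

Lemma gamma_neg (b y : R) : gamma b (- y +i* 0)%C = ((gamma b (y +i* 0)%C)^*)%C.
Proof.
by rewrite !gammaE rcoshN rsinhN; apply: complexP; rewrite ?Re_conj ?Im_conj /=; ring.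
Qed.

Lemma dgamma_neg (b y : R) : dgamma b (- y +i* 0)%C = - ((dgamma b (y +i* 0)%C)^*)%C.
Proof.
rewrite !dgammaE rcoshN rsinhN; apply: complexP; rewrite ?ReN ?ImN ?Re_conj ?Im_conj /= ?sin0; ring.
Qed.

(** Along the real axis the real part is thus odd and the imaginary part even, so an integral over
    [[- Y, Y]] is [2 i] times the integral of the imaginary part over [[0, Y]]. *)
Lemma g_fun_neg (b beta lambda t y : R) : 0 < b ->
  g_fun b beta lambda (- y +i* 0)%C t = - ((g_fun b beta lambda (y +i* 0)%C t)^*)%C.
Proof.
move=> b0; rewrite !g_funE gamma_neg dgamma_neg /symbol.
have p4 : - (pi / 4) <= (0 : R) < pi / 4.
  by have := @pi_gt0 R; move: (pi : R) => p p0; apply/andP; split; lra.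
move: (gamma _ _) (dgamma _ _) (Re_gamma_gt0 b0 y p4) => g v gp.
rewrite mulrN !conjM conjc_inv conjB conjR.
by rewrite (cpow_conj beta gp) -cexp_conj conjN conjM conjR.
Qed.
End symmetry.

(** * The quadrature error at one eigenvalue *)

Section error.
Context {R : realType}.
Local Notation mu := (@lebesgue_measure R).
Variables (b beta lambda1 d : R).
Hypotheses (b0 : 0 < b) (be : 0 < beta < 1) (bl : b < lambda1 / Num.sqrt 2) (dd : 0 < d < pi / 4).

Lemma full_line_limit lambda t : lambda1 <= lambda -> 0 < t ->
  normc (cint (- Y) Y (fun y => g_fun b beta lambda (y +i* 0)%C t) +
     2 * pi%:C%C * 'i%C * (expR (- (t * lambda `^ beta)))%:C%C) @[Y --> +oo] --> (0 : R).
Proof.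
move=> ll t0; have lm := half_line_limit b0 be t0 (bl_sqrt bl ll).
have [cr ci] := continuous_g beta t b0 (bl_sqrt bl ll).
set e := expR _ in lm *.
have h : 2 * `|\int[mu]_(y in `[0, Y]) Im (g_fun b beta lambda (y +i* 0)%C t) - (- pi * e)| @[Y --> +oo] --> (0 : R).
  rewrite -[X in _ --> X](mulr0 2); apply: cvgM; first exact: cvg_cst.
  rewrite -[X in _ --> X](@normr0 _ R); apply: cvg_norm.
  rewrite -[X in _ --> X](subrr (- pi * e)); apply: cvgB; [exact: lm|exact: cvg_cst].
apply: cvg_trans h; apply: near_eq_cvg; near=> Y.
have Y0 : 0 <= Y by near: Y; apply: nbhs_pinfty_ge; exact: num_real.
rewrite /cint !Rintegral_sym//.
have -> : \int[mu]_(x in `[0, Y]) (Re (g_fun b beta lambda (- x +i* 0)%C t) + Re (g_fun b beta lambda (x +i* 0)%C t)) = 0.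
  rewrite (@eq_Rintegral _ _ _ _ _ (cst 0)); first by rewrite (Rintegral_cst _ _ 0)//= mul0r.
  by move=> x _; rewrite g_fun_neg// ReN Re_conj addNr.
have -> : \int[mu]_(x in `[0, Y]) (Im (g_fun b beta lambda (- x +i* 0)%C t) + Im (g_fun b beta lambda (x +i* 0)%C t)) =
    2 * \int[mu]_(x in `[0, Y]) Im (g_fun b beta lambda (x +i* 0)%C t).
  rewrite -RintegralZl//; last exact: continuous_itv_integrable.
  by apply: eq_Rintegral => x _; rewrite g_fun_neg// ImN Im_conj opprK mulrDl mul1r.
move: (\int[mu]_(_ in _) _) => I.
rewrite normcE (_ : Re _ = 0) 1?(_ : Im _ = 2 * (I - (- pi * e))).
- by rewrite expr0n /= add0r sqrtr_sqr normrM [`|2|]gtr0_norm.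
- by rewrite !(ReD, ImD, ReM, ImM) /=; ring.
- by rewrite !(ReD, ImD, ReM, ImM) /=; ring.
Unshelve. all: by end_near. Qed.

Lemma symmetric_sum (G : R -> R[i]) (k : R) N n :
  \sum_(0 <= q < (N + n).*2.+1) G (sinc_node (N + n) k q) =
  \sum_(0 <= q < N.*2.+1) G (sinc_node N k q) +
  \sum_(0 <= i < n) (G ((N + i.+1)%:R * k) + G (- ((N + i.+1)%:R * k))).
Proof.
elim: n => [|n IH]; first by rewrite addn0 [X in _ + X]big_geq// addr0.
rewrite [X in _ = _ + X]big_nat_recr//= addrA -IH addnS doubleS.
rewrite big_nat_recl// big_nat_recr//=.
have -> : \sum_(0 <= i < (N + n).*2.+1) G (sinc_node (N + n).+1 k i.+1) =
    \sum_(0 <= q < (N + n).*2.+1) G (sinc_node (N + n) k q).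
  by apply: eq_bigr => q _; congr (G _); rewrite /sinc_node -!natr1; ring.
have -> : sinc_node (N + n).+1 k 0 = - ((N + n).+1%:R * k) by rewrite /sinc_node; ring.
have -> : sinc_node (N + n).+1 k (N + n).*2.+2 = (N + n).+1%:R * k.
  by rewrite /sinc_node -doubleS -addnn natrD; ring.
ring.
Qed.

(** As [2 * pi >= 1], the error may be bounded after multiplication by [2 pi i], which clears the
    denominator. *)
Lemma normc_2pi_ge (z : R[i]) : normc z <= normc (2 * pi%:C%C * 'i%C * z).
Proof.
rewrite !Normc.normcM normcR (_ : normc ('i%C : R[i]) = 1) ?mulr1; last first.
  by rewrite normcE /= expr0n /= add0r expr1n sqrtr1.
rewrite (_ : (2 : R[i]) = (2 : R)%:C%C) ?normcR ?[`|2|]gtr0_norm//; last first.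
  by apply: complexP; rewrite ?ReD ?ImD //= addr0.
rewrite ler_peMl ?normc_ge0//; have := @pi_ge2 R; rewrite gtr0_norm ?pi_gt0//; move: (pi : R) => p; lra.
Qed.

Lemma quadrature_errorE N k t lambda :
  2 * pi%:C%C * 'i%C * quadrature_error b beta N k t lambda =
  2 * pi%:C%C * 'i%C * (expR (- (t * lambda `^ beta)))%:C%C +
  k%:C%C * \sum_(0 <= j < N.*2.+1) g_fun b beta lambda (sinc_node N k j)%:C%C t.
Proof.
have c0 : (2 * pi%:C%C * 'i%C : R[i]) != 0.
  have pn : pi%:C%C != 0 :> R[i] by rewrite (inj_eq (@complexI R)) gt_eqF// pi_gt0.
  have i0 : 'i%C != 0 :> R[i] by rewrite eq_complex /= oner_eq0 andbF.
  by rewrite !mulf_neq0// pnatr_eq0.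
rewrite /quadrature_error mulrDr; congr (_ + _); rewrite mulrA; congr (_ * _).
by rewrite mulrC divfK.
Qed.

End error.

Section scalar_error.
Context {R : realType}.
Local Notation mu := (@lebesgue_measure R).
Variables (b beta lambda1 d : R).
Hypotheses (b0 : 0 < b) (be : 0 < beta < 1) (bl : b < lambda1 / Num.sqrt 2) (dd : 0 < d < pi / 4).
Local Notation rate := (rate b beta d).

Lemma truncated_N_fun lambda t Y Nv : lambda1 <= lambda -> N_fun b beta lambda1 d t = Nv%:E ->
  \int[mu]_(x in `[- Y, Y]) (normc (g_fun b beta lambda (x +i* d)%C t) +
    normc (g_fun b beta lambda (x -i* d)%C t)) <= Nv.
Proof.
move=> ll NE; have [d0 d1] := andP dd.
have cg s : - d <= s <= d -> continuous (fun y => normc (g_fun b beta lambda (y +i* s)%C t)).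
  move=> sd; apply: continuous_normc.
  have h := C1_g_strip beta b0 bl dd t ll.
  by apply: (@C1_continuous R _ (fun z => g_fun b beta lambda z t) s h) => x /=.
have hdd : - d <= d <= d by apply/andP; split; lra.
have hnd : - d <= - d <= d by apply/andP; split; lra.
have cF : continuous (fun x => normc (g_fun b beta lambda (x +i* d)%C t) + normc (g_fun b beta lambda (x -i* d)%C t)).
  by move=> x; apply: cvgD; [exact: (cg d)|exact: (cg (- d))].
have iF := continuous_itv_integrable (- Y) Y cF.
rewrite -lee_fin -NE /Rintegral fineK; last exact: integrable_fin_num iF.
apply: (@le_trans _ _ (\int[mu]_x (normc (g_fun b beta lambda (x +i* d)%C t) +
    normc (g_fun b beta lambda (x -i* d)%C t))%:E)%E).
  apply: ge0_subset_integral => //.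
  - by apply/measurable_EFinP; exact: continuous_measurable_fun.
  - by move=> x _; rewrite lee_fin addr_ge0 ?normc_ge0.
by apply: ereal_sup_ubound; exists lambda.
Qed.

(** The trapezoidal sum with [N + n] nodes on each side is compared with the integral over
    [[- Y, Y]], with [n] arbitrarily large; the bounds on the trapezoidal error and on the nodes
    beyond [N] do not depend on [n]. *)
Lemma scalar_error : exists2 C : R, 0 < C & forall lambda t k N Nv,
  lambda1 <= lambda -> 0 < t -> 0 < k -> N_fun b beta lambda1 d t = Nv%:E ->
  normc (quadrature_error b beta N k t lambda) <=
  C * (Nv * (expR (2 * pi * d / k) - 1)^-1 +
       M_fun b beta d t * expR (- (rate t * expR (k * N%:R * beta)))).
Proof.
have [C0 C00 hC] := g_decay b0 be bl dd; have [be0 be1] := andP be; have [d0 d1] := andP dd.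
exists (4 + 2 * C0 * expR 1 * beta^-1).
  by rewrite addr_gt0// !mulr_gt0 ?expR_gt0 ?invr_gt0.
move=> lambda t k N Nv ll t0 k0 NE; have r0 := rate_gt0 b0 be dd t0.
pose f z := g_fun b beta lambda z t.
pose tl : R := 2 * C0 * expR 1 * beta^-1 * (M_fun b beta d t * expR (- (rate t * expR (k * N%:R * beta)))).
pose trap : R := 4 * ((expR (2 * pi * d / k) - 1)^-1 * Nv).
have M0 : 0 <= M_fun b beta d t.
  apply: le_trans (M_fun_bound b0 be dd t0); rewrite ln_ge0// lerDl invr_ge0 ltW//.
  exact: (qmin_gt0 b0 be dd t0).
have ge1 : 0 < expR (2 * pi * d / k) - 1.
  by rewrite subr_gt0 expR_gt1 !mulr_gt0 ?invr_gt0 ?pi_gt0.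
have Nv0 : 0 <= Nv.
  apply: le_trans (truncated_N_fun 0 ll NE).
  by apply: Rintegral_ge0 => x _; rewrite addr_ge0 ?normc_ge0.
apply: (@le_trans _ _ (trap + tl)); last first.
  have h1 : 0 <= (expR (2 * pi * d / k) - 1)^-1 * Nv by rewrite mulr_ge0 ?invr_ge0 ?(ltW ge1).
  have h2 : 0 <= M_fun b beta d t * expR (- (rate t * expR (k * N%:R * beta))) by rewrite mulr_ge0 ?expR_ge0.
  have h3 : 0 <= 2 * C0 * expR 1 / beta by rewrite !mulr_ge0 ?expR_ge0 ?invr_ge0 ?(ltW be0)// ltW.
  rewrite /tl /trap [Nv * _]mulrC; move: (_ / beta) (_^-1 * Nv) (M_fun _ _ _ _ * _) h1 h2 h3 => u v w h1 h2 h3.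
  have := mulr_ge0 h3 h1; lra.
(* At distance [(N + i.+1) * k] the exponent is [rate t * expR (beta * N * k)] times
   [expR (beta * i.+1 * k)], so the omitted nodes form a logistic sum with an exponentially small
   prefactor. *)
have tail n : normc (k%:C%C * \sum_(0 <= i < n) (f ((N + i.+1)%:R * k)%:C%C + f (- ((N + i.+1)%:R * k))%:C%C)) <= tl.
  have pe : rate t <= rate t * expR (beta * (N%:R * k)).
    by rewrite ler_peMr ?(ltW r0)// -expR0 ler_expR !mulr_ge0// ltW.
  have term i : normc (f ((N + i.+1)%:R * k)%:C%C + f (- ((N + i.+1)%:R * k))%:C%C) <=
      2 * C0 * (expR (- (rate t * expR (beta * (N%:R * k)))) * (expR 1 * logistic beta (qmin b beta d t) (i.+1%:R * k))).
    have ik : 0 <= i.+1%:R * k by rewrite mulr_ge0// ltW.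
    have nik : 0 <= (N + i.+1)%:R * k by rewrite mulr_ge0// ltW.
    have key (x : R) : `|x| = (N + i.+1)%:R * k -> normc (f x%:C%C) <=
        C0 * (expR (- (rate t * expR (beta * (N%:R * k)))) * (expR 1 * logistic beta (qmin b beta d t) (i.+1%:R * k))).
      move=> xE; have s0 : `|0 : R| <= d by rewrite normr0 ltW.
      apply: le_trans (hC lambda t x 0 ll t0 s0) _; rewrite ler_pM2l// xE natrD mulrDl mulrDr expRD mulrA.
      exact: (decay_le_logistic b0 be dd t0 pe ik).
    apply: le_trans (le_normcD _ _) _; rewrite -[X in _ <= X]mulrA [X in _ <= X]mulrDl mul1r.
    by apply: lerD; apply: key; rewrite ?normrN ger0_norm.
  rewrite Normc.normcM normcR (gtr0_norm k0).
  apply: (@le_trans _ _ (k * \sum_(0 <= i < n) 2 * C0 * (expR (- (rate t * expR (beta * (N%:R * k)))) * (expR 1 * logistic beta (qmin b beta d t) (i.+1%:R * k))))).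
    by rewrite ler_pM2l//; apply: le_trans (normc_sum _ _) _; apply: ler_sum => i _; exact: term.
  set E := expR (- _).
  have -> : k * \sum_(0 <= i < n) 2 * C0 * (E * (expR 1 * logistic beta (qmin b beta d t) (i.+1%:R * k))) =
     2 * C0 * expR 1 * E * \sum_(0 <= i < n) k * logistic beta (qmin b beta d t) (i.+1%:R * k).
    by rewrite !mulr_sumr; apply: eq_bigr => i _; ring.
  have E0 : 0 < 2 * C0 * expR 1 * E by rewrite !mulr_gt0 ?expR_gt0.
  have ls := logistic_sum be0 (qmin_gt0 b0 be dd t0) n k0; rewrite softplus0 in ls.
  apply: le_trans (ler_wpM2l (ltW E0) ls) _.
  have bi : 0 < beta^-1 by rewrite invr_gt0.
  rewrite mulrA; apply: le_trans (ler_wpM2l (ltW (mulr_gt0 E0 bi)) (M_fun_bound b0 be dd t0)) _.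
  rewrite /tl /E (_ : beta * (N%:R * k) = k * N%:R * beta); last by ring.
  by rewrite le_eqVlt; apply/orP; left; apply/eqP; ring.
(* The slack [e] absorbs the truncation of the line to [[- Y, Y]] and the contribution of the
   vertical edges, both vanishing as [Y] grows. *)
apply/ler_addgt0Pr => e e0.
have lim1 := full_line_limit b0 be bl ll t0.
(* For the edges the weak bound [expR (beta * Y) >= beta * Y] in the exponent is enough. *)
have lim2 : 8 * (2 * C0 * expR (- (rate t * beta * Y)) * d) @[Y --> +oo] --> (0 : R).
  have h1 : rate t * beta * Y @[Y --> +oo] --> +oo.
    by apply: gt0_cvgMry; [exact: mulr_gt0|exact: cvg_id].
  have h2 : expR (- (rate t * beta * Y)) @[Y --> +oo] --> (0 : R).
    by apply: (@cvg_comp _ _ _ (fun Y => rate t * beta * Y) (fun z => expR (- z)) _ _ _ h1); exact: cvgr_expR.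
  have h3 : 8 * (2 * C0 * expR (- (rate t * beta * Y)) * d) @[Y --> +oo] --> 8 * (2 * C0 * (0 : R) * d).
    by apply: cvgM; [exact: cvg_cst|apply: cvgM; [apply: cvgM; [exact: cvg_cst|exact: h2]|exact: cvg_cst]].
  by rewrite mulr0 mul0r mulr0 in h3.
have FF : Filter (+oo%R : set_system R) by exact: _.
have lim := cvgD lim1 lim2; move: (lim FF) => {}lim; rewrite addr0 in lim.
have [Y0 [_ hY]] : \forall Y \near +oo, normc (cint (- Y) Y (fun y : R => g_fun b beta lambda (y +i* 0)%C t) +
    2 * pi%:C%C * 'i%C * (expR (- (t * lambda `^ beta)))%:C%C) +
    8 * (2 * C0 * expR (- (rate t * beta * Y)) * d) < e.
  exact: (cvgr_lt _ lim e e0).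
have [n hn] : exists n, Y0 < n%:R * k.
  exists (Num.truncn (`|Y0| / k)).+1; apply: le_lt_trans (ler_norm Y0) _; rewrite -ltr_pdivrMr//.
  exact: truncnS_gt.
pose m := (N + n)%N; pose Y := (m%:R + 2^-1) * k.
have YY0 : Y0 < Y.
  apply: lt_trans hn _; rewrite /Y ltr_pM2r// /m natrD; have := ler0n R N; lra.
have Yp : 0 < Y by rewrite /Y mulr_gt0// ltr_wpDl.
have edge s : - d <= s <= d -> normc (f (Y +i* s)%C - f (- Y +i* s)%C) <= 2 * C0 * expR (- (rate t * beta * Y)).
  move=> sd; have sd' : `|s| <= d by rewrite ler_norml.
  have key (x : R) : `|x| = Y -> normc (f (x +i* s)%C) <= C0 * expR (- (rate t * beta * Y)).
    move=> xY; apply: le_trans (hC lambda t x s ll t0 sd') _; rewrite ler_pM2l// ler_expR lerN2 xY -mulrA ler_pM2l//.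
    by have := expR_ge1Dx (beta * Y); lra.
  apply: le_trans (le_normcD _ _) _; rewrite normcN -[X in _ <= X]mulrA [X in _ <= X]mulrDl mul1r.
  by apply: lerD; apply: key; rewrite ?normrN gtr0_norm.
have tr := trapezoid k0 d0 (C1_g_strip beta b0 bl dd t ll) edge.
apply: le_trans (normc_2pi_ge _) _; rewrite quadrature_errorE.
have := symmetric_sum (fun x => f x%:C%C) k N n; rewrite -/m => sE.
pose I := cint (- Y) Y (fun y : R => f (y +i* 0)%C).
pose A : R[i] := 2 * pi%:C%C * 'i%C * (expR (- (t * lambda `^ beta)))%:C%C.
pose T := \sum_(0 <= i < n) (f ((N + i.+1)%:R * k)%:C%C + f (- ((N + i.+1)%:R * k))%:C%C).
(* Three contributions: the truncated integral against its limit, the trapezoidal error with [m]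
   nodes on each side, and the nodes beyond [N]. *)
have -> : 2 * pi%:C%C * 'i%C * (expR (- (t * lambda `^ beta)))%:C%C +
   k%:C%C * \sum_(0 <= j < N.*2.+1) g_fun b beta lambda (sinc_node N k j)%:C%C t =
   (I + A) - (I - k%:C%C * \sum_(0 <= q < m.*2.+1) f (sinc_node m k q)%:C%C) - k%:C%C * T.
  by rewrite sE -/T -/A /f; ring.
have hYY := hY Y YY0; have tn := tail n.
have tr2 : normc (I - k%:C%C * \sum_(0 <= q < m.*2.+1) f (sinc_node m k q)%:C%C) <=
    trap + 8 * (2 * C0 * expR (- (rate t * beta * Y)) * d).
  apply: le_trans tr _; rewrite lerD2r /trap ler_pM2l// ler_pM2l ?invr_gt0//.
  exact: (truncated_N_fun Y ll NE).
apply: le_trans (le_normcD _ _) _; rewrite normcN.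
apply: le_trans (lerD (le_normcD _ _) tn) _; rewrite normcN.
move: hYY tr2; rewrite -/f -/I -/A; move: (normc (I + A)) (normc (I - _)) => u v; lra.
Qed.

End scalar_error.

Lemma sinc_node_real {R : realType} (N : nat) (k : R) i : (sinc_node N k i)%:C%C = (sinc_node N k i +i* 0)%C :> R[i].
Proof. by []. Qed.

(** Inserts the factor [cosh / sinh] of the stated estimate. *)
Lemma rcosh_rsinh_ge1 {R : realType} (x : R) : 0 < x -> 1 <= rcosh x / rsinh x.
Proof.
move=> x0; have s0 := rsinh_gt0 x0; rewrite ler_pdivlMr// mul1r /rsinh /rcosh.
by rewrite ler_pM2r// lerD2l; have := expR_gt0 (- x); lra.
Qed.

Section N_fun_facts.
Context {R : realType}.
Variables (b beta lambda1 d : R).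
Hypotheses (b0 : 0 < b) (be : 0 < beta < 1) (bl : b < lambda1 / Num.sqrt 2) (dd : 0 < d < pi / 4).

Lemma N_fun_ge0 t : (0 <= N_fun b beta lambda1 d t)%E.
Proof.
apply: le_trans (ereal_sup_ubound _); last by exists lambda1 => //=.
by apply: integral_ge0 => y _; rewrite lee_fin addr_ge0 ?normc_ge0.
Qed.

Lemma N_fun_fin t : 0 < t -> exists2 Nv, 0 <= Nv & N_fun b beta lambda1 d t = Nv%:E.
Proof.
move=> t0; have [C C0 hC] := N_fun_bound b0 be bl dd; have := hC t t0; have := N_fun_ge0 t.
by case: (N_fun _ _ _ _ _) => // v; rewrite lee_fin => v0 _; exists v.
Qed.

Lemma M_fun_ge0 t : 0 <= M_fun b beta d t.
Proof. by rewrite /M_fun /L_fun !addr_ge0. Qed.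

Lemma qmin_homo s t : 0 < s -> s <= t -> qmin b beta d s <= qmin b beta d t.
Proof.
move=> s0 st; rewrite /qmin le_min !ge_min lexx /=; apply/orP; right.
by rewrite /rate ler_pM2l// mulr_gt0 ?powR_gt0 ?kappa_gt0.
Qed.
End N_fun_facts.

Unset Implicit Arguments.

Theorem theorem4p1 (R : realType) (n : nat) (hn : n = 2%N \/ n = 3%N)
    (Om : set 'rV[R]_n) (hOm : polyhedral_lipschitz_domain Om)
    (A : ('rV[R]_n -> R[i]) -> ('rV[R]_n -> R[i]) -> R[i])
    (hA : hermitian_coercive_bounded Om A)
    (lambda1 : R) (hlambda1_gt0 : 0 < lambda1)
    (hlambda1 : smallest_eigenvalue Om A lambda1)
    (hs : set R) (T : R -> seq (n.+1.-tuple 'rV[R]_n))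
    (hT : quasi_uniform_meshes Om hs T)
    (beta : R) (hbeta0 : 0 < beta) (hbeta1 : beta < 1)
    (b : R) (hb0 : 0 < b) (hb1 : b < lambda1 / Num.sqrt 2)
    (d : R) (hd0 : 0 < d) (hd1 : d < pi / 4) :
  exists C : R,
    [/\ forall (h : R) (M : nat)
          (psi : 'I_M -> 'rV[R]_n -> R[i]) (lam : 'I_M -> R),
          hs h ->
          discrete_eigenbasis Om A (fe_space Om (T h)) psi lam ->
          forall (N : nat) (k t : R), (0 < N)%N -> 0 < k -> 0 < t ->
          (op_norm Om (fe_space Om (T h))
             (fun w x => (discrete_semigroup Om psi lam beta t w x -
                sinc_quadrature Om A (fe_space Om (T h)) b beta N k t w x)%R)
           <= C%:E *
              (N_fun b beta lambda1 d t * ((expR (2 * pi * d / k) - 1)^-1)%:E +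
               (M_fun b beta d t * rcosh (k * N%:R) / rsinh (k * N%:R) *
                expR (- (kappa b beta d * 2 `^ (- beta) * t *
                         expR (k * N%:R * beta))))%:E))%E,
        forall t0 : R, 0 < t0 -> exists B : R,
          forall t, t0 <= t -> (N_fun b beta lambda1 d t <= B%:E)%E &
        \forall t \near (0 : R)^'+,
          (N_fun b beta lambda1 d t <= (C * M_fun b beta d t)%:E)%E].
Proof.
have be : 0 < beta < 1 by rewrite hbeta0.
have dd : 0 < d < pi / 4 by rewrite hd0.
have [C1 C10 hC1] := scalar_error hb0 be hb1 dd.
have [C2 C20 hC2] := N_fun_bound hb0 be hb1 dd.
have oOm := domain_open hOm; have [rho rho0 Omrho] := bounded_cube (domain_bounded hOm).
(* [C1] governs the error and [C2] the growth of [N_fun]; their sum serves both claims. *)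
exists (C1 + C2); split.
- move=> h M psi lam hh hpsi N k t N0 k0 t0.
  (* [N_fun] is finite at [t], so the extended real inequality becomes a real one. *)
  have [Nv Nv0 NE] := N_fun_fin hb0 be hb1 dd t0.
  have e0 : 0 < expR (2 * pi * d / k) - 1.
    by rewrite subr_gt0 expR_gt1; apply: divr_gt0 => //; apply: mulr_gt0 => //; apply: mulr_gt0 => //; exact: pi_gt0.
  have kN : 0 < k * N%:R by rewrite mulr_gt0// ltr0n.
  have cs := rcosh_rsinh_ge1 kN.
  have M0 := M_fun_ge0 b beta d t.
  have E0 := expR_ge0 (- (kappa b beta d * 2 `^ (- beta) * t * expR (k * N%:R * beta))).
  set Y := M_fun b beta d t * rcosh (k * N%:R) / rsinh (k * N%:R) * _.
  have -> : ((C1 + C2)%:E * (N_fun b beta lambda1 d t * ((expR (2 * pi * d / k) - 1)^-1)%:E + Y%:E))%E =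
      ((C1 + C2) * (Nv * (expR (2 * pi * d / k) - 1)^-1 + Y))%:E by rewrite NE.
  set X := (C1 + C2) * _.
  have X1 : C1 * (Nv * (expR (2 * pi * d / k) - 1)^-1 +
       M_fun b beta d t * expR (- (kappa b beta d * 2 `^ (- beta) * t * expR (k * N%:R * beta)))) <= X.
    have h1 : 0 <= Nv * (expR (2 * pi * d / k) - 1)^-1 by rewrite mulr_ge0// invr_ge0 ltW.
    have h2 : M_fun b beta d t * expR (- (kappa b beta d * 2 `^ (- beta) * t * expR (k * N%:R * beta))) <=
       M_fun b beta d t * rcosh (k * N%:R) / rsinh (k * N%:R) * expR (- (kappa b beta d * 2 `^ (- beta) * t * expR (k * N%:R * beta))).
      by rewrite ler_wpM2r// -mulrA ler_peMr.
    have h3 := mulr_ge0 M0 E0.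
    rewrite /X; apply: ler_pM.
    + exact: ltW.
    + exact: addr_ge0.
    + by rewrite lerDl ltW.
    + by rewrite lerD2l.
  have X0 : 0 <= X.
    apply: le_trans X1; apply: mulr_ge0; first exact: ltW.
    by apply: addr_ge0; apply: mulr_ge0 => //; rewrite invr_ge0 ltW.
  (* Over an empty space the operator norm is the supremum of the empty set; otherwise an element
     [w] gives the zero function as [- w + w]. *)
  have [[w Vw]|none] := pselect (exists w, fe_space Om (T h) w); last first.
    by apply: ub_ereal_sup => y [w [Vw _] _]; exfalso; apply: none; exists w.
  have Vlin := @fe_space_lin _ _ _ _ oOm Omrho (T h).
  have V0 : fe_space Om (T h) (fun=> 0).
    by have := Vlin (-1) w w Vw Vw; under eq_fun do rewrite mulN1r addNr.
  have VH : fe_space Om (T h) `<=` H10 Om by move=> v [].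
  (* [psi j] has norm 1 in [H10], so it both witnesses that the Rayleigh infimum is over a nonempty
     set and tests the resulting bound. *)
  have lam_ge j : lambda1 <= lam j.
    have [p1 pl] := eigenvalue_form oOm VH hpsi j.
    have Hp : H10 Om (psi j) by apply: VH; exact: (eigenbasis_in hpsi).
    have nontrivial : exists2 v, H10 Om v & l2norm Om v != 0.
      by exists (psi j); rewrite ?p1 ?oner_neq0.
    have := smallest_eigenvalue_rayleigh rho0 oOm Omrho hA nontrivial hlambda1 Hp.
    by rewrite p1 pl expr1n mulr1.
  apply: (op_norm_le oOm hA V0 Vlin VH hpsi).
  + by rewrite lee_fin.
  (* The nodes are real, where [gamma] avoids every [lambda >= lambda1]; hence the resolvents
     exist. *)
  + move=> i j; rewrite sinc_node_real; apply: gamma_neq => //; first exact: (bl_sqrt hb1 (lam_ge j)).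
    by have := @pi_gt0 R; move: (pi : R) => p p0; apply/andP; split; lra.
  + by move=> j; rewrite lee_fin; apply: le_trans X1; exact: hC1.
- move=> t0 t00; exists (C2 * ln (1 + (qmin b beta d t0)^-1)) => t tt.
  have tp : 0 < t by exact: lt_le_trans t00 tt.
  have q0 := qmin_gt0 hb0 be dd t00; have q1 := qmin_gt0 hb0 be dd tp.
  apply: le_trans (hC2 t tp) _; rewrite lee_fin ler_pM2l// ler_ln ?posrE.
  + by rewrite lerD2l lef_pV2 ?posrE//; exact: qmin_homo.
  + by rewrite addr_gt0// invr_gt0.
  + by rewrite addr_gt0// invr_gt0.
- near=> t; have t0 : 0 < t by near: t; exact: nbhs_right_gt.
  apply: le_trans (hC2 t t0) _; rewrite lee_fin.
  apply: (@le_trans _ _ (C2 * M_fun b beta d t)).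
    by rewrite ler_pM2l//; exact: M_fun_bound.
  by rewrite ler_wpM2r ?M_fun_ge0// lerDr ltW.
Unshelve. all: by end_near. Qed.
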